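(* Let $\alpha\neq 0$ be a real constant with $|\alpha|$ small enough that the boundary-value problem (BVP) of the context has a unique solution $\mathbf{A}=\mathbf{A}(\eta,\Phi)$. Consider the functional $$\begin{aligned}\mathcal{L}(\eta,\Phi)=&\int_{D_\eta}\Big(\tfrac12|\operatorname{curl}\mathbf{A}|^2-\tfrac12\alpha\,\mathbf{A}\cdot\operatorname{curl}\mathbf{A}\Big)+\int_{\mathbb{R}^2}\Big(-\tfrac12\alpha\nabla\Delta^{-1}(\nabla\cdot\mathbf{A}_\parallel^\perp)\cdot\mathbf{A}_\parallel-\nabla\Phi\cdot(\mathbf{A}^\star_\parallel)^{\perp}\Big)\\&+\int_{\mathbb{R}^2}\Big(\Gamma(\eta)+\tfrac12 g\eta^2+\sigma\big((1+|\nabla\eta|^2)^{1/2}-1\big)\Big),\end{aligned}$$ where $$\Gamma(\eta)=-\tfrac12\alpha\nabla\Delta^{-1}\big(\nabla\cdot(\mathbf{A}^\star_\parallel)^\perp\big)\cdot\mathbf{A}^\star_\parallel+\frac{|\mathbf{c}|^2}{2\alpha}(\sin\alpha\eta-\alpha\eta).$$ For sufficiently regular $(\eta,\Phi)$ (decaying at infinity), the vector field $\mathbf{v}=\operatorname{curl}\mathbf{A}$ satisfies $\operatorname{div}\mathbf{v}=0$ and $\operatorname{curl}\mathbf{v}=\alpha\mathbf{v}$ in $D_\eta$ and $\mathbf{v}\cdot\mathbf{j}=0$ at $y=-h$, and the Euler--Lagrange equations of the variational principle $\delta\mathcal{L}(\eta,\Phi)=0$ (variations taken with respect to $\eta$ and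 $\Phi$) are equivalent to the two free-surface conditions $$\mathbf{v}\cdot\mathbf{n}+\mathbf{u}^\star\cdot\mathbf{n}=0\quad\text{at }y=\eta,$$ $$\tfrac12|\mathbf{v}|^2+\mathbf{v}\cdot\mathbf{u}^\star+g\eta-\sigma\left(\frac{\eta_x}{(1+|\nabla\eta|^2)^{1/2}}\right)_x-\sigma\left(\frac{\eta_z}{(1+|\nabla\eta|^2)^{1/2}}\right)_z=0\quad\text{at }y=\eta.$$
   Context: Coordinates in $\mathbb{R}^3$ are $(x,y,z)$ with $y$ vertical; $h>0$, $g$, $\sigma$ and $\mathbf{c}=(c_1,c_3)^{\mathrm T}$ are real constants; $\mathbf{j}=(0,1,0)^{\mathrm T}$. For $\eta:\mathbb{R}^2\to(-h,\infty)$ (a function of $(x,z)$) set $D_\eta=\{(x,y,z):-h<y<\eta(x,z)\}$, $\mathbf{N}=(-\eta_x,1,-\eta_z)^{\mathrm T}$, $\mathbf{n}=\mathbf{N}/|\mathbf{N}|$. Write $\nabla=(\partial_x,\partial_z)^{\mathrm T}$, $\mathbf{f}^\perp=(-f_3,f_1)$ for $\mathbf{f}=(f_1,f_3)$, $\nabla^\perp f=(\nabla f)^\perp$. For a vector field $\mathbf{F}=(F_1,F_2,F_3)$ on $D_\eta$, $\mathbf{F}_{\mathrm h}=(F_1,F_3)^{\mathrm T}$ and $\mathbf{F}_\parallel=\big(\mathbf{F}_{\mathrm h}+F_2\nabla\eta\big)|_{y=\eta}$, a vector field on $\mathbb{R}^2$; $\mathbf{F}_\parallel^\perp=(\mathbf{F}_\parallel)^\perp$.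 $\Delta^{-1}$ is the inverse of the two-dimensional Laplacian (Newtonian potential); it is applied only to divergences, so that $\nabla\Delta^{-1}(\nabla\cdot\mathbf{f})$ is the gradient part $\nabla\Phi$ of $\mathbf{f}$ in the orthogonal (Hodge--Weyl) decomposition $\mathbf{f}=\nabla\Phi+\nabla^\perp\Psi$. $$\mathbf{u}^\star=c_1\begin{pmatrix}\cos\alpha y\\0\\\sin\alpha y\end{pmatrix}+c_3\begin{pmatrix}-\sin\alpha y\\0\\\cos\alpha y\end{pmatrix},\qquad \mathbf{A}^\star=\frac{c_1}{\alpha}\begin{pmatrix}\cos\alpha y-1\\0\\\sin\alpha y\end{pmatrix}+\frac{c_3}{\alpha}\begin{pmatrix}-\sin\alpha y\\0\\\cos\alpha y-1\end{pmatrix},$$ so $\operatorname{curl}\mathbf{A}^\star=\mathbf{u}^\star$. (BVP): for given $\eta$ and $\Phi:\mathbb{R}^2\to\mathbb{R}$, $\mathbf{A}:D_\eta\to\mathbb{R}^3$ denotes the unique solution of $\operatorname{curl}\operatorname{curl}\mathbf{A}=\alpha\operatorname{curl}\mathbf{A}$ and $\operatorname{div}\mathbf{A}=0$ in $D_\eta$; $\mathbf{A}\wedge\mathbf{j}=\mathbf{0}$ at $y=-h$; $\mathbf{A}\cdot\mathbf{n}=0$ at $y=\eta$; $(\operatorname{curl}\mathbf{A})_\parallel=\nabla\Phi-\alpha\nabla^\perp\Delta^{-1}(\nabla\cdot\mathbf{A}_\parallel^\perp)$ at $y=\eta$. Conventions: the result is at the level of the formal calculus of variations: all functions are assumed as regular,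 and decaying as $|(x,z)|\to\infty$, as required for the calculations (differentiation under integrals, integration by parts). The Euler--Lagrange equations are the equations expressing that the first variation of $\mathcal{L}$ vanishes for all infinitesimal variations $\dot\eta,\dot\Phi$, with $\mathbf{A}$ (and $D_\eta$) varying with $(\eta,\Phi)$ through (BVP). *)

(* Defs.v *)
(* MathComp-Analysis.  A point of R^3 is ((x, y), z) : R * R * R with y vertical, a
   point of the horizontal plane is (x, z) : R * R, and vectors are row vectors. *)
From HB Require Import structures.
From mathcomp Require Import all_boot all_order all_algebra.
From mathcomp Require Import all_classical all_reals all_analysis.
Import Order.TTheory GRing.Theory Num.Theory.
Import numFieldNormedType.Exports.

Set Implicit Arguments.
Unset Strict Implicit.
Unset Printing Implicit Defensive.

Local Open Scope classical_set_scope.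
Local Open Scope ring_scope.

(** * Regularity and decay *)

Section Regularity.
Context {R : realType} {V W : normedModType R}.
Implicit Types (U : set V) (f : V -> W).

Fixpoint iterD (vs : seq V) f : V -> W :=
  if vs is v :: vs' then fun p => 'D_v (iterD vs' f) p else f.

(* Meant for open U. *)
Definition Ck_on (n : nat) U f : Prop :=
  forall vs, (size vs <= n)%N -> forall p, U p ->
    {for p, continuous (iterD vs f)} /\
    ((size vs < n)%N -> differentiable (iterD vs f) p).

Definition smooth f : Prop := forall n, Ck_on n setT f.

(* f = O(r^{-2s}) on U for some s > a, where r is the distance from the origin of
   the horizontal projection hor p.  The threshold a = 1/2 is the one that makes
   products of two such functions integrable over the plane; a = 0 only says that f
   vanishes at infinity at some algebraic rate. *)
Definition decays (a : R) (hor : V -> R * R) U f : Prop :=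
  exists s C : R, a < s /\ forall p, U p ->
    `|f p| <= C * (1 + (hor p).1 ^+ 2 + (hor p).2 ^+ 2) `^ (- s).

End Regularity.

(** * Vector calculus *)

Section VectorCalculus.
Context {R : realType}.
Implicit Types (q : R * R) (p : R * R * R).

Definition vec2 (a b : R) : 'rV[R]_2 := \row_(i < 2) [:: a; b]`_i.
Definition vec3 (a b c : R) : 'rV[R]_3 := \row_(i < 3) [:: a; b; c]`_i.

Definition dot n (u v : 'rV[R]_n) : R := \sum_i u 0 i * v 0 i.

(* The norm `|_| of 'rV[R]_n is the sup norm. *)
Definition enorm n (u : 'rV[R]_n) : R := Num.sqrt (dot u u).

Definition cross (u v : 'rV[R]_3) : 'rV[R]_3 :=
  vec3 (u 0 1 * v 0 2 - u 0 2 * v 0 1)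
       (u 0 2 * v 0 0 - u 0 0 * v 0 2)
       (u 0 0 * v 0 1 - u 0 1 * v 0 0).

Definition perp (u : 'rV[R]_2) : 'rV[R]_2 := vec2 (- u 0 1) (u 0 0).

Definition d_x (f : R * R -> R) q : R := 'D_((1, 0) : R * R) f q.
Definition d_z (f : R * R -> R) q : R := 'D_((0, 1) : R * R) f q.

Definition grad (f : R * R -> R) q : 'rV[R]_2 := vec2 (d_x f q) (d_z f q).
Definition gradperp (f : R * R -> R) q : 'rV[R]_2 := perp (grad f q).
Definition div2 (F : R * R -> 'rV[R]_2) q : R :=
  d_x (fun q' => F q' 0 0) q + d_z (fun q' => F q' 0 1) q.
Definition laplacian (f : R * R -> R) : R * R -> R := div2 (grad f).

Definition D_x (f : R * R * R -> R) p : R := 'D_((1, 0, 0) : R * R * R) f p.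
Definition D_y (f : R * R * R -> R) p : R := 'D_((0, 1, 0) : R * R * R) f p.
Definition D_z (f : R * R * R -> R) p : R := 'D_((0, 0, 1) : R * R * R) f p.

Definition div3 (F : R * R * R -> 'rV[R]_3) p : R :=
  D_x (fun p' => F p' 0 0) p + D_y (fun p' => F p' 0 1) p
  + D_z (fun p' => F p' 0 2) p.

Definition curl (F : R * R * R -> 'rV[R]_3) p : 'rV[R]_3 :=
  vec3 (D_y (fun p' => F p' 0 2) p - D_z (fun p' => F p' 0 1) p)
       (D_z (fun p' => F p' 0 0) p - D_x (fun p' => F p' 0 2) p)
       (D_x (fun p' => F p' 0 1) p - D_y (fun p' => F p' 0 0) p).

Definition horizontal p : R * R := (p.1.1, p.2).

(** ** The inverse of the two-dimensional Laplacian *)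

(* P is the potential of rho that vanishes at infinity and has a decaying gradient.
   Such a P is unique, and when rho = div2 f with f decaying, grad P and f - grad P
   are the (L^2-orthogonal) gradient and divergence-free parts of f. *)
Definition is_invLap (rho P : R * R -> R) : Prop :=
  [/\ Ck_on 2 setT P, decays 0 idfun setT P, decays 2^-1 idfun setT (grad P)
    & forall q, laplacian P q = rho q].

Definition has_invLap (rho : R * R -> R) : Prop := exists P, is_invLap rho P.

Definition invLap (rho : R * R -> R) : R * R -> R :=
  xget (fun=> 0) [set P | is_invLap rho P].

(** ** Integration *)

Definition area := (@lebesgue_measure R \x @lebesgue_measure R)%E.
Definition volume := (area \x @lebesgue_measure R)%E.

End VectorCalculus.

(** * The variational problem *)

Section Problem.
Context {R : realType}.
Variables h alpha : R.
Implicit Types (eta Phi : R * R -> R) (F A : R * R * R -> 'rV[R]_3).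
Implicit Types (q : R * R) (p : R * R * R).

Definition jvec : 'rV[R]_3 := vec3 0 1 0.

Definition fluid eta : set (R * R * R) :=
  [set p | - h < p.1.2 < eta (horizontal p)].

Definition surf eta q : R * R * R := (q.1, eta q, q.2).

Definition Nvec eta q : 'rV[R]_3 := vec3 (- d_x eta q) 1 (- d_z eta q).
Definition nvec eta q : 'rV[R]_3 := (enorm (Nvec eta q))^-1 *: Nvec eta q.

Definition par eta F q : 'rV[R]_2 :=
  let Fs := F (surf eta q) in
  vec2 (Fs 0 0) (Fs 0 2) + Fs 0 1 *: grad eta q.

Definition decaying_smooth (f : R * R -> R) : Prop :=
  smooth f /\ forall vs, decays 2^-1 idfun setT (iterD vs f).

Definition admissible_surface eta : Prop :=
  decaying_smooth eta /\ forall q, - h < eta q.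

(* Only the gradient of a potential has to decay at the rate of a field. *)
Definition admissible_potential Phi : Prop :=
  [/\ smooth Phi, decays 0 idfun setT Phi
    & forall vs, (0 < size vs)%N -> decays 2^-1 idfun setT (iterD vs Phi)].

(* Vector fields on the closure of the fluid domain that are C^2 up to the boundary
   are represented by C^2 extensions to R^3; the values off that closure are
   irrelevant. *)
Definition regular_field A : Prop :=
  Ck_on 2 setT A /\
  forall vs, (size vs <= 2)%N -> decays 2^-1 horizontal setT (iterD vs A).

Definition solves_BVP eta Phi A : Prop :=
  let rho := div2 (fun q => perp (par eta A q)) in
  [/\ regular_field A /\ has_invLap rho,
      forall p, fluid eta p ->
        curl (curl A) p = alpha *: curl A p /\ div3 A p = 0,
      forall x z, cross (A (x, - h, z)) jvec = 0,
      forall q, dot (A (surf eta q)) (nvec eta q) = 0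
    & forall q, par eta (curl A) q
                = grad Phi q - alpha *: gradperp (invLap rho) q].

Definition uniquely_solvable eta Phi : Prop :=
  (exists A, solves_BVP eta Phi A) /\
  (forall A A', solves_BVP eta Phi A -> solves_BVP eta Phi A' ->
     forall p, fluid eta p -> A p = A' p).

(* The solution A(eta, Phi); determined on the closure of the fluid domain when
   [uniquely_solvable eta Phi]. *)
Definition BVPsol eta Phi : R * R * R -> 'rV[R]_3 :=
  xget (fun=> 0) [set A | solves_BVP eta Phi A].

Definition vary (f df : R * R -> R) (e : R) q : R := f q + e * df q.

Definition uniquely_solvable_near eta Phi : Prop :=
  forall deta dPhi, decaying_smooth deta -> admissible_potential dPhi ->
    \forall e \near (0 : R), uniquely_solvable (vary eta deta e) (vary Phi dPhi e).

(* Along every line through (eta, Phi) the solutions form a C^2 family, with decay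
   that is uniform in the parameter, up to the moving boundary. *)
Definition regular_dependence eta Phi : Prop :=
  forall deta dPhi, decaying_smooth deta -> admissible_potential dPhi ->
    exists (d : R) (F : R * (R * R * R) -> 'rV[R]_3),
    let I := [set ep : R * (R * R * R) | `|ep.1| < d] in
    [/\ 0 < d,
        Ck_on 2 I F,
        forall vs, (size vs <= 2)%N ->
          decays 2^-1 (fun ep => horizontal ep.2) I (iterD vs F)
      & forall e, `|e| < d ->
          solves_BVP (vary eta deta e) (vary Phi dPhi e) (fun p => F (e, p))].

Variables c1 c3 : R.

Definition ustar (y : R) : 'rV[R]_3 :=
  c1 *: vec3 (cos (alpha * y)) 0 (sin (alpha * y))
  + c3 *: vec3 (- sin (alpha * y)) 0 (cos (alpha * y)).

Definition Astar p : 'rV[R]_3 :=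
  let y := p.1.2 in
  (c1 / alpha) *: vec3 (cos (alpha * y) - 1) 0 (sin (alpha * y))
  + (c3 / alpha) *: vec3 (- sin (alpha * y)) 0 (cos (alpha * y) - 1).

(* Regularity and decay of the potential occurring in Gamma below. *)
Definition star_regular_near eta : Prop :=
  forall deta, decaying_smooth deta ->
    \forall e \near (0 : R),
      has_invLap (div2 (fun q => perp (par (vary eta deta e) Astar q))).

Definition Gamma eta q : R :=
  - 2^-1 * alpha
    * dot (grad (invLap (div2 (fun q' => perp (par eta Astar q')))) q)
          (par eta Astar q)
  + (c1 ^+ 2 + c3 ^+ 2) / (2 * alpha) * (sin (alpha * eta q) - alpha * eta q).

Variables g sigma : R.

Definition Lagrangian eta Phi : R :=
  let A := BVPsol eta Phi in
  \int[volume]_(p in fluid eta)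
    (2^-1 * enorm (curl A p) ^+ 2 - 2^-1 * alpha * dot (A p) (curl A p))
  + \int[area]_q
      (- 2^-1 * alpha
         * dot (grad (invLap (div2 (fun q' => perp (par eta A q')))) q)
               (par eta A q)
       - dot (grad Phi q) (perp (par eta Astar q)))
  + \int[area]_q
      (Gamma eta q + 2^-1 * g * eta q ^+ 2
       + sigma * (Num.sqrt (1 + enorm (grad eta q) ^+ 2) - 1)).

Definition Euler_Lagrange eta Phi : Prop :=
  forall deta dPhi, decaying_smooth deta -> admissible_potential dPhi ->
    is_derive (0 : R) (1 : R)
      (fun e => Lagrangian (vary eta deta e) (vary Phi dPhi e)) 0.

Definition kinematic_condition eta (v : R * R * R -> 'rV[R]_3) : Prop :=
  forall q, dot (v (surf eta q)) (nvec eta q)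
            + dot (ustar (eta q)) (nvec eta q) = 0.

Definition dynamic_condition eta (v : R * R * R -> 'rV[R]_3) : Prop :=
  let slope := fun q => Num.sqrt (1 + enorm (grad eta q) ^+ 2) in
  forall q,
    2^-1 * enorm (v (surf eta q)) ^+ 2 + dot (v (surf eta q)) (ustar (eta q))
    + g * eta q
    - sigma * d_x (fun q' => d_x eta q' / slope q') q
    - sigma * d_z (fun q' => d_z eta q' / slope q') q = 0.

End Problem.

(* Main.v *)
(** Along a line (eta + e deta, Phi + e dPhi) write a = A_par, v = curl A, N = (-eta_x, 1, -eta_z)
    and E = grad invLap (div a^perp); let a', E', u' be these quantities for the trivial flow
    (a' and E' from Astar, u' = ustar).  Flatten the fluid domain onto a slab.  Since
    curl v = alpha v, the divergence theorem turns the volume integral into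
    int a . (v_par)^perp / 2, while differentiating it under the integral sign and integrating
    by parts yields a second boundary integral.  Comparing the two, the unknown dA/de drops out.
    The nonlocal integrals int E . a are quadratic forms of an L^2-contraction whose
    antisymmetric part is local, so they can be differentiated although nothing is known about
    the dependence of E on e.  The result is
      dL = int (- grad dPhi . (a + a')^perp + deta K),
      K = |v|^2/2 - (v . N) v_2 + grad Phi . u' - alpha E' . (u')^perp + g eta - capillarity.
    Testing against powers of 1 / (1 + |q - q0|^2) gives div (a + a')^perp = 0 and K = 0.  The
    first equation is the kinematic condition, because div a^perp = v . N and
    div (a')^perp = u' . N.  It makes E + E' both curl-free and divergence-free, hence zero,
    and then the tangential boundary condition identifies K = 0 with the dynamic condition. *)
From HB Require Import structures.
Require Import Defs.
From mathcomp Require Import all_boot all_order all_algebra.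
From mathcomp Require Import all_classical all_reals all_analysis.
From mathcomp Require Import measurable_realfun.
From mathcomp Require Import ring lra.
Import Order.TTheory GRing.Theory Num.Theory.
Import numFieldNormedType.Exports.
Local Open Scope classical_set_scope.
Local Open Scope ring_scope.
Set Implicit Arguments.
Unset Strict Implicit.
Unset Printing Implicit Defensive.

(** * Continuously differentiable functions *)

(** Why dA/de drops out: the bulk functional is quadratic in A with linear boundary data, so on
    solutions it equals half of its boundary pairing with grad Phi. Let s be the derivative computed
    from that pairing and l the one computed under the integral sign. From s = l follows s = 2 s -
    l, and in 2 s - l all terms with dA/de cancel pointwise, up to the divergence of nu A_2
    (M_par)^perp, where nu is the variation of eta and M = v - alpha A / 2. The exponent 1/2 of the
    decay classes does double duty: products of two such functions are integrable over the plane,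
    and the flux of one through the boundary of a large square tends to zero. A curl-free field of
    that class has a potential that is bounded but need not decay; this suffices for the
    orthogonality behind the contraction. A solution is determined only on the closure of the fluid
    domain, so [BVPsol] and the C^2 family of extensions are compared by openness inside and by
    continuity at the surface. Powers of a rational kernel serve in place of bump functions, because
    all their derivatives are explicit and decay. *)

Section C1.
Context {R : realType}.

(* An inductive wrapper, which keeps unification from unfolding the quantifiers. *)
Variant C1 {V : normedModType R} (U : set V) (f : V -> R) : Prop :=
  IsC1 of forall p, U p -> differentiable f p /\ forall v, {for p, continuous ('D_v f)}.

Lemma mean_value (f df : R -> R) (a b : R) : a <= b ->
  (forall x, a <= x <= b -> is_derive x (1 : R) f (df x)) ->
  exists2 c, a <= c <= b & f b - f a = df c * (b - a).
Proof.
move=> ab dfE.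
have cf : {within `[a, b], continuous f}.
  apply: continuous_in_subspaceT => x; rewrite inE /= in_itv /= => xab.
  apply: differentiable_continuous; apply/derivable1_diffP.
  by have := dfE x xab => -[].
have df' x : x \in `]a, b[ -> is_derive x (1 : R) f (df x).
  by rewrite in_itv /= => /andP[ax xb]; apply: dfE; rewrite !ltW.
have [c] := MVT_segment ab df' cf.
by rewrite in_itv /= => cab cE; exists c.
Qed.

Lemma is_derive_line {V : normedModType R} (f : V -> R) (p v : V) (t : R) :
  derivable f (p + t *: v) v ->
  is_derive t (1 : R) (fun s => f (p + s *: v)) ('D_v f (p + t *: v)).
Proof.
have E : (fun h : R => h^-1 *: ((f \o shift (p + t *: v)) (h *: v) - f (p + t *: v)))
       = (fun h : R => h^-1 *: (((fun s => f (p + s *: v)) \o shift t) (h *: 1)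
                                - f (p + t *: v))).
  apply/funext => h /=; congr (_ *: (f _ - _)).
  by rewrite [h *: 1]mulr1 scalerDl addrCA.
move=> df; apply: DeriveDef.
  by move: df; rewrite /derivable E.
by rewrite /derive E.
Qed.

Lemma deriveZv {V : normedModType R} (f : V -> R) (p v : V) (k : R) :
  differentiable f p -> 'D_(k *: v) f p = k * 'D_v f p.
Proof. by move=> df; rewrite !deriveE// linearZ. Qed.

Section closure.
Context {V : normedModType R} (U : set V) (oU : open U).
Implicit Types f g : V -> R.

Lemma C1_intro f : (forall p, U p -> differentiable f p) ->
  (forall v, exists g, forall p, U p -> 'D_v f p = g p /\ {for p, continuous g}) ->
  C1 U f.
Proof.
move=> df dg; split=> p Up; split; first exact: df.
move=> v; have [g gP] := dg v.
have [e cg] := gP p Up.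
have nE : \near p, g p = 'D_v f p.
  have : \near p, U p by exact: open_nbhs_nbhs.
  by apply: filterS => q /gP[].
rewrite /prop_for /continuous_at e.
apply: cvg_trans cg; exact: near_eq_cvg.
Qed.

Lemma C1_differentiable f p : C1 U f -> U p -> differentiable f p.
Proof. by move=> [Cf] /Cf[]. Qed.

Lemma C1_derivable f p v : C1 U f -> U p -> derivable f p v.
Proof. by move=> [Cf] /Cf[df _]; exact: diff_derivable. Qed.

Lemma C1_continuous f p : C1 U f -> U p -> {for p, continuous f}.
Proof. by move=> [Cf] /Cf[/differentiable_continuous]. Qed.

Lemma C1_derive_continuous f p v : C1 U f -> U p -> {for p, continuous ('D_v f)}.
Proof. by move=> [Cf] /Cf[_]. Qed.

Arguments C1_derive_continuous {f p} v.

Lemma C1_cst c : C1 U (fun=> c).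
Proof.
apply: C1_intro => [p Up|v]; first exact: differentiable_cst.
exists (fun=> 0) => p Up; rewrite derive_cst; split=> //; exact: cst_continuous.
Qed.

Lemma C1D f g : C1 U f -> C1 U g -> C1 U (fun p => f p + g p).
Proof.
move=> Cf Cg; apply: C1_intro => [p Up|v].
  by apply: differentiableD; exact: C1_differentiable.
exists (fun p => 'D_v f p + 'D_v g p) => p Up; split.
  by apply: deriveD; exact: C1_derivable.
by apply: continuousD; exact: C1_derive_continuous.
Qed.

Lemma C1N f : C1 U f -> C1 U (fun p => - f p).
Proof.
move=> Cf; apply: C1_intro => [p Up|v].
  by apply: differentiableN; exact: C1_differentiable.
exists (fun p => - 'D_v f p) => p Up; split.
  by apply: deriveN; exact: C1_derivable.
by apply: continuousN; exact: C1_derive_continuous.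
Qed.

Lemma C1B f g : C1 U f -> C1 U g -> C1 U (fun p => f p - g p).
Proof. by move=> Cf Cg; exact: (C1D Cf (C1N Cg)). Qed.

Lemma C1M f g : C1 U f -> C1 U g -> C1 U (fun p => f p * g p).
Proof.
move=> Cf Cg; apply: C1_intro => [p Up|v].
  by apply: differentiableM; exact: C1_differentiable.
exists (fun p => f p * 'D_v g p + g p * 'D_v f p) => p Up; split.
  by apply: deriveM; exact: C1_derivable.
apply: continuousD; apply: continuousM.
- exact: C1_continuous.
- exact: C1_derive_continuous.
- exact: C1_continuous.
- exact: C1_derive_continuous.
Qed.

Lemma C1_derive_eq f g p v : (forall p, U p -> f p = g p) -> U p ->
  'D_v f p = 'D_v g p.
Proof.
move=> fg Up; apply: near_eq_derive.
have : \near p, U p by exact: open_nbhs_nbhs.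
by apply: filterS => q /fg.
Qed.

End closure.
Arguments C1_derive_continuous {V U f p} v.
Arguments C1_derivable {V U f p} v.

(** The inner map is presented as a combination of fixed vectors [b i] with scalar coefficients. The
    chain rule then comes out as a sum of directional derivatives of [f] along the [b i], the form
    in which [D_x], [D_y], [D_z] and the parameter derivative are defined. *)
Lemma C1_comp {V W : normedModType R} n (b : 'I_n -> V) (g : 'I_n -> W -> R)
    (gm : W -> V) (U : set V) (U' : set W) (f : V -> R) :
  open U' -> (forall p, gm p = \sum_i g i p *: b i) ->
  (forall i, C1 U' (g i)) -> (forall p, U' p -> U (gm p)) -> C1 U f ->
  C1 U' (f \o gm) /\
  forall v p, U' p -> 'D_v (f \o gm) p = \sum_i 'D_v (g i) p * 'D_(b i) f (gm p).
Proof.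
move=> oU' gmE Cg gmU Cf.
have gmE' : gm = \sum_i (fun p => g i p *: b i).
  by apply/funext => p; rewrite fct_sumE gmE.
have dgi i p : U' p -> differentiable (g i) p by exact: (C1_differentiable (Cg i)).
have dgm p : U' p -> differentiable gm p.
  move=> Up; rewrite gmE'; apply: differentiable_sum => i.
  by apply: differentiableZl; exact: dgi.
have Dgm v p : U' p -> 'D_v gm p = \sum_i 'D_v (g i) p *: b i.
  move=> Up; rewrite gmE' derive_sum; last first.
    by move=> i; apply: diff_derivable; apply: differentiableZl; exact: dgi.
  apply: eq_bigr => i _.
  rewrite deriveE; last by apply: differentiableZl; exact: dgi.
  by rewrite diffZl/= -?deriveE//; exact: dgi.
have D v p : U' p -> 'D_v (f \o gm) p = \sum_i 'D_v (g i) p * 'D_(b i) f (gm p).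
  move=> Up.
  have dfp : differentiable f (gm p) by exact: (C1_differentiable Cf (gmU _ Up)).
  rewrite deriveE; last by apply: differentiable_comp => //; exact: dgm.
  rewrite diff_comp//; last exact: dgm.
  rewrite /= -(deriveE v (dgm p Up)) Dgm// linear_sum; apply: eq_bigr => i _.
  by rewrite linearZ -deriveE.
split; last exact: D.
apply: C1_intro => // [p Up|v].
  apply: differentiable_comp; first exact: dgm.
  exact: (C1_differentiable Cf (gmU _ Up)).
exists (fun p => \sum_i 'D_v (g i) p * 'D_(b i) f (gm p)) => p Up; split; first exact: D.
have cgm : {for p, continuous gm}.
  by apply: differentiable_continuous; exact: dgm.
have -> : (fun p => \sum_i 'D_v (g i) p * 'D_(b i) f (gm p)) =
          \sum_i (fun p => 'D_v (g i) p * 'D_(b i) f (gm p)).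
  by apply/funext => q; rewrite fct_sumE.
elim/big_ind : _ => [|u w cu cw|i _]; first exact: cst_continuous.
  exact: continuousD.
apply: continuousM; first exact: (C1_derive_continuous _ (Cg i) Up).
apply: (@continuous_comp _ _ _ gm ('D_(b i) f)); first exact: cgm.
exact: (C1_derive_continuous _ Cf (gmU _ Up)).
Qed.

(* The mean value theorem applied to second differences. *)
Lemma derive_comm {V : normedModType R} (U : set V) (f fv fw : V -> R) (v w p : V) :
  open U -> C1 U f -> C1 U fv -> C1 U fw ->
  (forall q, U q -> 'D_v f q = fv q) -> (forall q, U q -> 'D_w f q = fw q) ->
  U p -> 'D_w fv p = 'D_v fw p.
Proof.
move=> oU Cf Cfv Cfw fvE fwE Up.
have key (e : R) : 0 < e -> \forall t \near 0^'+, forall x y : R, 0 <= x <= t -> 0 <= y <= t ->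
    [/\ U (p + x *: v + y *: w), `|'D_w fv (p + x *: v + y *: w) - 'D_w fv p| < e
      & `|'D_v fw (p + x *: v + y *: w) - 'D_v fw p| < e].
  move=> e0.
  have c1 := C1_derive_continuous w Cfv Up.
  have c2 := C1_derive_continuous v Cfw Up.
  pose m (xy : R * R) := p + xy.1 *: v + xy.2 *: w.
  have m0 : m (0, 0) = p by rewrite /m /= !scale0r !addr0.
  have cm : {for (0, 0), continuous m}.
    move=> ?; apply: cvgD; [apply: cvgD; first exact: cvg_cst|]; apply: cvgZl.
      exact: cvg_fst.
    exact: cvg_snd.
  have : \forall q \near p, [/\ U q, `|'D_w fv q - 'D_w fv p| < e
      & `|'D_v fw q - 'D_v fw p| < e].
    near=> q; split.
    - by near: q; exact: open_nbhs_nbhs.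
    - by near: q; move/cvgrPdist_lt : c1 => /(_ e e0); apply: filterS => q; rewrite distrC.
    - by near: q; move/cvgrPdist_lt : c2 => /(_ e e0); apply: filterS => q; rewrite distrC.
  rewrite -{1}m0 => /cm /= [[A B]] /= [/nbhs_ballP[a a0 aA] /nbhs_ballP[b b0 bB]] AB.
  near=> t => x y /andP[x0 xt] /andP[y0 yt].
  apply: (AB (x, y)); split => /=.
    apply: aA; rewrite /ball /= sub0r normrN ger0_norm//.
    by apply: le_lt_trans xt _; near: t; exact: nbhs_right_lt.
  apply: bB; rewrite /ball /= sub0r normrN ger0_norm//.
  by apply: le_lt_trans yt _; near: t; exact: nbhs_right_lt.
apply/eqP; rewrite -subr_eq0 -normr_eq0 eq_le normr_ge0 andbT.
apply/ler_addgt0Pr => e e0; rewrite add0r.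
have e20 : 0 < e / 2 by rewrite divr_gt0.
have : \forall t \near (0 : R)^'+, `|'D_w fv p - 'D_v fw p| <= e.
  near=> t.
  have t0 : 0 < t by [].
  have key' : forall x y : R, 0 <= x <= t -> 0 <= y <= t ->
    [/\ U (p + x *: v + y *: w), `|'D_w fv (p + x *: v + y *: w) - 'D_w fv p| < e / 2
      & `|'D_v fw (p + x *: v + y *: w) - 'D_v fw p| < e / 2].
    by near: t; exact: key.
  have tt : 0 <= t <= t by rewrite lexx ltW.
  have t00 : 0 <= (0 : R) <= t by apply/andP; split; [exact: lexx|exact: ltW].
  (* Used for (v, w) and for (w, v). The second difference is symmetric, so both mixed derivatives,
     each at its own point of the small parallelogram, are equal to its quotient by t^2. *)
  have half (f' fa fb : V -> R) (a b : V) : C1 U f' -> C1 U fa ->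
     (forall q, U q -> 'D_a f' q = fa q) ->
     (forall x y, 0 <= x <= t -> 0 <= y <= t -> U (p + x *: a + y *: b)) ->
     exists x y, [/\ 0 <= x <= t, 0 <= y <= t &
       (f' (p + t *: a + t *: b) - f' (p + t *: a)) - (f' (p + t *: b) - f' p)
       = t * t * 'D_b fa (p + x *: a + y *: b)].
    move=> Cf' Cfa faE inU.
    have inU0 x : 0 <= x <= t -> U (p + x *: a).
      by move=> xt; have := inU x 0 xt t00; rewrite scale0r addr0.
    pose g x := f' (p + t *: b + x *: a) - f' (p + x *: a).
    have sw x y : p + y *: b + x *: a = p + x *: a + y *: b by rewrite addrAC.
    have dg x : 0 <= x <= t -> is_derive x (1 : R) g
         (fa (p + x *: a + t *: b) - fa (p + x *: a)).
      move=> xt; apply: is_deriveB; rewrite -faE.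
      - rewrite -sw; apply: is_derive_line; rewrite sw.
        exact: (C1_derivable _ Cf' (inU _ _ xt tt)).
      - exact: (inU _ _ xt tt).
      - by apply: is_derive_line; exact: (C1_derivable _ Cf' (inU0 _ xt)).
      - exact: inU0.
    have [x xt] := mean_value (ltW t0) dg; rewrite subr0 /g => gE.
    pose k y := fa (p + x *: a + y *: b).
    have dk y : 0 <= y <= t -> is_derive y (1 : R) k ('D_b fa (p + x *: a + y *: b)).
      by move=> yt; apply: is_derive_line; exact: (C1_derivable _ Cfa (inU _ _ xt yt)).
    have [y yt] := mean_value (ltW t0) dk; rewrite subr0 /k scale0r addr0 => kE.
    exists x, y; split => //.
    move: gE; rewrite kE !scale0r !addr0 sw => gE; rewrite [LHS]gE; ring.
  have [x [y [xt yt E1]]] := half f fv fw v w Cf Cfv fvE (fun x y xt yt =>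
    let: And3 a _ _ := key' x y xt yt in a).
  have [x' [y' [xt' yt' E2]]] := half f fw fv w v Cf Cfw fwE (fun x y xt yt =>
    let: And3 a _ _ := key' y x yt xt in ltac:(by rewrite addrAC)).
  have [_ k1 _] := key' x y xt yt.
  have [_ _ k2] := key' y' x' yt' xt'.
  have E : 'D_w fv (p + x *: v + y *: w) = 'D_v fw (p + y' *: v + x' *: w).
    have tt0 : t * t != 0 by rewrite mulf_neq0 ?gt_eqF.
    apply: (mulfI tt0); rewrite -E1 (addrAC p (y' *: v)) -E2 (addrAC p (t *: w)); ring.
  rewrite E in k1; rewrite distrC in k1.
  have := ler_normD ('D_w fv p - 'D_v fw (p + y' *: v + x' *: w))
                    ('D_v fw (p + y' *: v + x' *: w) - 'D_v fw p).
  rewrite addrA subrK => /le_trans; apply.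
  by rewrite [leRHS]splitr lerD// ltW.
by move=> /filter_ex[].
Unshelve. all: by end_near. Qed.

End C1.
Arguments C1_derivable {R V U f p} v _ _.
Arguments C1_derive_continuous {R V U f p} v _ _.
Arguments C1_continuous {R V U f p} _ _.
Arguments C1_differentiable {R V U f p} _ _.
Arguments C1_cst {R V U} oU c.
Arguments C1D {R V U} oU {f g} _ _.
Arguments C1B {R V U} oU {f g} _ _.
Arguments C1N {R V U} oU {f} _.
Arguments C1M {R V U} oU {f g} _ _.

(** * Decay *)

Section Decay.
Context {R : realType}.

Definition wt (s : R) (q : R * R) : R := (1 + q.1 ^+ 2 + q.2 ^+ 2) `^ (- s).

Lemma wt_base_ge1 (q : R * R) : 1 <= 1 + q.1 ^+ 2 + q.2 ^+ 2.
Proof. by rewrite -addrA lerDl addr_ge0 ?sqr_ge0. Qed.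

Lemma wt_gt0 s q : 0 < wt s q.
Proof. by apply: powR_gt0; apply: lt_le_trans (wt_base_ge1 q). Qed.

Lemma wt_ge0 s q : 0 <= wt s q. Proof. exact/ltW/wt_gt0. Qed.

Lemma wt0 q : wt 0 q = 1. Proof. by rewrite /wt oppr0 powRr0. Qed.

Lemma wtM s t q : wt s q * wt t q = wt (s + t) q.
Proof.
rewrite /wt opprD powRD//; apply/implyP => _.
by rewrite gt_eqF// (lt_le_trans _ (wt_base_ge1 q)).
Qed.

Lemma wt_anti s t q : s <= t -> wt t q <= wt s q.
Proof. by move=> st; apply: ler_powR; [exact: wt_base_ge1|rewrite lerN2]. Qed.

Lemma wt_le1 s q : 0 <= s -> wt s q <= 1.
Proof. by move=> s0; rewrite -(wt0 q); exact: wt_anti. Qed.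

Definition bnd {T : Type} (U : set T) (f : T -> R) : Prop :=
  exists C : R, forall p, U p -> `|f p| <= C.

Section closure.
Context {V : normedModType R} (hor : V -> R * R) (U : set V).
Implicit Types f g : V -> R.

(** [decays] leaves the sign of the constant open; the estimates of sums and products use [0 <= C],
    which the absolute value of the constant provides. *)
Lemma decaysP a f : decays a hor U f <->
  exists s C : R, [/\ a < s, 0 <= C & forall p, U p -> `|f p| <= C * wt s (hor p)].
Proof.
split=> [[s [C [as_ fC]]]|[s [C [as_ _ fC]]]]; last by exists s, C.
exists s, `|C|; split => // p Up; apply: (le_trans (fC p Up)).
by apply: ler_wpM2r; [exact: wt_ge0|exact: ler_norm].
Qed.

Lemma decays_weak a b f : a <= b -> decays b hor U f -> decays a hor U f.
Proof. by move=> ab [s [C [bs fC]]]; exists s, C; split=> //; exact: le_lt_trans bs. Qed.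

Lemma decays_bnd a f : 0 <= a -> decays a hor U f -> bnd U f.
Proof.
move=> a0 /decaysP[s [C [as_ C0 fC]]]; exists C => p Up.
apply: (le_trans (fC p Up)); rewrite ler_piMr// wt_le1//.
exact/ltW/(le_lt_trans a0).
Qed.

Lemma decays0 a : decays a hor U (fun=> 0 : R).
Proof.
exists (a + 1), 0; split; first by rewrite ltrDl.
by move=> p _; rewrite normr0 mul0r.
Qed.

Lemma decaysD a f g : decays a hor U f -> decays a hor U g ->
  decays a hor U (fun p => f p + g p).
Proof.
move=> /decaysP[s [C [as_ C0 fC]]] /decaysP[t [D [at_ D0 gD]]].
exists (Num.min s t), (C + D); split; first by rewrite lt_min as_.
move=> p Up; apply: (le_trans (ler_normD _ _)); rewrite mulrDl lerD//.
  apply: (le_trans (fC p Up)); rewrite ler_wpM2l//; apply: wt_anti.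
  by rewrite ge_min lexx.
apply: (le_trans (gD p Up)); rewrite ler_wpM2l//; apply: wt_anti.
by rewrite ge_min lexx orbT.
Qed.

Lemma decaysN a f : decays a hor U f -> decays a hor U (fun p => - f p).
Proof. by move=> [s [C [as_ fC]]]; exists s, C; split=> // p Up; rewrite normrN fC. Qed.

Lemma decaysB a f g : decays a hor U f -> decays a hor U g ->
  decays a hor U (fun p => f p - g p).
Proof. by move=> df dg; exact: (decaysD df (decaysN dg)). Qed.

Lemma decaysM a b f g : decays a hor U f -> decays b hor U g ->
  decays (a + b) hor U (fun p => f p * g p).
Proof.
move=> /decaysP[s [C [as_ C0 fC]]] /decaysP[t [D [at_ D0 gD]]].
exists (s + t), (C * D); split; first by rewrite ltrD.
move=> p Up; rewrite normrM -/(wt (s + t) (hor p)) -wtM mulrACA.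
by apply: ler_pM => //; [exact: fC|exact: gD].
Qed.

Lemma bndM_decays a f g : bnd U f -> decays a hor U g ->
  decays a hor U (fun p => f p * g p).
Proof.
move=> [C fC] /decaysP[t [D [at_ D0 gD]]].
exists t, (C * D); split => // p Up; rewrite normrM -mulrA.
by apply: ler_pM => //; [exact: fC|exact: gD].
Qed.

Lemma decaysM_bnd a f g : decays a hor U f -> bnd U g ->
  decays a hor U (fun p => f p * g p).
Proof.
move=> df bg; have := bndM_decays bg df.
by under [in X in X -> _]eq_fun do rewrite mulrC.
Qed.

Lemma decays_le a f g : (forall p, U p -> `|f p| <= `|g p|) ->
  decays a hor U g -> decays a hor U f.
Proof.
by move=> fg [s [C [as_ fC]]]; exists s, C; split => // p Up; apply: le_trans (fC p Up); exact: fg.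
Qed.

Lemma decays_sum a n (f : 'I_n -> V -> R) : (forall i, decays a hor U (f i)) ->
  decays a hor U (fun p => \sum_i f i p).
Proof.
move=> df; elim: n f df => [|n IH] f df.
  by under eq_fun do rewrite big_ord0; exact: decays0.
by under eq_fun do rewrite big_ord_recl; apply: decaysD => //; exact: IH.
Qed.

Lemma bnd_cst c : bnd U (fun=> c). Proof. by exists `|c|. Qed.

Lemma bndD f g : bnd U f -> bnd U g -> bnd U (fun p => f p + g p).
Proof.
move=> [C fC] [D gD]; exists (C + D) => p Up.
by apply: le_trans (ler_normD _ _) _; apply: lerD; [exact: fC|exact: gD].
Qed.

Lemma bndN f : bnd U f -> bnd U (fun p => - f p).
Proof. by move=> [C fC]; exists C => p Up; rewrite normrN fC. Qed.

Lemma bndM f g : bnd U f -> bnd U g -> bnd U (fun p => f p * g p).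
Proof.
move=> [C fC] [D gD]; exists (C * D) => p Up.
by rewrite normrM; apply: ler_pM => //; [exact: fC|exact: gD].
Qed.

End closure.

Lemma decays_comp {V W : normedModType R} a (hor : V -> R * R) (hor' : W -> R * R)
    (U : set V) (U' : set W) (f : V -> R) (gm : W -> V) :
  (forall p, U' p -> U (gm p)) -> (forall p, U' p -> hor (gm p) = hor' p) ->
  decays a hor U f -> decays a hor' U' (fun p => f (gm p)).
Proof.
move=> gU gh [s [C [as_ fC]]]; exists s, C; split=> // p Up.
by rewrite -gh// fC//; exact: gU.
Qed.

Lemma decays_sub {V : normedModType R} a (hor : V -> R * R)
    (U U' : set V) (f : V -> R) :
  U' `<=` U -> decays a hor U f -> decays a hor U' f.
Proof. by move=> UU; apply: (@decays_comp _ _ _ _ _ _ _ _ idfun). Qed.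

Lemma bnd_comp {T T' : Type} (U : set T) (U' : set T') (f : T -> R) (gm : T' -> T) :
  (forall p, U' p -> U (gm p)) -> bnd U f -> bnd U' (fun p => f (gm p)).
Proof. by move=> gU [C fC]; exists C => p Up; apply: fC; exact: gU. Qed.

(* [reg a U D f]: f is C^1 on the open set U, and f and its derivatives are
   O(r^{-2s}) on D, s > a; [breg U D f]: same with bounds in place of decay. *)
Section reg.
Context {V : normedModType R} (hor : V -> R * R) (U : set V) (oU : open U) (D : set V)
  (DU : D `<=` U).
Implicit Types f g : V -> R.

Variant reg a f : Prop :=
  IsReg of C1 U f & decays a hor D f & forall v, decays a hor D ('D_v f).
Variant breg f : Prop := IsBreg of C1 U f & bnd D f & forall v, bnd D ('D_v f).

Lemma reg_C1 a f : reg a f -> C1 U f. Proof. by case. Qed.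
Lemma reg_breg a f : 0 <= a -> reg a f -> breg f.
Proof.
move=> a0 [Cf df dDf]; split=> //; first exact: decays_bnd df.
by move=> v; exact: decays_bnd (dDf v).
Qed.

Lemma decays_eq a f g : (forall p, D p -> f p = g p) -> decays a hor D g -> decays a hor D f.
Proof. by move=> fg; apply: decays_le => p Dp; rewrite fg. Qed.

Lemma bnd_eq f g : (forall p, D p -> f p = g p) -> bnd D g -> bnd D f.
Proof. by move=> fg [C gC]; exists C => p Dp; rewrite fg// gC. Qed.

Lemma derive_C1D f g p v : C1 U f -> C1 U g -> U p ->
  'D_v (fun p => f p + g p) p = 'D_v f p + 'D_v g p.
Proof. by move=> Cf Cg Up; exact: (deriveD (C1_derivable _ Cf Up) (C1_derivable _ Cg Up)). Qed.

Lemma derive_C1N f p v : C1 U f -> U p ->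
  'D_v (fun p => - f p) p = - 'D_v f p.
Proof. by move=> Cf Up; exact: (deriveN (C1_derivable _ Cf Up)). Qed.

Lemma derive_C1B f g p v : C1 U f -> C1 U g -> U p ->
  'D_v (fun p => f p - g p) p = 'D_v f p - 'D_v g p.
Proof. by move=> Cf Cg Up; exact: (deriveB (C1_derivable _ Cf Up) (C1_derivable _ Cg Up)). Qed.

Lemma derive_C1M f g p v : C1 U f -> C1 U g -> U p ->
  'D_v (fun p => f p * g p) p = f p * 'D_v g p + g p * 'D_v f p.
Proof. by move=> Cf Cg Up; exact: (deriveM (C1_derivable _ Cf Up) (C1_derivable _ Cg Up)). Qed.

Lemma breg_cst c : breg (fun=> c).
Proof.
split; [exact: C1_cst|exact: bnd_cst|move=> v].
apply: (@bnd_eq _ (fun=> 0)); [by move=> p _; rewrite derive_cst|exact: bnd_cst].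
Qed.

Lemma bregD f g : breg f -> breg g -> breg (fun p => f p + g p).
Proof.
move=> [Cf bf bDf] [Cg bg bDg]; split; [exact: C1D|exact: bndD|move=> v].
apply: (@bnd_eq _ (fun p => 'D_v f p + 'D_v g p)); last exact: bndD.
by move=> p Dp; apply: derive_C1D => //; exact: DU.
Qed.

Lemma bregN f : breg f -> breg (fun p => - f p).
Proof.
move=> [Cf bf bDf]; split; [exact: C1N|exact: bndN|move=> v].
apply: (@bnd_eq _ (fun p => - 'D_v f p)); last exact: bndN.
by move=> p Dp; apply: derive_C1N => //; exact: DU.
Qed.

Lemma bregB f g : breg f -> breg g -> breg (fun p => f p - g p).
Proof. by move=> bf bg; exact: (bregD bf (bregN bg)). Qed.

Lemma bregM f g : breg f -> breg g -> breg (fun p => f p * g p).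
Proof.
move=> [Cf bf bDf] [Cg bg bDg]; split; [exact: C1M|exact: bndM|move=> v].
apply: (@bnd_eq _ (fun p => f p * 'D_v g p + g p * 'D_v f p)).
  by move=> p Dp; apply: derive_C1M => //; exact: DU.
by apply: bndD; apply: bndM.
Qed.

Lemma regD a f g : reg a f -> reg a g -> reg a (fun p => f p + g p).
Proof.
move=> [Cf bf bDf] [Cg bg bDg]; split; [exact: C1D|exact: decaysD|move=> v].
apply: (@decays_eq _ _ (fun p => 'D_v f p + 'D_v g p)); last exact: decaysD.
by move=> p Dp; apply: derive_C1D => //; exact: DU.
Qed.

Lemma regN a f : reg a f -> reg a (fun p => - f p).
Proof.
move=> [Cf bf bDf]; split; [exact: C1N|exact: decaysN|move=> v].
apply: (@decays_eq _ _ (fun p => - 'D_v f p)); last exact: decaysN.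
by move=> p Dp; apply: derive_C1N => //; exact: DU.
Qed.

Lemma regB a f g : reg a f -> reg a g -> reg a (fun p => f p - g p).
Proof. by move=> bf bg; exact: (regD bf (regN bg)). Qed.

Lemma regM a b f g : reg a f -> reg b g -> reg (a + b) (fun p => f p * g p).
Proof.
move=> [Cf bf bDf] [Cg bg bDg]; split; [exact: C1M|exact: decaysM|move=> v].
apply: (@decays_eq _ _ (fun p => f p * 'D_v g p + g p * 'D_v f p)).
  by move=> p Dp; apply: derive_C1M => //; exact: DU.
by apply: decaysD; [|rewrite addrC]; apply: decaysM.
Qed.

Lemma reg_half2 f g : reg 2^-1 f -> reg 2^-1 g -> reg 1 (fun p => f p * g p).
Proof.
move=> rf rg; have -> : 1 = 2^-1 + 2^-1 :> R by rewrite [LHS]splitr mul1r.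
exact: regM.
Qed.

Lemma bregM_reg a f g : breg f -> reg a g -> reg a (fun p => f p * g p).
Proof.
move=> [Cf bf bDf] [Cg bg bDg]; split; [exact: C1M|exact: bndM_decays|move=> v].
apply: (@decays_eq _ _ (fun p => f p * 'D_v g p + g p * 'D_v f p)).
  by move=> p Dp; apply: derive_C1M => //; exact: DU.
by apply: decaysD; [exact: bndM_decays|exact: decaysM_bnd].
Qed.

Lemma regM_breg a f g : reg a f -> breg g -> reg a (fun p => f p * g p).
Proof.
move=> rf bg; have := bregM_reg bg rf.
by under [in X in X -> _]eq_fun do rewrite mulrC.
Qed.

End reg.

Lemma decays_half2 {V : normedModType R} (hor : V -> R * R) (U : set V) (f g : V -> R) :
  decays 2^-1 hor U f -> decays 2^-1 hor U g -> decays 1 hor U (fun p => f p * g p).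
Proof.
move=> rf rg; have -> : 1 = 2^-1 + 2^-1 :> R by rewrite [LHS]splitr mul1r.
exact: decaysM.
Qed.

Section regcomp.
Context {V W : normedModType R} n (b : 'I_n -> V) (g : 'I_n -> W -> R)
    (gm : W -> V) (hor : V -> R * R) (hor' : W -> R * R) (U D : set V) (U' D' : set W).
Hypotheses (oU' : open U') (gmE : forall p, gm p = \sum_i g i p *: b i)
  (Cg : forall i, C1 U' (g i)) (gmU : forall p, U' p -> U (gm p))
  (DU' : D' `<=` U') (gmD : forall p, D' p -> D (gm p))
  (bDg : forall i v, bnd D' ('D_v (g i))).

Lemma reg_comp a (f : V -> R) : (forall p, D' p -> hor (gm p) = hor' p) ->
  reg hor U D a f -> reg hor' U' D' a (fun p => f (gm p)).
Proof.
move=> horE [Cf df dDf]; have [Cfg DE] := C1_comp oU' gmE Cg gmU Cf.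
split => // [|v]; first exact: decays_comp df.
apply: (@decays_eq _ _ _ _ _ (fun p => \sum_i 'D_v (g i) p * 'D_(b i) f (gm p))).
  by move=> p Dp; apply: DE; exact: DU'.
apply: decays_sum => i; apply: bndM_decays => //.
exact: decays_comp (dDf _).
Qed.

End regcomp.
End Decay.

(** * Integration over the plane *)

Section Measurability.
Context {R : realType}.

(* A Carathéodory function is the pointwise limit of its values at [floor (n z) / n]. *)
Lemma measurable_fun_caratheodory d (T : measurableType d)
    (f : T * measurableTypeR R -> R) :
  (forall z, measurable_fun setT (fun t => f (t, z))) ->
  (forall t, continuous (fun z : R => f (t, z))) ->
  measurable_fun setT f.
Proof.
move=> mf cf.
pose r n (z : R) : R := (Num.floor (z * n.+1%:R))%:~R / n.+1%:R.
apply: (@measurable_fun_cvg _ _ _ _ (fun n (p : T * measurableTypeR R) => f (p.1, r n p.2))).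
- move=> n _ Y mY; rewrite setTI.
  (* On a strip k/(n+1) <= z < (k+1)/(n+1) the approximation does not depend on z, so a preimage is
     a countable union of measurable rectangles. *)
  rewrite (_ : _ @^-1` _ = \bigcup_(k : int) (((fun t => f (t, k%:~R / n.+1%:R)) @^-1` Y) `*`
     [set z : R | (k%:~R / n.+1%:R <= z < (k + 1)%:~R / n.+1%:R)])); last first.
    have n0 : 0 < n.+1%:R :> R by rewrite ltr0n.
    apply/seteqP; split=> [[t z] /= Yf|[t z] [k _ [/= Yf]]].
      exists (Num.floor (z * n.+1%:R)) => //; split => //=.
      by rewrite ler_pdivrMr// ltr_pdivlMr// floor_itv.
    rewrite ler_pdivrMr// ltr_pdivlMr// => zk.
    by rewrite /r (floor_def zk).
  apply: countable_bigcupT_measurable => [|k]; first exact: countableP.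
  apply: measurableX; first by rewrite -[X in _ X]setTI; exact: mf.
  have -> : [set z : R | (k%:~R / n.+1%:R <= z < (k + 1)%:~R / n.+1%:R)] =
     `[k%:~R / n.+1%:R, (k + 1)%:~R / n.+1%:R[%classic.
    by apply/seteqP; split=> z /=; rewrite in_itv.
  exact: measurable_itv.
- move=> [t z] _ /=.
  have cr : r n z @[n --> \oo] --> z.
    apply/cvgrPdist_le => e e0.
    near=> n.
    have n0 : 0 < n.+1%:R :> R by rewrite ltr0n.
    have /andP[f1 f2] := floor_itv (z * n.+1%:R).
    have g1 : r n z <= z by rewrite /r ler_pdivrMr.
    rewrite ger0_norm ?subr_ge0//.
    have : z - r n z <= n.+1%:R^-1.
      rewrite lerBlDr /r -{1}[n.+1%:R^-1]mul1r -mulrDl ler_pdivlMr// ltW//.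
      by move: f2; rewrite intrD addrC.
    move/le_trans; apply.
    rewrite -(invrK e) lef_pV2 ?posrE ?invr_gt0//.
    apply: (@le_trans _ _ n%:R); last by rewrite ler_nat.
    near: n; exact: nbhs_infty_ger.
  exact: (continuous_cvg _ (cf t z) cr).
Unshelve. all: by end_near. Qed.

Lemma continuous_pairl {T U : topologicalType} (u : U) :
  continuous (fun t : T => (t, u)).
Proof. by move=> t; apply: cvg_pair; [exact: cvg_id|exact: cvg_cst]. Qed.

Lemma continuous_pairr {T U : topologicalType} (t : T) :
  continuous (fun u : U => (t, u)).
Proof. by move=> u; apply: cvg_pair; [exact: cvg_cst|exact: cvg_id]. Qed.

(** Measurability refers to the product sigma-algebra. It is reached through continuity in each
    variable separately, by the Carathéodory argument, and not through Borel sets of the plane. *)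
Lemma continuous_measurable2 (f : R * R -> R) : continuous f ->
  measurable_fun setT (f : measurableTypeR R * measurableTypeR R -> R).
Proof.
move=> cf; apply: measurable_fun_caratheodory => [z|t].
  apply: continuous_measurable_fun => x.
  apply: (@continuous_comp _ _ _ (fun t : R => (t, z)) f); last exact: cf.
  exact: continuous_pairl.
move=> x.
apply: (@continuous_comp _ _ _ (fun z : R => (t, z)) f); last exact: cf.
exact: continuous_pairr.
Qed.

Lemma continuous_measurable3 (f : R * R * R -> R) : continuous f ->
  measurable_fun setT
    (f : measurableTypeR R * measurableTypeR R * measurableTypeR R -> R).
Proof.
move=> cf; apply: measurable_fun_caratheodory => [z|t].
  apply: continuous_measurable2 => x.
  apply: (@continuous_comp _ _ _ (fun t : R * R => (t, z)) f); last exact: cf.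
  exact: continuous_pairl.
move=> x.
apply: (@continuous_comp _ _ _ (fun z : R => (t, z)) f); last exact: cf.
exact: continuous_pairr.
Qed.
End Measurability.

(** * The fundamental theorem of calculus and weights of one variable *)

Section FTC.
Context {R : realType}.
Notation mu := (@lebesgue_measure R).

Lemma continuous_integrable_itv (f : R -> R) a b :
  {within `[a, b], continuous f} -> mu.-integrable `[a, b] (EFin \o f).
Proof. by move=> cf; apply: continuous_compact_integrable => //; exact: segment_compact. Qed.

Lemma FTC_Rintegral (F f : R -> R) a b : a <= b ->
  {within `[a, b], continuous f} ->
  (forall x, a <= x <= b -> is_derive x (1 : R) F (f x)) ->
  \int[mu]_(x in `[a, b]) f x = F b - F a.
Proof.
rewrite le_eqVlt => /predU1P[<- _ _|ab cf dF].
  by rewrite set_itv1 Rintegral_set1 subrr.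
have cF x : a <= x <= b -> {for x, continuous F}.
  move=> /dF[dFx _]; apply: differentiable_continuous; exact/derivable1_diffP.
rewrite /Rintegral (@continuous_FTC2 _ f F a b)//.
- split=> [x||].
  + by rewrite in_itv /= => /andP[ax xb]; have [] := dF x; rewrite ?ltW.
  + by apply: cvg_at_right_filter; apply: cF; rewrite lexx ltW.
  + by apply: cvg_at_left_filter; apply: cF; rewrite lexx ltW.
- move=> x; rewrite in_itv /= => /andP[ax xb].
  by rewrite derive1E; have [|_ ->//] := dF x; rewrite !ltW.
Qed.

Lemma is_derive_scaled_powR (b c y : R) : 0 <= c -> 0 <= y ->
  is_derive y (1 : R) (fun s => (1 + c * s) `^ b) (c * (b * (1 + c * y) `^ (b - 1))).
Proof.
move=> c0 y0.
have p1 : 0 < 1 + c * y by rewrite ltr_wpDr// mulr_ge0.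
have d1 : is_derive y (1 : R) (fun s => 1 + c * s) c.
  have dc : is_derive y (1 : R) (fun=> 1 : R) 0 by exact: is_derive_cst.
  have di : is_derive y (1 : R) (fun s : R => c * s) c.
    have := @is_deriveZ _ _ _ (@idfun R) c y (1 : R) (1 : R) (is_derive_id _ _).
    by rewrite [_ *: _]mulr1.
  by have := is_deriveD dc di; rewrite add0r.
rewrite mulrC.
exact: (@is_derive1_comp _ (fun z => z `^ b) (fun s => 1 + c * s) y _ _
  (is_derive1_powR b p1) d1).
Qed.

Lemma continuous_powR_base (V : topologicalType) (g : V -> R) (b : R) :
  continuous g -> (forall x, 0 < g x) -> continuous (fun x => g x `^ b).
Proof.
move=> cg g0 x; apply: (@continuous_comp _ _ _ g (fun z => z `^ b)); first exact: cg.
apply: differentiable_continuous; apply/derivable1_diffP.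
by have [] := is_derive1_powR b (g0 x).
Qed.

(* Substituting y = c s, the integral is that of (1 + y^2)^{-a} over [0, c L]. *)
Lemma integral_scaled_weight_le (a : R) : 2^-1 < a ->
  exists2 K, 0 <= K & forall c L : R, 0 <= c -> 0 <= L ->
  \int[mu]_(s in `[0, L]) (c * (1 + (c * s) ^+ 2) `^ (- a)) <= K.
Proof.
move=> a2.
have a1 : 0 < 2 * a - 1 by lra.
(* From (1 + y)^2 <= 2 (1 + y^2) the integrand is at most c 2^a (1 + c s)^(-2a), and [F c] is a
   primitive of this majorant. As 2a > 1, its increment is at most 2^a / (2a - 1), whatever c and
   L. *)
pose F c s : R := - (2 `^ a / (2 * a - 1)) * (1 + c * s) `^ (1 - 2 * a).
have dF (c s : R) : 0 <= c -> 0 <= s ->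
    is_derive s (1 : R) (F c) (c * (2 `^ a * (1 + c * s) `^ (- (2 * a)))).
  move=> c0 s0; have dp := @is_derive_scaled_powR (1 - 2 * a) c s c0 s0.
  have := @is_deriveZ _ _ _ _ (- (2 `^ a / (2 * a - 1))) s 1 _ dp.
  rewrite [X in is_derive _ _ _ X](_ : _ = (c * (2 `^ a * (1 + c * s) `^ (- (2 * a)))))//.
  have -> : 1 - 2 * a - 1 = - (2 * a) by ring.
  by rewrite /GRing.scale/=; field; rewrite gt_eqF.
exists (2 `^ a / (2 * a - 1)); first by rewrite divr_ge0 ?powR_ge0// ltW.
move=> c L c0 L0.
have b0 s : 0 <= s -> 0 < 1 + c * s by move=> s0; rewrite ltr_wpDr// mulr_ge0.
have cf : continuous (fun s : R => c * (1 + (c * s) ^+ 2) `^ (- a)).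
  have cb : continuous (fun s : R => (1 + (c * s) ^+ 2) `^ (- a)).
    apply: continuous_powR_base => [x|x]; last by rewrite ltr_wpDr// sqr_ge0.
    apply: cvgD; first exact: cvg_cst.
    rewrite expr2; apply: cvgM; (apply: cvgM; [exact: cvg_cst | exact: cvg_id]).
  by move=> s; apply: cvgM; [exact: cvg_cst|exact: cb].
have cg : {within `[0, L], continuous (fun s : R => c * (2 `^ a * (1 + c * s) `^ (- (2 * a))))}.
  apply: continuous_in_subspaceT => s; rewrite inE /= in_itv /= => /andP[s0 _].
  have cp : {for s, continuous (fun s : R => (1 + c * s) `^ (- (2 * a)))}.
    apply: differentiable_continuous; apply/derivable1_diffP.
    by have [] := @is_derive_scaled_powR (- (2 * a)) c s c0 s0.
  apply: cvgM; first exact: cvg_cst.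
  by apply: cvgM; [exact: cvg_cst|exact: cp].
apply: (@le_trans _ _ (F c L - F c 0)); last first.
  rewrite /F mulr0 addr0 powR1 mulr1 mulNr opprK gerDr oppr_le0 mulr_ge0 ?powR_ge0//.
  by rewrite divr_ge0 ?powR_ge0// ltW.
have dFc s : 0 <= s <= L -> is_derive s (1 : R) (F c) (c * (2 `^ a * (1 + c * s) `^ (- (2 * a)))).
  by move=> /andP[s0 _]; exact: dF.
rewrite -(FTC_Rintegral L0 cg dFc).
apply: le_Rintegral => //.
- by apply: continuous_integrable_itv; apply: continuous_subspaceT.
- exact: continuous_integrable_itv.
move=> s /=; rewrite in_itv /= => /andP[s0 _]; rewrite ler_wpM2l//.
have -> : - (2 * a) = 2 * - a by ring.
rewrite powRrM powR_mulrn ?(ltW (b0 _ s0))//.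
have -> : 2 `^ a = 2^-1 `^ (- a) :> R.
  by rewrite -powR_inv1// -powRrM mulN1r opprK.
rewrite -powRM ?invr_ge0// ?sqr_ge0//.
rewrite !powRN lef_pV2 ?posrE ?powR_gt0//; last 2 first.
- by rewrite ltr_wpDr// sqr_ge0.
- by rewrite mulr_gt0// ?invr_gt0// exprn_gt0// b0.
apply: ge0_ler_powR; rewrite ?nnegrE.
- by lra.
- by rewrite mulr_ge0// sqr_ge0.
- by rewrite addr_ge0// sqr_ge0.
rewrite ler_pdivrMl//; have := sqr_ge0 (1 - c * s); rewrite !expr2; nra.
Qed.

Definition wt1 (a x : R) : R := (1 + x ^+ 2) `^ (- a).

Lemma wt1_gt0 a x : 0 < wt1 a x.
Proof. by apply: powR_gt0; rewrite ltr_wpDr// sqr_ge0. Qed.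

Lemma wt1_continuous a : continuous (wt1 a).
Proof.
apply: continuous_powR_base => [x|x]; last by rewrite ltr_wpDr// sqr_ge0.
apply: cvgD; first exact: cvg_cst.
by rewrite expr2; apply: cvgM; exact: cvg_id.
Qed.

Lemma integral_wt1_lty (a : R) : 2^-1 < a ->
  (\int[mu]_x (wt1 a x)%:E < +oo)%E.
Proof.
move=> a2; rewrite ge0_symfun_integralT//; last 3 first.
- by move=> x; rewrite ltW// wt1_gt0.
- exact: wt1_continuous.
- by move=> x; rewrite /wt1 /= sqrrN.
apply: lte_mul_pinfty => //.
rewrite -set_itvcy.
have [K K0 KP] := integral_scaled_weight_le a2.
apply: (@le_lt_trans _ _ K%:E); last exact: ltry.
have w0 x : 0 <= wt1 a x by rewrite ltW// wt1_gt0.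
have mw : measurable_fun setT (wt1 a).
  apply: continuous_measurable_fun; exact: wt1_continuous.
have cv := @ge0_cvgn_integral R (@lebesgue_measure R) _ w0 mw.
apply: (cvge_to_le cv); near=> n.
have := KP 1 n%:R ler01 (ler0n _ n).
have -> : \int[mu]_(s in `[0, n%:R]) (1 * (1 + (1 * s) ^+ 2) `^ (- a))
        = \int[mu]_(s in `[0, n%:R]) wt1 a s.
  by apply: eq_Rintegral => s _; rewrite !mul1r.
rewrite -lee_fin /Rintegral fineK//.
apply: integrable_fin_num => //; apply: continuous_integrable_itv.
by apply: continuous_subspaceT; exact: wt1_continuous.
Unshelve. all: by end_near. Qed.

End FTC.

(** * Integrability of the weights over the plane *)

Section Weights.
Context {R : realType}.
Notation mu := (@lebesgue_measure R).

Lemma wt_continuous s : continuous (wt s : R * R -> R).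
Proof.
apply: continuous_powR_base => [x|x]; last exact: lt_le_trans (wt_base_ge1 x).
apply: cvgD; first apply: cvgD; first exact: cvg_cst.
- by rewrite expr2; apply: cvgM; exact: cvg_fst.
- by rewrite expr2; apply: cvgM; exact: cvg_snd.
Qed.

(** From (1 + x^2)(1 + z^2) <= (1 + x^2 + z^2)^2. Halving the exponent separates the variables, so
    Tonelli reduces integrability over the plane for s > 1 to integrability over the line for s/2 >
    1/2. *)
Lemma wt_le_prod s (x z : R) : 0 <= s -> wt s (x, z) <= wt1 (s / 2) x * wt1 (s / 2) z.
Proof.
move=> s0; rewrite /wt /wt1 /=.
rewrite -powRM ?addr_ge0 ?sqr_ge0//.
have -> : - s = 2 * - (s / 2) by field.
have b0 : 0 <= 1 + x ^+ 2 + z ^+ 2 by rewrite !addr_ge0 ?sqr_ge0.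
rewrite powRrM powR_mulrn//.
have p1 : 0 < 1 + x ^+ 2 by rewrite ltr_wpDr// sqr_ge0.
have p2 : 0 < 1 + z ^+ 2 by rewrite ltr_wpDr// sqr_ge0.
rewrite !powRN lef_pV2 ?posrE ?powR_gt0//; last 2 first.
- by rewrite exprn_gt0// -addrA ltr_wpDr// addr_ge0 ?sqr_ge0.
- by rewrite mulr_gt0.
apply: ge0_ler_powR; rewrite ?nnegrE.
- by rewrite divr_ge0.
- by rewrite mulr_ge0 ?ltW.
- by rewrite exprn_ge0.
have := sqr_ge0 x; have := sqr_ge0 z.
set X := x ^+ 2; set Z := z ^+ 2; rewrite expr2; nra.
Qed.

Lemma wt_integrable s : 1 < s -> (@area R).-integrable setT (EFin \o wt s).
Proof.
move=> s1; apply/integrable12ltyP.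
  by apply/measurable_EFinP; apply: continuous_measurable2; exact: wt_continuous.
have s2 : 2^-1 < s / 2 by lra.
have W := integral_wt1_lty s2.
set I := (\int[mu]_x _)%E in W.
have w0 x : 0 <= wt1 (s / 2) x by rewrite ltW// wt1_gt0.
have mw : measurable_fun setT (EFin \o wt1 (s / 2)).
  by apply/measurable_EFinP; apply: continuous_measurable_fun; exact: wt1_continuous.
apply: (@le_lt_trans _ _ (\int[mu]_x ((wt1 (s / 2) x)%:E * I))%E).
  apply: ge0_le_integral => //.
  - by move=> x _; apply: integral_ge0.
  - apply: (@measurable_fun_fubini_tonelli_F _ _ _ _ R (@lebesgue_measure R)
       (fun q => `|(EFin \o wt s) q|%E)) => //.
    apply: measurableT_comp => //.
    by apply/measurable_EFinP; apply: continuous_measurable2; exact: wt_continuous.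
  - exact: emeasurable_funM.
  - move=> x _ /=; rewrite -ge0_integralZl ?lee_fin//; last by move=> ? _; rewrite lee_fin.
    apply: ge0_le_integral => //.
    + apply/measurable_EFinP; apply: measurableT_comp => //.
      exact: (measurable_fun_pair2 _ (continuous_measurable2 (@wt_continuous s))).
    + exact: emeasurable_funM.
    + move=> z _ /=; rewrite ger0_norm ?wt_ge0// lee_fin; apply: wt_le_prod; lra.
have I0 : (0 <= I)%E by apply: integral_ge0 => x _; rewrite lee_fin.
rewrite ge0_integralZr//; last by move=> x _; rewrite lee_fin.
by rewrite lte_mul_pinfty// ge0_fin_numE.
Qed.
End Weights.

(** * Integrals that depend on a parameter *)

Section ParamIntegral.
Context {R : realType}.

Lemma is_derive_Rintegral d (Y : measurableType d) (mu : {measure set Y -> \bar R})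
    (B : set Y) (f df : R -> Y -> R) (G : Y -> R) (a r : R) :
  measurable B -> 0 < r ->
  (forall x, `|x - a| < r -> mu.-integrable B (EFin \o f x)) ->
  (forall x y, `|x - a| < r -> B y -> is_derive x (1 : R) (f ^~ y) (df x y)) ->
  mu.-integrable B (EFin \o G) ->
  (forall x y, `|x - a| < r -> B y -> `|df x y| <= G y) ->
  is_derive a (1 : R) (fun x => \int[mu]_(y in B) f x y) (\int[mu]_(y in B) df a y).
Proof.
move=> mB r0 intf derf intG Gub.
pose G' (y : Y) : R := `|G y|.
have intG' : mu.-integrable B (EFin \o G').
  by have := integrable_abse intG; apply: eq_integrable => // y yB.
have G0 y : 0 <= G' y by exact: normr_ge0.
have Ia : `]a - r, a + r[%classic a by rewrite /= in_itv /= gtrDl oppr_lt0 r0 ltrDl r0.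
have nI x : `]a - r, a + r[%classic x -> `|x - a| < r.
  by rewrite /= in_itv /= ltr_distl.
have intf' x : `]a - r, a + r[%classic x -> mu.-integrable B (EFin \o f x).
  by move=> /nI; exact: intf.
have derf' x y : `]a - r, a + r[%classic x -> B y -> derivable (f ^~ y) x 1.
  by move=> /nI xI By; have [] := derf x y xI By.
have Gub' x y : `]a - r, a + r[%classic x -> B y -> `|partial1of2 f x y| <= G' y.
  move=> /nI xI By; rewrite partial1of2E; have [_ ->] := derf x y xI By.
  exact: le_trans (Gub _ _ xI By) (ler_norm _).
apply: DeriveDef; first exact: (derivable_under_integral mB Ia intf' derf' G0 intG' Gub').
rewrite -derive1E (differentiation_under_integral mB Ia intf' derf' G0 intG' Gub').
apply: eq_Rintegral => y; rewrite inE => By; rewrite partial1of2E.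
by have [|_ ->//] := derf a y _ By; rewrite subrr normr0.
Qed.

Lemma continuous_bounded_box (f : R * R -> R) (M : R) : continuous f ->
  exists C, forall x z, `|x| <= M -> `|z| <= M -> `|f (x, z)| <= C.
Proof.
move=> cf; have [M0|M0] := leP 0 M; last first.
  by exists 0 => x z xM; have := le_lt_trans xM M0; rewrite normr_lt0.
have nf : {within (`[- M, M] `*` `[- M, M]), continuous (fun q : R * R => `|f q|)}.
  apply: continuous_subspaceT => q; exact: (cvg_norm (cf q)).
have ne : (`[- M, M]%classic `*` `[- M, M]%classic) !=set0.
  by exists (0, 0); split => /=; rewrite in_itv /= oppr_le0 M0.
have cc := compact_setX (@segment_compact R (- M) M) (@segment_compact R (- M) M).
have [c _ cP] := compact_EVT_max ne cc nf.
exists `|f c| => x z xM zM; apply: cP; rewrite inE; split => /=; rewrite in_itv /= -ler_norml//.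
Qed.

Lemma is_derive_integral01 (f df : R * R -> R) (a : R) :
  continuous f -> continuous df ->
  (forall u s, is_derive u (1 : R) (fun u => f (u, s)) (df (u, s))) ->
  is_derive a (1 : R) (fun u => \int[lebesgue_measure]_(s in `[0, 1]) f (u, s))
     (\int[lebesgue_measure]_(s in `[0, 1]) df (a, s)).
Proof.
move=> cf cdf dfE.
have [C CP] := @continuous_bounded_box df (`|a| + 1) cdf.
apply: (@is_derive_Rintegral _ (measurableTypeR R) (@lebesgue_measure R) `[0, 1]%classic
  (fun u s => f (u, s)) (fun u s => df (u, s)) (fun=> C) a 1) => //.
- move=> x _; apply: continuous_integrable_itv; apply: continuous_subspaceT => s.
  apply: (@continuous_comp _ _ _ (fun s : R => (x, s)) f); last exact: cf.
  exact: continuous_pairr.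
- apply: continuous_integrable_itv; apply: continuous_subspaceT => s; exact: cst_continuous.
- move=> x s xa; rewrite /= in_itv /= => /andP[s0 s1]; apply: CP.
    rewrite -(subrK a x) (le_trans (ler_normD _ _))// addrC lerD2l ltW//.
  by rewrite ger0_norm// (le_trans s1)// lerDr.
Qed.

Lemma lipschitz_of_derive (g dg : R -> R) (M a b : R) :
  (forall x, is_derive x (1 : R) g (dg x)) -> (forall x, `|dg x| <= M) ->
  `|g b - g a| <= M * `|b - a|.
Proof.
move=> dgE bdg.
wlog ab : a b / a <= b.
  move=> H; have [/H//|/ltW /H] := leP a b.
  by rewrite distrC (distrC a b).
have [c _ ->] := mean_value ab (fun x _ => dgE x).
by rewrite normrM ler_wpM2r.
Qed.

(** Two points are joined by two segments parallel to the axes, along each of which [f] is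
    M-Lipschitz. This gives the joint continuity of the potential of a curl-free field, of which
    only the two partial derivatives are known. *)
Lemma continuous_of_bounded_partials (f f1 f2 : R * R -> R) (M : R) :
  (forall x z, is_derive x (1 : R) (fun x => f (x, z)) (f1 (x, z))) ->
  (forall x z, is_derive z (1 : R) (fun z => f (x, z)) (f2 (x, z))) ->
  (forall q, `|f1 q| <= M) -> (forall q, `|f2 q| <= M) -> continuous f.
Proof.
move=> d1 d2 b1 b2 [x z]; apply/cvgrPdist_lt => e e0.
have M0 : 0 <= M by exact: le_trans (b1 (x, z)).
have d0 : 0 < e / 2 / (M + 1) by rewrite !divr_gt0// ltr_wpDl.
have nx : \forall q \near (x, z), `|x - q.1| < e / 2 / (M + 1).
  exists ([set y | `|x - y| < e / 2 / (M + 1)], setT); last by move=> [a b] [].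
  by split; [exact: (nbhsx_ballx x _ d0)|exact: filterT].
have nz : \forall q \near (x, z), `|z - q.2| < e / 2 / (M + 1).
  exists (setT, [set y | `|z - y| < e / 2 / (M + 1)]); last by move=> [a b] [].
  by split; [exact: filterT|exact: (nbhsx_ballx z _ d0)].
near=> q.
have hx : `|x - q.1| < e / 2 / (M + 1) by near: q.
have hz : `|z - q.2| < e / 2 / (M + 1) by near: q.
have M1 : 0 < M + 1 by rewrite ltr_wpDl.
have L1 : `|f (x, z) - f (q.1, z)| <= M * `|x - q.1|.
  exact: (@lipschitz_of_derive (fun x => f (x, z)) (fun x => f1 (x, z))).
have L2 : `|f (q.1, z) - f (q.1, q.2)| <= M * `|z - q.2|.
  exact: (@lipschitz_of_derive (fun z => f (q.1, z)) (fun z => f2 (q.1, z))).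
have -> : f q = f (q.1, q.2) by case: (q).
have := ler_normD (f (x, z) - f (q.1, z)) (f (q.1, z) - f (q.1, q.2)).
rewrite addrA subrK => /le_lt_trans; apply.
apply: (le_lt_trans (lerD L1 L2)).
rewrite [ltRHS]splitr; apply: ltrD.
  apply: (@le_lt_trans _ _ ((M + 1) * `|x - q.1|)); first by rewrite ler_wpM2r// lerDl.
  by rewrite mulrC -ltr_pdivlMr.
apply: (@le_lt_trans _ _ ((M + 1) * `|z - q.2|)); first by rewrite ler_wpM2r// lerDl.
by rewrite mulrC -ltr_pdivlMr.
Unshelve. all: by end_near. Qed.

End ParamIntegral.

Section RectangleFubini.
Context {R : realType} d1 d2 (T1 : measurableType d1) (T2 : measurableType d2)
  (m1 : {sigma_finite_measure set T1 -> \bar R})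
  (m2 : {sigma_finite_measure set T2 -> \bar R}).

(** Every slice, and not merely almost every slice, is assumed integrable, so that [fine] can be
    undone inside the outer integral at each point. *)
Lemma Rintegral_prod12 (A : set T1) (B : set T2) (f : T1 * T2 -> R) :
  measurable A -> measurable B ->
  (m1 \x m2)%E.-integrable (A `*` B) (EFin \o f) ->
  (forall x, A x -> m2.-integrable B (EFin \o (fun y => f (x, y)))) ->
  Rintegral (m1 \x m2)%E (A `*` B) f =
  \int[m1]_(x in A) \int[m2]_(y in B) f (x, y).
Proof.
move=> mA mB intf intf2.
rewrite /Rintegral integral_mkcond.
have intf' : (m1 \x m2)%E.-integrable setT ((EFin \o f) \_ (A `*` B)).
  exact: (integrable_mkcond _ (measurableX mA mB)).1.
rewrite -(integral12_prod_meas1 intf') [in RHS]integral_mkcond; congr fine.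
apply: eq_integral => x _; rewrite /fubini_F /= [RHS]patchE.
case: ifPn => [xA|xA].
  rewrite /= fineK; last by apply: integrable_fin_num => //; apply: intf2; rewrite inE in xA.
  rewrite [RHS]integral_mkcond; apply: eq_integral => y _; rewrite !patchE.
  by rewrite in_setX xA.
by apply: integral0_eq => y _; rewrite patchE in_setX (negbTE xA).
Qed.

Lemma Rintegral_prod21 (A : set T1) (B : set T2) (f : T1 * T2 -> R) :
  measurable A -> measurable B ->
  (m1 \x m2)%E.-integrable (A `*` B) (EFin \o f) ->
  (forall y, B y -> m1.-integrable A (EFin \o (fun x => f (x, y)))) ->
  Rintegral (m1 \x m2)%E (A `*` B) f =
  \int[m2]_(y in B) \int[m1]_(x in A) f (x, y).
Proof.
move=> mA mB intf intf2.
rewrite /Rintegral integral_mkcond.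
have intf' : (m1 \x m2)%E.-integrable setT ((EFin \o f) \_ (A `*` B)).
  exact: (integrable_mkcond _ (measurableX mA mB)).1.
rewrite -(integral21_prod_meas1 intf') [in RHS]integral_mkcond; congr fine.
apply: eq_integral => y _; rewrite /fubini_G /= [RHS]patchE.
case: ifPn => [yB|yB].
  rewrite /= fineK; last by apply: integrable_fin_num => //; apply: intf2; rewrite inE in yB.
  rewrite [RHS]integral_mkcond; apply: eq_integral => x _; rewrite !patchE.
  by rewrite in_setX yB andbT.
by apply: integral0_eq => x _; rewrite patchE in_setX (negbTE yB) andbF.
Qed.
End RectangleFubini.

(** * Decaying functions on the plane and on the slab are integrable *)

Section Plane.
Context {R : realType}.
Notation P := (R * R)%type.
Notation mu := (@lebesgue_measure R).

Lemma plane_sigma_finite : sigma_finite setT (mu \x mu)%E.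
Proof.
have /sigma_finiteP[F [TF ndF Foo]] := sigma_finiteT mu.
exists (fun n => F n `*` F n).
  rewrite -setXTT TF predeqE => -[x y]; split.
    move=> [/= [n _ Fnx] [k _ Gky]]; exists (maxn n k) => //; split.
    - by move: x Fnx; exact/subsetPset/ndF/leq_maxl.
    - by move: y Gky; exact/subsetPset/ndF/leq_maxr.
  by move=> [n _ []/= ? ?]; split; exists n.
move=> k; have [? ?] := Foo k.
split; first exact: measurableX.
by rewrite product_measure1E// lte_mul_pinfty// ge0_fin_numE.
Qed.

(** [area] bundled with its sigma-finiteness, as it must be to act as the first factor of [volume]
    in the Fubini theorems. *)
Definition plane_measure := HB.pack_for
  {sigma_finite_measure set (measurableTypeR R * measurableTypeR R)%type -> \bar R}
  (mu \x mu)%E (Measure_isSigmaFinite.Build _ _ _ (mu \x mu)%E plane_sigma_finite).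

Lemma decays_integrable (f : P -> R) : continuous f -> decays 1 idfun setT f ->
  (@area R).-integrable setT (EFin \o f).
Proof.
move=> cf /decaysP[s [C [s1 C0 fC]]].
have iw := wt_integrable s1.
have H := @le_integrable _ _ R plane_measure setT measurableT (EFin \o f)
  (EFin \o (fun q : P => C * wt s q)).
apply: H => //.
- by apply/measurable_EFinP; exact: continuous_measurable2.
- move=> q _ /=; rewrite lee_fin [leRHS]ger0_norm ?mulr_ge0 ?wt_ge0//; exact: fC.
- by have := @integrableZl _ _ R plane_measure setT measurableT C _ iw; apply: eq_integrable.
Qed.

Definition slab : set (P * R) := [set: P] `*` `[0, 1]%classic.

Lemma measurable_slab : measurable (slab : set (measurableTypeR R * measurableTypeR R * measurableTypeR R)).
Proof. by apply: measurableX => //; exact: measurable_itv. Qed.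

Lemma measurable_cylinder a b : measurable
  ([set: P] `*` `[a, b]%classic : set (measurableTypeR R * measurableTypeR R * measurableTypeR R)).
Proof. by apply: measurableX => //; exact: measurable_itv. Qed.

Lemma wt_cylinder_integrable s a b : 1 < s ->
  (@volume R).-integrable ([set: P] `*` `[a, b]%classic) (EFin \o (fun t : P * R => wt s t.1)).
Proof.
move=> s1; have iw := wt_integrable s1.
set D := _ `*` _.
have mD : measurable (D : set (measurableTypeR R * measurableTypeR R * measurableTypeR R)).
  exact: measurable_cylinder.
apply/(@integrable_mkcond _ _ R (plane_measure \x mu)%E D _ mD).
have mw : measurable_fun setT (fun t : measurableTypeR R * measurableTypeR R * measurableTypeR R => (wt s t.1)%:E).
  apply/measurable_EFinP; apply: measurableT_comp => //.
  exact: continuous_measurable2 (@wt_continuous _ s).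
have mp : measurable_fun setT ((EFin \o (fun t : P * R => wt s t.1)) \_ D :
   measurableTypeR R * measurableTypeR R * measurableTypeR R -> \bar R).
  apply/(measurable_restrictT _ _).1 => //.
  exact: measurable_funTS.
apply: (@integrable12ltyP _ _ _ _ R plane_measure mu _ mp).2.
have L : (mu (`[a, b]%classic : set R) < +oo)%E.
  by rewrite lebesgue_measure_itv /=; case: ifP => // _; rewrite -EFinD ltry.
have fL : mu (`[a, b]%classic : set R) \is a fin_num by rewrite ge0_fin_numE.
have /integrableP[mwt wlty] := iw.
apply: (@le_lt_trans _ _ (\int[plane_measure]_q (`|(EFin \o wt s) q| * mu `[a, b]%classic))%E); last first.
  rewrite ge0_integralZr//; last exact: measurableT_comp.
  by rewrite lte_mul_pinfty//; [exact: integral_ge0|rewrite ge0_fin_numE//; exact: integral_ge0].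
apply: ge0_le_integral => //.
- by move=> q _; apply: integral_ge0.
- apply: (@measurable_fun_fubini_tonelli_F _ _ _ _ R (@lebesgue_measure R)
    (fun t => `|((EFin \o (fun t : P * R => wt s t.1)) \_ D) t|%E)) => //.
  exact: measurableT_comp.
- by apply: emeasurable_funM => //; exact: measurableT_comp.
- move=> q _.
  rewrite (_ : (\int[_]_y _)%E = (\int[mu]_(y in `[a, b]) (cst `|(wt s q)%:E|) y)%E).
    by rewrite integral_cst//; exact: measurable_itv.
  rewrite [RHS]integral_mkcond; apply: eq_integral => y _; rewrite !patchE in_setX in_setT /=.
  by case: ifPn => _ /=; rewrite ?normr0.
Qed.

Lemma wt_slab_integrable s : 1 < s -> (@volume R).-integrable slab (EFin \o (fun t : P * R => wt s t.1)).
Proof. exact: wt_cylinder_integrable. Qed.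

Lemma decays_slab_integrable (f : P * R -> R) : continuous f -> decays 1 fst slab f ->
  (@volume R).-integrable slab (EFin \o f).
Proof.
move=> cf /decaysP[s [C [s1 C0 fC]]].
have iw := wt_slab_integrable s1.
have H := @le_integrable _ _ R (plane_measure \x mu)%E slab measurable_slab (EFin \o f)
  (EFin \o (fun t : P * R => C * wt s t.1)).
apply: H => //.
- by apply: measurable_funTS; apply/measurable_EFinP; exact: continuous_measurable3.
- move=> q Sq /=; rewrite lee_fin [leRHS]ger0_norm ?mulr_ge0 ?wt_ge0//; exact: fC.
- by have := @integrableZl _ _ R (plane_measure \x mu)%E slab measurable_slab C _ iw; apply: eq_integrable => //; exact: measurable_slab.
Qed.
End Plane.

(** * The divergence theorem in the plane *)

Section PlaneDivergence.
Context {R : realType}.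
Notation P := (R * R)%type.
Notation mu := (@lebesgue_measure R).

Lemma lebesgue_sym (n : nat) :
  lebesgue_measure (`[- n%:R, n%:R]%classic : set R) = (n%:R + n%:R)%:E :> \bar R.
Proof.
rewrite lebesgue_measure_itv /=; case: ifPn => [_|]; first by rewrite -EFinD opprK.
rewrite lte_fin -leNgt => nn.
case: n nn => [|n] nn; first by rewrite addr0.
by move: nn; rewrite -subr_le0 opprK -natrD lern0.
Qed.

Definition box (n : nat) : set P := `[- n%:R, n%:R]%classic `*` `[- n%:R, n%:R]%classic.

Lemma measurable_box n : measurable (box n : set (measurableTypeR R * measurableTypeR R)).
Proof. by apply: measurableX; exact: measurable_itv. Qed.

Lemma box_norm n x z : box n (x, z) -> `|x| <= n%:R /\ `|z| <= n%:R.
Proof. by move=> [/=]; rewrite !in_itv /= -!ler_norml. Qed.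

Lemma Rintegral_box_cvg (k : P -> R) : (@area R).-integrable setT (EFin \o k) ->
  \int[@area R]_(q in box n) k q @[n --> \oo] --> \int[@area R]_q k q.
Proof.
move=> ik; have /integrableP[mk _] := ik.
have fk : (\int[@area R]_q (k q)%:E)%E \is a fin_num.
  exact: (@integrable_fin_num _ _ R plane_measure).
suff : (\int[@area R]_q ((EFin \o k) \_ (box n)) q)%E @[n --> \oo] -->
    (\int[@area R]_q (k q)%:E)%E.
  rewrite -(fineK fk) => /fine_cvg; rewrite /Rintegral.
  by under [in X in X -> _]eq_fun do rewrite /= -integral_mkcond.
have H := @dominated_cvg _ _ R plane_measure setT measurableT
  (fun n => (EFin \o k) \_ (box n)) (EFin \o k) (fun q => `|(k q)%:E|%E).
apply: H.
- move=> n; apply/(measurable_restrictT _ _).1; first exact: measurable_box.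
  exact: measurable_funTS.
- move=> [x z] _; apply: cvg_near_cst.
  near=> n; rewrite patchE ifT// inE /box.
  by split => /=; rewrite in_itv /= -ler_norml; near: n; exact: nbhs_infty_ger.
- by [].
- exact: (@integrable_abse _ _ R plane_measure).
- move=> n q _; rewrite patchE; case: ifPn => // _.
  by rewrite abse0.
Unshelve. all: by end_near. Qed.

Lemma continuous_integrable_box n (k : P -> R) : continuous k ->
  (@area R).-integrable (box n) (EFin \o k).
Proof.
move=> ck.
have H := @measurable_bounded_integrable _ _ R plane_measure k (box n) (@measurable_box n).
apply: H.
- rewrite /= product_measure1E; try exact: measurable_itv.
  have L := ltry (n%:R + n%:R : R); rewrite -lebesgue_sym in L.
  by apply: lte_mul_pinfty => //; rewrite ge0_fin_numE.
- by apply: measurable_funTS; exact: continuous_measurable2.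
- have [C CP] := continuous_bounded_box n%:R ck.
  exists C; split; first exact: num_real.
  move=> x Cx [a b] /box_norm[an bn]; apply: le_trans (ltW Cx); exact: CP.
Qed.

Lemma Rintegral_box_dx n (g k : P -> R) : continuous k ->
  (forall x z, is_derive x (1 : R) (fun x => g (x, z)) (k (x, z))) ->
  \int[@area R]_(q in box n) k q =
  \int[mu]_(z in `[- n%:R, n%:R]) (g (n%:R, z) - g (- n%:R, z)).
Proof.
move=> ck dg.
have cz z : continuous (fun x : R => k (x, z)).
  by move=> x; apply: (@continuous_comp _ _ _ (fun x : R => (x, z)) k); [exact: continuous_pairl|exact: ck].
have mI : measurable (`[- n%:R, n%:R]%classic : set (measurableTypeR R)) by exact: measurable_itv.
rewrite /area (Rintegral_prod21 mI mI).
- apply: eq_Rintegral => z _.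
  rewrite (@FTC_Rintegral _ (fun x => g (x, z)))//.
  + by rewrite (@le_trans _ _ 0)// oppr_le0.
  + exact: continuous_subspaceT.
- exact: continuous_integrable_box.
- by move=> z _; apply: continuous_integrable_itv; exact: continuous_subspaceT.
Qed.

Lemma Rintegral_box_dz n (g k : P -> R) : continuous k ->
  (forall x z, is_derive z (1 : R) (fun z => g (x, z)) (k (x, z))) ->
  \int[@area R]_(q in box n) k q =
  \int[mu]_(x in `[- n%:R, n%:R]) (g (x, n%:R) - g (x, - n%:R)).
Proof.
move=> ck dg.
have cx x : continuous (fun z : R => k (x, z)).
  by move=> z; apply: (@continuous_comp _ _ _ (fun z : R => (x, z)) k); [exact: continuous_pairr|exact: ck].
have mI : measurable (`[- n%:R, n%:R]%classic : set (measurableTypeR R)) by exact: measurable_itv.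
rewrite /area (Rintegral_prod12 mI mI).
- apply: eq_Rintegral => x _.
  rewrite (@FTC_Rintegral _ (fun z => g (x, z)))//.
  + by rewrite (@le_trans _ _ 0)// oppr_le0.
  + exact: continuous_subspaceT.
- exact: continuous_integrable_box.
- by move=> x _; apply: continuous_integrable_itv; exact: continuous_subspaceT.
Qed.

Lemma Rintegral_itv_le (f : R -> R) (C : R) n : continuous f ->
  (forall x, `|f x| <= C) -> `|\int[mu]_(x in `[- n%:R, n%:R]) f x| <= C * (n%:R + n%:R).
Proof.
move=> cf fC.
have cI (h : R -> R) : continuous h -> mu.-integrable `[- n%:R, n%:R] (EFin \o h).
  by move=> ch; apply: continuous_integrable_itv; exact: continuous_subspaceT.
have cn : continuous (fun x => `|f x|) by move=> x; exact: (cvg_norm (cf x)).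
apply: (le_trans (le_normr_Rintegral _ (cI _ cf))); first exact: measurable_itv.
apply: (@le_trans _ _ (\int[mu]_(x in `[- n%:R, n%:R]) C)).
  apply: le_Rintegral => //; first exact: (cI _ cn).
  by apply: (cI (fun=> C)) => x; exact: cst_continuous.
rewrite Rintegral_cst; last exact: measurable_itv.
rewrite le_eqVlt; apply/orP; left; apply/eqP; congr (_ * _).
exact: (congr1 fine (lebesgue_sym n)).
Qed.

(** Since n <= (1 + n^2)^(1/2), the sequence is at most 2 |C| (1 + n^2)^(-(s - 1/2)). The threshold
    1/2 of the decay classes is exactly what makes boundary fluxes vanish in the limit. *)
Lemma flux_cvg0 (C s : R) : 2^-1 < s ->
  (C * (1 + n%:R ^+ 2) `^ (- s) * (n%:R + n%:R)) @[n --> \oo] --> (0 : R).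
Proof.
move=> s2.
have d0 : 0 < s - 2^-1 by rewrite subr_gt0.
have c1 : (1 + (n%:R : R) ^+ 2) `^ (- (s - 2^-1)) @[n --> \oo] --> (0 : R).
  apply/cvgrPdist_le => e e0; near=> n.
  have b1 : 0 < 1 + (n%:R : R) ^+ 2 by rewrite ltr_wpDr// sqr_ge0.
  rewrite sub0r normrN ger0_norm ?powR_ge0// powRN -(invrK e) lef_pV2 ?posrE ?invr_gt0 ?powR_gt0//.
  have -> : e^-1 = (e^-1 `^ (s - 2^-1)^-1) `^ (s - 2^-1).
    by rewrite -powRrM mulVf ?gt_eqF// powRr1// invr_ge0 ltW.
  apply: ge0_ler_powR; rewrite ?nnegrE ?powR_ge0// ?(ltW b1)// ?(ltW d0)//.
  apply: (@le_trans _ _ n%:R); first by near: n; exact: nbhs_infty_ger.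
  have := sqr_ge0 ((n%:R : R) - 1); have : 0 <= n%:R :> R by []; rewrite !expr2; nra.
have c2 : `|C| * 2 * (1 + (n%:R : R) ^+ 2) `^ (- (s - 2^-1)) @[n --> \oo] --> (0 : R).
  by rewrite -[X in _ --> X](mulr0 (`|C| * 2)); apply: cvgM => //; exact: cvg_cst.
apply/norm_cvg0P; apply: (squeeze_cvgr _ (@cvg_cst _ _ _ _ _) c2).
near=> n; rewrite normr_ge0 /= !normrM.
have b1 : 0 < 1 + (n%:R : R) ^+ 2 by rewrite ltr_wpDr// sqr_ge0.
rewrite (ger0_norm (powR_ge0 _ _)) (ger0_norm (addr_ge0 (ler0n _ _) (ler0n _ _))).
have nn : (n%:R : R) <= (1 + n%:R ^+ 2) `^ 2^-1.
  have {1}-> : n%:R = ((n%:R : R) ^+ 2) `^ 2^-1 by rewrite -powR_mulrn// -powRrM divff// powRr1.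
  by apply: ge0_ler_powR; rewrite ?nnegrE ?sqr_ge0 ?(ltW b1) ?lerDr ?invr_ge0.
have -> : - (s - 2^-1) = - s + 2^-1 by ring.
rewrite powRD; last by apply/implyP => _; rewrite gt_eqF.
have p0 : 0 <= `|C| * (1 + (n%:R : R) ^+ 2) `^ (- s) by rewrite mulr_ge0 ?powR_ge0.
have -> : `|C| * 2 * ((1 + (n%:R : R) ^+ 2) `^ (- s) * (1 + n%:R ^+ 2) `^ 2^-1) =
  `|C| * (1 + n%:R ^+ 2) `^ (- s) * ((1 + n%:R ^+ 2) `^ 2^-1 + (1 + n%:R ^+ 2) `^ 2^-1) by ring.
by rewrite ler_wpM2l// lerD.
Unshelve. all: by end_near. Qed.

(* Flux through the boundary of a box of side 2n is O(n n^{-2s}), s > 1/2. *)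
Lemma plane_divergence (g1 g2 k1 k2 : P -> R) :
  continuous g1 -> continuous g2 -> continuous k1 -> continuous k2 ->
  (forall x z, is_derive x (1 : R) (fun x => g1 (x, z)) (k1 (x, z))) ->
  (forall x z, is_derive z (1 : R) (fun z => g2 (x, z)) (k2 (x, z))) ->
  decays 2^-1 idfun setT g1 -> decays 2^-1 idfun setT g2 ->
  (@area R).-integrable setT (EFin \o (fun q => k1 q + k2 q)) ->
  \int[@area R]_q (k1 q + k2 q) = 0.
Proof.
move=> cg1 cg2 ck1 ck2 d1 d2 /decaysP[s [C [s2 C0 gC]]] /decaysP[t [D [t2 D0 gD]]] ik.
have cv := Rintegral_box_cvg ik.
suff c0 : \int[@area R]_(q in box n) (k1 q + k2 q) @[n --> \oo] --> (0 : R).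
  exact: (cvg_unique _ cv c0).
have f1 := @flux_cvg0 (C + C) s s2; have f2 := @flux_cvg0 (D + D) t t2.
have f12 : ((C + C) * (1 + n%:R ^+ 2) `^ (- s) * (n%:R + n%:R)
    + (D + D) * (1 + n%:R ^+ 2) `^ (- t) * (n%:R + n%:R)) @[n --> \oo] --> (0 : R).
  by rewrite -[X in _ --> X](addr0 0); exact: cvgD.
apply/norm_cvg0P; apply: (squeeze_cvgr _ (@cvg_cst _ _ _ _ _) f12).
near=> n; rewrite normr_ge0 /=.
have I1 := @RintegralD _ _ R plane_measure (box n) k1 k2 (@measurable_box n)
  (continuous_integrable_box n ck1) (continuous_integrable_box n ck2).
rewrite [X in `|X|]I1.
rewrite (Rintegral_box_dx n ck1 d1) (Rintegral_box_dz n ck2 d2).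
have cx (g : P -> R) x : continuous g -> continuous (fun z : R => g (x, z)).
  by move=> cg z; apply: (@continuous_comp _ _ _ (fun z : R => (x, z)) g); [exact: continuous_pairr|exact: cg].
have cz (g : P -> R) z : continuous g -> continuous (fun x : R => g (x, z)).
  by move=> cg x; apply: (@continuous_comp _ _ _ (fun x : R => (x, z)) g); [exact: continuous_pairl|exact: cg].
(* On a side of the box one coordinate is n or -n; forgetting the other one leaves a bound that is
   constant along the side. *)
have wl u (a b : R) : 0 <= u -> wt u (a, b) <= (1 + a ^+ 2) `^ (- u) /\ wt u (a, b) <= (1 + b ^+ 2) `^ (- u).
  move=> u0; rewrite /wt /=; split; rewrite !powRN lef_pV2 ?posrE ?powR_gt0//;
    rewrite ?ltr_wpDr ?sqr_ge0// ?(lt_le_trans _ (wt_base_ge1 (a, b)))//;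
    apply: ge0_ler_powR; rewrite ?nnegrE ?addr_ge0 ?sqr_ge0//.
    by rewrite lerDl sqr_ge0.
  by rewrite addrAC lerDl sqr_ge0.
have s0 : 0 <= s by lra.
have t0 : 0 <= t by lra.
apply: (le_trans (ler_normD _ _)); apply: lerD.
  apply: Rintegral_itv_le.
    by move=> z; apply: cvgB; exact: cx.
  move=> z; apply: (le_trans (ler_normB _ _)); rewrite mulrDl; apply: lerD.
    by apply: (le_trans (gC _ I)); rewrite ler_wpM2l//; have [] := wl s n%:R z s0.
  by apply: (le_trans (gC _ I)); rewrite ler_wpM2l// -(sqrrN n%:R); have [] := wl s (- n%:R) z s0.
apply: Rintegral_itv_le.
  by move=> x; apply: cvgB; exact: cz.
move=> x; apply: (le_trans (ler_normB _ _)); rewrite mulrDl; apply: lerD.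
  by apply: (le_trans (gD _ I)); rewrite ler_wpM2l//; have [] := wl t x n%:R t0.
by apply: (le_trans (gD _ I)); rewrite ler_wpM2l// -(sqrrN n%:R); have [] := wl t x (- n%:R) t0.
Unshelve. all: by end_near. Qed.

Lemma is_derive_dx (f : P -> R) x z : differentiable f (x, z) ->
  is_derive x (1 : R) (fun x => f (x, z)) (d_x f (x, z)).
Proof.
move=> df; have E (t : R) : (0, z) + t *: ((1, 0) : R * R) = (t, z).
  by congr pair; rewrite /= /GRing.scale /= ?mulr0 ?mulr1 ?add0r ?addr0.
have := @is_derive_line R _ f (0, z) (1, 0) x.
rewrite E /d_x => /(_ (diff_derivable df)).
by under eq_fun do rewrite E.
Qed.

Lemma is_derive_dz (f : P -> R) x z : differentiable f (x, z) ->
  is_derive z (1 : R) (fun z => f (x, z)) (d_z f (x, z)).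
Proof.
move=> df; have E (t : R) : (x, 0) + t *: ((0, 1) : R * R) = (x, t).
  by congr pair; rewrite /= /GRing.scale /= ?mulr0 ?mulr1 ?add0r ?addr0.
have := @is_derive_line R _ f (x, 0) (0, 1) z.
rewrite E /d_z => /(_ (diff_derivable df)).
by under eq_fun do rewrite E.
Qed.

Lemma C1T_continuous (V : normedModType R) (f : V -> R) : C1 setT f -> continuous f.
Proof. by move=> Cf q; exact: C1_continuous Cf I. Qed.

Lemma C1T_dx_continuous (f : P -> R) : C1 setT f -> continuous (d_x f).
Proof. by move=> Cf q; exact: (C1_derive_continuous _ Cf I). Qed.

Lemma C1T_dz_continuous (f : P -> R) : C1 setT f -> continuous (d_z f).
Proof. by move=> Cf q; exact: (C1_derive_continuous _ Cf I). Qed.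

Lemma plane_divergence_C1 (g1 g2 : P -> R) : C1 setT g1 -> C1 setT g2 ->
  decays 2^-1 idfun setT g1 -> decays 2^-1 idfun setT g2 ->
  (@area R).-integrable setT (EFin \o (fun q => d_x g1 q + d_z g2 q)) ->
  \int[@area R]_q (d_x g1 q + d_z g2 q) = 0.
Proof.
move=> C1g1 C1g2; apply: plane_divergence.
- exact: C1T_continuous.
- exact: C1T_continuous.
- exact: C1T_dx_continuous.
- exact: C1T_dz_continuous.
- by move=> x z; apply: is_derive_dx; exact: (C1_differentiable C1g1 I).
- by move=> x z; apply: is_derive_dz; exact: (C1_differentiable C1g2 I).
Qed.

End PlaneDivergence.

(** * Orthogonality of curl-free and divergence-free fields in the plane *)

Section Hodge.
Context {R : realType}.
Notation P := (R * R)%type.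
Notation mu := (@lebesgue_measure R).

Lemma is_derive_mulc (c u : R) : is_derive u (1 : R) (fun u : R => c * u) c.
Proof.
have := @is_deriveZ _ _ _ (@idfun R) c u (1 : R) (1 : R) (is_derive_id _ _).
by rewrite [_ *: _]mulr1.
Qed.

Lemma is_derive_rescale (h dh : R -> R) (c u : R) :
  (forall t, is_derive t (1 : R) h (dh t)) ->
  is_derive u (1 : R) (fun u => h (c * u)) (c * dh (c * u)).
Proof.
move=> hE; rewrite mulrC.
exact: (@is_derive1_comp _ h (fun u => c * u) u _ _ (hE _) (is_derive_mulc c u)).
Qed.

Lemma is_derive_continuous (h dh : R -> R) :
  (forall t, is_derive t (1 : R) h (dh t)) -> continuous h.
Proof.
move=> hE t; apply: differentiable_continuous; apply/derivable1_diffP.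
by have [] := hE t.
Qed.

Lemma continuous_at_pair {T U V : topologicalType} (f : T -> U) (g : T -> V) (t : T) :
  {for t, continuous f} -> {for t, continuous g} ->
  {for t, continuous (fun x => (f x, g x))}.
Proof. by move=> cf cg; exact: (cvg_pair cf cg). Qed.

Lemma continuous_scale2 (h : R -> R) : continuous h ->
  continuous (fun q : P => h (q.2 * q.1)).
Proof.
move=> ch q; apply: (@continuous_comp _ _ _ (fun q : P => q.2 * q.1) h); last exact: ch.
by apply: cvgM; [exact: cvg_snd|exact: cvg_fst].
Qed.

(** The integral of h from 0 to u, rescaled to the fixed interval [0, 1]: this treats both signs of
    u alike and lets derivatives with respect to u be taken under the integral sign. *)
Definition primitive (h : R -> R) (u : R) : R :=
  \int[mu]_(s in `[0, 1]) (u * h (s * u)).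

Lemma primitive_is_derive (h dh : R -> R) (u : R) : continuous dh ->
  (forall t, is_derive t (1 : R) h (dh t)) -> is_derive u (1 : R) (primitive h) (h u).
Proof.
move=> cdh hE; have ch := is_derive_continuous hE.
pose f (q : P) := q.1 * h (q.2 * q.1).
pose df (q : P) := q.1 * (q.2 * dh (q.2 * q.1)) + h (q.2 * q.1).
have cf : continuous f.
  by move=> q; apply: cvgM; [exact: cvg_fst|exact: (continuous_scale2 ch)].
have cdf : continuous df.
  move=> q; apply: cvgD; last exact: (continuous_scale2 ch).
  apply: cvgM; first exact: cvg_fst.
  by apply: cvgM; [exact: cvg_snd|exact: (continuous_scale2 cdh)].
have dfE v s : is_derive v (1 : R) (fun v => f (v, s)) (df (v, s)).
  have d1 := @is_derive_rescale h dh s v hE.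
  have := is_deriveM (is_derive_id v (1 : R)) d1.
  by rewrite /GRing.scale /= mulr1.
have := is_derive_integral01 u cf cdf dfE.
suff -> : \int[mu]_(s in `[0, 1]) df (u, s) = h u by [].
have cs : {within `[0, 1], continuous (fun s : R => df (u, s))}.
  apply: continuous_subspaceT => s.
  by apply: (@continuous_comp _ _ _ (fun s : R => (u, s)) df); [exact: continuous_pairr|exact: cdf].
(* The u-derivative of the integrand is also the s-derivative of s h(u s), so its integral over
   [0, 1] is h u. *)
have dS (s : R) : 0 <= s <= 1 -> is_derive s (1 : R) (fun s => s * h (u * s)) (df (u, s)).
  move=> _; have d1 := @is_derive_rescale h dh u s hE.
  have := is_deriveM (is_derive_id s (1 : R)) d1.
  rewrite /GRing.scale /= mulr1.
  suff -> : s * (u * dh (u * s)) + h (u * s) = df (u, s) by [].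
  by rewrite /df /= (mulrC u s) mulrCA.
by rewrite (FTC_Rintegral ler01 cs dS) mul1r mul0r subr0 mulr1.
Qed.

(** After rescaling, the majorant is the scaled weight with c = |u|, whose integral is bounded
    uniformly in c. [K] depends on the exponent only, so that one bound serves all lines parallel to
    an axis. *)
Lemma primitive_bound (s : R) : 2^-1 < s -> exists K, forall (h : R -> R) (C u : R),
  continuous h -> 0 <= C -> (forall t, `|h t| <= C * (1 + t ^+ 2) `^ (- s)) ->
  `|primitive h u| <= C * K.
Proof.
move=> s2; have [K K0 KP] := integral_scaled_weight_le s2.
exists K => h C u ch C0 hC.
have cI (k : R -> R) : continuous k -> mu.-integrable `[0, 1] (EFin \o k).
  by move=> ck; apply: continuous_integrable_itv; exact: continuous_subspaceT.
have c1 : continuous (fun s : R => u * h (s * u)).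
  move=> t; apply: cvgM; first exact: cvg_cst.
  apply: (@continuous_comp _ _ _ (fun t : R => t * u) h); last exact: ch.
  by apply: cvgM; [exact: cvg_id|exact: cvg_cst].
have c2 : continuous (fun t : R => `|u| * (1 + (`|u| * t) ^+ 2) `^ (- s)).
  have cb : continuous (fun t : R => (1 + (`|u| * t) ^+ 2) `^ (- s)).
    apply: continuous_powR_base => [x|x]; last by rewrite ltr_wpDr// sqr_ge0.
    apply: cvgD; first exact: cvg_cst.
    rewrite expr2; apply: cvgM; (apply: cvgM; [exact: cvg_cst | exact: cvg_id]).
  by move=> t; apply: cvgM; [exact: cvg_cst|exact: cb].
apply: (le_trans (le_normr_Rintegral _ (cI _ c1))); first exact: measurable_itv.
apply: (@le_trans _ _ (\int[mu]_(t in `[0, 1]) (C * (`|u| * (1 + (`|u| * t) ^+ 2) `^ (- s))))).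
  apply: le_Rintegral => //.
  - by apply: (cI (fun t => `|u * h (t * u)|)) => t; exact: (cvg_norm (c1 t)).
  - apply: (cI (fun t => C * (`|u| * (1 + (`|u| * t) ^+ 2) `^ (- s)))) => t.
    by apply: cvgM; [exact: cvg_cst|exact: c2].
  - move=> t _; rewrite normrM mulrCA ler_wpM2l//.
    apply: (le_trans (hC _)).
    by rewrite !exprMn real_normK ?num_real// (mulrC (u ^+ 2)).
rewrite RintegralZl//; last exact: (cI _ c2).
by rewrite ler_wpM2l//; apply: KP.
Qed.

(** Unlike [reg], this asks no decay of the derivatives: for a gradient part, [is_invLap] provides
    decay of the gradient but not of the second derivatives of the potential. *)
Definition field (f : P -> R) := C1 setT f /\ decays 2^-1 idfun setT f.

Lemma fieldD f g : field f -> field g -> field (fun q => f q + g q).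
Proof. by move=> [Cf df] [Cg dg]; split; [exact: (C1D openT)|exact: decaysD]. Qed.

Lemma fieldN f : field f -> field (fun q => - f q).
Proof. by move=> [Cf df]; split; [exact: (C1N openT)|exact: decaysN]. Qed.

Lemma fieldB f g : field f -> field g -> field (fun q => f q - g q).
Proof. by move=> ff fg; exact: (fieldD ff (fieldN fg)). Qed.

Lemma field_continuous f : field f -> continuous f.
Proof. by move=> [Cf _]; exact: C1T_continuous. Qed.

Definition pint (f : P -> R) := (@area R).-integrable setT (EFin \o f).

Lemma pintD f g : pint f -> pint g -> pint (fun q => f q + g q).
Proof.
move=> pf pg; have := @integrableD _ _ R plane_measure setT measurableT _ _ pf pg.
by apply: eq_integrable.
Qed.

Lemma pintN f : pint f -> pint (fun q => - f q).
Proof.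
move=> pf; have := @integrableN _ _ R plane_measure setT _ pf.
by apply: eq_integrable.
Qed.

Lemma pintB f g : pint f -> pint g -> pint (fun q => f q - g q).
Proof. by move=> pf pg; exact: (pintD pf (pintN pg)). Qed.

Lemma pintZ c f : pint f -> pint (fun q => c * f q).
Proof.
move=> pf; have := @integrableZl _ _ R plane_measure setT measurableT c _ pf.
by apply: eq_integrable.
Qed.

Lemma pintM f g : field f -> field g -> pint (fun q => f q * g q).
Proof.
move=> ff fg; apply: decays_integrable.
  by move=> q; apply: cvgM; exact: field_continuous.
by apply: decays_half2; [case: ff|case: fg].
Qed.

Lemma pint_add f g : pint f -> pint g ->
  \int[@area R]_q (f q + g q) = \int[@area R]_q f q + \int[@area R]_q g q.
Proof. exact: (@RintegralD _ _ R plane_measure setT f g measurableT). Qed.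

Lemma pint_sub f g : pint f -> pint g ->
  \int[@area R]_q (f q - g q) = \int[@area R]_q f q - \int[@area R]_q g q.
Proof. exact: (@RintegralB _ _ R plane_measure setT f g measurableT). Qed.

Lemma pint_scale c f : pint f ->
  \int[@area R]_q (c * f q) = c * \int[@area R]_q f q.
Proof. exact: (@RintegralZl _ _ R plane_measure setT f c measurableT). Qed.

Lemma pint_ge0 f : (forall q, 0 <= f q) -> 0 <= \int[@area R]_q f q.
Proof. by move=> f0; apply: (@Rintegral_ge0 _ _ R plane_measure). Qed.

Lemma pint_le f g : pint f -> pint g -> (forall q, f q <= g q) ->
  \int[@area R]_q f q <= \int[@area R]_q g q.
Proof. by move=> pf pg fg; apply: (@le_Rintegral _ _ R plane_measure). Qed.

Lemma eq_pint f g : (forall q, f q = g q) -> \int[@area R]_q f q = \int[@area R]_q g q.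
Proof. by move=> fg; congr (Rintegral _ _ _); apply/funext. Qed.

(** The field f is the gradient of [psi], obtained by integrating f1 along the x-axis and then f2 in
    the direction of z. As f is O(r^(-2s)) with 2s > 1, both integrals are bounded, hence so is
    [psi]. Then psi g decays like g, and its divergence is f . g because g is divergence free. *)
Lemma curlfree_divfree_orthogonal (f1 f2 g1 g2 : P -> R) :
  field f1 -> field f2 -> field g1 -> field g2 ->
  (forall q, d_z f1 q = d_x f2 q) -> (forall q, d_x g1 q + d_z g2 q = 0) ->
  \int[@area R]_q (f1 q * g1 q + f2 q * g2 q) = 0.
Proof.
move=> ff1 ff2 fg1 fg2 curl0 div0.
have [C1f1 df1] := ff1; have [C1f2 df2] := ff2.
have [C1g1 dg1] := fg1; have [C1g2 dg2] := fg2.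
have cf1 := C1T_continuous C1f1; have cf2 := C1T_continuous C1f2.
have cx (g : P -> R) x : continuous g -> continuous (fun z : R => g (x, z)).
  by move=> cg z; apply: (@continuous_comp _ _ _ (fun z : R => (x, z)) g); [exact: continuous_pairr|exact: cg].
have cz (g : P -> R) z : continuous g -> continuous (fun x : R => g (x, z)).
  by move=> cg x; apply: (@continuous_comp _ _ _ (fun x : R => (x, z)) g); [exact: continuous_pairl|exact: cg].
have dx (g : P -> R) : C1 setT g -> forall x z, is_derive x (1 : R) (fun x => g (x, z)) (d_x g (x, z)).
  by move=> Cg x z; apply: is_derive_dx; exact: (C1_differentiable Cg I).
have dz (g : P -> R) : C1 setT g -> forall x z, is_derive z (1 : R) (fun z => g (x, z)) (d_z g (x, z)).
  by move=> Cg x z; apply: is_derive_dz; exact: (C1_differentiable Cg I).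
pose psi (q : P) := primitive (fun x => f1 (x, 0)) q.1 + primitive (fun z => f2 (q.1, z)) q.2.
have psi_z x z : is_derive z (1 : R) (fun z => psi (x, z)) (f2 (x, z)).
  have dc : is_derive z (1 : R) (fun=> primitive (fun x => f1 (x, 0)) x) 0.
    exact: is_derive_cst.
  have dp : is_derive z (1 : R) (primitive (fun z => f2 (x, z))) (f2 (x, z)).
    apply: (@primitive_is_derive (fun z => f2 (x, z)) (fun z => d_z f2 (x, z))).
      by apply: cx; exact: C1T_dz_continuous.
    by move=> t; exact: dz.
  by have := is_deriveD dc dp; rewrite add0r.
have psi_x x z : is_derive x (1 : R) (fun x => psi (x, z)) (f1 (x, z)).
  have dp : is_derive x (1 : R) (primitive (fun x => f1 (x, 0))) (f1 (x, 0)).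
    apply: (@primitive_is_derive (fun x => f1 (x, 0)) (fun x => d_x f1 (x, 0))).
      by apply: cz; exact: C1T_dx_continuous.
    by move=> t; exact: dx.
  (* Differentiating the second integral under the integral sign produces the x-derivative of f2,
     which is the z-derivative of f1; its integral in z is f1(x, z) - f1(x, 0), and the last term
     cancels the contribution of the first integral. *)
  suff d2 : is_derive x (1 : R) (fun x => primitive (fun z => f2 (x, z)) z) (f1 (x, z) - f1 (x, 0)).
    by have := is_deriveD dp d2; rewrite [X in is_derive _ _ _ X]addrCA subrr addr0.
  pose f (q : P) := z * f2 (q.1, q.2 * z); pose df (q : P) := z * d_x f2 (q.1, q.2 * z).
  have cc (h : P -> R) : continuous h -> continuous (fun q : P => z * h (q.1, q.2 * z)).
    move=> ch q; apply: cvgM; first exact: cvg_cst.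
    apply: (@continuous_comp _ _ _ (fun q : P => (q.1, q.2 * z)) h); last exact: ch.
    apply: continuous_at_pair; first exact: cvg_fst.
    by apply: cvgM; [exact: cvg_snd|exact: cvg_cst].
  have dfE u s : is_derive u (1 : R) (fun u => f (u, s)) (df (u, s)).
    exact: (@is_deriveZ _ _ _ (fun u => f2 (u, s * z)) z u 1 _ (dx _ C1f2 _ _)).
  have := is_derive_integral01 x (cc _ cf2) (cc _ (C1T_dx_continuous C1f2)) dfE.
  suff -> : \int[mu]_(s in `[0, 1]) df (x, s) = f1 (x, z) - f1 (x, 0) by [].
  have cs : {within `[0, 1], continuous (fun s : R => df (x, s))}.
    by apply: continuous_subspaceT; apply: cx; apply: cc; exact: C1T_dx_continuous.
  have dS (s : R) : 0 <= s <= 1 -> is_derive s (1 : R) (fun s => f1 (x, z * s)) (df (x, s)).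
    move=> _; rewrite /df /= -curl0 (mulrC s).
    by apply: (@is_derive_rescale (fun z => f1 (x, z)) (fun z => d_z f1 (x, z))) => t; exact: dz.
  by rewrite (FTC_Rintegral ler01 cs dS) mulr1 mulr0.
have bpsi : bnd setT psi.
  have /decaysP[s [C [s2 C0 fC]]] := df1; have /decaysP[t [D [t2 D0 fD]]] := df2.
  have [K KP] := primitive_bound s2; have [L LP] := primitive_bound t2.
  exists (C * K + D * L) => q _; apply: (le_trans (ler_normD _ _)); apply: lerD.
    apply: KP => //; first exact: cz.
    by move=> x; have := fC (x, 0) I; rewrite /wt /= expr0n addr0.
  apply: LP => //; first exact: cx.
  move=> z; apply: (le_trans (fD (q.1, z) I)); rewrite ler_wpM2l// /wt /=.
  rewrite !powRN lef_pV2 ?posrE ?powR_gt0// ?ltr_wpDr ?sqr_ge0//; apply: ge0_ler_powR;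
    rewrite ?nnegrE ?addr_ge0 ?sqr_ge0//; first by lra.
  by rewrite addrAC lerDl sqr_ge0.
have cpsi : continuous psi.
  have h0 : 0 <= 2^-1 :> R by rewrite invr_ge0.
  have [M1 bM1] := decays_bnd h0 df1; have [M2 bM2] := decays_bnd h0 df2.
  apply: (@continuous_of_bounded_partials _ _ f1 f2 (Num.max M1 M2)) => // q.
    by rewrite le_max bM1.
  by rewrite le_max bM2 ?orbT.
pose k1 q := psi q * d_x g1 q + g1 q * f1 q; pose k2 q := psi q * d_z g2 q + g2 q * f2 q.
have kE q : f1 q * g1 q + f2 q * g2 q = k1 q + k2 q.
  have := div0 q; rewrite /k1 /k2 => d0.
  have -> : d_z g2 q = - d_x g1 q by lra.
  ring.
rewrite (eq_pint kE).
have cM (g h : P -> R) : continuous g -> continuous h -> continuous (fun q => g q * h q).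
  by move=> cg ch q; apply: cvgM; [exact: cg|exact: ch].
have cD (g h : P -> R) : continuous g -> continuous h -> continuous (fun q => g q + h q).
  by move=> cg ch q; apply: cvgD; [exact: cg|exact: ch].
have cg1 := C1T_continuous C1g1; have cg2 := C1T_continuous C1g2.
apply: (@plane_divergence _ (fun q => psi q * g1 q) (fun q => psi q * g2 q)).
- exact: cM.
- exact: cM.
- by apply: cD; apply: cM => //; exact: C1T_dx_continuous.
- by apply: cD; apply: cM => //; exact: C1T_dz_continuous.
- by move=> x z; exact: (is_deriveM (psi_x x z) (dx _ C1g1 x z)).
- by move=> x z; exact: (is_deriveM (psi_z x z) (dz _ C1g2 x z)).
- exact: bndM_decays.
- exact: bndM_decays.
- have -> : (fun q => k1 q + k2 q) = (fun q => f1 q * g1 q + f2 q * g2 q).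
    by apply/funext => q; rewrite kE.
  by apply: pintD; exact: pintM.
Qed.
End Hodge.

(** * The nonlocal term *)

Section HodgeVariation.
Context {R : realType}.
Notation P := (R * R)%type.

(* (E1, E2) is the gradient part of the rotated field (- a2, a1). *)
Definition hodge (a1 a2 E1 E2 : P -> R) : Prop :=
  [/\ field a1 /\ field a2, field E1 /\ field E2,
      forall q, d_z E1 q = d_x E2 q &
      forall q, d_x (fun q => - a2 q - E1 q) q + d_z (fun q => a1 q - E2 q) q = 0].

Lemma d_xB (f g : P -> R) q : C1 setT f -> C1 setT g ->
  d_x (fun q => f q - g q) q = d_x f q - d_x g q.
Proof. by move=> Cf Cg; exact: (derive_C1B _ Cf Cg I). Qed.

Lemma d_zB (f g : P -> R) q : C1 setT f -> C1 setT g ->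
  d_z (fun q => f q - g q) q = d_z f q - d_z g q.
Proof. by move=> Cf Cg; exact: (derive_C1B _ Cf Cg I). Qed.

Lemma d_xN (f : P -> R) q : C1 setT f -> d_x (fun q => - f q) q = - d_x f q.
Proof. by move=> Cf; exact: (derive_C1N _ Cf I). Qed.

Lemma d_zN (f : P -> R) q : C1 setT f -> d_z (fun q => - f q) q = - d_z f q.
Proof. by move=> Cf; exact: (derive_C1N _ Cf I). Qed.

Lemma hodgeB a1 a2 E1 E2 b1 b2 G1 G2 : hodge a1 a2 E1 E2 -> hodge b1 b2 G1 G2 ->
  hodge (fun q => a1 q - b1 q) (fun q => a2 q - b2 q)
        (fun q => E1 q - G1 q) (fun q => E2 q - G2 q).
Proof.
move=> [[fa1 fa2] [fE1 fE2] cE dE] [[fb1 fb2] [fG1 fG2] cG dG].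
have [[Ca1 _] [Ca2 _] [CE1 _] [CE2 _]] := And4 fa1 fa2 fE1 fE2.
have [[Cb1 _] [Cb2 _] [CG1 _] [CG2 _]] := And4 fb1 fb2 fG1 fG2.
split; [by split; exact: fieldB|by split; exact: fieldB| |].
  by move=> q; rewrite (d_zB q CE1 CG1) (d_xB q CE2 CG2) cE cG.
move=> q.
have -> : (fun q => - (a2 q - b2 q) - (E1 q - G1 q)) =
          (fun q => (- a2 q - E1 q) - (- b2 q - G1 q)).
  by apply/funext => r; ring.
have -> : (fun q => a1 q - b1 q - (E2 q - G2 q)) =
          (fun q => (a1 q - E2 q) - (b1 q - G2 q)).
  by apply/funext => r; ring.
rewrite d_xB; last 2 first.
- by apply: (C1B openT) => //; exact: (C1N openT).
- by apply: (C1B openT) => //; exact: (C1N openT).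
rewrite d_zB; [|by apply: (C1B openT)|by apply: (C1B openT)].
have := dE q; have := dG q; lra.
Qed.

(** Write a^perp = E + w and b^perp = G + w' with w and w' divergence free. Up to sign the integrand
    is G . E^perp + (w')^perp . w, and a quarter turn exchanges curl-free and divergence-free
    fields, so both terms integrate to zero. In other words the form given by the integral of G . a
    is symmetric up to a local term. *)
Lemma hodge_reciprocity a1 a2 E1 E2 b1 b2 G1 G2 :
  hodge a1 a2 E1 E2 -> hodge b1 b2 G1 G2 ->
  \int[@area R]_q ((G1 q * a1 q + G2 q * a2 q) - (E1 q * b1 q + E2 q * b2 q)
                   + (b2 q * a1 q - b1 q * a2 q)) = 0.
Proof.
move=> [[fa1 fa2] [fE1 fE2] cE dE] [[fb1 fb2] [fG1 fG2] cG dG].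
have fNa2 := fieldB (fieldN fa2) fE1; have fw2 := fieldB fa1 fE2.
have fNb2 := fieldB (fieldN fb2) fG1; have fv2 := fieldB fb1 fG2.
have fNE2 := fieldN fE2.
have H1 := curlfree_divfree_orthogonal fG1 fG2 fNE2 fE1 cG.
have {}H1 : \int[@area R]_q (G1 q * - E2 q + G2 q * E1 q) = 0.
  by apply: H1 => q; rewrite d_xN ?cE; [ring|case: fE2].
have H2 := @curlfree_divfree_orthogonal _ (fun q => - (b1 q - G2 q)) (fun q => - b2 q - G1 q)
  (fun q => - a2 q - E1 q) (fun q => a1 q - E2 q) (fieldN fv2) fNb2 fNa2 fw2.
have {}H2 : \int[@area R]_q (- (b1 q - G2 q) * (- a2 q - E1 q)
                    + (- b2 q - G1 q) * (a1 q - E2 q)) = 0.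
  apply: H2 => // q; rewrite d_zN; last by case: fv2.
  by have := dG q; lra.
have p1 : pint (fun q => G1 q * - E2 q + G2 q * E1 q) by apply: pintD; exact: pintM.
have p2 : pint (fun q => - (b1 q - G2 q) * (- a2 q - E1 q) + (- b2 q - G1 q) * (a1 q - E2 q)).
  by apply: pintD; apply: pintM => //; exact: fieldN.
have := pint_add p1 p2; rewrite H1 H2 addr0 => S0.
rewrite -[RHS](mulr0 (-1)) -[X in _ = _ * X]S0 -(pint_scale (-1) (pintD p1 p2)).
apply: eq_pint => q; ring.
Qed.

(** The contraction estimate in the form in which it is applied, namely to the difference of the
    decompositions at two parameter values. *)
Lemma hodge_pairing_le a1 a2 E1 E2 : hodge a1 a2 E1 E2 ->
  `|\int[@area R]_q (E1 q * a1 q + E2 q * a2 q)| <=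
  \int[@area R]_q (a1 q * a1 q + a2 q * a2 q).
Proof.
move=> [[fa1 fa2] [fE1 fE2] cE dE].
have fw1 := fieldB (fieldN fa2) fE1; have fw2 := fieldB fa1 fE2.
have H := curlfree_divfree_orthogonal fE1 fE2 fw1 fw2 cE dE.
set w1 := fun q => - a2 q - E1 q in fw1 H; set w2 := fun q => a1 q - E2 q in fw2 H.
have pH : pint (fun q => E1 q * w1 q + E2 q * w2 q) by apply: pintD; exact: pintM.
have pa : pint (fun q => a1 q * a1 q + a2 q * a2 q) by apply: pintD; exact: pintM.
have pE : pint (fun q => E1 q * a1 q + E2 q * a2 q) by apply: pintD; exact: pintM.
have sq0 (x y : R) : 0 <= x * x + y * y by rewrite addr_ge0// -expr2 sqr_ge0.
(* |a|^2 = |E|^2 + |w|^2 + 2 E.w, so |a|^2 +- E.a - E.w is half a sum of squares. *)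
rewrite ler_norml; apply/andP; split.
- rewrite -subr_ge0 opprK -(pint_add pE pa).
  rewrite -[X in _ <= X]subr0 -[X in _ - X]H -(pint_sub (pintD pE pa) pH).
  apply: pint_ge0 => q; rewrite /w1 /w2.
  have := sq0 (a1 q + E1 q) (a2 q + E2 q); have := sq0 (- a2 q - E1 q) (a1 q - E2 q); nra.
- rewrite -subr_ge0 -(pint_sub pa pE).
  rewrite -[X in _ <= X]subr0 -[X in _ - X]H -(pint_sub (pintB pa pE) pH).
  apply: pint_ge0 => q; rewrite /w1 /w2.
  have := sq0 (a1 q - E1 q) (a2 q - E2 q); have := sq0 (- a2 q - E1 q) (a1 q - E2 q); nra.
Qed.

Lemma is_derive_fst {T : normedModType R} (G : R * T -> R) (e : R) (y : T) :
  differentiable G (e, y) ->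
  is_derive e (1 : R) (fun e => G (e, y)) ('D_(1, 0) G (e, y)).
Proof.
move=> dG; have E (t : R) : (0, y) + t *: ((1, 0) : R * T) = (t, y).
  by congr pair; rewrite /= ?scaler0 ?addr0// add0r [_ *: _]mulr1.
have := @is_derive_line R _ G (0, y) (1, 0) e.
rewrite E => /(_ (diff_derivable dG)).
by under eq_fun do rewrite E.
Qed.

Definition strip (T : Type) (d : R) : set (R * T) := [set ep | `|ep.1| < d].

Lemma open_strip (T : normedModType R) (d : R) : open (@strip T d).
Proof.
have -> : strip d = (fun ep : R * T => `|ep.1|) @^-1` [set x | x < d] by [].
apply: open_comp; last exact: open_lt.
by move=> p _; apply: continuous_comp; [exact: cvg_fst|exact: norm_continuous].
Qed.

Lemma fst_slice_continuous (T : normedModType R) (G : R * T -> R) d e :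
  C1 (strip d) G -> `|e| < d -> continuous (fun q : T => G (e, q)).
Proof.
move=> CG ed q.
apply: (@continuous_comp _ _ _ (fun q : T => (e, q)) G); first exact: continuous_pairr.
exact: (C1_continuous CG).
Qed.

(** Decay is asked of the integrand and of its parameter derivative alone. This suits integrands
    that contain a gradient part E, whose horizontal derivatives are not known to decay. *)
Lemma is_derive_area_family (G dG : R * P -> R) (d : R) : 0 < d ->
  (forall e, `|e| < d -> continuous (fun q => G (e, q))) ->
  (forall e q, `|e| < d -> is_derive e (1 : R) (fun e => G (e, q)) (dG (e, q))) ->
  decays 1 snd (strip d) G -> decays 1 snd (strip d) dG ->
  is_derive (0 : R) (1 : R) (fun e => \int[@area R]_q G (e, q))
    (\int[@area R]_q dG (0, q)).
Proof.
move=> d0 cG GE bG /decaysP[s [C [s1 C0 DGC]]].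
apply: (@is_derive_Rintegral _ _ _ plane_measure setT (fun e q => G (e, q))
  (fun e q => dG (e, q)) (fun q => C * wt s q) 0 d measurableT d0).
- move=> e; rewrite subr0 => ed; apply: decays_integrable; first exact: cG.
  exact: (@decays_comp _ _ _ _ snd idfun (strip d) setT G (fun q => (e, q))).
- by move=> e q; rewrite subr0 => ed _; exact: GE.
- exact: (pintZ C (wt_integrable s1)).
- by move=> e q; rewrite subr0 => ed _; exact: (DGC (e, q)).
Qed.

Lemma is_derive_area (G : R * P -> R) (d : R) : 0 < d ->
  reg snd (strip d) (strip d) 1 G ->
  is_derive (0 : R) (1 : R) (fun e => \int[@area R]_q G (e, q))
    (\int[@area R]_q 'D_(1, 0) G (0, q)).
Proof.
move=> d0 [CG dG dDG]; apply: (@is_derive_area_family G ('D_(1, 0) G) d d0) => //.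
- by move=> e ed; exact: fst_slice_continuous ed.
- by move=> e q ed; apply: is_derive_fst; exact: (C1_differentiable CG).
Qed.

Lemma is_derive_slab (G : R * (P * R) -> R) (d : R) : 0 < d ->
  reg (fun p => p.2.1) (strip d) [set p | `|p.1| < d /\ slab p.2] 1 G ->
  is_derive (0 : R) (1 : R) (fun e => \int[@volume R]_(t in slab) G (e, t))
    (\int[@volume R]_(t in slab) 'D_(1, 0) G (0, t)).
Proof.
move=> d0 [CG dG dDG].
have /decaysP[s [C [s1 C0 DGC]]] := dDG (1, 0).
apply: (@is_derive_Rintegral _ _ _ (plane_measure \x lebesgue_measure)%E slab (fun e q => G (e, q))
  (fun e q => 'D_(1, 0) G (e, q)) (fun t => C * wt s t.1) 0 d measurable_slab d0).
- move=> e; rewrite subr0 => ed; apply: decays_slab_integrable.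
    exact: fst_slice_continuous ed.
  exact: (@decays_comp _ _ _ _ (fun p => p.2.1) fst [set p | `|p.1| < d /\ slab p.2] slab G
    (fun q => (e, q))).
- by move=> e q; rewrite subr0 => ed _; apply: is_derive_fst; exact: (C1_differentiable CG).
- have := @integrableZl _ _ R (plane_measure \x lebesgue_measure)%E slab measurable_slab C _
    (wt_slab_integrable s1).
  by apply: eq_integrable => //; exact: measurable_slab.
- by move=> e q; rewrite subr0 => ed sq; apply: (DGC (e, q)).
Qed.

(** Differentiability of [F] at 0 is part of the conclusion: [F] is a differentiable function plus a
    constant plus an O(e^2) term. *)
Lemma is_derive_remainder (F S : R -> R) (c K d s' : R) : 0 < d ->
  (forall e, `|e| < d -> `|F e - (S e + c)| <= K * e ^+ 2) ->
  is_derive (0 : R) (1 : R) S s' -> is_derive (0 : R) (1 : R) F s'.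
Proof.
move=> d0 FS dS.
have K0 : 0 <= K.
  have := FS (d / 2); rewrite ger0_norm; last by rewrite divr_ge0// ltW.
  have h : d / 2 < d by lra.
  move=> /(_ h) /(le_trans (normr_ge0 _)); rewrite pmulr_lge0// exprn_gt0//; lra.
pose r e := F e - (S e + c).
have r0 : r 0 = 0.
  apply/eqP; rewrite -normr_le0 (le_trans (FS 0 _)) ?normr0//.
  by rewrite expr0n mulr0.
have dr : is_derive (0 : R) (1 : R) r 0.
  have cv : (h : R)^-1 *: ((r \o shift 0) (h *: 1) - r 0) @[h --> 0^'] --> (0 : R).
    apply/cvgrPdist_le => e e0; near=> h.
    have h0 : h != 0 by near: h; exact: nbhs_dnbhs_neq.
    rewrite sub0r normrN /= r0 subr0 addr0 [h *: 1]mulr1 normrM.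
    have hd : `|h| < d by near: h; apply: dnbhs0_lt.
    apply: (@le_trans _ _ (`|h^-1| * (K * h ^+ 2))); first by rewrite ler_wpM2l// FS.
    have -> : `|h^-1| * (K * h ^+ 2) = K * `|h|.
      by rewrite -(real_normK (num_real h)) normfV; field; rewrite normr_eq0.
    have : `|h| < e / (K + 1) by near: h; apply: dnbhs0_lt; rewrite divr_gt0// ltr_wpDl.
    rewrite ltr_pdivlMr ?ltr_wpDl// => /ltW; apply: le_trans.
    by rewrite mulrC ler_wpM2l// lerDl.
  apply: DeriveDef; first by apply/cvg_ex; exists 0.
  exact/cvg_lim.
have -> : F = S + cst c + r by apply/funext => e; rewrite /r !fctE /=; ring.
rewrite -[s']addr0; apply: is_deriveD.
by rewrite -[s']addr0; apply: is_deriveD.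
Unshelve. all: by end_near. Qed.

(* The gradient parts E(e) need not depend differentiably on e: the operator a |-> E
   is a contraction in L^2, so replacing E(e) by E(0) costs O(e^2). *)
Lemma is_derive_hodge (a1 a2 : R * P -> R) (E1 E2 : R -> P -> R) (d : R) : 0 < d ->
  reg snd (strip d) (strip d) 2^-1 a1 -> reg snd (strip d) (strip d) 2^-1 a2 ->
  (forall e, `|e| < d ->
    hodge (fun q => a1 (e, q)) (fun q => a2 (e, q)) (E1 e) (E2 e)) ->
  is_derive (0 : R) (1 : R)
    (fun e => \int[@area R]_q (E1 e q * a1 (e, q) + E2 e q * a2 (e, q)))
    (\int[@area R]_q (2 * (E1 0 q * 'D_(1, 0) a1 (0, q) + E2 0 q * 'D_(1, 0) a2 (0, q))
       - ('D_(1, 0) a2 (0, q) * a1 (0, q) - 'D_(1, 0) a1 (0, q) * a2 (0, q)))).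
Proof.
move=> d0 ra1 ra2 hE.
have n0 : `|0 : R| < d by rewrite normr0.
have h0 := hE _ n0; have [[fa1 fa2] [fE1 fE2] cE dE] := h0.
have r1 e q : `|e| < d -> is_derive e (1 : R) (fun e => a1 (e, q)) ('D_(1, 0) a1 (e, q)).
  by move=> ed; apply: is_derive_fst; exact: (C1_differentiable (reg_C1 ra1)).
have r2 e q : `|e| < d -> is_derive e (1 : R) (fun e => a2 (e, q)) ('D_(1, 0) a2 (e, q)).
  by move=> ed; apply: is_derive_fst; exact: (C1_differentiable (reg_C1 ra2)).
(* Expanding (E(e) - E(0)) . (a(e) - a(0)) and rewriting the integral of E(e) . a(0) by reciprocity
   gives: integral of E(e) . a(e) = integral of [S] - integral of E(0) . a(0) + a remainder
   quadratic in the increments. In [S] only a depends on e. *)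
pose S p := 2 * (E1 0 p.2 * a1 p + E2 0 p.2 * a2 p) - (a2 p * a1 (0, p.2) - a1 p * a2 (0, p.2)).
pose dS p := 2 * (E1 0 p.2 * 'D_(1, 0) a1 p + E2 0 p.2 * 'D_(1, 0) a2 p)
  - ('D_(1, 0) a2 p * a1 (0, p.2) - 'D_(1, 0) a1 p * a2 (0, p.2)).
have ca (f : P -> R) : field f -> decays 2^-1 snd (strip d) (fun p : R * P => f p.2).
  by move=> [_ df]; exact: (@decays_comp _ _ _ _ idfun snd setT (strip d) f snd).
have bS (x1 x2 : R * P -> R) : decays 2^-1 snd (strip d) x1 -> decays 2^-1 snd (strip d) x2 ->
   decays 1 snd (strip d) (fun p => 2 * (E1 0 p.2 * x1 p + E2 0 p.2 * x2 p)
      - (x2 p * a1 (0, p.2) - x1 p * a2 (0, p.2))).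
  move=> dx1 dx2; apply: decaysB; last first.
    apply: decaysB; apply: decays_half2 => //; exact: (ca (fun q => _ (0, q))).
  apply: bndM_decays; first exact: bnd_cst.
  by apply: decaysD; apply: decays_half2 => //; exact: ca.
have cM (g h : P -> R) : continuous g -> continuous h -> continuous (fun q => g q * h q).
  by move=> cg ch q; apply: cvgM; [exact: cg|exact: ch].
have dSE : is_derive (0 : R) (1 : R) (fun e => \int[@area R]_q S (e, q)) (\int[@area R]_q dS (0, q)).
  apply: (@is_derive_area_family S dS d d0).
  - move=> e ed; have [[fb1 fb2] _ _ _] := hE _ ed.
    have [c1 c2] := (field_continuous fb1, field_continuous fb2).
    have [c3 c4] := (field_continuous fa1, field_continuous fa2).
    have [c5 c6] := (field_continuous fE1, field_continuous fE2).
    move=> q; apply: cvgB; last by apply: cvgB; apply: cM.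
    apply: cvgM; first exact: cvg_cst.
    by apply: cvgD; apply: cM.
  - move=> e q ed; rewrite /S /dS /=.
    have d1 := r1 e q ed; have d2 := r2 e q ed.
    have i1 := is_deriveZ (E1 0 q) d1; have i2 := is_deriveZ (E2 0 q) d2.
    have i3 := is_deriveZ 2 (is_deriveD i1 i2).
    have i4 := is_deriveZ (a1 (0, q)) d2; have i5 := is_deriveZ (a2 (0, q)) d1.
    have := is_deriveB i3 (is_deriveB i4 i5).
    rewrite /GRing.scale /= (mulrC (a1 (0, q))) (mulrC (a2 (0, q))).
    match goal with |- is_derive _ _ ?f _ -> is_derive _ _ ?g _ => suff -> : g = f by [] end.
    by apply/funext => x; rewrite [a2 (x, q) * _]mulrC [a1 (x, q) * a2 _]mulrC.
  - by apply: bS; [case: ra1|case: ra2].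
  - by apply: bS; [case: ra1|case: ra2].
have [[_ _ Dra1] [_ _ Dra2]] := (ra1, ra2).
have /decaysP[s [C [s2 C0 aC]]] := Dra1 (1, 0).
have /decaysP[t [D [t2 D0 aD]]] := Dra2 (1, 0).
(* By the mean value theorem in e, the squared increment of a is at most e^2 [m]; the contraction
   estimate then bounds the remainder by e^2 times the integral of [m]. *)
pose m q := (C * wt s q) * (C * wt s q) + (D * wt t q) * (D * wt t q).
have fw u c : 2^-1 < u -> decays 2^-1 idfun setT (fun q : P => c * wt u q).
  by move=> u2; exists u, `|c|; split => // q _; rewrite normrM (ger0_norm (wt_ge0 _ _)).
have cw u c : continuous (fun q : P => c * wt u q).
  by move=> q; apply: cvgM; [exact: cvg_cst|exact: wt_continuous].
have pm : pint m.
  by apply: pintD; apply: decays_integrable; [exact: cM|apply: decays_half2; exact: fw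
                                           |exact: cM|apply: decays_half2; exact: fw].
pose c := - (\int[@area R]_q (E1 0 q * a1 (0, q) + E2 0 q * a2 (0, q))).
apply: (@is_derive_remainder _ (fun e => \int[@area R]_q S (e, q)) c (\int[@area R]_q m q) d _ d0 _ dSE).
move=> e ed; have he := hE _ ed.
have [[fb1 fb2] [fG1 fG2] _ _] := he.
have rec := hodge_reciprocity h0 he.
have pA (f1 f2 g1 g2 : P -> R) : field f1 -> field f2 -> field g1 -> field g2 ->
    pint (fun q => f1 q * g1 q + f2 q * g2 q).
  by move=> ? ? ? ?; apply: pintD; exact: pintM.
have pX := pintB (pintM fb2 fa1) (pintM fb1 fa2).
have pS : pint (fun q => S (e, q)) by apply: pintB => //; apply: pintZ; exact: pA.
have pF : pint (fun q => E1 e q * a1 (e, q) + E2 e q * a2 (e, q)) by exact: pA.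
have p0 : pint (fun q => E1 0 q * a1 (0, q) + E2 0 q * a2 (0, q)) by exact: pA.
have hB := hodgeB he h0.
have RE : \int[@area R]_q (E1 e q * a1 (e, q) + E2 e q * a2 (e, q)) - (\int[@area R]_q S (e, q) + c)
  = \int[@area R]_q ((E1 e q - E1 0 q) * (a1 (e, q) - a1 (0, q)) + (E2 e q - E2 0 q) * (a2 (e, q) - a2 (0, q))).
  have pR := pintD (pintB (pA _ _ _ _ fG1 fG2 fa1 fa2) (pA _ _ _ _ fE1 fE2 fb1 fb2)) pX.
  rewrite /c opprD opprK addrA -(pint_sub pF pS) -(pint_add (pintB pF pS) p0).
  rewrite -[LHS]subr0 -[X in _ - X]rec -(pint_sub (pintD (pintB pF pS) p0) pR).
  by apply: eq_pint => q; rewrite /S /=; ring.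
rewrite RE; apply: (le_trans (hodge_pairing_le hB)).
rewrite mulrC -(pint_scale _ pm); apply: pint_le.
- by have [[fB1 fB2] _ _ _] := hB; exact: pA.
- exact: pintZ.
have lip (f df : R -> R) M : (forall x, `|x| < d -> is_derive x (1 : R) f (df x)) ->
    (forall x, `|x| < d -> `|df x| <= M) -> (f e - f 0) * (f e - f 0) <= e ^+ 2 * (M * M).
  move=> fE fM.
  have M0 : 0 <= M by exact: le_trans (normr_ge0 _) (fM 0 n0).
  suff : `|f e - f 0| <= `|e| * M.
    move=> H; rewrite -!expr2 -(real_normK (num_real (_ - _))) -(real_normK (num_real e)) -exprMn.
    by rewrite lerXn2r ?nnegrE ?mulr_ge0.
  have [e0|e0] := leP 0 e.
    have fE' x : 0 <= x <= e -> is_derive x (1 : R) f (df x).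
      by move=> /andP[x0 xe]; apply: fE; rewrite ger0_norm// (le_lt_trans xe)// -(ger0_norm e0).
    have [x /andP[x0 xe] ->] := mean_value e0 fE'.
    rewrite subr0 normrM mulrC ler_wpM2l// fM//.
    by rewrite ger0_norm// (le_lt_trans xe)// -(ger0_norm e0).
  have fE' x : e <= x <= 0 -> is_derive x (1 : R) f (df x).
    by move=> /andP[ex x0]; apply: fE; rewrite ler0_norm// (le_lt_trans _ ed)// (ltr0_norm e0) lerN2.
  have [x /andP[ex x0] E] := mean_value (ltW e0) fE'.
  rewrite distrC E sub0r normrM normrN mulrC ler_wpM2l// fM//.
  by rewrite ler0_norm// (le_lt_trans _ ed)// (ltr0_norm e0) lerN2.
move=> q; rewrite /m [leRHS]mulrDr; apply: lerD.
  have L := lip (fun e => a1 (e, q)) (fun e => 'D_(1, 0) a1 (e, q)) (C * wt s q).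
  by apply: L => x xd; exact: (aC (x, q)).
have L := lip (fun e => a2 (e, q)) (fun e => 'D_(1, 0) a2 (e, q)) (D * wt t q).
  by apply: L => x xd; exact: (aD (x, q)).
Qed.

End HodgeVariation.

(** * The flattened fluid domain *)

Section Linear.
Context {R : realType}.

Lemma C1_linear (V : normedModType R) (U : set V) (f : {linear V -> R}) :
  open U -> continuous f -> C1 U f.
Proof.
move=> oU cf.
have df p : differentiable f p by exact: linear_differentiable.
apply: (C1_intro oU) => // v; exists (fun=> f v) => p Up; split; last exact: cst_continuous.
by rewrite deriveE// diff_lin.
Qed.

Lemma derive_linear (V : normedModType R) (f : {linear V -> R}) (p v : V) :
  continuous f -> 'D_v f p = f v.
Proof. by move=> cf; rewrite deriveE ?diff_lin//; exact: linear_differentiable. Qed.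

End Linear.

(** * Fubini and integration by parts on the slab *)

Section Slab.
Context {R : realType}.
Notation P := (R * R)%type.
Notation mu := (@lebesgue_measure R).

Lemma slab_slice_continuous (f : P * R -> R) s : continuous f -> continuous (fun q : P => f (q, s)).
Proof.
move=> cf q; apply: (@continuous_comp _ _ _ (fun q : P => (q, s)) f); last exact: cf.
exact: continuous_pairl.
Qed.

Lemma slab_slice_integrable (f : P * R -> R) s : continuous f -> decays 1 fst slab f ->
  0 <= s <= 1 -> pint (fun q : P => f (q, s)).
Proof.
move=> cf df s01; apply: decays_integrable; first exact: slab_slice_continuous.
apply: (@decays_comp _ _ _ _ fst idfun slab setT f (fun q => (q, s))) => //.
Qed.

Definition slint (f : P * R -> R) := (@volume R).-integrable slab (EFin \o f).

Lemma slint_add f g : slint f -> slint g ->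
  \int[@volume R]_(t in slab) (f t + g t) =
  \int[@volume R]_(t in slab) f t + \int[@volume R]_(t in slab) g t.
Proof. exact: (@RintegralD _ _ R (plane_measure \x mu)%E slab f g measurable_slab). Qed.

Lemma eq_slint f g : (forall q s, 0 <= s <= 1 -> f (q, s) = g (q, s)) ->
  \int[@volume R]_(t in slab) f t = \int[@volume R]_(t in slab) g t.
Proof.
move=> fg; apply: (@eq_Rintegral _ _ R (plane_measure \x mu)%E) => -[q s].
by rewrite inE => -[_ /=]; rewrite in_itv /= => /fg.
Qed.

Lemma slab_fubini21 (f : P * R -> R) : continuous f -> decays 1 fst slab f ->
  \int[@volume R]_(t in slab) f t =
  \int[mu]_(s in `[0, 1]) \int[@area R]_q f (q, s).
Proof.
move=> cf df.
have H := @Rintegral_prod21 R _ _ _ _ plane_measure mu setT `[0, 1]%classic f measurableT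
  (measurable_itv _) (decays_slab_integrable cf df).
apply: H => s; rewrite /= in_itv /= => s01; exact: slab_slice_integrable.
Qed.

Lemma slab_fubini12 (f : P * R -> R) : continuous f -> decays 1 fst slab f ->
  \int[@volume R]_(t in slab) f t =
  \int[@area R]_q \int[mu]_(s in `[0, 1]) f (q, s).
Proof.
move=> cf df.
have H := @Rintegral_prod12 R _ _ _ _ plane_measure mu setT `[0, 1]%classic f measurableT
  (measurable_itv _) (decays_slab_integrable cf df).
apply: H => q _; apply: continuous_integrable_itv; apply: continuous_subspaceT => s.
apply: (@continuous_comp _ _ _ (fun s : R => (q, s)) f); last exact: cf.
exact: continuous_pairr.
Qed.

Let ex : P * R := ((1, 0), 0).
Let ez : P * R := ((0, 1), 0).
Let es : P * R := ((0, 0), 1).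

Lemma slab_horizontal_divergence (U1 U3 : P * R -> R) :
  reg fst setT slab 1 U1 -> reg fst setT slab 1 U3 ->
  \int[@volume R]_(t in slab) ('D_ex U1 t + 'D_ez U3 t) = 0.
Proof.
move=> [C1 d1 D1] [C3 d3 D3].
have c1 : continuous ('D_ex U1) by move=> t; exact: (C1_derive_continuous _ C1 I).
have c3 : continuous ('D_ez U3) by move=> t; exact: (C1_derive_continuous _ C3 I).
have c13 : continuous (fun t => 'D_ex U1 t + 'D_ez U3 t).
  by move=> t; apply: cvgD; [exact: c1|exact: c3].
have d13 : decays 1 fst slab (fun t => 'D_ex U1 t + 'D_ez U3 t) by exact: decaysD.
have S (s : R) : 0 <= s <= 1 -> \int[@area R]_q ('D_ex U1 (q, s) + 'D_ez U3 (q, s)) = 0.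
  move=> s01.
  have hw (f : P * R -> R) : decays 1 fst slab f -> decays 2^-1 idfun setT (fun q => f (q, s)).
    move=> df; apply: (@decays_weak _ _ _ _ _ 1); first by lra.
    apply: (@decays_comp _ _ _ _ fst idfun slab setT f (fun q => (q, s))) => //.
  apply: (@plane_divergence _ (fun q => U1 (q, s)) (fun q => U3 (q, s)) (fun q => 'D_ex U1 (q, s)) (fun q => 'D_ez U3 (q, s))).
  - by apply: slab_slice_continuous; exact: C1T_continuous.
  - by apply: slab_slice_continuous; exact: C1T_continuous.
  - exact: (@slab_slice_continuous ('D_ex U1) s c1).
  - exact: (@slab_slice_continuous ('D_ez U3) s c3).
  - move=> x z.
    have E (t : R) : ((0, z), s) + t *: ex = ((t, z), s).
      by rewrite /ex; congr pair; [congr pair|];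
         rewrite /= /GRing.scale /= ?mulr0 ?mulr1 ?add0r ?addr0.
    have := @is_derive_line R _ U1 ((0, z), s) ex x.
    rewrite E => /(_ (C1_derivable _ C1 I)).
    by under eq_fun do rewrite E.
  - move=> x z.
    have E (t : R) : ((x, 0), s) + t *: ez = ((x, t), s).
      by rewrite /ez; congr pair; [congr pair|];
         rewrite /= /GRing.scale /= ?mulr0 ?mulr1 ?add0r ?addr0.
    have := @is_derive_line R _ U3 ((x, 0), s) ez z.
    rewrite E => /(_ (C1_derivable _ C3 I)).
    by under eq_fun do rewrite E.
  - exact: hw.
  - exact: hw.
  - exact: (slab_slice_integrable c13).
rewrite slab_fubini21//.
rewrite (@eq_Rintegral _ _ R mu `[0, 1]%classic (fun=> 0)); last first.
  by move=> s; rewrite inE /= in_itv /=; exact: S.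
by rewrite Rintegral_cst ?mul0r//; exact: measurable_itv.
Qed.

Lemma slab_vertical_FTC (U : P * R -> R) : reg fst setT slab 1 U ->
  \int[@volume R]_(t in slab) 'D_es U t = \int[@area R]_q (U (q, 1) - U (q, 0)).
Proof.
move=> [CU dU DU].
have cU : continuous ('D_es U) by move=> t; exact: (C1_derive_continuous _ CU I).
rewrite slab_fubini12//; apply: eq_pint => q.
have cq : {within `[0, 1], continuous (fun s : R => 'D_es U (q, s))}.
  apply: continuous_subspaceT => s.
  apply: (@continuous_comp _ _ _ (fun s : R => (q, s)) ('D_es U)); last exact: cU.
  exact: continuous_pairr.
have dq (s : R) : 0 <= s <= 1 -> is_derive s (1 : R) (fun s => U (q, s)) ('D_es U (q, s)).
  move=> _; have E (t : R) : (q, 0) + t *: es = (q, t).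
    rewrite /es; congr pair; first by rewrite /= scaler0 addr0.
    by rewrite /= /GRing.scale /= mulr1 add0r.
  have := @is_derive_line R _ U (q, 0) es s.
  rewrite E => /(_ (C1_derivable _ CU I)).
  by under eq_fun do rewrite E.
exact: (FTC_Rintegral ler01 cq dq).
Qed.

End Slab.

(** * Change of variables from the fluid domain to the slab *)

Section Flatten.
Context {R : realType}.
Notation P := (R * R)%type.
Notation mu := (@lebesgue_measure R).
Notation MR := (measurableTypeR R).

Let swap (t : MR * MR * MR) : MR * MR * MR := ((t.1.1, t.2), t.1.2).

Let measurable_swap3 : measurable_fun setT swap.
Proof.
apply: measurable_fun_pair; last exact: measurableT_comp.
by apply: measurable_fun_pair => //; exact: measurableT_comp.
Qed.

(** [volume] integrates over (x, y) and then z, whereas flattening needs the vertical variable as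
    the separate one. For each x, Tonelli exchanges the last two integrations. *)
Let volume_swap_ge0 (g : MR * MR * MR -> \bar R) : measurable_fun setT g ->
  (forall p, 0 <= g p)%E ->
  (\int[@volume R]_p g p = \int[@volume R]_p g (swap p))%E.
Proof.
move=> mg g0.
have mgs : measurable_fun setT (g \o swap) by exact: measurableT_comp.
have F1 := @fubini_tonelli1 _ _ _ _ R plane_measure mu g mg g0.
have F2 := @fubini_tonelli1 _ _ _ _ R plane_measure mu (g \o swap) mgs (fun p => g0 (swap p)).
have mF1 := @measurable_fun_fubini_tonelli_F _ _ _ _ R mu g mg.
have mF2 := @measurable_fun_fubini_tonelli_F _ _ _ _ R mu (g \o swap) mgs.
have G1 := @fubini_tonelli1 _ _ _ _ R mu mu _ (mF1 g0) (fun x => @integral_ge0 _ _ R mu setT _ (fun y _ => g0 (x, y))).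
have G2 := @fubini_tonelli1 _ _ _ _ R mu mu _ (mF2 (fun p => g0 (swap p)))
  (fun x => @integral_ge0 _ _ R mu setT _ (fun y _ => g0 (swap (x, y)))).
apply: (eq_trans F1); apply: (eq_trans G1); apply/esym.
apply: (eq_trans F2); apply: (eq_trans G2); apply/esym.
apply: eq_integral => x _; rewrite /fubini_F /=.
have mgx : measurable_fun setT (fun yz : MR * MR => g ((x, yz.1), yz.2)).
  apply: (measurableT_comp mg); apply: measurable_fun_pair => //.
  exact: measurable_fun_pair.
exact: (@fubini_tonelli _ _ _ _ R mu mu _ mgx (fun p => g0 _)).
Qed.

Let volume_swap (g : MR * MR * MR -> \bar R) : measurable_fun setT g ->
  (\int[@volume R]_p g p = \int[@volume R]_p g (swap p))%E.
Proof.
move=> mg.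
rewrite [LHS](@integralE _ _ R (plane_measure \x mu)%E) [RHS](@integralE _ _ R (plane_measure \x mu)%E).
congr (_ - _)%E.
- apply: (eq_trans (@volume_swap_ge0 (g^\+)%E (measurable_funepos mg) (fun p => funepos_ge0 g p))).
  apply: (@eq_integral _ _ R (plane_measure \x mu)%E) => p _.
  by rewrite /= !funeposE.
- apply: (eq_trans (@volume_swap_ge0 (g^\-)%E (measurable_funeneg mg) (fun p => funeneg_ge0 g p))).
  apply: (@eq_integral _ _ R (plane_measure \x mu)%E) => p _.
  by rewrite /= !funenegE.
Qed.

(** Slab coordinates are ((x, z), s): s = 0 is the bottom, s = 1 the free surface, and the Jacobian
    is eta + h. *)
Definition flat (h : R) (eta : P -> R) (t : P * R) : R * R * R :=
  ((t.1.1, - h + t.2 * (eta t.1 + h)), t.1.2).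

Lemma flat_continuous h eta : continuous eta -> continuous (flat h eta).
Proof.
move=> ce t; apply: (@continuous_at_pair _ _ _ (fun t : P * R => (t.1.1, - h + t.2 * (eta t.1 + h)))
  (fun t : P * R => t.1.2)).
  apply: (@continuous_at_pair _ _ _ (fun t : P * R => t.1.1)).
    by apply: (@continuous_comp _ _ _ fst fst); exact: cvg_fst.
  apply: cvgD; first exact: cvg_cst.
  apply: cvgM; first exact: cvg_snd.
  apply: cvgD; last exact: cvg_cst.
  by apply: (@continuous_comp _ _ _ fst eta); [exact: cvg_fst|exact: ce].
by apply: (@continuous_comp _ _ _ fst snd); [exact: cvg_fst|exact: cvg_snd].
Qed.

Lemma affine_substitution (G : R -> R) (a J : R) : 0 < J -> continuous G ->
  (\int[mu]_(y in `]a, (a + J)%R[) (G y)%:E = \int[mu]_(s in `[0%R, 1%R]) (J * G (a + s * J)%R)%:E)%E.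
Proof.
move=> J0 cG.
have mG D : measurable D -> measurable_fun (D : set MR) (EFin \o G).
  by move=> mD; apply: measurable_funTS; apply/measurable_EFinP; exact: continuous_measurable_fun.
pose F s : R := a + s * J.
have dF s : is_derive s (1 : R) F J.
  have dc : is_derive s (1 : R) (fun=> a) 0 by exact: is_derive_cst.
  have := is_deriveD dc (is_derive_mulc J s); rewrite add0r.
  match goal with |- is_derive _ _ ?f _ -> is_derive _ _ ?g _ => suff -> : g = f by [] end.
  by apply/funext => x; rewrite /F mulrC.
have F'E : F^`()%classic = fun=> J by apply/funext => s; rewrite derive1E; have [_ ->] := dF s.
have cF : continuous F by move=> s; apply: differentiable_continuous; apply/derivable1_diffP; have [] := dF s.
have F0 : F 0 = a by rewrite /F mul0r addr0.
have F1 : F 1 = a + J by rewrite /F mul1r.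
have S : (\int[mu]_(y in `[F 0%R, F 1%R]) (G y)%:E =
          \int[mu]_(s in `[0%R, 1%R]) (G (F s) * F^`()%classic s)%:E)%E.
  apply: (@integration_by_substitution_increasing R F G 0 1 ler01).
  - by move=> x y _ _ xy; rewrite /F ltrD2l ltr_pM2r.
  - by rewrite F'E => s _; exact: cst_continuous.
  - by rewrite F'E; exact: is_cvg_cst.
  - by rewrite F'E; exact: is_cvg_cst.
  - split => [s _||]; first by have [] := dF s.
      by apply: cvg_at_right_filter; exact: cF.
    by apply: cvg_at_left_filter; exact: cF.
  - exact: continuous_subspaceT.
rewrite F0 F1 (integral_itv_bndoo _ _ (mG _ (measurable_itv _))) in S.
rewrite S; apply: eq_integral => s _; rewrite F'E; congr EFin.
exact: mulrC.
Qed.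

Lemma volume_flatten (h : R) (eta : P -> R) (f : R * R * R -> R) :
  continuous eta -> bnd setT eta -> (forall q, - h < eta q) ->
  continuous f -> decays 1 horizontal setT f ->
  \int[@volume R]_(p in fluid h eta) f p =
  \int[@volume R]_(t in slab) ((eta t.1 + h) * f (flat h eta t)).
Proof.
move=> ce [B eB] eh cf df.
have chor : continuous (@horizontal R).
  move=> p; apply: (@continuous_at_pair _ _ _ (fun p : R * R * R => p.1.1) snd); last exact: cvg_snd.
  by apply: (@continuous_comp _ _ _ fst fst); exact: cvg_fst.
have cy : continuous (fun p : R * R * R => p.1.2).
  by move=> p; apply: (@continuous_comp _ _ _ fst snd); [exact: cvg_fst|exact: cvg_snd].
have mf : measurable_fun setT (EFin \o f : MR * MR * MR -> \bar R).
  by apply/measurable_EFinP; exact: continuous_measurable3.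
have mfl : measurable (fluid h eta : set (MR * MR * MR)).
  have -> : fluid h eta = (fun p => p.1.2 + h) @^-1` `]0, +oo[%classic
     `&` (fun p => eta (horizontal p) - p.1.2) @^-1` `]0, +oo[%classic.
    apply/seteqP; split => p /=; rewrite !in_itv /= !andbT subr_gt0 -ltrBlDr sub0r.
      by move=> /andP.
    by move=> [ha hb]; rewrite /fluid /= ha.
  apply: measurableI; rewrite -[X in measurable X]setTI.
    have m1 : measurable_fun setT (fun p : MR * MR * MR => p.1.2 + h).
      apply: (@continuous_measurable3 _ (fun p : R * R * R => p.1.2 + h)) => p.
      by apply: cvgD; [exact: cy|exact: cvg_cst].
    by apply: m1 => //; exact: measurable_itv.
  have m2 : measurable_fun setT (fun p : MR * MR * MR => eta (horizontal p) - p.1.2).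
    apply: (@continuous_measurable3 _ (fun p : R * R * R => eta (horizontal p) - p.1.2)) => p.
    apply: cvgB; last exact: cy.
    by apply: (@continuous_comp _ _ _ (@horizontal R) eta); [exact: chor|exact: ce].
  by apply: m2 => //; exact: measurable_itv.
pose g := (EFin \o f) \_ (fluid h eta).
have mg : measurable_fun setT (g : MR * MR * MR -> \bar R).
  apply/(measurable_restrictT _ _).1 => //; exact: measurable_funTS.
have mgs : measurable_fun setT (g \o swap) by exact: measurableT_comp.
have inner q : (\int[mu]_y (g \o swap) (q, y) =
   (\int[mu]_(s in `[0, 1]) ((eta q + h) * f (flat h eta (q, s))))%R%:E)%E.
  have J0 : 0 < eta q + h by have := eh q; lra.
  have cG : continuous (fun y : R => f (q.1, y, q.2)).
    move=> y; apply: (@continuous_comp _ _ _ (fun y : R => (q.1, y, q.2)) f); last exact: cf.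
    apply: (@continuous_at_pair _ _ _ (fun y : R => (q.1, y)) (fun=> q.2)); last exact: cvg_cst.
    exact: continuous_pairr.
  have S := affine_substitution (- h) J0 cG.
  have E : - h + (eta q + h) = eta q by ring.
  rewrite E in S.
  transitivity (\int[mu]_(y in `](- h)%R, (eta q)[) (f (q.1, y, q.2))%:E)%E.
    rewrite [RHS]integral_mkcond; apply: eq_integral => y _; rewrite /g /= !patchE.
    have -> // : (swap (q, y) \in fluid h eta) = (y \in `](- h)%R, (eta q)[%classic).
    by apply/idP/idP; rewrite !inE /= in_itv /= /fluid /horizontal /=; case: (q).
  rewrite S /Rintegral fineK; first by [].
  apply: integrable_fin_num; first exact: measurable_itv.
  apply: continuous_integrable_itv; apply: continuous_subspaceT => s.
  apply: cvgM; first exact: cvg_cst.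
  apply: (@continuous_comp _ _ _ (fun s : R => (q, s)) (f \o flat h eta)); first exact: continuous_pairr.
  by apply: continuous_comp; [exact: flat_continuous|exact: cf].
(* As eta <= B, the fluid domain lies in the cylinder -h <= y <= B, over which the weight that
   dominates [f] is integrable. *)
have igs : (@volume R).-integrable setT (g \o swap).
  have /decaysP[s [C [s1 C0 fC]]] := df.
  have iw := wt_cylinder_integrable (- h) B s1.
  have mcyl := measurable_cylinder (- h) B.
  have iwC := @integrableZl _ _ R (plane_measure \x mu)%E _ mcyl C _ iw.
  have iwr := (@integrable_mkcond _ _ R (plane_measure \x mu)%E _ _ mcyl).1 iwC.
  have H := @le_integrable _ _ R (plane_measure \x mu)%E setT measurableT (g \o swap).
  apply: (H _ _ _ iwr) => //.
  move=> [q y] _; rewrite /g /= !patchE.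
  case: ifPn => [|_]; last by rewrite [leLHS]abse0 abse_ge0.
  rewrite inE => /andP[/= y1 y2].
  rewrite ifT; last first.
    rewrite inE /=; split => //; rewrite in_itv /= (ltW y1) /=.
    apply: (le_trans (ltW y2)); apply: (le_trans (ler_norm _)); exact: eB.
  rewrite /= lee_fin [leRHS]ger0_norm ?mulr_ge0 ?wt_ge0//.
  by have := fC ((q.1, y), q.2) I.
rewrite {1}/Rintegral integral_mkcond -/g volume_swap//.
have F := @integral12_prod_meas1 _ _ _ _ R plane_measure mu _ igs.
rewrite -[X in fine X]F.
rewrite slab_fubini12; last 2 first.
- move=> t; apply: cvgM.
    apply: cvgD; last exact: cvg_cst.
    by apply: (@continuous_comp _ _ _ fst eta); [exact: cvg_fst|exact: ce].
  by apply: (@continuous_comp _ _ _ (flat h eta) f); [exact: flat_continuous|exact: cf].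
- apply: bndM_decays.
    exists (B + `|h|) => -[q s] _ /=; apply: (le_trans (ler_normD _ _)).
    by rewrite lerD2r; exact: eB.
  by apply: (@decays_comp _ _ _ _ horizontal fst setT slab f (flat h eta)) => // -[[]].
rewrite /Rintegral; congr fine; apply: eq_integral => q _.
by rewrite /fubini_F inner.
Qed.

End Flatten.

(** * Rules for directional derivatives *)

Section Combinators.
Context {R : realType} {V : normedModType R}.
Implicit Types (f g : V -> R) (p v : V).

(* [is_derive] without the instance resolution, which would pick terms in [*:]. *)
Variant hder p v f (df : R) : Prop := Hder of derivable f p v & 'D_v f p = df.

Lemma hderE f p v df : hder p v f df -> is_derive p v f df.
Proof. by move=> [d1 d2]; exact: DeriveDef. Qed.

Lemma hder_val f p v df : hder p v f df -> 'D_v f p = df.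
Proof. by case. Qed.

Lemma hder_is f p v df : is_derive p v f df -> hder p v f df.
Proof. by move=> [d1 d2]; split. Qed.

Lemma hder_conv f p v df df' : hder p v f df -> df = df' -> hder p v f df'.
Proof. by move=> ? <-. Qed.

Lemma hderD f g p v df dg : hder p v f df -> hder p v g dg ->
  hder p v (fun x => f x + g x) (df + dg).
Proof. by move=> [d1 <-] [d2 <-]; split; [exact: derivableD|exact: deriveD]. Qed.

Lemma hderN f p v df : hder p v f df -> hder p v (fun x => - f x) (- df).
Proof. by move=> [d1 <-]; split; [exact: derivableN|exact: deriveN]. Qed.

Lemma hderM f g p v df dg : hder p v f df -> hder p v g dg ->
  hder p v (fun x => f x * g x) (f p * dg + g p * df).
Proof. by move=> [d1 <-] [d2 <-]; split; [exact (derivableM d1 d2)|exact (deriveM d1 d2)]. Qed.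

Lemma hder_cst c p v : hder p v (fun=> c : R) 0.
Proof. by apply: hder_is; exact: is_derive_cst. Qed.

Lemma hder_C1 U f p v : C1 U f -> U p -> hder p v f ('D_v f p).
Proof. by move=> Cf Up; split => //; exact: (C1_derivable _ Cf). Qed.

Lemma hder_linear (f : {linear V -> R}) p v : continuous f -> hder p v f (f v).
Proof.
move=> cf; split; last exact: derive_linear.
by apply: diff_derivable; exact: linear_differentiable.
Qed.

End Combinators.

(** The derivative is built along the shape of the function, its value being left as a metavariable;
    at a leaf a matching [hder] hypothesis of the context is taken. [derive_by] then leaves the
    comparison with the announced value as an equation. *)
Ltac der := lazymatch goal with
  | |- hder _ _ (fun x => @?f x + @?g x) _ => refine (hderD _ _); [der|der]
  | |- hder _ _ (fun x => - @?f x) _ => refine (hderN _); der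
  | |- hder _ _ (fun x => @?f x * @?g x) _ => refine (hderM _ _); [der|der]
  | |- hder _ _ (fun _ => ?c) _ => exact (hder_cst c _ _)
  | |- hder ?p _ _ _ => match goal with
      | H : hder _ _ _ _ |- _ => exact H
      | H : forall p', hder p' _ _ _ |- _ => exact (H p)
      end
  end.

Ltac derive_by := refine (hder_conv _ _); [der|cbv beta].

Section Compositions.
Context {R : realType} {W : normedModType R}.
Notation P := (R * R)%type.
Notation P3 := (R * R * R)%type.


Lemma comp3_sum (g0 g1 g2 : W -> R) p : ((g0 p, g1 p), g2 p) =
  \sum_(i < 3) (nth (fun=> 0) [:: g0; g1; g2] i) p *:
    nth 0 [:: (1, 0, 0); (0, 1, 0); (0, 0, 1)] i :> P3.
Proof.
rewrite !big_ord_recl big_ord0 /=.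
congr pair; [congr pair|]; rewrite /= /GRing.scale /=; ring.
Qed.

Lemma comp4_sum (g g0 g1 g2 : W -> R) p : (g p, ((g0 p, g1 p), g2 p)) =
  \sum_(i < 4) (nth (fun=> 0) [:: g; g0; g1; g2] i) p *:
    nth 0 [:: (1, 0); (0, (1, 0, 0)); (0, (0, 1, 0)); (0, (0, 0, 1))] i :> R * P3.
Proof.
rewrite !big_ord_recl big_ord0 /=.
congr pair; [|congr pair; [congr pair|]]; rewrite /= /GRing.scale /=; ring.
Qed.

Lemma sum_nth3 (S T : Type) (F : S -> T -> R) s t a0 a1 a2 b0 b1 b2 :
  \sum_(i < 3) F (nth s [:: a0; a1; a2] i) (nth t [:: b0; b1; b2] i) =
  F a0 b0 + F a1 b1 + F a2 b2.
Proof. by rewrite !big_ord_recl big_ord0 addr0 !addrA. Qed.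

Lemma sum_nth4 (S T : Type) (F : S -> T -> R) s t a a0 a1 a2 b b0 b1 b2 :
  \sum_(i < 4) F (nth s [:: a; a0; a1; a2] i) (nth t [:: b; b0; b1; b2] i) =
  F a b + F a0 b0 + F a1 b1 + F a2 b2.
Proof. by rewrite !big_ord_recl big_ord0 addr0 !addrA. Qed.

Section C1comp.
Variables (U' : set W) (g g0 g1 g2 : W -> R).
Hypotheses (oU' : open U') (Cg : C1 U' g) (Cg0 : C1 U' g0) (Cg1 : C1 U' g1) (Cg2 : C1 U' g2).

Lemma C1_comp3 (U : set P3) (f : P3 -> R) :
  (forall p, U' p -> U ((g0 p, g1 p), g2 p)) -> C1 U f ->
  C1 U' (fun p => f ((g0 p, g1 p), g2 p)) /\
  forall v p, U' p -> 'D_v (fun p => f ((g0 p, g1 p), g2 p)) p =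
     'D_v g0 p * D_x f ((g0 p, g1 p), g2 p) + 'D_v g1 p * D_y f ((g0 p, g1 p), g2 p)
     + 'D_v g2 p * D_z f ((g0 p, g1 p), g2 p).
Proof.
move=> gU Cf.
have Cs (i : 'I_3) : C1 U' (nth (fun=> 0) [:: g0; g1; g2] i) by move: i => [[|[|[|]]]].
have [DC DE] := C1_comp oU' (comp3_sum g0 g1 g2) Cs gU Cf.
split; first exact: DC.
move=> v p Up; apply: (eq_trans (DE v p Up)).
exact: (@sum_nth3 (W -> R) P3 (fun g b => 'D_v g p * 'D_b f ((g0 p, g1 p), g2 p)) (fun=> 0) 0
  g0 g1 g2 (1, 0, 0) (0, 1, 0) (0, 0, 1)).
Qed.

Lemma C1_comp4 (U : set (R * P3)) (f : R * P3 -> R) :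
  (forall p, U' p -> U (g p, ((g0 p, g1 p), g2 p))) -> C1 U f ->
  C1 U' (fun p => f (g p, ((g0 p, g1 p), g2 p))) /\
  forall v p, U' p -> 'D_v (fun p => f (g p, ((g0 p, g1 p), g2 p))) p =
     'D_v g p * 'D_(1, 0) f (g p, ((g0 p, g1 p), g2 p))
     + 'D_v g0 p * 'D_(0, (1, 0, 0)) f (g p, ((g0 p, g1 p), g2 p))
     + 'D_v g1 p * 'D_(0, (0, 1, 0)) f (g p, ((g0 p, g1 p), g2 p))
     + 'D_v g2 p * 'D_(0, (0, 0, 1)) f (g p, ((g0 p, g1 p), g2 p)).
Proof.
move=> gU Cf.
have Cs (i : 'I_4) : C1 U' (nth (fun=> 0) [:: g; g0; g1; g2] i) by move: i => [[|[|[|[|]]]]].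
have [DC DE] := C1_comp oU' (comp4_sum g g0 g1 g2) Cs gU Cf.
split; first exact: DC.
move=> v p Up; apply: (eq_trans (DE v p Up)).
exact: (@sum_nth4 (W -> R) (R * P3) (fun k b => 'D_v k p * 'D_b f (g p, ((g0 p, g1 p), g2 p))) (fun=> 0) 0
  g g0 g1 g2 (1, 0) (0, (1, 0, 0)) (0, (0, 1, 0)) (0, (0, 0, 1))).
Qed.

Variables (D' : set W) (hor' : W -> P).
Hypotheses (DU' : D' `<=` U') (bg : forall v, bnd D' ('D_v g))
  (bg0 : forall v, bnd D' ('D_v g0)) (bg1 : forall v, bnd D' ('D_v g1))
  (bg2 : forall v, bnd D' ('D_v g2)).

Lemma reg_comp3 (U D : set P3) (hor : P3 -> P) a (f : P3 -> R) :
  (forall p, U' p -> U ((g0 p, g1 p), g2 p)) ->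
  (forall p, D' p -> D ((g0 p, g1 p), g2 p)) ->
  (forall p, D' p -> hor ((g0 p, g1 p), g2 p) = hor' p) ->
  reg hor U D a f -> reg hor' U' D' a (fun p => f ((g0 p, g1 p), g2 p)).
Proof.
move=> gU gD gh; apply: (reg_comp oU' (comp3_sum g0 g1 g2)) => //.
- by move=> [[|[|[|]]]].
- by move=> [[|[|[|]]]].
Qed.

Lemma reg_comp4 (U D : set (R * P3)) (hor : R * P3 -> P) a (f : R * P3 -> R) :
  (forall p, U' p -> U (g p, ((g0 p, g1 p), g2 p))) ->
  (forall p, D' p -> D (g p, ((g0 p, g1 p), g2 p))) ->
  (forall p, D' p -> hor (g p, ((g0 p, g1 p), g2 p)) = hor' p) ->
  reg hor U D a f -> reg hor' U' D' a (fun p => f (g p, ((g0 p, g1 p), g2 p))).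
Proof.
move=> gU gD gh; apply: (reg_comp oU' (comp4_sum g g0 g1 g2)) => //.
- by move=> [[|[|[|[|]]]]].
- by move=> [[|[|[|[|]]]]].
Qed.

End C1comp.

End Compositions.

Section Families.
Context {R : realType}.
Notation P := (R * R)%type.
Notation P3 := (R * R * R)%type.

Lemma continuous_fstfst (A B C : topologicalType) : continuous (fun p : A * B * C => p.1.1).
Proof. by move=> p; apply: (@continuous_comp _ _ _ fst fst); exact: cvg_fst. Qed.

Lemma continuous_sndfst (A B C : topologicalType) : continuous (fun p : A * B * C => p.1.2).
Proof. by move=> p; apply: (@continuous_comp _ _ _ fst snd); [exact: cvg_fst|exact: cvg_snd]. Qed.

Section Affine.
Context {V W : normedModType R} (m L : W -> V).
Hypotheses (mL : forall p v t, m (t *: v + p) = t *: L v + m p)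
  (dm : forall p, differentiable m p).

(** The difference quotients of the two sides are the same function of t, so both derivatives are
    the limit of one expression. *)
Lemma derive_affine (f : V -> R) p v : 'D_v (fun p => f (m p)) p = 'D_(L v) f (m p).
Proof.
suff E : (fun t : R => t^-1 *: (((fun p => f (m p)) \o shift p) (t *: v) - f (m p))) =
  (fun t => t^-1 *: ((f \o shift (m p)) (t *: L v) - f (m p))) by rewrite /derive E.
by apply/funext => t /=; rewrite mL.
Qed.

Variables (U D : set V) (U' D' : set W).
Hypotheses (oU' : open U') (DU' : D' `<=` U') (mU : forall p, U' p -> U (m p))
  (mD : forall p, D' p -> D (m p)).

Lemma C1_affine (f : V -> R) : C1 U f -> C1 U' (fun p => f (m p)).
Proof.
move=> Cf; apply: (C1_intro oU') => [p Up|v].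
  by apply: (@differentiable_comp _ _ _ _ m f) => //; apply: (C1_differentiable Cf); exact: mU.
exists (fun p => 'D_(L v) f (m p)) => p Up; split; first exact: derive_affine.
apply: (@continuous_comp _ _ _ m ('D_(L v) f)); first exact: differentiable_continuous.
by apply: (C1_derive_continuous _ Cf); exact: mU.
Qed.

Lemma reg_affine (hor : V -> P) (hor' : W -> P) a (f : V -> R) :
  (forall p, D' p -> hor (m p) = hor' p) ->
  reg hor U D a f -> reg hor' U' D' a (fun p => f (m p)).
Proof.
move=> mh [Cf df dDf]; split; [exact: C1_affine|exact: decays_comp df|move=> v].
apply: (@decays_eq _ _ _ _ _ _ (fun p => 'D_(L v) f (m p))); last exact: decays_comp (dDf _).
by move=> p _; exact: derive_affine.
Qed.

Lemma breg_affine (f : V -> R) : breg U D f -> breg U' D' (fun p => f (m p)).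
Proof.
move=> [Cf df dDf]; split; [exact: C1_affine|exact: bnd_comp df|move=> v].
apply: (@bnd_eq _ _ _ _ (fun p => 'D_(L v) f (m p))); last exact: bnd_comp (dDf _).
by move=> p _; exact: derive_affine.
Qed.

End Affine.

Lemma breg_linear (W : normedModType R) (U D : set W) (f : {linear W -> R}) :
  open U -> continuous f -> bnd D f -> breg U D f.
Proof.
move=> oU cf bf; split => //; first exact: C1_linear.
by move=> v; exists `|f v| => p _; rewrite derive_linear.
Qed.

Lemma differentiable_fst (A B : normedModType R) (p : A * B) : differentiable (fst : A * B -> A) p.
Proof. by apply: linear_differentiable => q; exact: cvg_fst. Qed.

Lemma differentiable_snd (A B : normedModType R) (p : A * B) : differentiable (snd : A * B -> B) p.
Proof. by apply: linear_differentiable => q; exact: cvg_snd. Qed.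

Lemma differentiable_pairr (A B : normedModType R) (a : A) (b : B) :
  differentiable (fun b : B => (a, b)) b.
Proof. by apply: differentiable_pair => //; exact: differentiable_cst. Qed.

Lemma pairr_affine (A B : normedModType R) (a : A) (b v : B) (t : R) :
  (a, t *: v + b) = t *: ((0, v) : A * B) + (a, b).
Proof. by congr pair; rewrite /= scaler0 add0r. Qed.

Lemma pairl_affine (A B : normedModType R) (b : B) (a v : A) (t : R) :
  (t *: v + a, b) = t *: ((v, 0) : A * B) + (a, b).
Proof. by congr pair; rewrite /= scaler0 add0r. Qed.

End Families.

(* [oU] and [DU] are the openness and the inclusion that the closure lemmas require. *)
Ltac regular oU DU := first [match goal with H : ?T |- ?T' => constr_eq T T'; exact H end | lazymatch goal with
  | |- reg ?hor ?U ?D ?a (fun p => @?f p + - @?g p) =>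
      refine (@regB _ _ hor U oU D DU a f g _ _); regular oU DU
  | |- reg ?hor ?U ?D ?a (fun p => @?f p + @?g p) =>
      refine (@regD _ _ hor U oU D DU a f g _ _); regular oU DU
  | |- reg ?hor ?U ?D ?a (fun p => - @?f p) =>
      refine (@regN _ _ hor U oU D DU a f _); regular oU DU
  | |- reg ?hor ?U ?D ?a (fun p => @?f p * @?g p) => first
      [ solve [refine (@reg_half2 _ _ hor U oU D DU f g _ _); regular oU DU]
      | solve [refine (@bregM_reg _ _ hor U oU D DU a f g _ _); regular oU DU]
      | solve [refine (@regM_breg _ _ hor U oU D DU a f g _ _); regular oU DU] ]
  | |- breg ?U ?D (fun p => @?f p + - @?g p) =>
      refine (@bregB _ _ U oU D DU f g _ _); regular oU DU
  | |- breg ?U ?D (fun p => @?f p + @?g p) =>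
      refine (@bregD _ _ U oU D DU f g _ _); regular oU DU
  | |- breg ?U ?D (fun p => - @?f p) =>
      refine (@bregN _ _ U oU D DU f _); regular oU DU
  | |- breg ?U ?D (fun p => @?f p * @?g p) =>
      refine (@bregM _ _ U oU D DU f g _ _); regular oU DU
  | |- breg ?U ?D (fun _ => ?c) => exact (@breg_cst _ _ U oU D c)
  | |- reg _ _ _ _ _ => match goal with H : reg _ _ _ _ _ |- _ => exact H end
  | |- breg _ _ _ => match goal with
      | H : breg _ _ _ |- _ => exact H
      | H : reg _ _ _ _ _ |- _ => refine (reg_breg _ H); lra
      end
  end].

(** * The divergence theorem in the fluid domain *)

Section Fluid.
Context {R : realType}.

Notation P := (R * R)%type.
Notation P3 := (R * R * R)%type.

Lemma slabT : (slab : set (P * R)) `<=` setT. Proof. by []. Qed.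

Lemma breg_slab_x : breg setT slab (fun t : P * R => t.2).
Proof.
apply: (@breg_linear _ _ _ _ snd openT); first by move=> p; exact: cvg_snd.
by exists 1 => -[q s] [_ /=]; rewrite in_itv /= => /andP[s0 s1]; rewrite ger0_norm.
Qed.

Lemma hder_on_slab (f : P -> R) (t v : P * R) : C1 setT f ->
  hder t v (fun t : P * R => f t.1) ('D_(v.1) f t.1).
Proof.
move=> Cf; rewrite -(@derive_affine _ _ _ fst fst)//; apply: (hder_C1 (U := setT)) => //.
apply: (@C1_affine _ _ _ fst fst _ _ setT setT openT) => //; exact: differentiable_fst.
Qed.

Lemma hder_slab_s (t v : P * R) : hder t v (fun t : P * R => t.2) v.2.
Proof. by apply: (@hder_linear _ _ snd) => p; exact: cvg_snd. Qed.

Lemma breg_on_slab (f : P -> R) : breg setT setT f -> breg setT slab (fun t : P * R => f t.1).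
Proof.
apply: (@breg_affine _ _ _ fst fst _ _ setT setT setT slab openT) => //.
exact: differentiable_fst.
Qed.


Section Flat.
Variables (h : R) (eta : P -> R) (reta : breg setT setT eta).

Let height : P * R -> R := fun t => - h + t.2 * (eta t.1 + h).

Let breg_height : breg setT slab height.
Proof.
have e1 := breg_on_slab reta; have e2 := breg_slab_x.
by rewrite /height; regular (@openT (P * R)%type) slabT.
Qed.

Let hder_height t v :
  hder t v height (v.2 * (eta t.1 + h) + t.2 * 'D_(v.1) eta t.1).
Proof.
have [Ce _ _] := reta; have d1 := hder_on_slab t v Ce; have d2 := hder_slab_s t v.
rewrite /height; derive_by.
ring.
Qed.

Let C1x : C1 setT (fun t : P * R => t.1.1).
Proof. by apply: (@C1_linear _ _ _ (fst \o fst) openT); exact: continuous_fstfst. Qed.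

Let C1z : C1 setT (fun t : P * R => t.1.2).
Proof. by apply: (@C1_linear _ _ _ (snd \o fst) openT); exact: continuous_sndfst. Qed.

Let derive_x t v : 'D_v (fun t : P * R => t.1.1) t = v.1.1.
Proof. by rewrite (@derive_linear _ _ (fst \o fst))//; exact: continuous_fstfst. Qed.

Let derive_z t v : 'D_v (fun t : P * R => t.1.2) t = v.1.2.
Proof. by rewrite (@derive_linear _ _ (snd \o fst))//; exact: continuous_sndfst. Qed.

Lemma reg_flat a (f : P3 -> R) : reg (@horizontal R) setT setT a f ->
  reg fst setT slab a (fun t => f (flat h eta t)).
Proof.
have [Ch _ Dh] := breg_height.
apply: (reg_comp3 openT C1x Ch C1z slabT) => //.
- by move=> v; exists `|v.1.1| => t _; rewrite derive_x.
- by move=> v; exists `|v.1.2| => t _; rewrite derive_z.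
- by move=> [[]].
Qed.

Lemma hder_flat (f : P3 -> R) t v : C1 setT f ->
  hder t v (fun t => f (flat h eta t)) (v.1.1 * D_x f (flat h eta t)
     + (v.2 * (eta t.1 + h) + t.2 * 'D_(v.1) eta t.1) * D_y f (flat h eta t)
     + v.1.2 * D_z f (flat h eta t)).
Proof.
have [Ch _ _] := breg_height; move=> Cf.
have [Cfl E] := C1_comp3 openT C1x Ch C1z (fun _ _ => I) Cf.
have := hder_C1 v Cfl (I : setT t).
by rewrite E// derive_x derive_z (hder_val (hder_height t v)).
Qed.

Variables (rx : breg setT setT (d_x eta)) (rz : breg setT setT (d_z eta)).

(* The Piola transform of W by [flat] is divergence free exactly when W is. *)
Lemma fluid_divergence (W1 W2 W3 : P3 -> R) :
  reg (@horizontal R) setT setT 1 W1 -> reg (@horizontal R) setT setT 1 W2 ->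
  reg (@horizontal R) setT setT 1 W3 ->
  \int[@volume R]_(t in slab) ((eta t.1 + h) *
    (D_x W1 (flat h eta t) + D_y W2 (flat h eta t) + D_z W3 (flat h eta t))) =
  \int[@area R]_q (W2 (surf eta q) - d_x eta q * W1 (surf eta q) - d_z eta q * W3 (surf eta q)
     - W2 ((q.1, - h), q.2)).
Proof.
move=> r1 r2 r3.
have w1 := reg_flat r1; have w2 := reg_flat r2; have w3 := reg_flat r3.
have e0 := breg_on_slab reta; have ex := breg_on_slab rx; have ez := breg_on_slab rz.
have es := breg_slab_x.
(* Level s is mapped to the graph of -h + s (eta + h), whose slope is s grad eta. Accordingly [U2]
   is the flux density of W through that graph, while [U1] and [U3] are the horizontal components
   multiplied by the Jacobian. *)
pose U1 t := (eta t.1 + h) * W1 (flat h eta t).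
pose U3 t := (eta t.1 + h) * W3 (flat h eta t).
pose U2 t := W2 (flat h eta t) - t.2 * (d_x eta t.1 * W1 (flat h eta t)
                                        + d_z eta t.1 * W3 (flat h eta t)).
have u1 : reg fst setT slab 1 U1 by rewrite /U1; regular (@openT (P * R)%type) slabT.
have u2 : reg fst setT slab 1 U2 by rewrite /U2; regular (@openT (P * R)%type) slabT.
have u3 : reg fst setT slab 1 U3 by rewrite /U3; regular (@openT (P * R)%type) slabT.
have H13 := slab_horizontal_divergence u1 u3.
have H2 := slab_vertical_FTC u2.
transitivity (\int[@volume R]_(t in slab)
    ('D_((1, 0), 0) U1 t + 'D_((0, 1), 0) U3 t + 'D_((0, 0), 1) U2 t)).
  apply: eq_slint => q s s01; set t := (q, s).
  have [[C1W _ _] [C2W _ _] [C3W _ _]] := And3 r1 r2 r3.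
  have [[Ce _ _] [Cx _ _] [Cz _ _]] := And3 reta rx rz.
  have D1 : 'D_((1, 0), 0) U1 t = d_x eta q * W1 (flat h eta t)
      + (eta q + h) * (D_x W1 (flat h eta t) + s * d_x eta q * D_y W1 (flat h eta t)).
    apply: hder_val; rewrite /U1.
    have hW := hder_flat t ((1, 0), 0) C1W; have he := hder_on_slab t ((1, 0), 0) Ce.
    by derive_by; rewrite /= -/(d_x eta q); ring.
  have D3 : 'D_((0, 1), 0) U3 t = d_z eta q * W3 (flat h eta t)
      + (eta q + h) * (D_z W3 (flat h eta t) + s * d_z eta q * D_y W3 (flat h eta t)).
    apply: hder_val; rewrite /U3.
    have hW := hder_flat t ((0, 1), 0) C3W; have he := hder_on_slab t ((0, 1), 0) Ce.
    by derive_by; rewrite /= -/(d_z eta q); ring.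
  have D2 : 'D_((0, 0), 1) U2 t = (eta q + h) * D_y W2 (flat h eta t)
      - (d_x eta q * W1 (flat h eta t) + d_z eta q * W3 (flat h eta t))
      - s * ((eta q + h) * (d_x eta q * D_y W1 (flat h eta t) + d_z eta q * D_y W3 (flat h eta t))).
    apply: hder_val; rewrite /U2.
    have hs := hder_slab_s t ((0, 0), 1).
    have hW1 := hder_flat t ((0, 0), 1) C1W; have hW2 := hder_flat t ((0, 0), 1) C2W.
    have hW3 := hder_flat t ((0, 0), 1) C3W.
    have hx := hder_on_slab t ((0, 0), 1) Cx; have hz := hder_on_slab t ((0, 0), 1) Cz.
    derive_by; rewrite /= !derive0; ring.
  by rewrite D1 D2 D3 /=; ring.
have [[Cu1 _ Du1] [Cu2 _ Du2] [Cu3 _ Du3]] := And3 u1 u2 u3.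
have ci (U : P * R -> R) v : C1 setT U -> continuous ('D_v U).
  by move=> CU t; exact: (C1_derive_continuous _ CU I).
rewrite slint_add; last 2 first.
- apply: decays_slab_integrable; last exact: decaysD.
  by move=> t; apply: cvgD; exact: ci.
- by apply: decays_slab_integrable => //; exact: ci.
rewrite H13 H2 add0r; apply: eq_pint => q.
rewrite /U2 /flat /surf /= !mul1r !mul0r !addr0 subr0.
have -> : - h + (eta q + h) = eta q by ring.
ring.
Qed.

End Flat.
End Fluid.

(** * Families of fields on a moving domain *)

Section Spacetime.
Context {R : realType}.
Notation P := (R * R)%type.
Notation P3 := (R * R * R)%type.
Notation Q := (R * P3)%type.

Definition dE (f : Q -> R) ep : R := 'D_((1, 0) : Q) f ep.
Definition dX (f : Q -> R) ep : R := 'D_((0, (1, 0, 0)) : Q) f ep.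
Definition dY (f : Q -> R) ep : R := 'D_((0, (0, 1, 0)) : Q) f ep.
Definition dZ (f : Q -> R) ep : R := 'D_((0, (0, 0, 1)) : Q) f ep.

Definition qhor (ep : Q) : P := horizontal ep.2.
Definition qreg d a f := reg qhor (strip d) (strip d) a (f : Q -> R).
(** C^2 jointly in the parameter and the point, with decay up to second order: mixed derivatives
    must commute so that the e-derivative passes through the curl. *)
Definition qreg2 d f := qreg d 2^-1 f /\ forall v, qreg d 2^-1 ('D_v f).

Variant lin (W : normedModType R) (k : W -> R) : Prop :=
  IsLin of C1 setT k & forall p v, 'D_v k p = k v.

Lemma lin_linear (W : normedModType R) (k : {linear W -> R}) : continuous k -> lin k.
Proof. by move=> ck; split=> [|p v]; [exact: (C1_linear openT)|exact: derive_linear]. Qed.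

Section Pullback.
Context {W : normedModType R} (E X Z H : W -> R) (d : R) (D : set W).
Hypotheses (lE : lin E) (lX : lin X) (lZ : lin Z).
Let U : set W := [set p | `|E p| < d].
Hypotheses (DU : D `<=` U) (bH : breg U D H).

Lemma open_dom : open U.
Proof.
have -> : U = (fun p => `|E p|) @^-1` [set x | x < d] by [].
apply: open_comp; last exact: open_lt.
move=> p _; apply: (@continuous_comp _ _ _ E); last exact: norm_continuous.
by have [CE _] := lE; exact: (C1_continuous CE).
Qed.

Let C1U (k : W -> R) : lin k -> C1 U k.
Proof. by move=> [[Ck] _]; split=> p _; exact: Ck. Qed.

(** Common to the surface map and to the slab map of a moving domain: the parameter and the two
    horizontal coordinates depend linearly on the new variables, and only the height [H] does
    not. *)
Lemma reg_pullback a (f : Q -> R) (hor : W -> P) : (forall p, D p -> hor p = (X p, Z p)) ->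
  qreg d a f -> reg hor U D a (fun p => f (E p, ((X p, H p), Z p))).
Proof.
move=> horE; have oU := open_dom; have [CH _ DH] := bH.
have bl (k : W -> R) : lin k -> forall v, bnd D ('D_v k).
  by move=> [_ kE] v; exists `|k v| => p _; rewrite kE.
apply: (reg_comp4 oU (C1U lE) (C1U lX) CH (C1U lZ) DU (bl _ lE) (bl _ lX) DH (bl _ lZ)).
- by move=> p Up.
- by move=> p /DU.
- by move=> p /horE ->.
Qed.

Lemma hder_pullback (f : Q -> R) p v dH : U p -> C1 (strip d) f -> hder p v H dH ->
  E v = 1 -> X v = 0 -> Z v = 0 ->
  hder p v (fun p => f (E p, ((X p, H p), Z p)))
    (dE f (E p, ((X p, H p), Z p)) + dH * dY f (E p, ((X p, H p), Z p))).
Proof.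
move=> Up Cf hH E1 X0 Z0; have oU := open_dom; have [CH _ _] := bH.
have [Cc Ec] := C1_comp4 oU (C1U lE) (C1U lX) CH (C1U lZ) (fun p (Up : U p) => Up) Cf.
have [[_ eE] [_ eX] [_ eZ]] := And3 lE lX lZ.
apply: (hder_conv (hder_C1 v Cc Up)); apply: (eq_trans (Ec v p Up)).
have aux (a b c e w x y z y' : R) : a = 1 -> b = 0 -> c = e -> w = 0 ->
    a * x + b * y + c * z + w * y' = x + e * z.
  by move=> -> -> -> ->; rewrite !mul0r mul1r !addr0.
apply: aux; [by rewrite eE|by rewrite eX|exact: hder_val|by rewrite eZ].
Qed.

End Pullback.

Lemma qreg_slice d e a (f : Q -> R) : `|e| < d -> qreg d a f ->
  reg (@horizontal R) setT setT a (fun p => f (e, p)).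
Proof.
move=> ed; apply: (@reg_affine _ _ _ (pair e) (pair 0) (pairr_affine e)
  (differentiable_pairr e)) => //; exact: openT.
Qed.

Lemma D_x_slice e (f : Q -> R) p : D_x (fun p => f (e, p)) p = dX f (e, p).
Proof. exact: (@derive_affine _ _ _ (pair e) (pair 0) (pairr_affine e)). Qed.

Lemma D_y_slice e (f : Q -> R) p : D_y (fun p => f (e, p)) p = dY f (e, p).
Proof. exact: (@derive_affine _ _ _ (pair e) (pair 0) (pairr_affine e)). Qed.

Lemma D_z_slice e (f : Q -> R) p : D_z (fun p => f (e, p)) p = dZ f (e, p).
Proof. exact: (@derive_affine _ _ _ (pair e) (pair 0) (pairr_affine e)). Qed.

Lemma qreg2_comm d (f : Q -> R) v w p : qreg2 d f -> `|p.1| < d ->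
  'D_w ('D_v f) p = 'D_v ('D_w f) p.
Proof.
move=> [[Cf _ _] df] pd; have [Cv _ _] := df v; have [Cw _ _] := df w.
exact: (derive_comm (@open_strip _ _ d) Cf Cv Cw).
Qed.

End Spacetime.

(** * Pull-back to the moving surface and to the slab *)

Section MovingSurface.
Context {R : realType}.
Notation P := (R * R)%type.
Notation P3 := (R * R * R)%type.
Notation Q := (R * P3)%type.
Variables (h d : R) (eta nu : P -> R).
Hypotheses (beta : breg setT setT eta) (bnu : breg setT setT nu).

Definition surfE (p : R * P) : Q := (p.1, surf (vary eta nu p.1) p.2).
Definition slabE (p : R * (P * R)) : Q := (p.1, flat h (vary eta nu p.1) p.2).
Definition slabdom : set (R * (P * R)) := [set p | `|p.1| < d /\ slab p.2].

Lemma slabdom_strip : slabdom `<=` strip d. Proof. by move=> p []. Qed.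

Let cfst (A B : normedModType R) : continuous (fst : A * B -> A).
Proof. by move=> p; exact: cvg_fst. Qed.

Let csnd (A B : normedModType R) : continuous (snd : A * B -> B).
Proof. by move=> p; exact: cvg_snd. Qed.

Let lE (T : normedModType R) : lin (fun p : R * T => p.1).
Proof. by apply: (@lin_linear _ _ fst); exact: cfst. Qed.

Let lX : lin (fun p : R * P => p.2.1).
Proof.
apply: (@lin_linear _ _ (fst \o snd)) => p.
by apply: (@continuous_comp _ _ _ snd fst); [exact: csnd|exact: cfst].
Qed.

Let lZ : lin (fun p : R * P => p.2.2).
Proof.
apply: (@lin_linear _ _ (snd \o snd)) => p.
by apply: (@continuous_comp _ _ _ snd snd); exact: csnd.
Qed.

Let lin_hor (k : P -> R) : lin k -> lin (fun p : R * (P * R) => k p.2.1).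
Proof.
have mL (p v : R * (P * R)) (t : R) : (t *: v + p).2.1 = t *: v.2.1 + p.2.1 by [].
have dm (p : R * (P * R)) : differentiable (fun p : R * (P * R) => p.2.1) p.
  apply: (@differentiable_comp _ _ _ _ snd fst); first exact: differentiable_snd.
  exact: differentiable_fst.
move=> [Ck kE]; split; last by move=> p v; rewrite (derive_affine mL).
exact: (C1_affine mL dm openT (fun _ _ => I) Ck).
Qed.

Let lX3 : lin (fun p : R * (P * R) => p.2.1.1).
Proof. by apply: (@lin_hor fst); apply: lin_linear; exact: cfst. Qed.

Let lZ3 : lin (fun p : R * (P * R) => p.2.1.2).
Proof. by apply: (@lin_hor snd); apply: lin_linear; exact: csnd. Qed.

Lemma breg_time (T : normedModType R) : breg (strip d) (strip d) (fun p : R * T => p.1).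
Proof.
apply: (@breg_linear _ _ _ _ fst (@open_strip _ _ d)); first exact: cfst.
by exists d => p /ltW.
Qed.

Lemma breg_snd (f : P -> R) : breg setT setT f -> breg (strip d) (strip d) (fun p : R * P => f p.2).
Proof.
by apply: (@breg_affine _ _ _ snd snd _ _ setT setT _ _ (@open_strip _ _ d)) => // p;
  exact: differentiable_snd.
Qed.

Lemma reg_snd a (f : P -> R) : reg idfun setT setT a f ->
  reg snd (strip d) (strip d) a (fun p : R * P => f p.2).
Proof.
by apply: (@reg_affine _ _ _ snd snd _ _ setT setT _ _ (@open_strip _ _ d)) => // p;
  exact: differentiable_snd.
Qed.

Lemma hder_snd (f : P -> R) (p v : R * P) : C1 setT f ->
  hder p v (fun p : R * P => f p.2) ('D_(v.2) f p.2).
Proof.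
move=> Cf; rewrite -(@derive_affine _ _ _ snd snd)//; apply: (hder_C1 (U := setT)) => //.
by apply: (@C1_affine _ _ _ snd snd _ _ setT setT openT) => // q; exact: differentiable_snd.
Qed.

Lemma hder_time (T : normedModType R) (p v : R * T) : hder p v (fun p : R * T => p.1) v.1.
Proof. by apply: (@hder_linear _ _ fst); exact: cfst. Qed.

Let height (p : R * P) := eta p.2 + p.1 * nu p.2.

Let breg_height : breg (strip d) (strip d) height.
Proof.
have b1 := breg_snd beta; have b2 := breg_snd bnu; have b3 := @breg_time P.
rewrite /height; regular (@open_strip R P d) (@subset_refl _ (@strip R P d)).
Qed.

Lemma reg_surfE a (f : Q -> R) : qreg d a f ->
  reg snd (strip d) (strip d) a (fun p => f (surfE p)).
Proof.
move=> rf; have hh (p : R * P) : strip d p -> snd p = (p.2.1, p.2.2) by case: p => e [].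
exact: (reg_pullback (@lE P) lX lZ (@subset_refl _ (strip d)) breg_height hh rf).
Qed.

Lemma hder_surfE (f : Q -> R) (p : R * P) : `|p.1| < d -> C1 (strip d) f ->
  hder p (1, 0) (fun p => f (surfE p)) (dE f (surfE p) + nu p.2 * dY f (surfE p)).
Proof.
move=> pd Cf; have [Ce _ _] := beta; have [Cn _ _] := bnu.
have h1 := hder_snd p (1, 0) Ce; have h2 := hder_snd p (1, 0) Cn; have h3 := hder_time p (1, 0).
have hH : hder p (1, 0) height (nu p.2).
  by rewrite /height; derive_by; rewrite /= !derive0; ring.
exact: (hder_pullback (@lE P) lX lZ breg_height pd Cf hH).
Qed.

Let slabheight (p : R * (P * R)) := - h + p.2.2 * (eta p.2.1 + p.1 * nu p.2.1 + h).

Let mslab_lin (p v : R * (P * R)) (t : R) :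
  ((t *: v + p).1, (t *: v + p).2.1) = t *: (v.1, v.2.1) + (p.1, p.2.1).
Proof. by []. Qed.

Let mslab_diff (p : R * (P * R)) : differentiable (fun p : R * (P * R) => (p.1, p.2.1)) p.
Proof.
apply: differentiable_pair; first exact: differentiable_fst.
apply: (@differentiable_comp _ _ _ _ snd fst); first exact: differentiable_snd.
exact: differentiable_fst.
Qed.

Lemma breg_slabdom (f : R * P -> R) : breg (strip d) (strip d) f ->
  breg (strip d) slabdom (fun p => f (p.1, p.2.1)).
Proof.
by apply: (breg_affine mslab_lin mslab_diff (@open_strip _ _ d)) => // p [].
Qed.

Lemma hder_slabdom (f : R * P -> R) (p v : R * (P * R)) : `|p.1| < d -> C1 (strip d) f ->
  hder p v (fun p : R * (P * R) => f (p.1, p.2.1)) ('D_(v.1, v.2.1) f (p.1, p.2.1)).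
Proof.
move=> pd Cf; rewrite -(derive_affine mslab_lin).
apply: (hder_C1 (U := strip d)) => //.
by apply: (C1_affine mslab_lin mslab_diff _ _ Cf) => //; exact: open_strip.
Qed.

Let breg_slab_snd : breg (strip d) slabdom (fun p : R * (P * R) => p.2.2).
Proof.
apply: (@breg_linear _ _ _ _ (snd \o snd) (@open_strip _ _ d)).
  by move=> p; apply: (@continuous_comp _ _ _ snd snd); exact: csnd.
by exists 1 => -[e [q s]] [_ [_ /=]]; rewrite in_itv /= => /andP[s0 s1]; rewrite ger0_norm.
Qed.

Let breg_slabheight : breg (strip d) slabdom slabheight.
Proof.
have b1 := breg_slabdom (breg_snd beta); have b2 := breg_slab_snd.
have b3 := breg_slabdom (breg_snd bnu); have b4 := breg_slabdom (@breg_time P).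
rewrite /slabheight; regular (@open_strip R (P * R)%type d) slabdom_strip.
Qed.

Lemma breg_depth : breg (strip d) slabdom (fun p : R * (P * R) => vary eta nu p.1 p.2.1 + h).
Proof.
have b1 := breg_slabdom (breg_snd beta).
have b3 := breg_slabdom (breg_snd bnu); have b4 := breg_slabdom (@breg_time P).
rewrite /vary; regular (@open_strip R (P * R)%type d) slabdom_strip.
Qed.

Lemma hder_depth (p : R * (P * R)) : `|p.1| < d ->
  hder p (1, 0) (fun p : R * (P * R) => vary eta nu p.1 p.2.1 + h) (nu p.2.1).
Proof.
move=> pd; have [Ce _ _] := breg_snd beta; have [Cn _ _] := breg_snd bnu.
have [Ct _ _] := @breg_time P.
have h1 := hder_slabdom (1, 0) pd Ce; have h2 := hder_slabdom (1, 0) pd Cn.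
have h3 := hder_slabdom (1, 0) pd Ct.
rewrite /vary; derive_by.
have [Ce' _ _] := beta; have [Cn' _ _] := bnu.
rewrite (hder_val (hder_snd _ _ Ce')) (hder_val (hder_snd _ _ Cn')) (hder_val (hder_time _ _)) /=.
by rewrite !derive0; ring.
Qed.

Lemma reg_slabE a (f : Q -> R) : qreg d a f ->
  reg (fun p => p.2.1) (strip d) slabdom a (fun p => f (slabE p)).
Proof.
move=> rf.
have hh (p : R * (P * R)) : slabdom p -> p.2.1 = (p.2.1.1, p.2.1.2) by case: p => e [[]].
exact: (reg_pullback (@lE (P * R)%type) lX3 lZ3 slabdom_strip breg_slabheight hh rf).
Qed.

Lemma hder_slabE (f : Q -> R) (p : R * (P * R)) : `|p.1| < d -> C1 (strip d) f ->
  hder p (1, 0) (fun p => f (slabE p)) (dE f (slabE p) + p.2.2 * nu p.2.1 * dY f (slabE p)).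
Proof.
move=> pd Cf; have h1 := hder_depth pd.
have h2 : hder p (1, 0) (fun p : R * (P * R) => p.2.2) 0.
  by apply: (@hder_linear _ _ (snd \o snd)) => q; apply: (@continuous_comp _ _ _ snd snd); exact: csnd.
have hH : hder p (1, 0) slabheight (p.2.2 * nu p.2.1).
  rewrite /slabheight; rewrite /vary in h1; have := hderD (hder_cst (- h) p (1, 0)) (hderM h2 h1).
  by move/hder_conv; apply; ring.
exact: (hder_pullback (@lE (P * R)%type) lX3 lZ3 breg_slabheight pd Cf hH).
Qed.

End MovingSurface.

Section FixedSurface.
Context {R : realType}.
Notation P := (R * R)%type.
Notation P3 := (R * R * R)%type.
Variable eta : P -> R.
Hypothesis beta : breg setT setT eta.

Let CX : C1 setT (fst : P -> R).
Proof. by apply: C1_linear; [exact: openT|move=> p; exact: cvg_fst]. Qed.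

Let CZ : C1 setT (snd : P -> R).
Proof. by apply: C1_linear; [exact: openT|move=> p; exact: cvg_snd]. Qed.

Lemma reg_surf a (g : P3 -> R) : reg (@horizontal R) setT setT a g ->
  reg idfun setT setT a (fun q => g (surf eta q)).
Proof.
have [Ce _ De] := beta.
apply: (reg_comp3 openT CX Ce CZ (@subset_refl _ setT)) => //.
- by move=> v; exists `|v.1| => t _; rewrite (@derive_linear _ _ fst)// => p; exact: cvg_fst.
- by move=> v; exists `|v.2| => t _; rewrite (@derive_linear _ _ snd)// => p; exact: cvg_snd.
- by move=> [].
Qed.

Lemma hder_surf (g : P3 -> R) q v : C1 setT g ->
  hder q v (fun q => g (surf eta q)) (v.1 * D_x g (surf eta q)
     + 'D_v eta q * D_y g (surf eta q) + v.2 * D_z g (surf eta q)).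
Proof.
have [Ce _ _] := beta; move=> Cg.
have [Cc E] := C1_comp3 openT CX Ce CZ (fun _ _ => I) Cg.
have := hder_C1 v Cc (I : setT q).
rewrite E// (@derive_linear _ _ fst); last by move=> p; exact: cvg_fst.
by rewrite (@derive_linear _ _ snd)// => p; exact: cvg_snd.
Qed.

End FixedSurface.

(** * The flux of a cross product *)

Section CrossFlux.
Context {R : realType}.
Notation P := (R * R)%type.
Notation P3 := (R * R * R)%type.
Notation reg3 a f := (reg (@horizontal R) setT setT a f).

Definition curl1 (X2 X3 : P3 -> R) p := D_y X3 p - D_z X2 p.
Definition curl2 (X1 X3 : P3 -> R) p := D_z X1 p - D_x X3 p.
Definition curl3 (X1 X2 : P3 -> R) p := D_x X2 p - D_y X1 p.

Variables (h : R) (eta : P -> R).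
Hypotheses (beta : breg setT setT eta) (bx : breg setT setT (d_x eta)) (bz : breg setT setT (d_z eta)).

(** The divergence theorem for W = X x Y, with div W = Y . curl X - X . curl Y. At the bottom the
    vertical component of W vanishes with X_1 and X_3; at the surface W . N depends only on the
    tangential traces of X and Y. *)
Lemma cross_flux (X1 X2 X3 Y1 Y2 Y3 : P3 -> R) :
  reg3 2^-1 X1 -> reg3 2^-1 X2 -> reg3 2^-1 X3 ->
  reg3 2^-1 Y1 -> reg3 2^-1 Y2 -> reg3 2^-1 Y3 ->
  (forall q, X1 ((q.1, - h), q.2) = 0) -> (forall q, X3 ((q.1, - h), q.2) = 0) ->
  \int[@volume R]_(t in slab) ((eta t.1 + h) * let p := flat h eta t in
    (Y1 p * curl1 X2 X3 p + Y2 p * curl2 X1 X3 p + Y3 p * curl3 X1 X2 p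
     - (X1 p * curl1 Y2 Y3 p + X2 p * curl2 Y1 Y3 p + X3 p * curl3 Y1 Y2 p))) =
  \int[@area R]_q let p := surf eta q in
    ((X3 p + X2 p * d_z eta q) * (Y1 p + Y2 p * d_x eta q)
     - (X1 p + X2 p * d_x eta q) * (Y3 p + Y2 p * d_z eta q)).
Proof.
move=> x1 x2 x3 y1 y2 y3 X10 X30.
pose W1 p := X2 p * Y3 p - X3 p * Y2 p.
pose W2 p := X3 p * Y1 p - X1 p * Y3 p.
pose W3 p := X1 p * Y2 p - X2 p * Y1 p.
have w1 : reg3 1 W1 by rewrite /W1; regular (@openT P3) (@subset_refl _ [set: P3]).
have w2 : reg3 1 W2 by rewrite /W2; regular (@openT P3) (@subset_refl _ [set: P3]).
have w3 : reg3 1 W3 by rewrite /W3; regular (@openT P3) (@subset_refl _ [set: P3]).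
have F := fluid_divergence h beta bx bz w1 w2 w3.
transitivity (\int[@volume R]_(t in slab) ((eta t.1 + h) *
    (D_x W1 (flat h eta t) + D_y W2 (flat h eta t) + D_z W3 (flat h eta t)))).
  apply: eq_slint => q s s01; congr (_ * _); set p := flat h eta (q, s).
  have [[CX1 _ _] [CX2 _ _] [CX3 _ _]] := And3 x1 x2 x3.
  have [[CY1 _ _] [CY2 _ _] [CY3 _ _]] := And3 y1 y2 y3.
  have dx1 v := hder_C1 v CX1 (I : setT p); have dx2 v := hder_C1 v CX2 (I : setT p).
  have dx3 v := hder_C1 v CX3 (I : setT p); have dy1 v := hder_C1 v CY1 (I : setT p).
  have dy2 v := hder_C1 v CY2 (I : setT p); have dy3 v := hder_C1 v CY3 (I : setT p).
  have E1 : D_x W1 p = X2 p * D_x Y3 p + Y3 p * D_x X2 p - (X3 p * D_x Y2 p + Y2 p * D_x X3 p).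
    exact: hder_val (hderD (hderM (dx2 _) (dy3 _)) (hderN (hderM (dx3 _) (dy2 _)))).
  have E2 : D_y W2 p = X3 p * D_y Y1 p + Y1 p * D_y X3 p - (X1 p * D_y Y3 p + Y3 p * D_y X1 p).
    exact: hder_val (hderD (hderM (dx3 _) (dy1 _)) (hderN (hderM (dx1 _) (dy3 _)))).
  have E3 : D_z W3 p = X1 p * D_z Y2 p + Y2 p * D_z X1 p - (X2 p * D_z Y1 p + Y1 p * D_z X2 p).
    exact: hder_val (hderD (hderM (dx1 _) (dy2 _)) (hderN (hderM (dx2 _) (dy1 _)))).
  rewrite E1 E2 E3 /= /curl1 /curl2 /curl3.
  move: (X1 p) (X2 p) (X3 p) (Y1 p) (Y2 p) (Y3 p) (D_x X2 p) (D_x X3 p) (D_y X3 p) (D_y X1 p)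
    (D_z X1 p) (D_z X2 p) (D_x Y2 p) (D_x Y3 p) (D_y Y3 p) (D_y Y1 p) (D_z Y1 p) (D_z Y2 p) => *.
  ring.
rewrite F; apply: eq_pint => q; rewrite /W1 /W2 /W3 X10 X30 /=.
move: (X1 _) (X2 _) (X3 _) (Y1 (surf _ _)) (Y2 (surf _ _)) (Y3 (surf _ _)) => *; ring.
Qed.

End CrossFlux.

Lemma reg_pairing {R : realType} (ex ez f1 f2 f3 g1 g2 g3 : R * R -> R) :
  breg setT setT ex -> breg setT setT ez ->
  reg idfun setT setT 2^-1 f1 -> reg idfun setT setT 2^-1 f2 -> reg idfun setT setT 2^-1 f3 ->
  reg idfun setT setT 2^-1 g1 -> reg idfun setT setT 2^-1 g2 -> reg idfun setT setT 2^-1 g3 ->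
  reg idfun setT setT 1 (fun q => (f3 q + f2 q * ez q) * (g1 q + g2 q * ex q)
    - (f1 q + f2 q * ex q) * (g3 q + g2 q * ez q)).
Proof.
by move=> *; regular (@openT (R * R)%type) (@subset_refl _ [set: R * R]).
Qed.

Lemma hder_energy_form {R : realType} {V : normedModType R} (alpha : R)
    (v1 v2 v3 a1 a2 a3 : V -> R) (p v : V) (w1 w2 w3 b1 b2 b3 : R) :
  hder p v v1 w1 -> hder p v v2 w2 -> hder p v v3 w3 ->
  hder p v a1 b1 -> hder p v a2 b2 -> hder p v a3 b3 ->
  hder p v (fun p => 2^-1 * (v1 p * v1 p + v2 p * v2 p + v3 p * v3 p)
    - 2^-1 * alpha * (a1 p * v1 p + a2 p * v2 p + a3 p * v3 p))
   (v1 p * w1 + v2 p * w2 + v3 p * w3 - 2^-1 * alpha * (a1 p * w1 + a2 p * w2 + a3 p * w3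
     + (b1 * v1 p + b2 * v2 p + b3 * v3 p))).
Proof. by move=> *; derive_by; field. Qed.

(** * The bulk energy along a line: its boundary form and its derivative *)

Section Energy.
Context {R : realType}.
Notation P := (R * R)%type.
Notation P3 := (R * R * R)%type.
Notation Q := (R * P3)%type.
Notation preg f := (reg idfun (@setT P) (@setT P) 2^-1 f).

Variables (h alpha d : R) (eta nu : P -> R) (A1 A2 A3 : Q -> R).

Definition vort1 (X2 X3 : Q -> R) ep := dY X3 ep - dZ X2 ep.
Definition vort2 (X1 X3 : Q -> R) ep := dZ X1 ep - dX X3 ep.
Definition vort3 (X1 X2 : Q -> R) ep := dX X2 ep - dY X1 ep.

Let V1 := vort1 A2 A3.
Let V2 := vort2 A1 A3.
Let V3 := vort3 A1 A2.

(** Decay up to second order: the slopes and their derivatives enter through the variation of the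
    tangential traces. *)
Definition surface_admissible (f : P -> R) :=
  [/\ preg f, preg (d_x f) & preg (d_z f)].

(** Stated on the closed slab because the equation is also evaluated on the free surface itself, at
    s = 1. *)
Definition beltrami_on_slab := forall e t, `|e| < d -> slab t ->
  let p := slabE h eta nu (e, t) in
  [/\ vort1 V2 V3 p = alpha * V1 p, vort2 V1 V3 p = alpha * V2 p
    & vort3 V1 V2 p = alpha * V3 p].

Definition no_slip := forall e q, `|e| < d ->
  A1 (e, ((q.1, - h), q.2)) = 0 /\ A3 (e, ((q.1, - h), q.2)) = 0.

Hypotheses (d0 : 0 < d) (seta : surface_admissible eta) (snu : surface_admissible nu)
  (rA1 : qreg2 d A1) (rA2 : qreg2 d A2) (rA3 : qreg2 d A3)
  (bulk : beltrami_on_slab) (bottom : no_slip).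

Lemma qreg_vort : [/\ qreg d 2^-1 V1, qreg d 2^-1 V2 & qreg d 2^-1 V3].
Proof.
have [[_ r1] [_ r2] [_ r3]] := And3 rA1 rA2 rA3.
have os := @open_strip R P3 d; have ss := @subset_refl _ (@strip R P3 d).
by split; apply: (regB os ss); [exact: (r3 _)|exact: (r2 _)|exact: (r1 _)|exact: (r3 _)
  |exact: (r2 _)|exact: (r1 _)].
Qed.

Definition energy ep := 2^-1 * (V1 ep * V1 ep + V2 ep * V2 ep + V3 ep * V3 ep)
  - 2^-1 * alpha * (A1 ep * V1 ep + A2 ep * V2 ep + A3 ep * V3 ep).

Lemma qreg_energy : qreg d 1 energy.
Proof.
have [v1 v2 v3] := qreg_vort; have [[a1 _] [a2 _] [a3 _]] := And3 rA1 rA2 rA3.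
rewrite /qreg in v1 v2 v3 a1 a2 a3 *; rewrite /energy.
regular (@open_strip R P3 d) (@subset_refl _ (@strip R P3 d)).
Qed.

Definition slab_energy e := \int[@volume R]_(t in slab)
  ((vary eta nu e t.1 + h) * energy (slabE h eta nu (e, t))).

Lemma d_x_vary e q : d_x (vary eta nu e) q = d_x eta q + e * d_x nu q.
Proof.
have [[Ce _ _] _ _] := seta; have [[Cn _ _] _ _] := snu.
have h1 := hder_C1 ((1, 0) : P) Ce (I : setT q); have h2 := hder_C1 ((1, 0) : P) Cn (I : setT q).
by apply: hder_val; rewrite /vary; derive_by; rewrite mulr0 addr0.
Qed.

Lemma d_z_vary e q : d_z (vary eta nu e) q = d_z eta q + e * d_z nu q.
Proof.
have [[Ce _ _] _ _] := seta; have [[Cn _ _] _ _] := snu.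
have h1 := hder_C1 ((0, 1) : P) Ce (I : setT q); have h2 := hder_C1 ((0, 1) : P) Cn (I : setT q).
by apply: hder_val; rewrite /vary; derive_by; rewrite mulr0 addr0.
Qed.

Lemma preg_breg (f : P -> R) : preg f -> breg setT setT f.
Proof. by apply: reg_breg; lra. Qed.

Lemma breg_vary e : [/\ breg setT setT (vary eta nu e),
  breg setT setT (d_x (vary eta nu e)) & breg setT setT (d_z (vary eta nu e))].
Proof.
have [e0 e1 e2] := seta; have [n0 n1 n2] := snu.
have T := @subset_refl _ [set: P].
split.
- by apply: preg_breg; rewrite /vary; regular (@openT P) T.
- rewrite (_ : d_x _ = fun q => d_x eta q + e * d_x nu q); last by apply/funext => q; exact: d_x_vary.
  by apply: preg_breg; regular (@openT P) T.
- rewrite (_ : d_z _ = fun q => d_z eta q + e * d_z nu q); last by apply/funext => q; exact: d_z_vary.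
  by apply: preg_breg; regular (@openT P) T.
Qed.

Lemma curl_slice (X2 X3 : Q -> R) e p :
  [/\ curl1 (fun p => X2 (e, p)) (fun p => X3 (e, p)) p = vort1 X2 X3 (e, p),
      curl2 (fun p => X2 (e, p)) (fun p => X3 (e, p)) p = vort2 X2 X3 (e, p)
    & curl3 (fun p => X2 (e, p)) (fun p => X3 (e, p)) p = vort3 X2 X3 (e, p)].
Proof. by rewrite /curl1 /curl2 /curl3 !D_x_slice !D_y_slice !D_z_slice. Qed.

Lemma slint_scale c (f : P * R -> R) : slint f ->
  \int[@volume R]_(t in slab) (c * f t) = c * \int[@volume R]_(t in slab) f t.
Proof. exact: (@RintegralZl _ _ R (plane_measure \x lebesgue_measure)%E slab f c measurable_slab). Qed.

Let G (p : R * (P * R)) := (vary eta nu p.1 p.2.1 + h) * energy (slabE h eta nu p).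

Let reg_G : reg (fun p => p.2.1) (strip d) (slabdom d) 1 G.
Proof.
have [/preg_breg be _ _] := seta; have [/preg_breg bn _ _] := snu.
have r1 := reg_slabE h be bn qreg_energy; have r2 := breg_depth h d be bn.
rewrite /G; regular (@open_strip R (P * R)%type d) (@slabdom_strip R d).
Qed.

Lemma reg_slab_slint (F : R * (P * R) -> R) e : `|e| < d ->
  reg (fun p => p.2.1) (strip d) (slabdom d) 1 F -> slint (fun t => F (e, t)).
Proof.
move=> ed [CF dF _]; apply: decays_slab_integrable; first exact: fst_slice_continuous ed.
exact: (@decays_comp _ _ _ _ _ _ _ slab _ (pair e)) dF.
Qed.

(** [cross_flux] with X = A and Y = v: as curl v = alpha v, the density v . curl A - A . curl v is
    |v|^2 - alpha A . v, twice the energy density. *)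
Lemma slab_energy_surface e : `|e| < d ->
  slab_energy e = 2^-1 * \int[@area R]_q let p := surfE eta nu (e, q) in
    ((A3 p + A2 p * d_z (vary eta nu e) q) * (V1 p + V2 p * d_x (vary eta nu e) q)
     - (A1 p + A2 p * d_x (vary eta nu e) q) * (V3 p + V2 p * d_z (vary eta nu e) q)).
Proof.
move=> ed; have [be bx bz] := breg_vary e.
have [v1 v2 v3] := qreg_vort; have [[a1 _] [a2 _] [a3 _]] := And3 rA1 rA2 rA3.
have F := cross_flux be bx bz (qreg_slice ed a1) (qreg_slice ed a2) (qreg_slice ed a3)
  (qreg_slice ed v1) (qreg_slice ed v2) (qreg_slice ed v3)
  (fun q => (bottom q ed).1) (fun q => (bottom q ed).2).
have S : 2 * slab_energy e = \int[@volume R]_(t in slab) ((vary eta nu e t.1 + h) *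
    let p := flat h (vary eta nu e) t in
    (V1 (e, p) * curl1 (fun p => A2 (e, p)) (fun p => A3 (e, p)) p
     + V2 (e, p) * curl2 (fun p => A1 (e, p)) (fun p => A3 (e, p)) p
     + V3 (e, p) * curl3 (fun p => A1 (e, p)) (fun p => A2 (e, p)) p
     - (A1 (e, p) * curl1 (fun p => V2 (e, p)) (fun p => V3 (e, p)) p
        + A2 (e, p) * curl2 (fun p => V1 (e, p)) (fun p => V3 (e, p)) p
        + A3 (e, p) * curl3 (fun p => V1 (e, p)) (fun p => V2 (e, p)) p))).
  rewrite -slint_scale; last exact: (reg_slab_slint ed reg_G).
  apply: eq_slint => q s s01.
  have slt : slab (q, s) by split => //=; rewrite in_itv.
  have [B1 B2 B3] := bulk ed slt; rewrite /slabE /= in B1 B2 B3.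
  rewrite /slabE /=; set p := flat h _ (q, s) in B1 B2 B3 *.
  have [-> _ _] := curl_slice A2 A3 e p; have [_ -> _] := curl_slice A1 A3 e p.
  have [_ _ ->] := curl_slice A1 A2 e p; have [-> _ _] := curl_slice V2 V3 e p.
  have [_ -> _] := curl_slice V1 V3 e p; have [_ _ ->] := curl_slice V1 V2 e p.
  rewrite B1 B2 B3 -/(V1 (e, p)) -/(V2 (e, p)) -/(V3 (e, p)) /energy.
  move: (V1 _) (V2 _) (V3 _) (A1 _) (A2 _) (A3 _) (vary _ _ _ _) => *; by field.
have -> : \int[@area R]_q _ = 2 * slab_energy e := etrans (esym F) (esym S).
by field.
Qed.

Lemma dE_vort1 (X2 X3 : Q -> R) p : qreg2 d X2 -> qreg2 d X3 -> `|p.1| < d ->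
  dE (vort1 X2 X3) p = vort1 (dE X2) (dE X3) p.
Proof.
move=> r2 r3 pd; have [_ /(_ (0, (0, 1, 0)))[C3 _ _]] := r3.
have [_ /(_ (0, (0, 0, 1)))[C2 _ _]] := r2.
rewrite /vort1 /dY /dZ /dE (qreg2_comm _ _ r2 pd) (qreg2_comm _ _ r3 pd).
exact: (derive_C1B ((1, 0) : Q) C3 C2 pd).
Qed.

Lemma dE_vort2 (X1 X3 : Q -> R) p : qreg2 d X1 -> qreg2 d X3 -> `|p.1| < d ->
  dE (vort2 X1 X3) p = vort2 (dE X1) (dE X3) p.
Proof.
move=> r2 r3 pd; have [_ /(_ (0, (1, 0, 0)))[C3 _ _]] := r3.
have [_ /(_ (0, (0, 0, 1)))[C2 _ _]] := r2.
rewrite /vort2 /dX /dZ /dE (qreg2_comm _ _ r2 pd) (qreg2_comm _ _ r3 pd).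
exact: (derive_C1B ((1, 0) : Q) C2 C3 pd).
Qed.

Lemma dE_vort3 (X1 X2 : Q -> R) p : qreg2 d X1 -> qreg2 d X2 -> `|p.1| < d ->
  dE (vort3 X1 X2) p = vort3 (dE X1) (dE X2) p.
Proof.
move=> r2 r3 pd; have [_ /(_ (0, (1, 0, 0)))[C3 _ _]] := r3.
have [_ /(_ (0, (0, 1, 0)))[C2 _ _]] := r2.
rewrite /vort3 /dX /dY /dE (qreg2_comm _ _ r2 pd) (qreg2_comm _ _ r3 pd).
exact: (derive_C1B ((1, 0) : Q) C3 C2 pd).
Qed.

Lemma vary0 : vary eta nu 0 = eta.
Proof. by apply/funext => q; rewrite /vary mul0r addr0. Qed.

Lemma slint_sub (f g : P * R -> R) : slint f -> slint g ->
  \int[@volume R]_(t in slab) (f t - g t) =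
  \int[@volume R]_(t in slab) f t - \int[@volume R]_(t in slab) g t.
Proof. exact: (@RintegralB _ _ R (plane_measure \x lebesgue_measure)%E slab f g measurable_slab). Qed.

(** On solutions the field M = v - alpha A / 2 has curl M = alpha v / 2, and this is the
    coefficient, up to sign, with which the undifferentiated dA/de enters the variation of the
    energy density. *)
Definition defect (V A : Q -> R) ep := V ep - 2^-1 * alpha * A ep.
Let M1 := defect V1 A1.
Let M2 := defect V2 A2.
Let M3 := defect V3 A3.

Lemma qreg_defect V A : qreg d 2^-1 V -> qreg2 d A -> qreg d 2^-1 (defect V A).
Proof.
move=> rV [rA _]; rewrite /qreg in rV rA *; rewrite /defect.
regular (@open_strip R P3 d) (@subset_refl _ (@strip R P3 d)).
Qed.

Lemma derive_defect V A p v : qreg d 2^-1 V -> qreg2 d A -> `|p.1| < d ->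
  'D_v (defect V A) p = 'D_v V p - 2^-1 * alpha * 'D_v A p.
Proof.
move=> [CV _ _] [[CA _ _] _] pd.
have h1 := hder_C1 v CV pd; have h2 := hder_C1 v CA pd.
by apply: hder_val; rewrite /defect; derive_by; ring.
Qed.

Lemma bottom_derive (A : Q -> R) p : C1 (strip d) A ->
  (forall e, `|e| < d -> A (e, p) = 0) -> dE A (0, p) = 0.
Proof.
move=> CA A0.
rewrite /dE -(@derive_affine _ _ _ _ _ (pairl_affine p) A 0 1).
transitivity ('D_1 (fun=> 0 : R) (0 : R)); last exact: derive_cst.
apply: near_eq_derive; exists d => // e; rewrite /ball /= sub0r normrN; exact: A0.
Qed.

Lemma reg_pint (f : P -> R) : reg idfun setT setT 1 f -> pint f.
Proof. by move=> [Cf df _]; apply: decays_integrable => //; exact: C1T_continuous. Qed.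

(** A transport formula. With B = dA/de and M the defect field, the energy density at a fixed point
    varies by M . curl B - B . curl M = div (B x M). By [cross_flux] this becomes a pairing of the
    tangential traces of B and M; the motion of the surface contributes nu times the density
    there. *)
Lemma is_derive_slab_energy :
  is_derive (0 : R) (1 : R) slab_energy (\int[@area R]_q let p := (0, surf eta q) in
    ((dE A3 p + dE A2 p * d_z eta q) * (M1 p + M2 p * d_x eta q)
     - (dE A1 p + dE A2 p * d_x eta q) * (M3 p + M2 p * d_z eta q)
     + nu q * energy p)).
Proof.
have DG := is_derive_slab d0 reg_G.
have d00 : `|0 : R| < d by rewrite normr0.
have [/preg_breg be /preg_breg bx /preg_breg bz] := seta; have [/preg_breg bn _ _] := snu.
have [v1 v2 v3] := qreg_vort.
have m1 := qreg_defect v1 rA1; have m2 := qreg_defect v2 rA2; have m3 := qreg_defect v3 rA3.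
have [b1 b2 b3] : [/\ qreg d 2^-1 (dE A1), qreg d 2^-1 (dE A2) & qreg d 2^-1 (dE A3)].
  by split; [exact: (rA1.2 (1, 0))|exact: (rA2.2 (1, 0))|exact: (rA3.2 (1, 0))].
have [[CA1 _ _] [CA2 _ _] [CA3 _ _]] := And3 rA1.1 rA2.1 rA3.1.
have [[CV1 _ _] [CV2 _ _] [CV3 _ _]] := And3 v1 v2 v3.
have F := cross_flux be bx bz (qreg_slice d00 b1) (qreg_slice d00 b2) (qreg_slice d00 b3)
  (qreg_slice d00 m1) (qreg_slice d00 m2) (qreg_slice d00 m3)
  (fun q => bottom_derive CA1 (fun e ed => (bottom q ed).1))
  (fun q => bottom_derive CA3 (fun e ed => (bottom q ed).2)).
have re := reg_flat h be (qreg_slice d00 qreg_energy).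
(* The s-derivative of [U] collects the two effects of the moving coordinates, the variation nu of
   the Jacobian and the vertical displacement s nu of the points. Subtracting it leaves the Jacobian
   times the e-derivative at a fixed point, and [U] integrates to the surface term. *)
pose U (t : P * R) := t.2 * nu t.1 * energy (0, flat h eta t).
have Ue : reg fst setT slab 1 U.
  have bns := breg_on_slab bn; have bs := @breg_slab_x R.
  rewrite /U; regular (@openT (P * R)%type) (@slabT R).
have FU := slab_vertical_FTC Ue.
have sU : slint ('D_((0, 0), 1) U).
  have [CU _ DU] := Ue; apply: decays_slab_integrable => //.
  by move=> t; exact: (C1_derive_continuous _ CU I).
have sG : slint (fun t => 'D_(1, 0) G (0, t)).
  have [CG _ /(_ (1, 0)) dG] := reg_G; apply: decays_slab_integrable.
    move=> t; apply: (@continuous_comp _ _ _ (pair 0) ('D_(1, 0) G)); first exact: continuous_pairr.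
    exact: (C1_derive_continuous _ CG).
  exact: (@decays_comp _ _ _ _ _ _ _ slab _ (pair 0)) dG.
have D := slint_sub sG sU.
suff E : \int[@volume R]_(t in slab) ('D_(1, 0) G (0, t)
    - 'D_((0, 0), 1) U t) =
  \int[@area R]_q let p := (0, surf eta q) in
    ((dE A3 p + dE A2 p * d_z eta q) * (M1 p + M2 p * d_x eta q)
     - (dE A1 p + dE A2 p * d_x eta q) * (M3 p + M2 p * d_z eta q)).
  have aux (w x y k z : R) : w = x - y -> w = k -> y = z -> x = k + z.
    by move=> -> <- <-; rewrite subrK.
  have tot := aux _ _ _ _ _ D E FU.
  have FU' : \int[@area R]_q (U (q, 1) - U (q, 0)) = \int[@area R]_q (nu q * energy (0, surf eta q)).
    apply: eq_pint => q; rewrite /U /flat /surf /= mul1r !mul0r subr0 mul1r.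
    by have -> : - h + (eta q + h) = eta q by ring.
  suff tot' : \int[@volume R]_(t in slab) 'D_(1, 0) G (0, t) = \int[@area R]_q
      let p := (0, surf eta q) in
      ((dE A3 p + dE A2 p * d_z eta q) * (M1 p + M2 p * d_x eta q)
       - (dE A1 p + dE A2 p * d_x eta q) * (M3 p + M2 p * d_z eta q)
       + nu q * energy p) by rewrite -tot'; exact: DG.
  rewrite tot FU' -pint_add //; apply: reg_pint.
  - have sb1 := reg_surf be (qreg_slice d00 b1); have sb2 := reg_surf be (qreg_slice d00 b2).
    have sb3 := reg_surf be (qreg_slice d00 b3); have sm1 := reg_surf be (qreg_slice d00 m1).
    have sm2 := reg_surf be (qreg_slice d00 m2); have sm3 := reg_surf be (qreg_slice d00 m3).
    exact: (reg_pairing bx bz sb1 sb2 sb3 sm1 sm2 sm3).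
  - have se := reg_surf be (qreg_slice d00 qreg_energy).
    exact: (bregM_reg openT (@subset_refl _ [set: P]) bn se).
rewrite -[RHS]F; apply: eq_slint => q s s01.
set t := (q, s); set p := flat h eta t.
have slt : slab (q, s) by split => //=; rewrite in_itv.
have sl0 : slabE h eta nu (0, t) = (0, p) by rewrite /slabE /= vary0.
have [B1 B2 B3] := bulk d00 slt; rewrite sl0 in B1 B2 B3.
have pd : `|((0, p) : Q).1| < d by [].
have -> : 'D_(1, 0) G (0, t) = nu q * energy (0, p)
   + (eta q + h) * (dE energy (0, p) + s * nu q * dY energy (0, p)).
  have [Ce _ _] := qreg_energy.
  have h1 := hder_depth h be bn (p := (0, t)) d00; have h2 := hder_slabE h be bn (p := (0, t)) d00 Ce.
  apply: hder_val; apply: (hder_conv (hderM h1 h2)); rewrite sl0 /= vary0.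
  move: (dE energy _) (dY energy _) (energy _) => *; ring.
have -> : 'D_((0, 0), 1) U t =
   nu q * energy (0, p) + s * nu q * ((eta q + h) * dY energy (0, p)).
  have [Cn _ _] := bn; have [Ce _ _] := qreg_slice d00 qreg_energy.
  have h1 := hder_slab_s t ((0, 0), 1); have h2 := hder_on_slab t ((0, 0), 1) Cn.
  have h3 := hder_flat h be t ((0, 0), 1) Ce.
  by apply: hder_val; rewrite /U; derive_by; rewrite /= !derive0 D_y_slice -/p; ring.
have -> : dE energy (0, p) = V1 (0, p) * dE V1 (0, p) + V2 (0, p) * dE V2 (0, p) + V3 (0, p) * dE V3 (0, p)
   - 2^-1 * alpha * (A1 (0, p) * dE V1 (0, p) + A2 (0, p) * dE V2 (0, p) + A3 (0, p) * dE V3 (0, p)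
     + (dE A1 (0, p) * V1 (0, p) + dE A2 (0, p) * V2 (0, p) + dE A3 (0, p) * V3 (0, p))).
  have h1 := hder_C1 ((1, 0) : Q) CV1 pd; have h2 := hder_C1 ((1, 0) : Q) CV2 pd.
  have h3 := hder_C1 ((1, 0) : Q) CV3 pd; have h4 := hder_C1 ((1, 0) : Q) CA1 pd.
  have h5 := hder_C1 ((1, 0) : Q) CA2 pd; have h6 := hder_C1 ((1, 0) : Q) CA3 pd.
  exact: hder_val (hder_energy_form alpha h1 h2 h3 h4 h5 h6).
cbv zeta; rewrite -/t -/p.
have [-> _ _] := curl_slice (dE A2) (dE A3) 0 p; have [_ -> _] := curl_slice (dE A1) (dE A3) 0 p.
have [_ _ ->] := curl_slice (dE A1) (dE A2) 0 p; have [-> _ _] := curl_slice M2 M3 0 p.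
have [_ -> _] := curl_slice M1 M3 0 p; have [_ _ ->] := curl_slice M1 M2 0 p.
rewrite -(dE_vort1 rA2 rA3 pd) -(dE_vort2 rA1 rA3 pd) -(dE_vort3 rA1 rA2 pd).
have aux (a b c e k : R) : a - b = alpha * k -> a - 2^-1 * alpha * c - (b - 2^-1 * alpha * e)
    = alpha * k - 2^-1 * alpha * (c - e).
  by move=> <-; ring.
have aux' (k : R) : alpha * k - 2^-1 * alpha * k = 2^-1 * alpha * k by field.
have -> : vort1 M2 M3 (0, p) = 2^-1 * alpha * V1 (0, p).
  rewrite /vort1 /dY /dZ (derive_defect _ v2 rA2 pd) (derive_defect _ v3 rA3 pd).
  by apply: (eq_trans _ (aux' _)); exact: aux B1.
have -> : vort2 M1 M3 (0, p) = 2^-1 * alpha * V2 (0, p).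
  rewrite /vort2 /dZ /dX (derive_defect _ v1 rA1 pd) (derive_defect _ v3 rA3 pd).
  by apply: (eq_trans _ (aux' _)); exact: aux B2.
have -> : vort3 M1 M2 (0, p) = 2^-1 * alpha * V3 (0, p).
  rewrite /vort3 /dX /dY (derive_defect _ v2 rA2 pd) (derive_defect _ v1 rA1 pd).
  by apply: (eq_trans _ (aux' _)); exact: aux B3.
rewrite -/V1 -/V2 -/V3 /M1 /M2 /M3 /defect -/t.
move: (V1 _) (V2 _) (V3 _) (A1 _) (A2 _) (A3 _) (dE A1 _) (dE A2 _) (dE A3 _) (dE V1 _) (dE V2 _) (dE V3 _) => *.
by field.
Qed.

End Energy.

(** The elimination of dA/de in pointwise form. B stands for dA/de; X2, Y1, Y2, Y3 and Z2 are
    spatial derivatives of A, and the letters mX, mY, mZ are those of M. Of the left side, which is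
    2 s - l at a point, no B survives on the right. The last two lines there form the planar
    divergence of nu A_2 (M_par)^perp. The three premises state curl M = alpha v / 2. *)
Lemma variation_identity {R : realType} (alpha nu nx nz ex ez exz A1 A2 A3 B1 B2 B3 X2 Y1 Y2 Y3 Z2
    V2 E1 E2 G1 G2 mX2 mX3 mY1 mY2 mY3 mZ1 mZ2 : R) :
  let V1 := Y3 - Z2 in let V3 := X2 - Y1 in
  let F1 := V1 + V2 * ex - alpha * E2 in let F2 := V3 + V2 * ez + alpha * E1 in
  let M1 := V1 - 2^-1 * alpha * A1 in let M2 := V2 - 2^-1 * alpha * A2 in
  let M3 := V3 - 2^-1 * alpha * A3 in
  let a1 := A1 + A2 * ex in let a2 := A3 + A2 * ez in
  let a1' := B1 + nu * Y1 + ((B2 + nu * Y2) * ex + A2 * nx) in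
  let a2' := B3 + nu * Y3 + ((B2 + nu * Y2) * ez + A2 * nz) in
  let f := 2^-1 * (V1 * V1 + V2 * V2 + V3 * V3) - 2^-1 * alpha * (A1 * V1 + A2 * V2 + A3 * V3) in
  let p1 := - (M3 + M2 * ez) in let p2 := M1 + M2 * ex in
  mY3 - mZ2 = 2^-1 * alpha * V1 -> mZ1 - mX3 = 2^-1 * alpha * V2 ->
  mX2 - mY1 = 2^-1 * alpha * V3 ->
  (a2' * F1 + a2 * G1 - (a1' * F2 + a1 * G2))
  - ((B3 + B2 * ez) * (M1 + M2 * ex) - (B1 + B2 * ex) * (M3 + M2 * ez) + nu * f)
  + 2^-1 * alpha * (2 * (E1 * a1' + E2 * a2') - (a2' * a1 - a1' * a2)) =
  a2 * G1 - a1 * G2 + nu * (2^-1 * (V1 * V1 + V2 * V2 + V3 * V3) - (V2 - ex * V1 - ez * V3) * V2)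
  + (nx * A2 * p1 + nu * ((X2 + ex * Y2) * p1
       - A2 * (mX3 + ex * mY3 + ((mX2 + ex * mY2) * ez + M2 * exz)))
    + (nz * A2 * p2 + nu * ((Z2 + ez * Y2) * p2
       + A2 * (mZ1 + ez * mY1 + ((mZ2 + ez * mY2) * ex + M2 * exz))))).
Proof.
move=> V1 V3 F1 F2 M1 M2 M3 a1 a2 a1' a2' f p1 p2 e1 e2 e3.
have -> : mY3 = mZ2 + 2^-1 * alpha * V1 by rewrite -e1; ring.
have -> : mZ1 = mX3 + 2^-1 * alpha * V2 by rewrite -e2; ring.
have -> : mX2 = mY1 + 2^-1 * alpha * V3 by rewrite -e3; ring.
rewrite /p1 /p2 /f /a1' /a2' /a1 /a2 /M1 /M2 /M3 /F1 /F2 /V1 /V3.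
by field.
Qed.

Section RegularDivergence.
Context {R : realType}.
Notation P := (R * R)%type.

Lemma half_le1 : 2^-1 <= 1 :> R. Proof. by lra. Qed.

Lemma reg_divergence (g1 g2 : P -> R) :
  reg idfun setT setT 1 g1 -> reg idfun setT setT 1 g2 ->
  pint (fun q => d_x g1 q + d_z g2 q) /\ \int[@area R]_q (d_x g1 q + d_z g2 q) = 0.
Proof.
move=> [C1' d1 D1] [C2' d2 D2].
have p : pint (fun q => d_x g1 q + d_z g2 q).
  apply: decays_integrable; last exact: decaysD (D1 _) (D2 _).
  by move=> q; apply: cvgD; [exact: C1T_dx_continuous|exact: C1T_dz_continuous].
split=> //; exact: (plane_divergence_C1 C1' C2' (decays_weak half_le1 d1) (decays_weak half_le1 d2) p).
Qed.

End RegularDivergence.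

Section FamilyDerivative.
Context {R : realType}.
Notation P := (R * R)%type.
Variable d : R.
Hypothesis d0 : 0 < d.

Let d00 : `|0 : R| < d. Proof. by rewrite normr0. Qed.

Lemma time_derive_continuous (f : R * P -> R) : C1 (strip d) f ->
  continuous (fun q => 'D_(1, 0) f (0, q)).
Proof.
move=> Cf q; apply: (@continuous_comp _ _ _ (pair 0) ('D_(1, 0) f)); first exact: continuous_pairr.
by apply: (C1_derive_continuous _ Cf); rewrite /strip /= normr0.
Qed.

Lemma time_decays b (f : R * P -> R) : decays b snd (strip d) f ->
  decays b idfun setT (fun q => f (0, q)).
Proof.
by apply: (@decays_comp _ _ _ _ _ _ _ setT _ (pair 0)) => // p _; rewrite /strip /= normr0.
Qed.

Lemma pint_time_derive (f : R * P -> R) : reg snd (strip d) (strip d) 1 f ->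
  pint (fun q => 'D_(1, 0) f (0, q)).
Proof.
move=> [Cf _ Df]; apply: decays_integrable; first exact: (time_derive_continuous Cf).
exact: (time_decays (Df (1, 0))).
Qed.

Lemma pint_mul (f g : P -> R) : continuous f -> continuous g -> decays 2^-1 idfun setT f ->
  decays 2^-1 idfun setT g -> pint (fun q => f q * g q).
Proof.
move=> cf cg df dg; apply: decays_integrable; last exact: decays_half2.
by move=> q; apply: cvgM; [exact: cf|exact: cg].
Qed.

Lemma pint_hodge_derive (a1 a2 : R * P -> R) (E1 E2 : P -> R) :
  reg snd (strip d) (strip d) 2^-1 a1 -> reg snd (strip d) (strip d) 2^-1 a2 ->
  hodge (fun q => a1 (0, q)) (fun q => a2 (0, q)) E1 E2 ->
  pint (fun q => 2 * (E1 q * 'D_(1, 0) a1 (0, q) + E2 q * 'D_(1, 0) a2 (0, q))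
       - ('D_(1, 0) a2 (0, q) * a1 (0, q) - 'D_(1, 0) a1 (0, q) * a2 (0, q))).
Proof.
move=> r1 r2 [[fa1 fa2] [fE1 fE2] _ _].
have [ca1 ca2] := (field_continuous fa1, field_continuous fa2).
have [cE1 cE2] := (field_continuous fE1, field_continuous fE2).
have [[_ da1] [_ da2] [_ dE1] [_ dE2]] := And4 fa1 fa2 fE1 fE2.
have [[Cr1 _ /(_ (1, 0)) Dr1] [Cr2 _ /(_ (1, 0)) Dr2]] := (r1, r2).
have [e1 e2] := (time_derive_continuous Cr1, time_derive_continuous Cr2).
have [d1 d2] := (time_decays Dr1, time_decays Dr2).
exact: (pintB (pintZ 2 (pintD (pint_mul cE1 e1 dE1 d1) (pint_mul cE2 e2 dE2 d2)))
  (pintB (pint_mul e2 ca1 d2 da1) (pint_mul e1 ca2 d1 da2))).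
Qed.

End FamilyDerivative.

(** * Derivative of the part of the functional that involves A *)

Section Variation.
Context {R : realType}.
Notation P := (R * R)%type.
Notation P3 := (R * R * R)%type.
Notation Q := (R * P3)%type.
Notation preg f := (reg idfun (@setT P) (@setT P) 2^-1 f).

Variables (h alpha d : R) (eta nu F1 F2 G1 G2 : P -> R) (A1 A2 A3 : Q -> R) (E1 E2 : R -> P -> R).
Let V1 := vort1 A2 A3.
Let V2 := vort2 A1 A3.
Let V3 := vort3 A1 A2.

Definition par1E (p : R * P) :=
  A1 (surfE eta nu p) + A2 (surfE eta nu p) * (d_x eta p.2 + p.1 * d_x nu p.2).
Definition par2E (p : R * P) :=
  A3 (surfE eta nu p) + A2 (surfE eta nu p) * (d_z eta p.2 + p.1 * d_z nu p.2).

Definition tangential_condition := forall e q, `|e| < d -> let p := surfE eta nu (e, q) in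
  V1 p + V2 p * (d_x eta q + e * d_x nu q) = F1 q + e * G1 q + alpha * E2 e q /\
  V3 p + V2 p * (d_z eta q + e * d_z nu q) = F2 q + e * G2 q - alpha * E1 e q.

Hypotheses (d0 : 0 < d) (seta : surface_admissible eta) (snu : surface_admissible nu)
  (rF1 : preg F1) (rF2 : preg F2) (rG1 : preg G1) (rG2 : preg G2)
  (rA1 : qreg2 d A1) (rA2 : qreg2 d A2) (rA3 : qreg2 d A3)
  (bulk : beltrami_on_slab h alpha d eta nu A1 A2 A3) (bottom : no_slip h d A1 A3)
  (tangential : tangential_condition)
  (hE : forall e, `|e| < d -> hodge (fun q => par1E (e, q)) (fun q => par2E (e, q)) (E1 e) (E2 e)).

Let os := @open_strip R P d.
Let ss := @subset_refl _ (@strip R P d).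

Lemma reg_par : reg snd (strip d) (strip d) 2^-1 par1E /\ reg snd (strip d) (strip d) 2^-1 par2E.
Proof.
have [e0 e1 e2] := seta; have [n0 n1 n2] := snu.
have be := preg_breg e0; have bn := preg_breg n0.
have s1 := reg_surfE be bn rA1.1; have s2 := reg_surfE be bn rA2.1.
have s3 := reg_surfE be bn rA3.1.
have r1 := reg_snd d e1; have r2 := reg_snd d e2; have r3 := reg_snd d n1; have r4 := reg_snd d n2.
have bt := @breg_time R d P.
by split; rewrite /par1E /par2E; regular os ss.
Qed.

Let surf0 q : surfE eta nu (0, q) = (0, surf eta q).
Proof. by rewrite /surfE /= vary0. Qed.

Lemma hder_par q : let p := (0, surf eta q) in
  hder ((0, q) : R * P) (1, 0) par1E
    (dE A1 p + nu q * dY A1 p + ((dE A2 p + nu q * dY A2 p) * d_x eta q + A2 p * d_x nu q)) /\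
  hder ((0, q) : R * P) (1, 0) par2E
    (dE A3 p + nu q * dY A3 p + ((dE A2 p + nu q * dY A2 p) * d_z eta q + A2 p * d_z nu q)).
Proof.
have d00 : `|((0, q) : R * P).1| < d by rewrite /= normr0.
have [e0 [Ce1 _ _] [Ce2 _ _]] := seta; have [n0 [Cn1 _ _] [Cn2 _ _]] := snu.
have be := preg_breg e0; have bn := preg_breg n0.
have [[C1' _ _] [C2' _ _] [C3' _ _]] := And3 rA1.1 rA2.1 rA3.1.
have h1 := hder_surfE be bn d00 C1'; have h2 := hder_surfE be bn d00 C2'.
have h3 := hder_surfE be bn d00 C3'.
have k1 := hder_snd (0, q) (1, 0) Ce1; have k2 := hder_snd (0, q) (1, 0) Ce2.
have k3 := hder_snd (0, q) (1, 0) Cn1; have k4 := hder_snd (0, q) (1, 0) Cn2.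
have kt := hder_time ((0, q) : R * P) (1, 0).
have aux (a b c x y z w k : R) : a + b + (c * (0 + (0 * 0 + w * 1)) + (x + 0 * w) * (y + z)) =
   a + b + ((y + z) * x + c * w) by ring.
split.
  apply: (hder_conv (hderD h1 (hderM h2 (hderD k1 (hderM kt k3))))).
  by rewrite /= surf0 !derive0; exact: aux.
apply: (hder_conv (hderD h3 (hderM h2 (hderD k2 (hderM kt k4))))).
by rewrite /= surf0 !derive0; exact: aux.
Qed.

(* By the divergence theorem the energy is half of int a . (v_par)^perp, and so is its
   e-derivative up to explicit terms; equating the two forms eliminates dA/de. *)
Lemma is_derive_variation :
  is_derive (0 : R) (1 : R) (fun e => slab_energy h alpha eta nu A1 A2 A3 e
      - 2^-1 * alpha * \int[@area R]_q (E1 e q * par1E (e, q) + E2 e q * par2E (e, q)))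
    (\int[@area R]_q let p := (0, surf eta q) in
      (par2E (0, q) * G1 q - par1E (0, q) * G2 q
       + nu q * (2^-1 * (V1 p * V1 p + V2 p * V2 p + V3 p * V3 p)
                 - (V2 p - d_x eta q * V1 p - d_z eta q * V3 p) * V2 p))).
Proof.
have d00 : `|0 : R| < d by rewrite normr0.
have [r1 r2] := reg_par.
have DL := is_derive_slab_energy d0 seta snu rA1 rA2 rA3 bulk bottom.
have DQ := is_derive_hodge d0 r1 r2 hE.
(* In the boundary form of the energy, the tangential condition replaces v_par. Its nonlocal part
   contributes exactly alpha/2 times the integral of E . a, which is the term subtracted, so the
   functional is the integral of [S]. *)
pose S (p : R * P) := 2^-1 * (par2E p * (F1 p.2 + p.1 * G1 p.2) - par1E p * (F2 p.2 + p.1 * G2 p.2)).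
have rS : reg snd (strip d) (strip d) 1 S.
  have f1 := reg_snd d rF1; have f2 := reg_snd d rF2.
  have g1 := reg_snd d rG1; have g2 := reg_snd d rG2.
  have bt := @breg_time R d P.
  by rewrite /S; regular os ss.
have DS := is_derive_area d0 rS.
have SE e : `|e| < d -> slab_energy h alpha eta nu A1 A2 A3 e
      - 2^-1 * alpha * \int[@area R]_q (E1 e q * par1E (e, q) + E2 e q * par2E (e, q))
    = \int[@area R]_q S (e, q).
  move=> ed; have [[fa1 fa2] [fE1 fE2] _ _] := hE ed.
  have pS : pint (fun q => S (e, q)).
    have [CS dS _] := rS; apply: decays_integrable; first exact: fst_slice_continuous ed.
    exact: (@decays_comp _ _ _ _ _ _ _ setT _ (pair e)) dS.
  have pE : pint (fun q => E1 e q * par1E (e, q) + E2 e q * par2E (e, q)).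
    by apply: pintD; exact: pintM.
  rewrite (slab_energy_surface seta snu rA1 rA2 rA3 bulk bottom ed).
  rewrite (_ : \int[@area R]_q _ = 2 * (\int[@area R]_q S (e, q)
     + 2^-1 * alpha * \int[@area R]_q (E1 e q * par1E (e, q) + E2 e q * par2E (e, q)))); first by field.
  rewrite -pint_scale// -pint_add//; last exact: pintZ.
  rewrite -pint_scale; last by apply: pintD => //; exact: pintZ.
  apply: eq_pint => q; have [t1 t2] := tangential q ed.
  rewrite /= (d_x_vary seta snu) (d_z_vary seta snu) -/V1 -/V2 -/V3 t1 t2 /S /par1E /par2E /=.
  move: (A1 _) (A2 _) (A3 _) (d_x _ _) (d_z _ _) => *; by field.
pose D1 q := 'D_(1, 0) par1E (0, q); pose D2 q := 'D_(1, 0) par2E (0, q).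
have DS0 q : 'D_(1, 0) S (0, q) = 2^-1 * (D2 q * F1 q + par2E (0, q) * G1 q
    - (D1 q * F2 q + par1E (0, q) * G2 q)).
  have qd : `|((0, q) : R * P).1| < d by [].
  have [[Cr1 _ _] [Cr2 _ _]] := (r1, r2).
  have [[CF1 _ _] [CF2 _ _] [CG1 _ _] [CG2 _ _]] := And4 rF1 rF2 rG1 rG2.
  have a1 := hder_C1 ((1, 0) : R * P) Cr1 qd; have a2 := hder_C1 ((1, 0) : R * P) Cr2 qd.
  have k1 := hder_snd (0, q) (1, 0) CF1; have k2 := hder_snd (0, q) (1, 0) CF2.
  have k3 := hder_snd (0, q) (1, 0) CG1; have k4 := hder_snd (0, q) (1, 0) CG2.
  have kt := hder_time ((0, q) : R * P) (1, 0).
  apply: hder_val; apply: (hder_conv (hderM (hder_cst 2^-1 _ _)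
    (hderD (hderM a2 (hderD k1 (hderM kt k3))) (hderN (hderM a1 (hderD k2 (hderM kt k4))))))).
  have aux (a b c e f k l m t u v w x : R) : u = 0 -> v = 0 -> w = 0 -> x = 0 ->
     2^-1 * (a * (u + (0 * v + b * 1)) + (c + 0 * b) * e - (f * (w + (0 * x + k * 1)) + (l + 0 * k) * m))
     + t * 0 = 2^-1 * (e * c + a * b - (m * l + f * k)) by move=> -> -> -> ->; ring.
  by apply: aux; exact: derive0.
have pDS := pint_time_derive d0 rS.
pose iQ q := 2 * (E1 0 q * D1 q + E2 0 q * D2 q) - (D2 q * par1E (0, q) - D1 q * par2E (0, q)).
have pIQ : pint iQ := pint_hodge_derive d0 r1 r2 (hE d00).
have [pe pex pez] := seta; have [pn pnx pnz] := snu.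
have be := preg_breg pe; have bx := preg_breg pex; have bz := preg_breg pez.
have bn := preg_breg pn.
have [v1 v2 v3] := qreg_vort rA1 rA2 rA3.
have m1 := qreg_defect alpha v1 rA1; have m2 := qreg_defect alpha v2 rA2.
have m3 := qreg_defect alpha v3 rA3.
pose M1 := defect alpha V1 A1; pose M2 := defect alpha V2 A2; pose M3 := defect alpha V3 A3.
have sA2 := reg_surf be (qreg_slice d00 rA2.1).
have sm1 := reg_surf be (qreg_slice d00 m1); have sm2 := reg_surf be (qreg_slice d00 m2).
have sm3 := reg_surf be (qreg_slice d00 m3).
pose iL q := let p := (0, surf eta q) in
    ((dE A3 p + dE A2 p * d_z eta q) * (M1 p + M2 p * d_x eta q)
     - (dE A1 p + dE A2 p * d_x eta q) * (M3 p + M2 p * d_z eta q)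
     + nu q * energy alpha A1 A2 A3 p).
have pIL : pint iL.
  apply: pintD; apply: reg_pint.
    apply: (reg_pairing bx bz _ _ _ sm1 sm2 sm3);
      [exact: (reg_surf be (qreg_slice d00 (rA1.2 (1, 0))))
      |exact: (reg_surf be (qreg_slice d00 (rA2.2 (1, 0))))
      |exact: (reg_surf be (qreg_slice d00 (rA3.2 (1, 0))))].
  have se := reg_surf be (qreg_slice d00 (qreg_energy alpha rA1 rA2 rA3)).
  exact: (bregM_reg openT (@subset_refl _ [set: P]) bn se).
(* The vector (g1, g2) is nu A_2 (M_par)^perp. Adding its divergence, of integral zero, removes the
   gradient of nu that the variation of the slope introduces into the derivative of a. *)
pose g1 q := nu q * (A2 (0, surf eta q) * - (M3 (0, surf eta q) + M2 (0, surf eta q) * d_z eta q)).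
pose g2 q := nu q * (A2 (0, surf eta q) * (M1 (0, surf eta q) + M2 (0, surf eta q) * d_x eta q)).
have rg (f m n e' : P -> R) : preg f -> preg m -> preg n -> breg setT setT e' ->
    reg idfun setT setT 1 (fun q => nu q * (f q * - (m q + n q * e' q))) /\
    reg idfun setT setT 1 (fun q => nu q * (f q * (m q + n q * e' q))).
  by move=> *; split; regular (@openT P) (@subset_refl _ [set: P]).
have rg1 : reg idfun setT setT 1 g1 := (rg _ _ _ _ sA2 sm3 sm2 bz).1.
have rg2 : reg idfun setT setT 1 g2 := (rg _ _ _ _ sA2 sm1 sm2 bx).2.
have [[Cg1 _ _] [Cg2 _ _]] := (rg1, rg2).
have [pdiv div0] := reg_divergence rg1 rg2.
pose s1 := \int[@area R]_q 'D_(1, 0) S (0, q).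
set T := (X in is_derive _ _ _ X).
set L := (X in is_derive _ _ X _).
have nE : \forall e \near (0 : R), \int[@area R]_q S (e, q) = L e.
  by exists d => // e; rewrite /ball /= sub0r normrN => /SE.
have DLS := near_eq_is_derive nE DS.
suff : T = s1 by move=> ->; exact: DLS.
have DB := is_deriveB DL (is_deriveZ (2^-1 * alpha) DQ).
have E12 := etrans (esym (@derive_val _ _ _ _ _ _ _ DLS)) (@derive_val _ _ _ _ _ _ _ DB).
(* Here x is the derivative of the integral of [S], and y - z the same derivative obtained from the
   energy and the nonlocal term. The combination 2 x - y + z is the one in which dA/de cancels. *)
have aux (x y z w : R) : x = y - z -> w = 2 * x - y + z - 0 -> w = x.
  by move=> E ->; rewrite [X in 2 * X](E) E; ring.
apply: (aux _ _ _ _ E12).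
have pDS2 := pintZ 2 pDS; have pcQ := pintZ (2^-1 * alpha) pIQ.
have H : T = \int[@area R]_q (2 * 'D_(1, 0) S (0, q) - iL q + 2^-1 * alpha * iQ q
    - (d_x g1 q + d_z g2 q)).
  apply: eq_pint => q; set p := (0, surf eta q).
  have pd : `|((0, surf eta q) : Q).1| < d by [].
  have slt : slab (q, 1) by split => //=; rewrite in_itv /= ler01 lexx.
  have := bulk d00 slt; rewrite /slabE vary0 /flat /= mul1r.
  have -> : - h + (eta q + h) = eta q by ring.
  rewrite -/(surf eta q) -/p => -[B1 B2 B3].
  have [t1 t2] := tangential q d00.
  rewrite surf0 -/p !mul0r !addr0 in t1 t2.
  have F1E : F1 q = V1 p + V2 p * d_x eta q - alpha * E2 0 q by rewrite t1 addrK.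
  have F2E : F2 q = V3 p + V2 p * d_z eta q + alpha * E1 0 q by rewrite t2 subrK.
  have [/hder_val da1 /hder_val da2] := hder_par q; rewrite -/p -/(D1 q) in da1; rewrite -/p -/(D2 q) in da2.
  have par1 : par1E (0, q) = A1 p + A2 p * d_x eta q by rewrite /par1E surf0 /= (mul0r (d_x nu q)) addr0.
  have par2 : par2E (0, q) = A3 p + A2 p * d_z eta q by rewrite /par2E surf0 /= (mul0r (d_z nu q)) addr0.
  have [[CA2 _ _] [Cm1 _ _] [Cm2 _ _] [Cm3 _ _]] :=
    And4 (qreg_slice d00 rA2.1) (qreg_slice d00 m1) (qreg_slice d00 m2) (qreg_slice d00 m3).
  have [[Cn _ _] [Cx _ _] [Cz _ _]] := And3 pn pex pez.
  have exz : d_z (d_x eta) q = d_x (d_z eta) q.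
    have [Ce _ _] := pe; exact: (derive_comm openT Ce Cx Cz (fun _ _ => erefl) (fun _ _ => erefl) I).
  have hs1 (f : P3 -> R) : C1 setT f ->
      hder q ((1, 0) : P) (fun q => f (surf eta q)) (D_x f (surf eta q) + d_x eta q * D_y f (surf eta q)).
    by move=> Cf; apply: (hder_conv (hder_surf be q _ Cf)); rewrite /= mul1r mul0r addr0.
  have hs2 (f : P3 -> R) : C1 setT f ->
      hder q ((0, 1) : P) (fun q => f (surf eta q)) (D_z f (surf eta q) + d_z eta q * D_y f (surf eta q)).
    by move=> Cf; apply: (hder_conv (hder_surf be q _ Cf)); rewrite /= mul1r mul0r add0r addrC.
  have dg1E : d_x g1 q = d_x nu q * A2 p * - (M3 p + M2 p * d_z eta q)
      + nu q * ((dX A2 p + d_x eta q * dY A2 p) * - (M3 p + M2 p * d_z eta q)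
        - A2 p * (dX M3 p + d_x eta q * dY M3 p + ((dX M2 p + d_x eta q * dY M2 p) * d_z eta q
             + M2 p * d_x (d_z eta) q))).
    have a2 := hs1 _ CA2; have b3 := hs1 _ Cm3; have b2 := hs1 _ Cm2.
    rewrite D_x_slice D_y_slice -/p in a2; rewrite D_x_slice D_y_slice -/p in b3.
    rewrite D_x_slice D_y_slice -/p in b2.
    have n1 := hder_C1 ((1, 0) : P) Cn (I : setT q); have z1 := hder_C1 ((1, 0) : P) Cz (I : setT q).
    apply: hder_val; apply: (hder_conv (hderM n1 (hderM a2 (hderN (hderD b3 (hderM b2 z1)))))).
    rewrite -!/(d_x _ _) -/p -!/M3 -!/M2.
    move: (M3 p) (M2 p) (dX M3 p) (dX M2 p) (dY M3 p) (dY M2 p) => *; ring.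
  have dg2E : d_z g2 q = d_z nu q * A2 p * (M1 p + M2 p * d_x eta q)
      + nu q * ((dZ A2 p + d_z eta q * dY A2 p) * (M1 p + M2 p * d_x eta q)
        + A2 p * (dZ M1 p + d_z eta q * dY M1 p + ((dZ M2 p + d_z eta q * dY M2 p) * d_x eta q
             + M2 p * d_x (d_z eta) q))).
    have a2 := hs2 _ CA2; have b3 := hs2 _ Cm1; have b2 := hs2 _ Cm2.
    rewrite D_z_slice D_y_slice -/p in a2; rewrite D_z_slice D_y_slice -/p in b3.
    rewrite D_z_slice D_y_slice -/p in b2.
    have n1 := hder_C1 ((0, 1) : P) Cn (I : setT q); have z1 := hder_C1 ((0, 1) : P) Cx (I : setT q).
    apply: hder_val; apply: (hder_conv (hderM n1 (hderM a2 (hderD b3 (hderM b2 z1))))).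
    rewrite -!/(d_z _ _) -/p -!/M1 -!/M2 exz.
    move: (M1 p) (M2 p) (dZ M1 p) (dZ M2 p) (dY M1 p) (dY M2 p) => *; ring.
  have ax (a b c e k : R) : a - b = alpha * k -> a - 2^-1 * alpha * c - (b - 2^-1 * alpha * e)
      = alpha * k - 2^-1 * alpha * (c - e) by move=> <-; ring.
  have ax' (k : R) : alpha * k - 2^-1 * alpha * k = 2^-1 * alpha * k by field.
  have e1 : dY M3 p - dZ M2 p = 2^-1 * alpha * V1 p.
    rewrite /dY /dZ (derive_defect _ _ v3 rA3 pd) (derive_defect _ _ v2 rA2 pd).
    by apply: (eq_trans _ (ax' _)); exact: ax B1.
  have e2 : dZ M1 p - dX M3 p = 2^-1 * alpha * V2 p.
    rewrite /dX /dZ (derive_defect _ _ v3 rA3 pd) (derive_defect _ _ v1 rA1 pd).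
    by apply: (eq_trans _ (ax' _)); exact: ax B2.
  have e3 : dX M2 p - dY M1 p = 2^-1 * alpha * V3 p.
    rewrite /dX /dY (derive_defect _ _ v2 rA2 pd) (derive_defect _ _ v1 rA1 pd).
    by apply: (eq_trans _ (ax' _)); exact: ax B3.
  have J := @variation_identity R alpha (nu q) (d_x nu q) (d_z nu q) (d_x eta q) (d_z eta q)
    (d_x (d_z eta) q) (A1 p) (A2 p) (A3 p) (dE A1 p) (dE A2 p) (dE A3 p) (dX A2 p) (dY A1 p)
    (dY A2 p) (dY A3 p) (dZ A2 p) (V2 p) (E1 0 q) (E2 0 q) (G1 q) (G2 q) (dX M2 p) (dX M3 p)
    (dY M1 p) (dY M2 p) (dY M3 p) (dZ M1 p) (dZ M2 p) e1 e2 e3.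
  rewrite DS0 /iL /iQ da1 da2 F1E F2E par1 par2 dg1E dg2E -/p.
  have fin (t u v w x y : R) : x - v + w = t + y -> u = 2^-1 * x -> t = 2 * u - v + w - y.
    by move=> E' ->; rewrite mulrA divff ?mul1r ?E' ?addrK.
  exact: (fin _ _ _ _ _ _ J).
rewrite H (pint_sub (pintD (pintB pDS2 pIL) pcQ) pdiv) (pint_add (pintB pDS2 pIL) pcQ).
by rewrite (pint_sub pDS2 pIL) (pint_scale _ pDS) (pint_scale _ pIQ) div0.
Qed.

End Variation.

(** * The trivial flow and capillarity *)

Section Composition1.
Context {R : realType} {V : normedModType R}.
Variables (phi dphi : R -> R) (J : set R) (U : set V) (oU : open U) (g : V -> R).
Hypotheses (phiE : forall y, J y -> is_derive y (1 : R) phi (dphi y))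
  (cphi : forall y, J y -> {for y, continuous dphi})
  (gJ : forall p, U p -> J (g p)) (Cg : C1 U g).

Lemma hder_comp1 p v : U p -> hder p v (fun p => phi (g p)) (dphi (g p) * 'D_v g p).
Proof.
move=> Up; have dg := C1_differentiable Cg Up.
have ph := phiE (gJ Up).
have dph : differentiable phi (g p) by apply/derivable1_diffP; case: ph.
split; first by apply: diff_derivable; exact: differentiable_comp.
rewrite deriveE; last exact: differentiable_comp.
rewrite diff_comp//= -(deriveE v dg) -(deriveE _ dph).
transitivity ('D_('D_v g p *: (1 : R)) phi (g p)); first by rewrite [_ *: _]mulr1.
rewrite deriveZv// mulrC.
by case: ph => _ ->.
Qed.

Lemma C1_comp1 : C1 U (fun p => phi (g p)).
Proof.
apply: (C1_intro oU) => [p Up|v].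
  apply: (@differentiable_comp _ _ _ _ g phi); first exact: C1_differentiable Cg Up.
  by apply/derivable1_diffP; have [] := phiE (gJ Up).
exists (fun p => dphi (g p) * 'D_v g p) => p Up; split; first exact: hder_val (hder_comp1 _ Up).
apply: cvgM; last exact: (C1_derive_continuous _ Cg).
by apply: (@continuous_comp _ _ _ g dphi); [exact: C1_continuous Cg Up|exact/cphi/gJ].
Qed.

Variables (D : set V) (DU : D `<=` U) (hor : V -> R * R) (M : R).

Lemma breg_comp1 : (forall p, D p -> `|phi (g p)| <= M) -> (forall p, D p -> `|dphi (g p)| <= M) ->
  (forall v, bnd D ('D_v g)) -> breg U D (fun p => phi (g p)).
Proof.
move=> b1 b2 b3; split; [exact: C1_comp1|by exists M|move=> v].
apply: (@bnd_eq _ _ _ _ (fun p => dphi (g p) * 'D_v g p)).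
  by move=> p Dp; exact: hder_val (hder_comp1 _ (DU Dp)).
by apply: bndM => //; exists M.
Qed.

Lemma reg_comp1 a : (forall p, D p -> `|phi (g p)| <= M * `|g p|) ->
  (forall p, D p -> `|dphi (g p)| <= M) ->
  reg hor U D a g -> reg hor U D a (fun p => phi (g p)).
Proof.
move=> b1 b2 [_ dg Dg]; split; [exact: C1_comp1| |move=> v].
  apply: (@decays_le _ _ _ _ _ _ (fun p => M * g p)).
    move=> p Dp; rewrite normrM; apply: (le_trans (b1 p Dp)).
    by rewrite ler_wpM2r// ler_norm.
  by apply: bndM_decays => //; exact: bnd_cst.
apply: (@decays_eq _ _ _ _ _ _ (fun p => dphi (g p) * 'D_v g p)).
  by move=> p Dp; exact: hder_val (hder_comp1 _ (DU Dp)).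
by apply: bndM_decays => //; exists M.
Qed.

(** A function with a quadratic zero turns the decay class 1/2 into the integrable class 1; a
    first-order bound on the derivative is what keeps the derivatives in that class. *)
Lemma reg_comp1_quadratic : (forall p, D p -> `|phi (g p)| <= M * `|g p| ^+ 2) ->
  (forall p, D p -> `|dphi (g p)| <= M * `|g p|) ->
  reg hor U D 2^-1 g -> reg hor U D 1 (fun p => phi (g p)).
Proof.
move=> b1 b2 [_ dg Dg]; split; [exact: C1_comp1| |move=> v].
  apply: (@decays_le _ _ _ _ _ _ (fun p => M * (g p * g p))).
    move=> p Dp; rewrite !normrM -expr2; apply: (le_trans (b1 p Dp)).
    by rewrite ler_wpM2r ?sqr_ge0// ler_norm.
  by apply: bndM_decays; [exact: bnd_cst|exact: decays_half2].
apply: (@decays_eq _ _ _ _ _ _ (fun p => dphi (g p) * 'D_v g p)).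
  by move=> p Dp; exact: hder_val (hder_comp1 _ (DU Dp)).
apply: (@decays_le _ _ _ _ _ _ (fun p => M * (g p * 'D_v g p))).
  move=> p Dp; rewrite !normrM mulrA ler_wpM2r//; apply: (le_trans (b2 p Dp)).
  by rewrite ler_wpM2r// ler_norm.
by apply: bndM_decays; [exact: bnd_cst|exact: decays_half2].
Qed.

End Composition1.

Section Trigonometry.
Context {R : realType}.
Implicit Types (alpha x y : R).

Lemma is_derive_cosZ alpha y : is_derive y (1 : R) (fun y => cos (alpha * y)) (- (alpha * sin (alpha * y))).
Proof. by rewrite -mulrN; apply: is_derive_rescale => t; exact: is_derive_cos. Qed.

Lemma is_derive_sinZ alpha y : is_derive y (1 : R) (fun y => sin (alpha * y)) (alpha * cos (alpha * y)).
Proof. by apply: is_derive_rescale => t; exact: is_derive_sin. Qed.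

Lemma cosB1_le x : `|cos x - 1| <= `|x|.
Proof.
have := @lipschitz_of_derive R cos (fun x => - sin x) 1 0 x (@is_derive_cos R).
by rewrite cos0 subr0 mul1r; apply => y; rewrite normrN sin_max.
Qed.

Lemma sinBx_le x : `|sin x - x| <= `|x| ^+ 2.
Proof.
wlog x0 : x / 0 <= x.
  move=> H; have [/H//|/ltW x0] := leP 0 x.
  by have := H (- x); rewrite oppr_ge0 sinN -opprD !normrN; apply.
have d t : 0 <= t <= x -> is_derive t (1 : R) (fun t => sin t - t) (cos t - 1).
  move=> _; exact: is_deriveB (is_derive_sin t) (is_derive_id _ _).
have [c /andP[c0 cx]] := mean_value x0 d.
rewrite sin0 !subr0 => ->; rewrite normrM expr2 ler_wpM2r//.
by apply: (le_trans (cosB1_le c)); rewrite !ger0_norm// (le_trans c0).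
Qed.

End Trigonometry.

(** * The trivial flow on a moving surface *)

Section StarField.
Context {R : realType}.
Notation P := (R * R)%type.
Notation preg f := (reg idfun (@setT P) (@setT P) 2^-1 f).
Variables (alpha c1 c3 : R) (d : R) (eta nu : P -> R).
Hypotheses (alpha0 : alpha != 0) (d0 : 0 < d).
Hypotheses (seta : surface_admissible eta) (snu : surface_admissible nu).

(** The horizontal components of Astar as functions of the height; the vertical one being zero, they
    are also its tangential traces. With [ustar1] and [ustar3] for ustar, the relation curl Astar =
    ustar reads star1' = - ustar3 and star3' = ustar1. *)
Definition star1 y := c1 / alpha * (cos (alpha * y) - 1) - c3 / alpha * sin (alpha * y).
Definition star3 y := c1 / alpha * sin (alpha * y) + c3 / alpha * (cos (alpha * y) - 1).
Definition ustar1 y := c1 * cos (alpha * y) - c3 * sin (alpha * y).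
Definition ustar3 y := c1 * sin (alpha * y) + c3 * cos (alpha * y).

Lemma hder_cosZ y : hder y (1 : R) (fun y => cos (alpha * y)) (- (alpha * sin (alpha * y))).
Proof. by apply: hder_is; exact: is_derive_cosZ. Qed.

Lemma hder_sinZ y : hder y (1 : R) (fun y => sin (alpha * y)) (alpha * cos (alpha * y)).
Proof. by apply: hder_is; exact: is_derive_sinZ. Qed.

Lemma is_derive_star1 y : is_derive y (1 : R) star1 (- ustar3 y).
Proof.
have h1 := hder_cosZ y; have h2 := hder_sinZ y.
by apply: hderE; rewrite /star1 /ustar3; derive_by; field.
Qed.

Lemma is_derive_star3 y : is_derive y (1 : R) star3 (ustar1 y).
Proof.
have h1 := hder_cosZ y; have h2 := hder_sinZ y.
by apply: hderE; rewrite /star3 /ustar1; derive_by; field.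
Qed.

Lemma cosZ_continuous : continuous (fun y : R => cos (alpha * y)).
Proof. by apply: is_derive_continuous => y; exact: is_derive_cosZ. Qed.

Lemma sinZ_continuous : continuous (fun y : R => sin (alpha * y)).
Proof. by apply: is_derive_continuous => y; exact: is_derive_sinZ. Qed.

Lemma ustar1_continuous : continuous ustar1.
Proof.
by move=> y; apply: cvgB; apply: cvgM; try exact: cvg_cst; [exact: cosZ_continuous|exact: sinZ_continuous].
Qed.

Lemma ustar3_continuous : continuous ustar3.
Proof.
by move=> y; apply: cvgD; apply: cvgM; try exact: cvg_cst; [exact: sinZ_continuous|exact: cosZ_continuous].
Qed.

Let M := `|c1| + `|c3|.

Lemma ustar1_le y : `|ustar1 y| <= M.
Proof.
apply: (le_trans (ler_normB _ _)); rewrite !normrM.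
by apply: lerD; rewrite ler_piMr ?cos_max ?sin_max.
Qed.

Lemma ustar3_le y : `|ustar3 y| <= M.
Proof.
apply: (le_trans (ler_normD _ _)); rewrite !normrM.
by apply: lerD; rewrite ler_piMr ?cos_max ?sin_max.
Qed.

(** Astar is normalised to vanish at y = 0, and its derivative is bounded by |c1| + |c3|. This
    linear bound is what makes its trace on the surface decay with eta. *)
Lemma star1_le y : `|star1 y| <= M * `|y|.
Proof.
have := @lipschitz_of_derive R star1 (fun y => - ustar3 y) M 0 y is_derive_star1.
rewrite {2}/star1 !mulr0 cos0 sin0 subrr !mulr0 !subr0; apply => t.
by rewrite normrN ustar3_le.
Qed.

Lemma star3_le y : `|star3 y| <= M * `|y|.
Proof.
have := @lipschitz_of_derive R star3 ustar1 M 0 y is_derive_star3.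
rewrite {2}/star3 !mulr0 cos0 sin0 subrr !mulr0 !addr0 !subr0; apply => t.
exact: ustar1_le.
Qed.

Section Compose.
Context {V : normedModType R} (hor : V -> P) (U D : set V) (oU : open U) (DU : D `<=` U) (g : V -> R).
Hypothesis rg : reg hor U D 2^-1 g.
Let Cg : C1 U g. Proof. by case: rg. Qed.

Lemma reg_star1 : reg hor U D 2^-1 (fun p => star1 (g p)).
Proof.
apply: (@reg_comp1 _ _ star1 (fun y => - ustar3 y) setT U oU g _ _ _ Cg D DU hor M) => //.
- by move=> y _; exact: is_derive_star1.
- by move=> y _; apply: cvgN; exact: ustar3_continuous.
- by move=> p _; exact: star1_le.
- by move=> p _; rewrite normrN; exact: ustar3_le.
Qed.

Lemma reg_star3 : reg hor U D 2^-1 (fun p => star3 (g p)).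
Proof.
apply: (@reg_comp1 _ _ star3 ustar1 setT U oU g _ _ _ Cg D DU hor M) => //.
- by move=> y _; exact: is_derive_star3.
- by move=> y _; exact: ustar1_continuous.
- by move=> p _; exact: star3_le.
- by move=> p _; exact: ustar1_le.
Qed.

Lemma hder_star1 p v : U p -> hder p v (fun p => star1 (g p)) (- ustar3 (g p) * 'D_v g p).
Proof.
apply: (@hder_comp1 _ _ star1 (fun y => - ustar3 y) setT U g _ _ Cg) => // y _.
exact: is_derive_star1.
Qed.

Lemma hder_star3 p v : U p -> hder p v (fun p => star3 (g p)) (ustar1 (g p) * 'D_v g p).
Proof.
by apply: (@hder_comp1 _ _ star3 ustar1 setT U g _ _ Cg) => // y _; exact: is_derive_star3.
Qed.

Variable kappa : R.
(** With kappa = |c|^2 / (2 alpha) this is the trigonometric term of [Gamma]. Subtracting the linear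
    part of the sine makes it O(y^2), hence integrable along a decaying surface. *)
Definition sink y := kappa * (sin (alpha * y) - alpha * y).

Lemma is_derive_sink y : is_derive y (1 : R) sink (kappa * alpha * (cos (alpha * y) - 1)).
Proof.
have h2 := hder_sinZ y.
have h3 : hder y (1 : R) (fun y : R => alpha * y) alpha by apply: hder_is; exact: is_derive_mulc.
apply: hderE; apply: (hder_conv (hderM (hder_cst kappa _ _) (hderD h2 (hderN h3)))); ring.
Qed.

Let K := `|kappa| * `|alpha| ^+ 2.

Lemma reg_sink : reg hor U D 1 (fun p => sink (g p)).
Proof.
apply: (@reg_comp1_quadratic _ _ sink (fun y => kappa * alpha * (cos (alpha * y) - 1)) setT U oU g _ _ _
  Cg D DU hor K) => //.
- by move=> y _; exact: is_derive_sink.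
- move=> y _; apply: cvgM; first exact: cvg_cst.
  by apply: cvgB; [exact: cosZ_continuous|exact: cvg_cst].
- move=> p _; rewrite /sink normrM /K -mulrA ler_wpM2l//.
  by rewrite -exprMn -normrM; exact: sinBx_le.
- move=> p _; have := cosB1_le (alpha * g p); rewrite /K !normrM expr2.
  move=> H; rewrite -!mulrA; do 2! apply: ler_wpM2l => //.
Qed.

Lemma hder_sink p v : U p ->
  hder p v (fun p => sink (g p)) (kappa * alpha * (cos (alpha * g p) - 1) * 'D_v g p).
Proof.
apply: (@hder_comp1 _ _ sink (fun y => kappa * alpha * (cos (alpha * y) - 1)) setT U g _ _ Cg) => // y _.
exact: is_derive_sink.
Qed.

End Compose.

(* The variation of the trigonometric term of [Gamma] cancels a part of the variation of its
   nonlocal term. *)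
Lemma star_cancel y : alpha * (ustar1 y * star1 y + ustar3 y * star3 y) =
  (c1 ^+ 2 + c3 ^+ 2) * (1 - cos (alpha * y)).
Proof.
have := cos2Dsin2 (alpha * y); rewrite /ustar1 /star1 /ustar3 /star3.
move: (cos _) (sin _) => c s cs.
rewrite (_ : alpha * _ = (c1 ^+ 2 + c3 ^+ 2) * (c ^+ 2 + s ^+ 2 - c)); last by field.
by rewrite cs.
Qed.

End StarField.

(** * Surface tension *)

Section Capillarity.
Context {R : realType}.

(** The reciprocal of the square root of 1 + y, at y = |grad eta|^2. The factor 1 in front of y
    matches [is_derive_scaled_powR] at c = 1. *)
Definition invslope (y : R) : R := (1 + 1 * y) `^ (- 2^-1).
Definition dinvslope (y : R) : R := 1 * (- 2^-1 * (1 + 1 * y) `^ (- 2^-1 - 1)).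

Lemma is_derive_invslope (y : R) : 0 <= y -> is_derive y (1 : R) invslope (dinvslope y).
Proof. by move=> y0; exact: is_derive_scaled_powR. Qed.

Lemma continuous_scaled_powR (b y : R) : 0 <= y -> {for y, continuous (fun y : R => (1 + 1 * y) `^ b)}.
Proof.
move=> y0; apply: differentiable_continuous; apply/derivable1_diffP.
by have [] := @is_derive_scaled_powR R b 1 y ler01 y0.
Qed.

Lemma powR_le1 (b y : R) : b <= 0 -> 0 <= y -> `|(1 + 1 * y) `^ b| <= 1.
Proof.
move=> b0 y0; rewrite ger0_norm ?powR_ge0// -[leRHS](powRr0 (1 + 1 * y)) ler_powR//.
by rewrite mul1r lerDl.
Qed.

Lemma invslope_le y : 0 <= y -> `|invslope y| <= 1.
Proof. by apply: powR_le1; rewrite oppr_le0. Qed.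

Lemma dinvslope_le y : 0 <= y -> `|dinvslope y| <= 1.
Proof.
move=> y0; rewrite /dinvslope mul1r normrM -[leRHS]mulr1; apply: ler_pM => //.
  by rewrite normrN ger0_norm//; lra.
by apply: powR_le1 => //; lra.
Qed.

Lemma dinvslope_continuous (y : R) : 0 <= y -> {for y, continuous dinvslope}.
Proof.
move=> y0; apply: cvgM; first exact: cvg_cst.
by apply: cvgM; [exact: cvg_cst|exact: continuous_scaled_powR].
Qed.

Variable sigma : R.
Definition tension (y : R) : R := sigma * ((1 + 1 * y) `^ (2^-1) - 1).

Lemma is_derive_tension (y : R) : 0 <= y -> is_derive y (1 : R) tension (2^-1 * sigma * invslope y).
Proof.
move=> y0; have := @is_derive_scaled_powR R 2^-1 1 y ler01 y0.
have -> : 2^-1 - 1 = - 2^-1 :> R by field.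
move=> /hder_is h1; apply: hderE.
apply: (hder_conv (hderM (hder_cst sigma _ _) (hderD h1 (hderN (hder_cst 1 _ _))))).
rewrite /invslope; ring.
Qed.

Lemma tensionE y : 0 <= y -> tension y = sigma * (Num.sqrt (1 + y) - 1).
Proof. by move=> y0; rewrite /tension mul1r powR12_sqrt// addr_ge0. Qed.

Lemma invslopeE y : 0 <= y -> invslope y = (Num.sqrt (1 + y))^-1.
Proof. by move=> y0; rewrite /invslope mul1r powRN powR12_sqrt// addr_ge0. Qed.

Lemma tension_le y : 0 <= y -> `|tension y| <= `|sigma| * `|y|.
Proof.
move=> y0; rewrite tensionE// normrM ler_wpM2l//.
have s1 : 1 <= Num.sqrt (1 + y) by rewrite -[leLHS]sqrtr1 ler_wsqrtr// lerDl.
have s2 : Num.sqrt (1 + y) ^+ 2 = 1 + y by rewrite sqr_sqrtr// addr_ge0.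
rewrite !ger0_norm ?subr_ge0//; nra.
Qed.

Section Compose.
Context {V : normedModType R} (hor : V -> R * R) (U D : set V) (oU : open U) (DU : D `<=` U) (g : V -> R).
Hypotheses (rg : reg hor U D 1 g) (g0 : forall p, U p -> 0 <= g p).
Let Cg : C1 U g. Proof. by case: rg. Qed.

Lemma reg_tension : reg hor U D 1 (fun p => tension (g p)).
Proof.
apply: (@reg_comp1 _ _ tension (fun y => 2^-1 * sigma * invslope y) [set y | 0 <= y] U oU g _ _ _
  Cg D DU hor `|sigma|) => //.
- by move=> y; exact: is_derive_tension.
- by move=> y y0; apply: cvgM; [exact: cvg_cst|exact: continuous_scaled_powR].
- by move=> p /DU /g0; exact: tension_le.
- move=> p /DU /g0 gp; rewrite normrM -[leRHS]mulr1; apply: ler_pM => //; last exact: invslope_le.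
  by rewrite normrM ger0_norm// ler_piMl//; lra.
Qed.

Lemma hder_tension p v : U p ->
  hder p v (fun p => tension (g p)) (2^-1 * sigma * invslope (g p) * 'D_v g p).
Proof.
apply: (@hder_comp1 _ _ tension (fun y => 2^-1 * sigma * invslope y) [set y | 0 <= y] U g _ _ Cg) => //.
by move=> y; exact: is_derive_tension.
Qed.

Lemma breg_invslope : breg U D (fun p => invslope (g p)).
Proof.
apply: (@breg_comp1 _ _ invslope dinvslope [set y | 0 <= y] U oU g _ _ _ Cg D DU 1) => //.
- by move=> y; exact: is_derive_invslope.
- by move=> y; exact: dinvslope_continuous.
- by move=> p /DU /g0; exact: invslope_le.
- by move=> p /DU /g0; exact: dinvslope_le.
- by have [_ _ Dg] := rg; move=> v; apply: decays_bnd (Dg v); exact: ler01.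
Qed.

End Compose.
End Capillarity.

(** * Derivative of the part of the functional that involves the trivial flow and the potential
    energies *)

Section StarVariation.
Context {R : realType}.
Notation P := (R * R)%type.
Notation preg f := (reg idfun (@setT P) (@setT P) 2^-1 f).
Variables (alpha c1 c3 g sigma d : R) (eta nu F1 F2 G1 G2 : P -> R) (E1 E2 : R -> P -> R).

Definition heightE (p : R * P) := vary eta nu p.1 p.2.
Definition steepE (p : R * P) := (d_x eta p.2 + p.1 * d_x nu p.2) * (d_x eta p.2 + p.1 * d_x nu p.2)
  + (d_z eta p.2 + p.1 * d_z nu p.2) * (d_z eta p.2 + p.1 * d_z nu p.2).
Definition steep q := d_x eta q * d_x eta q + d_z eta q * d_z eta q.

Let b1 p := star1 alpha c1 c3 (heightE p).
Let b3 p := star3 alpha c1 c3 (heightE p).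
Let kappa := (c1 ^+ 2 + c3 ^+ 2) / (2 * alpha).

Hypotheses (alpha0 : alpha != 0) (d0 : 0 < d)
  (seta : surface_admissible eta) (snu : surface_admissible nu)
  (rF1 : preg F1) (rF2 : preg F2) (rG1 : preg G1) (rG2 : preg G2)
  (hE : forall e, `|e| < d -> hodge (fun q => b1 (e, q)) (fun q => b3 (e, q)) (E1 e) (E2 e)).

Let os := @open_strip R P d.
Let ss := @subset_refl _ (@strip R P d).
Let d00 : `|0 : R| < d. Proof. by rewrite normr0. Qed.

Lemma reg_height : reg snd (strip d) (strip d) 2^-1 heightE.
Proof.
have [e0 _ _] := seta; have [n0 _ _] := snu; have bt := @breg_time R d P.
have r1 := reg_snd d e0; have r2 := reg_snd d n0.
by rewrite /heightE /vary; regular os ss.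
Qed.

Lemma reg_steep : reg snd (strip d) (strip d) 1 steepE.
Proof.
have [_ e1 e2] := seta; have [_ n1 n2] := snu; have bt := @breg_time R d P.
have r1 := reg_snd d e1; have r2 := reg_snd d n1.
have r3 := reg_snd d e2; have r4 := reg_snd d n2.
by rewrite /steepE; regular os ss.
Qed.

Lemma steepE_ge0 p : 0 <= steepE p.
Proof. by apply: addr_ge0; rewrite -expr2 sqr_ge0. Qed.

Lemma steep_ge0 q : 0 <= steep q.
Proof. by apply: addr_ge0; rewrite -expr2 sqr_ge0. Qed.

(** The coupling - grad Phi . (Astar_par)^perp along the line, where (F1, F2) is grad Phi and (G1,
    G2) its variation. *)
Definition starE p := (F1 p.2 + p.1 * G1 p.2) * b3 p - (F2 p.2 + p.1 * G2 p.2) * b1 p.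
Definition potentialE p := sink alpha kappa (heightE p)
  + 2^-1 * g * (heightE p * heightE p) + tension sigma (steepE p).

Lemma reg_starE : reg snd (strip d) (strip d) 1 starE.
Proof.
have r1 := reg_star1 c1 c3 alpha0 os ss reg_height.
have r3 := reg_star3 c1 c3 alpha0 os ss reg_height.
have f1 := reg_snd d rF1; have f2 := reg_snd d rF2.
have g1 := reg_snd d rG1; have g2 := reg_snd d rG2.
have bt := @breg_time R d P.
by rewrite /starE /b1 /b3; regular os ss.
Qed.

Lemma reg_potentialE : reg snd (strip d) (strip d) 1 potentialE.
Proof.
have r1 := reg_sink alpha os ss reg_height kappa; have r2 := reg_height.
have r3 := reg_tension sigma os ss reg_steep (fun p _ => steepE_ge0 p).
by rewrite /potentialE; regular os ss.
Qed.

Let cap1 q := sigma * (d_x eta q * invslope (steep q)).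
Let cap2 q := sigma * (d_z eta q * invslope (steep q)).

Lemma reg_capillary : preg cap1 /\ preg cap2.
Proof.
have [_ e1 e2] := seta; have T := @subset_refl _ [set: P].
have rs : reg idfun setT setT 1 steep by rewrite /steep; regular (@openT P) T.
have bi := breg_invslope openT T rs (fun p _ => steep_ge0 p).
by split; rewrite /cap1 /cap2; regular (@openT P) T.
Qed.

Lemma hder_heightE q : hder ((0, q) : R * P) (1, 0) heightE (nu q).
Proof.
have [[Ce _ _] _ _] := seta; have [[Cn _ _] _ _] := snu.
have k1 := hder_snd (0, q) (1, 0) Ce; have k2 := hder_snd (0, q) (1, 0) Cn.
have kt := hder_time ((0, q) : R * P) (1, 0).
apply: (hder_conv (hderD k1 (hderM kt k2))).
have aux (u v w : R) : u = 0 -> v = 0 -> u + (0 * v + w * 1) = w by move=> -> ->; ring.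
by apply: aux; exact: derive0.
Qed.

Lemma hder_steepE q : hder ((0, q) : R * P) (1, 0) steepE
  (2 * (d_x eta q * d_x nu q + d_z eta q * d_z nu q)).
Proof.
have [_ [Ce1 _ _] [Ce2 _ _]] := seta; have [_ [Cn1 _ _] [Cn2 _ _]] := snu.
have k1 := hder_snd (0, q) (1, 0) Ce1; have k2 := hder_snd (0, q) (1, 0) Cn1.
have k3 := hder_snd (0, q) (1, 0) Ce2; have k4 := hder_snd (0, q) (1, 0) Cn2.
have kt := hder_time ((0, q) : R * P) (1, 0).
have h1 := hderD k1 (hderM kt k2); have h3 := hderD k3 (hderM kt k4).
apply: (hder_conv (hderD (hderM h1 h1) (hderM h3 h3))).
have aux (u v w u' v' w' a b : R) : u = 0 -> v = 0 -> u' = 0 -> v' = 0 ->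
  (a + 0 * w) * (u + (0 * v + w * 1)) + (a + 0 * w) * (u + (0 * v + w * 1))
  + ((b + 0 * w') * (u' + (0 * v' + w' * 1)) + (b + 0 * w') * (u' + (0 * v' + w' * 1)))
  = 2 * (a * w + b * w') by move=> -> -> -> ->; ring.
by apply: aux; exact: derive0.
Qed.

Let height0 q : heightE (0, q) = eta q.
Proof. by rewrite /heightE /= vary0. Qed.

Let steep0 q : steepE (0, q) = steep q.
Proof.
have aux (a b c e : R) : (a + 0 * b) * (a + 0 * b) + (c + 0 * e) * (c + 0 * e) = a * a + c * c.
  by rewrite !mul0r !addr0.
exact: aux.
Qed.

(** The trivial flow depends on e only through the height, so its e-derivatives are explicit
    multiples of nu. The response of the gradient part, which is not explicit, is handled by
    [is_derive_hodge]. *)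
Lemma is_derive_star_variation :
  is_derive (0 : R) (1 : R) (fun e => \int[@area R]_q (starE (e, q) + potentialE (e, q))
      - 2^-1 * alpha * \int[@area R]_q (E1 e q * b1 (e, q) + E2 e q * b3 (e, q)))
    (\int[@area R]_q (G1 q * star3 alpha c1 c3 (eta q) - G2 q * star1 alpha c1 c3 (eta q)
      + nu q * (F1 q * ustar1 alpha c1 c3 (eta q) + F2 q * ustar3 alpha c1 c3 (eta q)
        - alpha * (E2 0 q * ustar1 alpha c1 c3 (eta q) - E1 0 q * ustar3 alpha c1 c3 (eta q))
        + g * eta q - (d_x cap1 q + d_z cap2 q)))).
Proof.
have r1 : reg snd (strip d) (strip d) 2^-1 b1 := reg_star1 c1 c3 alpha0 os ss reg_height.
have r3 : reg snd (strip d) (strip d) 2^-1 b3 := reg_star3 c1 c3 alpha0 os ss reg_height.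
have DQ := is_derive_hodge d0 r1 r3 hE.
have rS := regD os ss reg_starE reg_potentialE.
have DS := is_derive_area d0 rS.
have D := is_deriveB DS (is_deriveZ (2^-1 * alpha) DQ).
set T := (X in is_derive _ _ _ X).
suff TE : T = \int[@area R]_q 'D_(1, 0) (fun p => starE p + potentialE p) (0, q)
   - 2^-1 * alpha * \int[@area R]_q
    (2 * (E1 0 q * 'D_(1, 0) b1 (0, q) + E2 0 q * 'D_(1, 0) b3 (0, q))
       - ('D_(1, 0) b3 (0, q) * b1 (0, q) - 'D_(1, 0) b1 (0, q) * b3 (0, q))).
  by rewrite TE; exact: D.
have pS := pint_time_derive d0 rS; have pQ := pint_hodge_derive d0 r1 r3 (hE d00).
have pcQ := pintZ (2^-1 * alpha) pQ.
have [rc1 rc2] := reg_capillary; have [rn _ _] := snu.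
have T2 := @subset_refl _ [set: P].
(* The derivative of the tension contains grad nu. Subtracting the divergence of nu times the
   capillary vector, whose integral is zero, moves the differentiation onto that vector. *)
have rg1 := reg_half2 openT T2 rn rc1; have rg2 := reg_half2 openT T2 rn rc2.
set g1 := fun q => nu q * cap1 q in rg1; set g2 := fun q => nu q * cap2 q in rg2.
have [pdiv div0] := reg_divergence rg1 rg2.
apply/esym; rewrite -[LHS]subr0 -[X in _ - X]div0 -(pint_scale _ pQ) -(pint_sub pS pcQ).
rewrite -(pint_sub (pintB pS pcQ) pdiv); apply: eq_pint => q.
have qd : `|((0, q) : R * P).1| < d by [].
have hh := hder_val (hder_heightE q).
have kb1 : hder ((0, q) : R * P) (1, 0) b1 (- ustar3 alpha c1 c3 (eta q) * nu q).
  apply: (hder_conv (hder_star1 c1 c3 alpha0 reg_height (1, 0) qd)); by rewrite hh height0.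
have kb3 : hder ((0, q) : R * P) (1, 0) b3 (ustar1 alpha c1 c3 (eta q) * nu q).
  apply: (hder_conv (hder_star3 c1 c3 alpha0 reg_height (1, 0) qd)); by rewrite hh height0.
have ks : hder ((0, q) : R * P) (1, 0) (fun p => sink alpha kappa (heightE p))
    (kappa * alpha * (cos (alpha * eta q) - 1) * nu q).
  apply: (hder_conv (hder_sink alpha reg_height kappa (1, 0) qd)); by rewrite hh height0.
have kt2 : hder ((0, q) : R * P) (1, 0) (fun p => tension sigma (steepE p))
    (2^-1 * sigma * invslope (steep q) * (2 * (d_x eta q * d_x nu q + d_z eta q * d_z nu q))).
  apply: (hder_conv (hder_tension sigma reg_steep (fun p _ => steepE_ge0 p) (1, 0) qd)).
  by rewrite (hder_val (hder_steepE q)) steep0.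
have E0 : b1 (0, q) = star1 alpha c1 c3 (eta q) by rewrite /b1 height0.
have E0' : b3 (0, q) = star3 alpha c1 c3 (eta q) by rewrite /b3 height0.
have DSq : 'D_(1, 0) (fun p => starE p + potentialE p) (0, q) =
    F1 q * (ustar1 alpha c1 c3 (eta q) * nu q) + G1 q * star3 alpha c1 c3 (eta q)
    + F2 q * (ustar3 alpha c1 c3 (eta q) * nu q) - G2 q * star1 alpha c1 c3 (eta q)
    + (kappa * alpha * (cos (alpha * eta q) - 1) * nu q + g * eta q * nu q
       + sigma * invslope (steep q) * (d_x eta q * d_x nu q + d_z eta q * d_z nu q)).
  have [[CF1 _ _] [CF2 _ _] [CG1 _ _] [CG2 _ _]] := And4 rF1 rF2 rG1 rG2.
  have k1 := hder_snd (0, q) (1, 0) CF1; have k2 := hder_snd (0, q) (1, 0) CF2.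
  have k3 := hder_snd (0, q) (1, 0) CG1; have k4 := hder_snd (0, q) (1, 0) CG2.
  have kt := hder_time ((0, q) : R * P) (1, 0).
  have kst : hder ((0, q) : R * P) (1, 0) starE (F1 q * (ustar1 alpha c1 c3 (eta q) * nu q)
     + G1 q * star3 alpha c1 c3 (eta q)
     + F2 q * (ustar3 alpha c1 c3 (eta q) * nu q) - G2 q * star1 alpha c1 c3 (eta q)).
    apply: (hder_conv (hderD (hderM (hderD k1 (hderM kt k3)) kb3)
      (hderN (hderM (hderD k2 (hderM kt k4)) kb1)))).
    rewrite E0 E0'.
    have aux (u v u' v' a b c e x y z w : R) : u = 0 -> v = 0 -> u' = 0 -> v' = 0 ->
      (a + 0 * c) * x + y * (u + (0 * v + c * 1)) - ((b + 0 * e) * (- z) + w * (u' + (0 * v' + e * 1)))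
      = a * x + c * y + b * z - e * w by move=> -> -> -> ->; ring.
    by rewrite mulNr; apply: aux; exact: derive0.
  have kp : hder ((0, q) : R * P) (1, 0) potentialE (kappa * alpha * (cos (alpha * eta q) - 1) * nu q
       + g * eta q * nu q
       + sigma * invslope (steep q) * (d_x eta q * d_x nu q + d_z eta q * d_z nu q)).
    have kh := hder_heightE q.
    apply: (hder_conv (hderD (hderD ks (hderM (hder_cst (2^-1 * g) _ _) (hderM kh kh))) kt2)).
    by rewrite height0; move: (invslope _) (cos _) (d_x _ _) (d_z _ _) => *; field.
  exact: hder_val (hderD kst kp).
have [[Cc1 _ _] [Cc2 _ _] [Cn _ _]] := And3 rc1 rc2 rn.
have dg1E : d_x g1 q = nu q * d_x cap1 q + cap1 q * d_x nu q.
  exact: (hder_val (hderM (hder_C1 ((1, 0) : P) Cn (I : setT q)) (hder_C1 _ Cc1 I))).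
have dg2E : d_z g2 q = nu q * d_z cap2 q + cap2 q * d_z nu q.
  exact: (hder_val (hderM (hder_C1 ((0, 1) : P) Cn (I : setT q)) (hder_C1 _ Cc2 I))).
rewrite DSq (hder_val kb1) (hder_val kb3) dg1E dg2E E0 E0' /cap1 /cap2.
have := star_cancel c1 c3 alpha0 (eta q).
move: (ustar1 _ _ _ _) (ustar3 _ _ _ _) (star1 _ _ _ _) (star3 _ _ _ _) (cos _) => u1 u3 s1 s3 c SC.
have kE : kappa * alpha = 2^-1 * (c1 ^+ 2 + c3 ^+ 2) by rewrite /kappa; field.
have SC' : kappa * alpha * (c - 1) = - (2^-1 * (alpha * (u1 * s1 + u3 * s3))) by rewrite SC kE; ring.
rewrite SC'.
move: (d_x _ _) (d_z _ _) (d_x _ _) (d_z _ _) (d_x _ _) (d_z _ _) (invslope _) => *.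
by field.
Qed.

End StarVariation.

(** * The boundary-value problem along a line *)

Section Regularity.
Context {R : realType}.
Notation P := (R * R)%type.
Notation P3 := (R * R * R)%type.

(** The components of an iterated derivative agree with the iterated derivatives of the components
    on an open set only, so differentiability has to be transferred along equality of germs. *)
Lemma near_differentiable (V : normedModType R) (f g : V -> R) p :
  (\near p, f p = g p) -> differentiable f p -> differentiable g p.
Proof.
move=> fg df; have fgp := nbhs_singleton fg.
have E : g \o shift p = cst (g p) + 'd f p +o_ 0 id.
  apply/eqaddoP => e e0; have := diff_locally df => /eqaddoP /(_ e e0) H.
  have fg' : \forall h \near nbhs (0 : V), f (h + p) = g (h + p).
    by move: fg; rewrite (near_shift 0); apply: filterS => h /=; rewrite subr0.
  apply: (@filterS _ (nbhs (0 : V)) _ _ _ _ (@filterI _ (nbhs (0 : V)) _ _ _ H fg')) => h [Hh Eh].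
  by move: Hh; rewrite !fctE /= Eh fgp.
have Ed := diff_unique (diff_continuous df) E.
by apply/diff_locallyP; rewrite Ed; split => //; exact: diff_continuous.
Qed.

Section Coordinates.
Context {V : normedModType R} (n : nat) (i : 'I_n).

Let coord : 'rV[R]_n -> R := fun M => M 0 i.
Let coord_lin : linear coord. Proof. by move=> k u v; rewrite /coord !mxE. Qed.
HB.instance Definition _ := GRing.isLinear.Build R 'rV[R]_n R _ coord coord_lin.

Lemma row_coord_le (M : 'rV[R]_n) : `|M 0 i| <= `|M|.
Proof.
rewrite [leRHS](_ : _ = mx_norm M)// mx_normE.
by rewrite -[leLHS]nngE num_le; exact: (le_bigmax _ _ (ord0, i)).
Qed.

Let coord_continuous : continuous coord.
Proof. exact: coord_continuous. Qed.

Lemma derive_coord (F : V -> 'rV[R]_n) p v : differentiable F p ->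
  differentiable (fun p => F p 0 i) p /\ 'D_v (fun p => F p 0 i) p = ('D_v F p) 0 i.
Proof.
move=> dF; have dc : differentiable coord (F p) by exact: linear_differentiable.
have dcF : differentiable (coord \o F) p by exact: differentiable_comp.
split=> //; rewrite -[LHS]/('D_v (coord \o F) p) deriveE// diff_comp//= deriveE//.
by rewrite diff_lin.
Qed.

End Coordinates.

Lemma Ck_on_C1 (V : normedModType R) (k : nat) (U : set V) (f : V -> R) (vs : seq V) :
  Ck_on k U f -> (size vs < k)%N -> C1 U (Defs.iterD vs f).
Proof.
move=> Ck sk; split=> p Up; split; first by have [_] := Ck vs (ltnW sk) p Up; exact.
by move=> v; have [] := Ck (v :: vs) sk p Up.
Qed.

Lemma Ck_on_coord (V : normedModType R) (k n : nat) (i : 'I_n) (U : set V) (F : V -> 'rV[R]_n) :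
  open U -> Ck_on k U F -> forall vs, (size vs <= k)%N -> forall p, U p ->
  Defs.iterD vs (fun p => F p 0 i) p = Defs.iterD vs F p 0 i.
Proof.
move=> oU Ck; elim=> [//|v vs IH] /= sk p Up.
rewrite (C1_derive_eq oU v (IH (ltnW sk)) Up).
by have [_ /(_ sk) dF] := Ck vs (ltnW sk) p Up; have [] := derive_coord i v dF.
Qed.

Lemma Ck_on_coord_C1 (V : normedModType R) (k n : nat) (i : 'I_n) (U : set V) (F : V -> 'rV[R]_n) (vs : seq V) :
  open U -> Ck_on k U F -> (size vs < k)%N -> C1 U (Defs.iterD vs (fun p => F p 0 i)).
Proof.
move=> oU Ck sk; apply: (C1_intro oU) => [p Up|v].
  have [_ /(_ sk) dF] := Ck vs (ltnW sk) p Up.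
  have [d1 _] := derive_coord i 0 dF.
  have E := Ck_on_coord i oU Ck (ltnW sk).
  apply: (near_differentiable _ d1).
  have : \near p, U p by exact: open_nbhs_nbhs.
  by apply: filterS => q Uq; rewrite E.
exists (fun p => Defs.iterD (v :: vs) F p 0 i) => p Up; split.
  exact: (Ck_on_coord i oU Ck (vs := v :: vs)).
have [cF _] := Ck (v :: vs) sk p Up.
apply: (@continuous_comp _ _ _ (Defs.iterD (v :: vs) F) (fun M : 'rV[R]_n => M 0 i) p cF).
exact: coord_continuous.
Qed.


Lemma decays_coord (V : normedModType R) (n : nat) (i : 'I_n) a (hor : V -> P) (U : set V)
    (F : V -> 'rV[R]_n) : decays a hor U F -> decays a hor U (fun p => F p 0 i).
Proof.
move=> [s [C [as_ FC]]]; exists s, C; split=> // p Up.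
by apply: le_trans (FC p Up); exact: row_coord_le.
Qed.

Lemma smooth_C1 (V : normedModType R) (f : V -> R) (vs : seq V) :
  smooth f -> C1 setT (Defs.iterD vs f).
Proof. by move=> sf; exact: (Ck_on_C1 (sf (size vs).+1)). Qed.

Lemma smooth_reg (f : P -> R) (vs : seq P) : smooth f ->
  (forall ws, (size vs <= size ws)%N -> decays 2^-1 idfun setT (Defs.iterD ws f)) ->
  reg idfun setT setT 2^-1 (Defs.iterD vs f).
Proof.
move=> sf df; split; [exact: smooth_C1|exact: df|move=> v].
exact: (df (v :: vs) (leqnSn _)).
Qed.

Lemma decaying_smooth_reg (f : P -> R) (vs : seq P) : decaying_smooth f ->
  reg idfun setT setT 2^-1 (Defs.iterD vs f).
Proof. by move=> [sf df]; exact: smooth_reg. Qed.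

Lemma decaying_smooth_surface (f : P -> R) : decaying_smooth f -> surface_admissible f.
Proof.
move=> sf; split; [exact: (decaying_smooth_reg [::] sf)|exact: (decaying_smooth_reg [:: (1, 0)] sf)
  |exact: (decaying_smooth_reg [:: (0, 1)] sf)].
Qed.

Lemma admissible_potential_reg (f : P -> R) : admissible_potential f ->
  reg idfun setT setT 2^-1 (d_x f) /\ reg idfun setT setT 2^-1 (d_z f).
Proof.
move=> [sf _ df].
split; [apply: (@smooth_reg f [:: (1, 0)] sf)|apply: (@smooth_reg f [:: (0, 1)] sf)] => ws s1;
  exact: df.
Qed.

Lemma decays_D_coord (V : normedModType R) (n : nat) (i : 'I_n) (U : set V) a (hor : V -> P)
    (F : V -> 'rV[R]_n) (vs : seq V) : open U -> Ck_on 2 U F -> (size vs <= 2)%N ->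
  decays a hor U (Defs.iterD vs F) -> decays a hor U (Defs.iterD vs (fun p => F p 0 i)).
Proof.
move=> oU Ck sk dF; apply: decays_eq (decays_coord i dF) => p Up.
exact: (Ck_on_coord i oU Ck sk Up).
Qed.

Lemma family_coord (d : R) (F : R * P3 -> 'rV[R]_3) (i : 'I_3) :
  Ck_on 2 [set ep : R * P3 | `|ep.1| < d] F ->
  (forall vs, (size vs <= 2)%N ->
     decays 2^-1 (fun ep => horizontal ep.2) [set ep : R * P3 | `|ep.1| < d] (Defs.iterD vs F)) ->
  qreg2 d (fun ep => F ep 0 i).
Proof.
move=> Ck dF; have os := @open_strip R P3 d.
have C (vs : seq (R * P3)) := @Ck_on_coord_C1 _ _ _ i _ F vs os Ck.
have D (vs : seq (R * P3)) sk := @decays_D_coord _ _ i _ 2^-1 _ F vs os Ck sk (dF vs sk).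
split; first exact (IsReg (C [::] isT) (D [::] isT) (fun v => D [:: v] isT)).
by move=> v; exact (IsReg (C [:: v] isT) (D [:: v] isT) (fun w => D [:: w; v] isT)).
Qed.

Lemma regular_field_coord (A : P3 -> 'rV[R]_3) (i : 'I_3) : regular_field A ->
  C1 setT (fun p => A p 0 i) /\ forall v, C1 setT ('D_v (fun p => A p 0 i)).
Proof.
move=> [Ck _]; split; first exact: (@Ck_on_coord_C1 _ _ _ i _ A [::] openT Ck).
by move=> v; exact: (@Ck_on_coord_C1 _ _ _ i _ A [:: v] openT Ck).
Qed.

End Regularity.

Section Components.
Context {R : realType}.
Notation P := (R * R)%type.
Notation P3 := (R * R * R)%type.
Notation Q := (R * P3)%type.

Lemma vec3E (a b c : R) : [/\ vec3 a b c 0 0 = a, vec3 a b c 0 1 = b & vec3 a b c 0 2 = c].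
Proof. by split; rewrite mxE. Qed.

Lemma vec2E (a b : R) : vec2 a b 0 0 = a /\ vec2 a b 0 1 = b.
Proof. by split; rewrite mxE. Qed.

Lemma dot3E (u v : 'rV[R]_3) : dot u v = u 0 0 * v 0 0 + u 0 1 * v 0 1 + u 0 2 * v 0 2.
Proof.
rewrite /dot !big_ord_recl big_ord0 addr0 addrA.
have -> : lift ord0 ord0 = 1 :> 'I_3 by exact/val_inj.
by have -> : lift ord0 (lift ord0 ord0) = 2 :> 'I_3 by exact/val_inj.
Qed.

Lemma dot2E (u v : 'rV[R]_2) : dot u v = u 0 0 * v 0 0 + u 0 1 * v 0 1.
Proof.
rewrite /dot !big_ord_recl big_ord0 addr0.
by have -> : lift ord0 ord0 = 1 :> 'I_2 by exact/val_inj.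
Qed.

Lemma enorm_sqr n (u : 'rV[R]_n) : enorm u ^+ 2 = dot u u.
Proof.
rewrite /enorm sqr_sqrtr// /dot; apply: sumr_ge0 => i _.
by rewrite -expr2 sqr_ge0.
Qed.

Lemma row3P (u v : 'rV[R]_3) : u 0 0 = v 0 0 -> u 0 1 = v 0 1 -> u 0 2 = v 0 2 -> u = v.
Proof.
move=> e0 e1 e2; apply/rowP => -[[|[|[|]]] i3]//.
- by rewrite (_ : Ordinal i3 = 0)//; exact/val_inj.
- by rewrite (_ : Ordinal i3 = 1)//; exact/val_inj.
- by rewrite (_ : Ordinal i3 = 2)//; exact/val_inj.
Qed.

Lemma parE (eta : P -> R) (A : P3 -> 'rV[R]_3) q :
  par eta A q 0 0 = A (surf eta q) 0 0 + A (surf eta q) 0 1 * d_x eta q /\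
  par eta A q 0 1 = A (surf eta q) 0 2 + A (surf eta q) 0 1 * d_z eta q.
Proof.
by rewrite /par !mxE /=.
Qed.

Lemma perpE (u : 'rV[R]_2) : perp u 0 0 = - u 0 1 /\ perp u 0 1 = u 0 0.
Proof. exact: vec2E. Qed.

Lemma gradE (f : P -> R) q : grad f q 0 0 = d_x f q /\ grad f q 0 1 = d_z f q.
Proof. exact: vec2E. Qed.

Lemma curl_family (F : Q -> 'rV[R]_3) e p :
  curl (fun p => F (e, p)) p = vec3 (vort1 (fun ep => F ep 0 1) (fun ep => F ep 0 2) (e, p))
    (vort2 (fun ep => F ep 0 0) (fun ep => F ep 0 2) (e, p))
    (vort3 (fun ep => F ep 0 0) (fun ep => F ep 0 1) (e, p)).
Proof.
rewrite /curl /vort1 /vort2 /vort3.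
have sx (i : 'I_3) := D_x_slice e (fun ep => F ep 0 i) p.
have sy (i : 'I_3) := D_y_slice e (fun ep => F ep 0 i) p.
have sz (i : 'I_3) := D_z_slice e (fun ep => F ep 0 i) p.
by rewrite (sy 2) (sz 1) (sz 0) (sx 2) (sx 1) (sy 0).
Qed.

End Components.

(** * The closed fluid domain and a uniform lower bound on the depth *)

Section Domain.
Context {R : realType}.
Notation P := (R * R)%type.
Notation P3 := (R * R * R)%type.

Lemma zero_on_closed (f : R -> R) : continuous f -> (forall s, 0 < s < 1 -> f s = 0) ->
  forall s, 0 <= s <= 1 -> f s = 0.
Proof.
move=> cf f0 s /andP[s0 s1]; apply/eqP; rewrite -normr_le0; apply/ler_addgt0Pr => e e0.
rewrite add0r.
have /cvgrPdist_lt/(_ e e0) := cf s.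
move=> [r /= r0 Hr].
(* A point of the open interval within r of s, the cases s = 0 and s = 1 included. *)
pose t := if s < 1 then s + Num.min (r / 2) ((1 - s) / 2) else s - Num.min (r / 2) (1 / 2).
have [st t01] : `|s - t| < r /\ 0 < t < 1.
  rewrite /t; case: ifPn => s1'.
    have m1 : Num.min (r / 2) ((1 - s) / 2) <= r / 2 by rewrite ge_min lexx.
    have m2 : Num.min (r / 2) ((1 - s) / 2) <= (1 - s) / 2 by rewrite ge_min lexx orbT.
    have m0 : 0 < Num.min (r / 2) ((1 - s) / 2) by rewrite lt_min !divr_gt0//; lra.
    split; first by rewrite opprD addrA subrr sub0r normrN ger0_norm; lra.
    by apply/andP; split; lra.
  have {s1'} -> : s = 1 by apply/eqP; rewrite eq_le s1 leNgt.
  have m1 : Num.min (r / 2) (1 / 2) <= r / 2 by rewrite ge_min lexx.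
  have m2 : Num.min (r / 2) (1 / 2 : R) <= 1 / 2 by rewrite ge_min lexx orbT.
  have m0 : 0 < Num.min (r / 2) (1 / 2 : R) by rewrite lt_min !divr_gt0.
  split; first by rewrite opprB addrA addrAC subrr add0r ger0_norm; lra.
  by apply/andP; split; lra.
by have := Hr t st; rewrite (f0 _ t01) subr0 => /ltW.
Qed.

Lemma flat_fluid h (eta : P -> R) q s : - h < eta q -> 0 < s < 1 -> fluid h eta (flat h eta (q, s)).
Proof.
move=> he /andP[s0 s1]; rewrite /fluid /flat /horizontal /=.
by case: q he => x z he /=; apply/andP; split; nra.
Qed.

Lemma flat1 h (eta : P -> R) q : flat h eta (q, 1) = surf eta q.
Proof.
rewrite /flat /surf /= mul1r.
by have -> : - h + (eta q + h) = eta q by ring.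
Qed.

Lemma closure_zero h (eta : P -> R) (f : P3 -> R) : (forall q, - h < eta q) -> continuous f ->
  (forall p, fluid h eta p -> f p = 0) ->
  forall q s, 0 <= s <= 1 -> f (flat h eta (q, s)) = 0.
Proof.
move=> he cf f0 q; apply: zero_on_closed => [s|s s01]; last by apply: f0; exact: flat_fluid.
apply: (@continuous_comp _ _ _ (fun s : R => flat h eta (q, s)) f); last exact: cf.
apply: (@continuous_at_pair _ _ _ (fun s : R => (q.1, - h + s * (eta q + h))) (fun=> q.2)); last exact: cvg_cst.
apply: (@continuous_comp _ _ _ (fun s : R => - h + s * (eta q + h)) (pair q.1)); last exact: continuous_pairr.
by apply: cvgD; [exact: cvg_cst|apply: cvgM; [exact: cvg_id|exact: cvg_cst]].
Qed.

Lemma surf_eq h (eta : P -> R) (f g : P3 -> R) : (forall q, - h < eta q) ->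
  continuous f -> continuous g -> (forall p, fluid h eta p -> f p = g p) ->
  forall q, f (surf eta q) = g (surf eta q).
Proof.
move=> he cf cg fg q; apply/eqP; rewrite -subr_eq0 -(flat1 h) //.
apply/eqP; apply: (closure_zero (f := fun p => f p - g p) he) => [p|p Fp|].
- by apply: cvgB; [exact: cf|exact: cg].
- by rewrite fg// subrr.
- by rewrite ler01 lexx.
Qed.

Lemma open_fluid h (eta : P -> R) : continuous eta -> open (fluid h eta).
Proof.
move=> ce.
have chor : continuous (@horizontal R).
  move=> p; apply: (@continuous_at_pair _ _ _ (fun p : P3 => p.1.1) snd); last exact: cvg_snd.
  exact: continuous_fstfst.
have -> : fluid h eta = (fun p : P3 => p.1.2) @^-1` [set y | - h < y]
    `&` (fun p : P3 => eta (horizontal p) - p.1.2) @^-1` [set y | 0 < y].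
  apply/seteqP; split => p /=; rewrite /fluid /= subr_gt0; first by move=> /andP.
  by move=> [-> ->].
apply: openI.
  by apply: open_comp; [move=> p _; exact: continuous_sndfst|exact: open_gt].
apply: open_comp; last exact: open_gt.
move=> p _; apply: cvgB; last exact: continuous_sndfst.
by apply: (@continuous_comp _ _ _ (@horizontal R) eta); [exact: chor|exact: ce].
Qed.

(** The pointwise inequality - h < eta has to become uniform, so that small multiples of a bounded
    variation keep the surface above the bottom. At infinity this comes from the decay of eta, on a
    large box from compactness. *)
Lemma depth_lower_bound h (eta : P -> R) : 0 < h -> continuous eta -> (forall q, - h < eta q) ->
  decays 2^-1 idfun setT eta -> exists2 m, 0 < m & forall q, m <= eta q + h.
Proof.
move=> h0 ce he /decaysP[s [C [s2 C0 eC]]].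
have p0 q : 0 < eta q + h by have := he q; lra.
have ci : continuous (fun q => (eta q + h)^-1).
  move=> q; apply: cvgV; first by rewrite gt_eqF.
  by apply: cvgD; [exact: ce|exact: cvg_cst].
(* Outside the box of half-side M one has |eta| <= C (1 + x^2 + z^2)^(-1/2) <= C / M = h / 2. *)
pose M := 2 * C / h.
have [K HK] := continuous_bounded_box M ci.
pose m := Num.min (h / 2) (`|K| + 1)^-1.
exists m; first by rewrite lt_min divr_gt0//= invr_gt0 ltr_wpDl.
move=> [x z]; have [far|near] := pselect (M < `|x| \/ M < `|z|).
  have M0 : 0 <= M by rewrite divr_ge0 ?mulr_ge0// ltW.
  suff : `|eta (x, z)| <= h / 2.
    have m1 : m <= h / 2 by rewrite ge_min lexx.
    by rewrite ler_norml => /andP[]; lra.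
  apply: (le_trans (eC (x, z) I)).
  have w : wt s (x, z) <= wt 2^-1 (x, z) by apply: wt_anti; exact: ltW.
  apply: (le_trans (ler_wpM2l C0 w)).
  have b0 : 0 <= 1 + x ^+ 2 + z ^+ 2 by rewrite !addr_ge0 ?sqr_ge0.
  rewrite /wt /= powRN powR12_sqrt//.
  set S := Num.sqrt _; have MS : M <= S.
    rewrite -[leLHS]ger0_norm// -sqrtr_sqr ler_wsqrtr//.
    have sx := sqr_ge0 x; have sz := sqr_ge0 z.
    case: far => /ltW f.
      have : M ^+ 2 <= `|x| ^+ 2 by rewrite lerXn2r// nnegrE.
      by rewrite real_normK ?num_real//; lra.
    have : M ^+ 2 <= `|z| ^+ 2 by rewrite lerXn2r// nnegrE.
    by rewrite real_normK ?num_real//; lra.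
  have S0 : 0 < S by rewrite sqrtr_gt0 ltr_wpDr ?sqr_ge0// ltr_wpDr ?sqr_ge0.
  rewrite ler_pdivrMr//.
  have : h / 2 * M <= h / 2 * S by apply: ler_wpM2l => //; lra.
  apply: le_trans; rewrite /M (_ : h / 2 * (2 * C / h) = C)//.
  by field; rewrite gt_eqF.
have [xM zM] : `|x| <= M /\ `|z| <= M.
  by split; rewrite leNgt; apply/negP => H; apply: near; [left|right].
have := HK x z xM zM; rewrite normrV ?unitfE ?gt_eqF//.
rewrite (ger0_norm (ltW (p0 _))) => H.
have m2 : m <= (`|K| + 1)^-1 by rewrite ge_min lexx orbT.
have K1 : 0 < `|K| + 1 by rewrite ltr_wpDl.
apply: (le_trans m2); rewrite -[leRHS]invrK lef_pV2 ?posrE ?invr_gt0 ?p0//.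
by apply: (le_trans H); apply: (le_trans (ler_norm _)); rewrite lerDl.
Qed.

Lemma vary_above h (eta nu : P -> R) : 0 < h -> admissible_surface h eta -> decaying_smooth nu ->
  exists2 d, 0 < d & forall e, `|e| < d -> forall q, - h < vary eta nu e q.
Proof.
move=> h0 [se he] sn.
have [Ce de _] := decaying_smooth_reg [::] se.
have [_ dn _] := decaying_smooth_reg [::] sn.
have [m m0 Hm] := depth_lower_bound h0 (C1T_continuous Ce) he de.
have [|K HK] := decays_bnd _ dn; first by lra.
exists (m / (`|K| + 1)); first by rewrite divr_gt0// ltr_wpDl.
move=> e; rewrite ltr_pdivlMr ?ltr_wpDl// => ed q.
have : `|e * nu q| < m.
  apply: le_lt_trans ed; rewrite normrM ler_wpM2l//.
  by apply: (le_trans (HK q I)); apply: (le_trans (ler_norm _)); rewrite lerDl.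
by rewrite ltr_norml /vary => /andP[]; have := Hm q; rewrite /=; lra.
Qed.

End Domain.

(** * The boundary-value problem along a line, in components *)

Section Line.
Context {R : realType}.
Notation P := (R * R)%type.
Notation P3 := (R * R * R)%type.
Notation Q := (R * P3)%type.

Lemma near0_ball (Pr : R -> Prop) : (\forall e \near (0 : R), Pr e) ->
  exists2 d : R, 0 < d & forall e, `|e| < d -> Pr e.
Proof.
move=> [d d0 H]; exists d => // e ed; apply: H.
by rewrite /ball /= sub0r normrN.
Qed.

Lemma reg_sub {V : normedModType R} (hor : V -> P) (U U' D D' : set V) a (f : V -> R) :
  U' `<=` U -> D' `<=` D -> reg hor U D a f -> reg hor U' D' a f.
Proof.
move=> UU DD [[Cf] df Df]; split; [by split=> p /UU; exact: Cf|exact: decays_sub df|].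
by move=> v; exact: decays_sub (Df v).
Qed.

Lemma qreg2_sub d d' (f : Q -> R) : d' <= d -> qreg2 d f -> qreg2 d' f.
Proof.
move=> dd [r1 r2]; have S : strip d' `<=` (strip d : set Q).
  by move=> p; rewrite /strip /= => /lt_le_trans; apply.
by split=> [|v]; [exact: reg_sub r1|exact: reg_sub (r2 v)].
Qed.

Lemma reg_slice d b (f : R * P -> R) e : `|e| < d -> reg snd (strip d) (strip d) b f ->
  reg idfun setT setT b (fun q => f (e, q)).
Proof.
move=> ed rf.
by apply: (@reg_affine _ _ _ (pair e) (pair 0) (pairr_affine e) (differentiable_pairr e)
    _ _ setT setT openT _ _ snd idfun b f _ rf) => //.
Qed.

Lemma family_field d (f : R * P -> R) e : `|e| < d -> reg snd (strip d) (strip d) 2^-1 f ->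
  field (fun q => f (e, q)).
Proof. by move=> ed /(reg_slice ed)[]. Qed.

(** When a potential exists, [invLap] is one. Its gradient is curl free by symmetry of second
    derivatives, and the Poisson equation says that the rotated field minus this gradient is
    divergence free. *)
Lemma invLap_hodge (f : P -> 'rV[R]_2) (a1 a2 : P -> R) :
  (forall q, f q 0 0 = a1 q /\ f q 0 1 = a2 q) -> field a1 -> field a2 ->
  has_invLap (div2 (fun q => perp (f q))) ->
  hodge a1 a2 (d_x (invLap (div2 (fun q => perp (f q))))) (d_z (invLap (div2 (fun q => perp (f q))))).
Proof.
move=> fE fa1 fa2 ex; set rho := div2 _ in ex *.
have : is_invLap rho (invLap rho) by rewrite /invLap; exact: xgetPex ex.
set p := invLap rho => -[Ck _ dg Lp].
have Cp : C1 setT p := Ck_on_C1 (vs := [::]) Ck isT.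
have Cx : C1 setT (d_x p) := Ck_on_C1 (vs := [:: ((1, 0) : P)]) Ck isT.
have Cz : C1 setT (d_z p) := Ck_on_C1 (vs := [:: ((0, 1) : P)]) Ck isT.
have dx : decays 2^-1 idfun setT (d_x p).
  by apply: (decays_eq _ (decays_coord 0 dg)) => q _; rewrite (gradE p q).1.
have dz : decays 2^-1 idfun setT (d_z p).
  by apply: (decays_eq _ (decays_coord 1 dg)) => q _; rewrite (gradE p q).2.
split; [exact: conj fa1 fa2|exact: conj (conj Cx dx) (conj Cz dz)| |].
- move=> q; exact: (derive_comm openT Cp Cx Cz (fun _ _ => erefl) (fun _ _ => erefl) I).
move=> q; have [[Ca1 _] [Ca2 _]] := (fa1, fa2).
rewrite (d_xB q (C1N openT Ca2) Cx) (d_zB q Ca1 Cz).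
have := Lp q; rewrite /laplacian /rho /div2.
rewrite (_ : (fun q' => grad p q' 0 0) = d_x p); last by apply/funext => q'; rewrite (gradE p q').1.
rewrite (_ : (fun q' => grad p q' 0 1) = d_z p); last by apply/funext => q'; rewrite (gradE p q').2.
rewrite (_ : (fun q' => perp (f q') 0 0) = fun q => - a2 q); last first.
  by apply/funext => q'; rewrite (perpE _).1 (fE q').2.
rewrite (_ : (fun q' => perp (f q') 0 1) = a1); last first.
  by apply/funext => q'; rewrite (perpE _).2 (fE q').1.
by move=> E; rewrite addrACA -opprD E subrr.
Qed.

Lemma d_x_vary_C1 (f k : P -> R) e q : C1 setT f -> C1 setT k ->
  d_x (vary f k e) q = d_x f q + e * d_x k q.
Proof.
move=> Cf Ck; have h1 := hder_C1 ((1, 0) : P) Cf (I : setT q); have h2 := hder_C1 ((1, 0) : P) Ck (I : setT q).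
by apply: hder_val; rewrite /vary; derive_by; rewrite mulr0 addr0.
Qed.

Lemma d_z_vary_C1 (f k : P -> R) e q : C1 setT f -> C1 setT k ->
  d_z (vary f k e) q = d_z f q + e * d_z k q.
Proof.
move=> Cf Ck; have h1 := hder_C1 ((0, 1) : P) Cf (I : setT q); have h2 := hder_C1 ((0, 1) : P) Ck (I : setT q).
by apply: hder_val; rewrite /vary; derive_by; rewrite mulr0 addr0.
Qed.

Lemma AstarE (alpha c1 c3 : R) p :
  [/\ Astar alpha c1 c3 p 0 0 = star1 alpha c1 c3 p.1.2, Astar alpha c1 c3 p 0 1 = 0
    & Astar alpha c1 c3 p 0 2 = star3 alpha c1 c3 p.1.2].
Proof. by split; rewrite /Astar /star1 /star3 !mxE /= ?mulr0 ?addr0 ?mulrN. Qed.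

Lemma par_Astar (alpha c1 c3 : R) (eta : P -> R) q :
  par eta (Astar alpha c1 c3) q 0 0 = star1 alpha c1 c3 (eta q) /\
  par eta (Astar alpha c1 c3) q 0 1 = star3 alpha c1 c3 (eta q).
Proof.
have [-> ->] := parE eta (Astar alpha c1 c3) q.
by have [-> -> ->] := AstarE alpha c1 c3 (surf eta q); rewrite !mul0r !addr0.
Qed.

Lemma ustarE (alpha c1 c3 y : R) :
  [/\ ustar alpha c1 c3 y 0 0 = ustar1 alpha c1 c3 y, ustar alpha c1 c3 y 0 1 = 0
    & ustar alpha c1 c3 y 0 2 = ustar3 alpha c1 c3 y].
Proof. by split; rewrite /ustar /ustar1 /ustar3 !mxE /= ?mulr0 ?addr0 ?mulrN. Qed.

Lemma cross_jvec_eq0 (u : 'rV[R]_3) : cross u jvec = 0 -> u 0 0 = 0 /\ u 0 2 = 0.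
Proof.
have [j0 j1 j2] : [/\ @jvec R 0 0 = 0, @jvec R 0 1 = 1 & @jvec R 0 2 = 0] := vec3E _ _ _.
have z00 (i : 'I_3) : (0 : 'rV[R]_3) 0 i = 0 by rewrite mxE.
have [c0 _ c2] := vec3E (u 0 1 * @jvec R 0 2 - u 0 2 * @jvec R 0 1)
  (u 0 2 * @jvec R 0 0 - u 0 0 * @jvec R 0 2) (u 0 0 * @jvec R 0 1 - u 0 1 * @jvec R 0 0).
move=> B; rewrite -[vec3 _ _ _]/(cross u jvec) B z00 j0 j1 j2 in c0 c2.
by move: c0 c2; rewrite !mulr0 !mulr1 subr0 sub0r => c0 <-; split=> //; rewrite -[LHS]opprK -c0 oppr0.
Qed.

Section BVPFamily.
Variables (h alpha d : R) (eta nu Phi dPhi : P -> R) (F : Q -> 'rV[R]_3).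
Let A1 ep := F ep 0 0.
Let A2 ep := F ep 0 1.
Let A3 ep := F ep 0 2.
Let V1 := vort1 A2 A3.
Let V2 := vort2 A1 A3.
Let V3 := vort3 A1 A2.
Hypotheses (seta : surface_admissible eta) (snu : surface_admissible nu)
  (CPhi : C1 setT Phi) (CdPhi : C1 setT dPhi)
  (rA1 : qreg2 d A1) (rA2 : qreg2 d A2) (rA3 : qreg2 d A3)
  (above : forall e, `|e| < d -> forall q, - h < vary eta nu e q)
  (bvp : forall e, `|e| < d ->
     solves_BVP h alpha (vary eta nu e) (vary Phi dPhi e) (fun p => F (e, p))).

Let rho e := div2 (fun q => perp (par (vary eta nu e) (fun p => F (e, p)) q)).

Lemma curl_slices e p : [/\ curl (fun p => F (e, p)) p 0 0 = V1 (e, p),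
  curl (fun p => F (e, p)) p 0 1 = V2 (e, p) & curl (fun p => F (e, p)) p 0 2 = V3 (e, p)].
Proof. by rewrite curl_family; exact: vec3E. Qed.

Lemma par_family e q : par (vary eta nu e) (fun p => F (e, p)) q 0 0 = par1E eta nu A1 A2 (e, q) /\
  par (vary eta nu e) (fun p => F (e, p)) q 0 1 = par2E eta nu A2 A3 (e, q).
Proof.
have [-> ->] := parE (vary eta nu e) (fun p => F (e, p)) q.
by rewrite (d_x_vary seta snu) (d_z_vary seta snu).
Qed.

Lemma family_hodge e : `|e| < d ->
  hodge (fun q => par1E eta nu A1 A2 (e, q)) (fun q => par2E eta nu A2 A3 (e, q))
    (d_x (invLap (rho e))) (d_z (invLap (rho e))).
Proof.
move=> ed; have [[_ ex] _ _ _ _] := bvp ed.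
have [r1 r2] := reg_par seta snu rA1 rA2 rA3.
apply: invLap_hodge ex; [exact: par_family|exact: (family_field ed r1)|exact: (family_field ed r2)].
Qed.

Lemma family_tangential : tangential_condition alpha d eta nu (d_x Phi) (d_z Phi) (d_x dPhi) (d_z dPhi)
  A1 A2 A3 (fun e => d_x (invLap (rho e))) (fun e => d_z (invLap (rho e))).
Proof.
move=> e q ed; have [_ _ _ _ /(_ q) T] := bvp ed.
have [p1 p2] := parE (vary eta nu e) (curl (fun p => F (e, p))) q.
have [k1 k2 k3] := curl_slices e (surf (vary eta nu e) q).
rewrite k1 k2 k3 (d_x_vary seta snu) (d_z_vary seta snu) T in p1 p2.
have T1 (G H : 'rV[R]_2) : (G - alpha *: perp H) 0 0 = G 0 0 + alpha * H 0 1.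
  by rewrite !mxE /= mulrN opprK.
have T2 (G H : 'rV[R]_2) : (G - alpha *: perp H) 0 1 = G 0 1 - alpha * H 0 0.
  by rewrite !mxE /=.
rewrite T1 (gradE _ q).1 (gradE _ q).2 (d_x_vary_C1 e q CPhi CdPhi) in p1.
rewrite T2 (gradE _ q).2 (gradE _ q).1 (d_z_vary_C1 e q CPhi CdPhi) in p2.
exact (conj (esym p1) (esym p2)).
Qed.

Lemma family_no_slip : no_slip h d A1 A3.
Proof.
by move=> e q ed; have [_ _ /(_ q.1 q.2) B _ _] := bvp ed; exact: cross_jvec_eq0 B.
Qed.

(** The extension F is C^2, hence v is C^1 across the boundary, and each component of curl v - alpha
    v vanishes on the closed slab as soon as it vanishes in the open domain. *)
Lemma family_beltrami : beltrami_on_slab h alpha d eta nu A1 A2 A3.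
Proof.
move=> e [q s] ed slt.
have s01 : 0 <= s <= 1 by move: slt => [_]; rewrite /= in_itv.
have [v1 v2 v3] := qreg_vort rA1 rA2 rA3.
have [_ B _ _ _] := bvp ed.
pose G ep := vec3 (V1 ep) (V2 ep) (V3 ep).
have cG : curl (fun p => F (e, p)) = fun p => G (e, p).
  by apply/funext => p; rewrite curl_family.
have B' p : fluid h (vary eta nu e) p -> [/\ vort1 V2 V3 (e, p) = alpha * V1 (e, p),
    vort2 V1 V3 (e, p) = alpha * V2 (e, p) & vort3 V1 V2 (e, p) = alpha * V3 (e, p)].
  move=> Fp; have [] := B p Fp; rewrite cG curl_family /G.
  have -> : (fun ep => vec3 (V1 ep) (V2 ep) (V3 ep) 0 0) = V1 by apply/funext => ep; have [] := vec3E (V1 ep) (V2 ep) (V3 ep).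
  have -> : (fun ep => vec3 (V1 ep) (V2 ep) (V3 ep) 0 1) = V2 by apply/funext => ep; have [] := vec3E (V1 ep) (V2 ep) (V3 ep).
  have -> : (fun ep => vec3 (V1 ep) (V2 ep) (V3 ep) 0 2) = V3 by apply/funext => ep; have [] := vec3E (V1 ep) (V2 ep) (V3 ep).
  move=> E _; split.
  - by have := congr1 (fun M : 'rV[R]_3 => M 0 0) E; rewrite !mxE.
  - by have := congr1 (fun M : 'rV[R]_3 => M 0 1) E; rewrite !mxE.
  - by have := congr1 (fun M : 'rV[R]_3 => M 0 2) E; rewrite !mxE.
have cV (V : Q -> R) w : qreg d 2^-1 V -> continuous (fun p : P3 => 'D_w V (e, p)).
  move=> [CV _ _] p; apply: (@continuous_comp _ _ _ (pair e) ('D_w V)); first exact: continuous_pairr.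
  exact: (C1_derive_continuous _ CV).
have cV0 (V : Q -> R) : qreg d 2^-1 V -> continuous (fun p : P3 => V (e, p)).
  by move=> [CV _ _]; exact: fst_slice_continuous ed.
have Z (W X : Q -> R) w x (V : Q -> R) : qreg d 2^-1 W -> qreg d 2^-1 X -> qreg d 2^-1 V ->
    (forall p, fluid h (vary eta nu e) p -> 'D_w W (e, p) - 'D_x X (e, p) = alpha * V (e, p)) ->
    'D_w W (e, flat h (vary eta nu e) (q, s)) - 'D_x X (e, flat h (vary eta nu e) (q, s))
      = alpha * V (e, flat h (vary eta nu e) (q, s)).
  move=> rW rX rV H.
  have cZ : continuous (fun p : P3 => 'D_w W (e, p) - 'D_x X (e, p) - alpha * V (e, p)).
    move=> p; apply: cvgB; last by apply: cvgM; [exact: cvg_cst|exact: (cV0 _ rV)].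
    by apply: cvgB; [exact: (cV _ _ rW)|exact: (cV _ _ rX)].
  have Z0 p : fluid h (vary eta nu e) p -> 'D_w W (e, p) - 'D_x X (e, p) - alpha * V (e, p) = 0.
    by move=> Fp; rewrite (H p Fp) subrr.
  exact (subr0_eq (closure_zero (above ed) cZ Z0 q s01)).
have v1' : qreg d 2^-1 V1 := v1; have v2' : qreg d 2^-1 V2 := v2; have v3' : qreg d 2^-1 V3 := v3.
split.
- by apply: (Z _ _ _ _ _ v3' v2' v1') => p /B'[].
- by apply: (Z _ _ _ _ _ v1' v3' v2') => p /B'[].
- by apply: (Z _ _ _ _ _ v2' v1' v3') => p /B'[].
Qed.

End BVPFamily.
End Line.

Section OnFluid.
Context {R : realType}.
Notation P := (R * R)%type.
Notation P3 := (R * R * R)%type.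

Lemma curl_eq_fluid (h : R) (eta : P -> R) (A B : P3 -> 'rV[R]_3) : continuous eta ->
  (forall p, fluid h eta p -> A p = B p) -> forall p, fluid h eta p -> curl A p = curl B p.
Proof.
move=> ce AB p Fp; have oF := @open_fluid R h eta ce.
have DE (i : 'I_3) v : 'D_v (fun p => A p 0 i) p = 'D_v (fun p => B p 0 i) p.
  have AB' r : fluid h eta r -> A r 0 i = B r 0 i by move=> Fr; rewrite AB.
  exact: (C1_derive_eq oF v AB' Fp).
by rewrite /curl /D_x /D_y /D_z !DE.
Qed.

Lemma eq_on_surface (h : R) (eta : P -> R) (A B : P3 -> 'rV[R]_3) : (forall q, - h < eta q) ->
  (forall i, continuous (fun p => A p 0 i)) -> (forall i, continuous (fun p => B p 0 i)) ->
  (forall p, fluid h eta p -> A p = B p) -> forall q, A (surf eta q) = B (surf eta q).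
Proof.
move=> he cA cB AB q.
have E (i : 'I_3) : A (surf eta q) 0 i = B (surf eta q) 0 i.
  by apply: (surf_eq he (cA i) (cB i)) => p Fp; rewrite AB.
by apply: row3P; exact: E.
Qed.

Lemma continuous_curl (A : P3 -> 'rV[R]_3) : regular_field A ->
  forall i, continuous (fun p => curl A p 0 i).
Proof.
move=> rA; have cD (j : 'I_3) v : continuous ('D_v (fun p => A p 0 j)).
  exact: C1T_continuous ((regular_field_coord j rA).2 v).
have c0 : continuous (fun p => curl A p 0 0).
  rewrite (_ : (fun p => curl A p 0 0) = fun p => D_y (fun p' => A p' 0 2) p - D_z (fun p' => A p' 0 1) p).
    by move=> p; apply: cvgB; exact: cD.
  by apply/funext => p; have [] := vec3E (D_y (fun p' => A p' 0 2) p - D_z (fun p' => A p' 0 1) p) 0 0; rewrite /curl !mxE.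
have c1 : continuous (fun p => curl A p 0 1).
  rewrite (_ : (fun p => curl A p 0 1) = fun p => D_z (fun p' => A p' 0 0) p - D_x (fun p' => A p' 0 2) p).
    by move=> p; apply: cvgB; exact: cD.
  by apply/funext => p; rewrite /curl !mxE.
have c2 : continuous (fun p => curl A p 0 2).
  rewrite (_ : (fun p => curl A p 0 2) = fun p => D_x (fun p' => A p' 0 1) p - D_y (fun p' => A p' 0 0) p).
    by move=> p; apply: cvgB; exact: cD.
  by apply/funext => p; rewrite /curl !mxE.
move=> [[|[|[|]]] i3]//.
- by rewrite (_ : Ordinal i3 = 0)//; exact/val_inj.
- by rewrite (_ : Ordinal i3 = 1)//; exact/val_inj.
- by rewrite (_ : Ordinal i3 = 2)//; exact/val_inj.
Qed.

(** Two fields that represent the same solution coincide in the open fluid domain only. Openness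
    carries the equality over to the curls, continuity to the traces on the surface. It identifies
    [BVPsol] with the C^2 family. *)
Lemma regular_field_eq (h : R) (eta : P -> R) (A B : P3 -> 'rV[R]_3) :
  continuous eta -> (forall q, - h < eta q) ->
  regular_field A -> regular_field B -> (forall p, fluid h eta p -> A p = B p) ->
  [/\ forall p, fluid h eta p -> curl A p = curl B p, par eta A = par eta B
    & forall q, curl A (surf eta q) = curl B (surf eta q)].
Proof.
move=> ce he rA rB AB; have cc := curl_eq_fluid ce AB.
have cA (X : P3 -> 'rV[R]_3) : regular_field X -> forall i, continuous (fun p => X p 0 i).
  by move=> rX i; exact: C1T_continuous (regular_field_coord i rX).1.
split=> //; last exact: (eq_on_surface he (continuous_curl rA) (continuous_curl rB) cc).
by apply/funext => q; rewrite /par (eq_on_surface he (cA _ rA) (cA _ rB) AB).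
Qed.

Lemma slice_pint d (f : R * P -> R) e : `|e| < d -> reg snd (strip d) (strip d) 1 f ->
  pint (fun q => f (e, q)).
Proof.
move=> ed /(reg_slice ed)[Cf df _]; exact: decays_integrable (C1T_continuous Cf) df.
Qed.

End OnFluid.

Section ContinuousDecay.
Context {R : realType}.
Notation P := (R * R)%type.

(** Weaker than [field]: the coefficient of the variation of eta contains second derivatives of eta,
    and only its continuity is known. *)
Definition decaying (f : P -> R) := continuous f /\ decays 2^-1 idfun setT f.

Lemma decayingD f g : decaying f -> decaying g -> decaying (fun q => f q + g q).
Proof.
by move=> [cf df] [cg dg]; split; [move=> q; apply: cvgD; [exact: cf|exact: cg]|exact: decaysD].
Qed.

Lemma decayingB f g : decaying f -> decaying g -> decaying (fun q => f q - g q).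
Proof.
by move=> [cf df] [cg dg]; split; [move=> q; apply: cvgB; [exact: cf|exact: cg]|exact: decaysB].
Qed.

Lemma decayingM_bnd f g : decaying f -> continuous g -> bnd setT g -> decaying (fun q => f q * g q).
Proof.
by move=> [cf df] cg bg; split; [move=> q; apply: cvgM; [exact: cf|exact: cg]|exact: decaysM_bnd].
Qed.

Lemma decayingM f g : decaying f -> decaying g -> decaying (fun q => f q * g q).
Proof.
move=> df [cg dg]; apply: decayingM_bnd => //; by apply: decays_bnd dg; rewrite invr_ge0 ler0n.
Qed.

Lemma decayingZ c f : decaying f -> decaying (fun q => c * f q).
Proof.
move=> [cf df]; split; first by move=> q; apply: cvgM; [exact: cvg_cst|exact: cf].
by apply: bndM_decays df; exact: bnd_cst.
Qed.

Lemma field_decaying f : field f -> decaying f.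
Proof. by move=> ff; split; [exact: field_continuous|exact: ff.2]. Qed.

Lemma reg_field f : reg idfun (@setT P) (@setT P) 2^-1 f -> field f.
Proof. by case. Qed.

Lemma reg_decaying_derive f v : reg idfun (@setT P) (@setT P) 2^-1 f -> decaying ('D_v f).
Proof. by move=> [Cf _ Df]; split; [move=> p; exact: (C1_derive_continuous _ Cf)|exact: Df]. Qed.

Lemma decaying_pint f g : decaying f -> decaying g -> pint (fun q => f q * g q).
Proof. by move=> [cf df] [cg dg]; exact: pint_mul. Qed.

End ContinuousDecay.

Section ShapeGradient.
Context {R : realType}.
Notation P := (R * R)%type.
Variables (h alpha c1 c3 g sigma : R) (eta Phi : P -> R).

Definition capillarity q :=
  d_x (fun q => sigma * (d_x eta q * invslope (steep eta q))) q
  + d_z (fun q => sigma * (d_z eta q * invslope (steep eta q))) q.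

(** The sum [inertia] + [star_force] is the factor K of the variation of eta. The first summand
    comes from A, the second from the coupling with the trivial flow, gravity and capillarity. *)
Definition inertia q :=
  let v := curl (BVPsol h alpha eta Phi) (surf eta q) in
  2^-1 * (v 0 0 * v 0 0 + v 0 1 * v 0 1 + v 0 2 * v 0 2)
  - (v 0 1 - d_x eta q * v 0 0 - d_z eta q * v 0 2) * v 0 1.

Definition star_force q :=
  let S := invLap (div2 (fun q => perp (par eta (Astar alpha c1 c3) q))) in
  d_x Phi q * ustar1 alpha c1 c3 (eta q) + d_z Phi q * ustar3 alpha c1 c3 (eta q)
  - alpha * (d_z S q * ustar1 alpha c1 c3 (eta q) - d_x S q * ustar3 alpha c1 c3 (eta q))
  + g * eta q - capillarity q.

End ShapeGradient.

(** * The Lagrangian along a line and its derivative *)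

Section LagrangianFamily.
Context {R : realType}.
Notation P := (R * R)%type.
Notation P3 := (R * R * R)%type.
Notation Q := (R * P3)%type.
Notation preg f := (reg idfun (@setT P) (@setT P) 2^-1 f).
Variables (h alpha c1 c3 g sigma d : R) (eta nu Phi dPhi : P -> R) (F : Q -> 'rV[R]_3).
Let A1 ep := F ep 0 0.
Let A2 ep := F ep 0 1.
Let A3 ep := F ep 0 2.
Let V1 := vort1 A2 A3.
Let V2 := vort2 A1 A3.
Let V3 := vort3 A1 A2.
Hypotheses (d0 : 0 < d) (alpha0 : alpha != 0)
  (seta : surface_admissible eta) (snu : surface_admissible nu)
  (CPhi : C1 setT Phi) (CdPhi : C1 setT dPhi)
  (rPx : preg (d_x Phi)) (rPz : preg (d_z Phi)) (rdPx : preg (d_x dPhi)) (rdPz : preg (d_z dPhi))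
  (rA1 : qreg2 d A1) (rA2 : qreg2 d A2) (rA3 : qreg2 d A3)
  (above : forall e, `|e| < d -> forall q, - h < vary eta nu e q)
  (bvp : forall e, `|e| < d ->
     solves_BVP h alpha (vary eta nu e) (vary Phi dPhi e) (fun p => F (e, p)))
  (uniq : forall e, `|e| < d -> uniquely_solvable h alpha (vary eta nu e) (vary Phi dPhi e))
  (star : forall e, `|e| < d ->
     has_invLap (div2 (fun q => perp (par (vary eta nu e) (Astar alpha c1 c3) q)))).

Let X e := BVPsol h alpha (vary eta nu e) (vary Phi dPhi e).
Let E e := invLap (div2 (fun q => perp (par (vary eta nu e) (fun p => F (e, p)) q))).
Let S e := invLap (div2 (fun q => perp (par (vary eta nu e) (Astar alpha c1 c3) q))).

Lemma vary_continuous e : continuous (vary eta nu e).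
Proof. have [[C _ _] _ _] := breg_vary seta snu e; exact: C1T_continuous. Qed.

Lemma BVPsol_family e : `|e| < d ->
  [/\ forall p, fluid h (vary eta nu e) p -> curl (X e) p = curl (fun p => F (e, p)) p,
      forall p, fluid h (vary eta nu e) p -> X e p = F (e, p),
      par (vary eta nu e) (X e) = par (vary eta nu e) (fun p => F (e, p))
    & forall q, curl (X e) (surf (vary eta nu e) q) = curl (fun p => F (e, p)) (surf (vary eta nu e) q)].
Proof.
move=> ed; have [ex un] := uniq ed.
have sX : solves_BVP h alpha (vary eta nu e) (vary Phi dPhi e) (X e).
  by rewrite /X /BVPsol; exact: xgetPex ex.
have XF := un _ _ sX (bvp ed).
have [[rX _] _ _ _ _] := sX; have [[rF _] _ _ _ _] := bvp ed.
by have [] := regular_field_eq (@vary_continuous e) (above ed) rX rF XF.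
Qed.

Lemma star_hodge e : `|e| < d ->
  hodge (fun q => star1 alpha c1 c3 (heightE eta nu (e, q)))
    (fun q => star3 alpha c1 c3 (heightE eta nu (e, q))) (d_x (S e)) (d_z (S e)).
Proof.
move=> ed; have rh := reg_height d seta snu.
have os := @open_strip R P d; have ss := @subset_refl _ (@strip R P d).
have r1 := reg_star1 c1 c3 alpha0 os ss rh; have r3 := reg_star3 c1 c3 alpha0 os ss rh.
apply: (invLap_hodge _ (family_field ed r1) (family_field ed r3) (star ed)) => q.
exact: par_Astar.
Qed.

Lemma Lagrangian_bulk e : `|e| < d ->
  \int[@volume R]_(p in fluid h (vary eta nu e))
    (2^-1 * enorm (curl (X e) p) ^+ 2 - 2^-1 * alpha * dot (X e p) (curl (X e) p))
  = slab_energy h alpha eta nu A1 A2 A3 e.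
Proof.
move=> ed; have [cX XF _ _] := BVPsol_family ed.
have rE := qreg_energy alpha rA1 rA2 rA3.
have [Cs dse _] := qreg_slice ed rE.
have [[Cv bv _] _ _] := breg_vary seta snu e.
rewrite /slab_energy -[RHS](volume_flatten (C1T_continuous Cv) bv (above ed) (C1T_continuous Cs) dse).
apply: (@eq_Rintegral _ _ R (plane_measure \x lebesgue_measure)%E) => p; rewrite inE => Fp.
rewrite (cX p Fp) (XF p Fp) enorm_sqr !dot3E.
by have [-> -> ->] := curl_slices F e p.
Qed.

(** The integrals are regrouped so that each bracket has a derivative already computed: the bulk
    energy stays with the nonlocal term of A, and the coupling of Phi with Astar joins the trivial
    flow. [BVPsol] is replaced by the family F, which is differentiable in e. *)
Lemma Lagrangian_family e : `|e| < d ->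
  Lagrangian h alpha c1 c3 g sigma (vary eta nu e) (vary Phi dPhi e) =
  (slab_energy h alpha eta nu A1 A2 A3 e - 2^-1 * alpha * \int[@area R]_q
     (d_x (E e) q * par1E eta nu A1 A2 (e, q) + d_z (E e) q * par2E eta nu A2 A3 (e, q)))
  + (\int[@area R]_q (starE alpha c1 c3 eta nu (d_x Phi) (d_z Phi) (d_x dPhi) (d_z dPhi) (e, q)
       + potentialE alpha c1 c3 g sigma eta nu (e, q))
     - 2^-1 * alpha * \int[@area R]_q
       (d_x (S e) q * star1 alpha c1 c3 (heightE eta nu (e, q))
        + d_z (S e) q * star3 alpha c1 c3 (heightE eta nu (e, q)))).
Proof.
move=> ed; have [_ _ pX _] := BVPsol_family ed.
rewrite /Lagrangian (Lagrangian_bulk ed) -/(X e) pX -/(E e).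
have pE : pint (fun q => d_x (E e) q * par1E eta nu A1 A2 (e, q)
    + d_z (E e) q * par2E eta nu A2 A3 (e, q)).
  have [[fa1 fa2] [fE1 fE2] _ _] := family_hodge seta snu rA1 rA2 rA3 bvp ed.
  exact: pintD (pintM fE1 fa1) (pintM fE2 fa2).
have pS : pint (fun q => d_x (S e) q * star1 alpha c1 c3 (heightE eta nu (e, q))
    + d_z (S e) q * star3 alpha c1 c3 (heightE eta nu (e, q))).
  have [[fa1 fa2] [fE1 fE2] _ _] := star_hodge ed.
  exact: pintD (pintM fE1 fa1) (pintM fE2 fa2).
have p1 := slice_pint ed (reg_starE c1 c3 d alpha0 seta snu rPx rPz rdPx rdPz).
have p2 := slice_pint ed (reg_potentialE alpha c1 c3 g sigma d seta snu).
have pT : pint (fun q => starE alpha c1 c3 eta nu (d_x Phi) (d_z Phi) (d_x dPhi) (d_z dPhi) (e, q)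
     - 2^-1 * alpha * (d_x (E e) q * par1E eta nu A1 A2 (e, q) + d_z (E e) q * par2E eta nu A2 A3 (e, q))).
  exact: pintB p1 (pintZ _ pE).
rewrite (pint_add p1 p2) -(pint_scale _ pE) -(pint_scale _ pS).
have -> (r s t u w : R) : r - s + (t + u - w) = r + (t - s) + (u - w) by ring.
rewrite -(pint_sub p1 (pintZ _ pE)) -(pint_sub p2 (pintZ _ pS)).
congr (_ + _ + _); apply: eq_pint => q.
  rewrite !dot2E (perpE _).1 (perpE _).2 !(gradE _ q).1 !(gradE _ q).2.
  have [-> ->] := par_family F seta snu e q.
  have [-> ->] := par_Astar alpha c1 c3 (vary eta nu e) q.
  rewrite (d_x_vary_C1 e q CPhi CdPhi) (d_z_vary_C1 e q CPhi CdPhi) /starE /=.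
  rewrite /heightE /=.
  by move: (d_x (E e) q) (d_z (E e) q) (par1E _ _ _ _ _) (par2E _ _ _ _ _) => *; ring.
rewrite /Gamma -/(S e) !dot2E !(gradE _ q).1 !(gradE _ q).2 enorm_sqr dot2E (gradE _ q).1 (gradE _ q).2.
have [-> ->] := par_Astar alpha c1 c3 (vary eta nu e) q.
rewrite (d_x_vary seta snu) (d_z_vary seta snu) /potentialE tensionE; last exact: steepE_ge0.
rewrite /sink /steepE /heightE /=.
by move: (d_x (S e) q) (d_z (S e) q) (Num.sqrt _) (sin _) => *; ring.
Qed.

Let X0 := BVPsol h alpha eta Phi.
Let sf q : Q := (0, surf eta q).
Let d00 : `|0 : R| < d. Proof. by rewrite normr0. Qed.

Lemma BVPsol_trace :
  (forall q, par eta X0 q 0 0 = par1E eta nu A1 A2 (0, q) /\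
     par eta X0 q 0 1 = par2E eta nu A2 A3 (0, q)) /\
  forall q, [/\ curl X0 (surf eta q) 0 0 = V1 (sf q), curl X0 (surf eta q) 0 1 = V2 (sf q)
    & curl X0 (surf eta q) 0 2 = V3 (sf q)].
Proof.
have [_ _ pX cX] := BVPsol_family d00.
rewrite /X !vary0 in pX cX.
split=> q; last by rewrite cX; exact: curl_slices.
by rewrite pX; have := par_family F seta snu 0 q; rewrite vary0.
Qed.

Lemma trace_hodge : let E0 := invLap (div2 (fun q => perp (par eta X0 q))) in
  hodge (fun q => par eta X0 q 0 0) (fun q => par eta X0 q 0 1) (d_x E0) (d_z E0).
Proof.
have [_ _ pX _] := BVPsol_family d00; rewrite /X !vary0 in pX.
move=> E0; have := family_hodge seta snu rA1 rA2 rA3 bvp d00; cbv beta; rewrite vary0 -pX.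
have [a1 a2] : (fun q => par1E eta nu A1 A2 (0, q)) = (fun q => par eta X0 q 0 0) /\
  (fun q => par2E eta nu A2 A3 (0, q)) = (fun q => par eta X0 q 0 1).
  by split; apply/funext => q; [rewrite (BVPsol_trace.1 q).1|rewrite (BVPsol_trace.1 q).2].
by rewrite -a1 -a2.
Qed.

Lemma trace_tangential q : let E0 := invLap (div2 (fun q => perp (par eta X0 q))) in
  let v := curl X0 (surf eta q) in
  v 0 0 + v 0 1 * d_x eta q = d_x Phi q + alpha * d_z E0 q /\
  v 0 2 + v 0 1 * d_z eta q = d_z Phi q - alpha * d_x E0 q.
Proof.
have [_ _ pX _] := BVPsol_family d00; rewrite /X !vary0 in pX.
move=> E0 v; have S0 : surfE eta nu (0, q) = sf q by rewrite /surfE /= vary0.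
have := family_tangential seta snu CPhi CdPhi bvp q d00; cbv beta zeta.
rewrite S0 vary0 -pX /v.
have [-> -> ->] := BVPsol_trace.2 q.
have aux (x y u w : R) : x = y + 0 * u + w -> x = y + w by move=> ->; ring.
have aux2 (x y u w k z : R) : x + y * (u + 0 * w) = k -> k = z -> x + y * u = z by move=> <- <-; ring.
by move=> [t1 t2]; split; [apply: (aux2 _ _ _ _ _ _ t1)|apply: (aux2 _ _ _ _ _ _ t2)]; apply: aux.
Qed.

Lemma trace_vorticity_reg : [/\ preg (fun q => curl X0 (surf eta q) 0 0),
  preg (fun q => curl X0 (surf eta q) 0 1) & preg (fun q => curl X0 (surf eta q) 0 2)].
Proof.
have [v1 v2 v3] := qreg_vort rA1 rA2 rA3.
have [e0 _ _] := seta; have be := preg_breg e0.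
have K (V : Q -> R) (f : P -> R) : qreg d 2^-1 V -> (forall q, f q = V (sf q)) -> preg f.
  move=> rV fE; have -> : f = fun q => V (0, surf eta q) by apply/funext.
  exact: (reg_surf be (qreg_slice d00 rV)).
by split; [apply: (K V1 _ v1)|apply: (K V2 _ v2)|apply: (K V3 _ v3)] => q; have [] := BVPsol_trace.2 q.
Qed.

(** The surface form of Stokes: the planar curl of a tangential trace is the normal component of the
    curl. Written out by the chain rule, the mixed second derivatives of eta cancel and so do the
    products of the two slopes. *)
Lemma trace_divergence q : let v := curl X0 (surf eta q) in
  d_z (fun q => par eta X0 q 0 0) q - d_x (fun q => par eta X0 q 0 1) q
  = v 0 1 - d_x eta q * v 0 0 - d_z eta q * v 0 2.
Proof.
cbv zeta; have [-> -> ->] := BVPsol_trace.2 q.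
have [e0 [Cx _ _] [Cz _ _]] := seta; have be := preg_breg e0; have [Ce _ _] := e0.
have [[C1' _ _] [C2' _ _] [C3' _ _]] := And3 (qreg_slice d00 rA1.1) (qreg_slice d00 rA2.1) (qreg_slice d00 rA3.1).
have -> : (fun q => par eta X0 q 0 0) = fun q => A1 (0, surf eta q) + A2 (0, surf eta q) * d_x eta q.
  by apply/funext => r; rewrite (BVPsol_trace.1 r).1 /par1E /surfE /= vary0 mul0r addr0.
have -> : (fun q => par eta X0 q 0 1) = fun q => A3 (0, surf eta q) + A2 (0, surf eta q) * d_z eta q.
  by apply/funext => r; rewrite (BVPsol_trace.1 r).2 /par2E /surfE /= vary0 mul0r addr0.
have k1 := hderD (hder_surf be q (0, 1) C1') (hderM (hder_surf be q (0, 1) C2')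
  (hder_C1 ((0, 1) : P) Cx (I : setT q))).
have k2 := hderD (hder_surf be q (1, 0) C3') (hderM (hder_surf be q (1, 0) C2')
  (hder_C1 ((1, 0) : P) Cz (I : setT q))).
rewrite /d_z /d_x (hder_val k1) (hder_val k2) -/(d_x eta) -/(d_z eta).
rewrite (derive_comm openT Ce Cx Cz (fun _ _ => erefl) (fun _ _ => erefl) (I : setT q)).
rewrite !D_x_slice !D_y_slice !D_z_slice /V1 /V2 /V3 /vort1 /vort2 /vort3 -/(sf q).
rewrite -/(d_x eta q) -/(d_z eta q).
move: (dX _ _) (dY _ _) (dZ _ _) (dX _ _) (dY _ _) (dZ _ _) (dX _ _) (dY _ _) (dZ _ _) ('D_(1, 0) (d_z eta) q) => *; rewrite /=; ring.
Qed.


Let S0 := invLap (div2 (fun q => perp (par eta (Astar alpha c1 c3) q))).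

Lemma star_trace_hodge :
  hodge (fun q => star1 alpha c1 c3 (eta q)) (fun q => star3 alpha c1 c3 (eta q)) (d_x S0) (d_z S0).
Proof.
have := star_hodge d00; rewrite /S vary0 -/S0.
by rewrite /heightE /= vary0.
Qed.

Lemma inertia_decaying : decaying (inertia h alpha eta Phi).
Proof.
have [/reg_field/field_decaying v1 /reg_field/field_decaying v2 /reg_field/field_decaying v3] := trace_vorticity_reg.
have [_ /reg_field/field_decaying ex /reg_field/field_decaying ez] := seta.
have k1 := decayingZ 2^-1 (decayingD (decayingD (decayingM v1 v1) (decayingM v2 v2)) (decayingM v3 v3)).
exact: (decayingB k1 (decayingM (decayingB (decayingB v2 (decayingM ex v1)) (decayingM ez v3)) v2)).
Qed.

Lemma star_force_decaying : decaying (star_force alpha c1 c3 g sigma eta Phi).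
Proof.
have [e0 _ _] := seta; have de := field_decaying (reg_field e0).
have [_ [/field_decaying sx /field_decaying sz] _ _] := star_trace_hodge.
have px := field_decaying (reg_field rPx); have pz := field_decaying (reg_field rPz).
have [rc1 rc2] := reg_capillary sigma seta.
have kc := decayingD (reg_decaying_derive (1, 0) rc1) (reg_decaying_derive (0, 1) rc2).
have c1' : continuous (fun q => ustar1 alpha c1 c3 (eta q)).
  by move=> q; apply: (@continuous_comp _ _ _ eta); [exact: de.1|exact: ustar1_continuous].
have c3' : continuous (fun q => ustar3 alpha c1 c3 (eta q)).
  by move=> q; apply: (@continuous_comp _ _ _ eta); [exact: de.1|exact: ustar3_continuous].
have b1' : bnd setT (fun q => ustar1 alpha c1 c3 (eta q)).
  by exists (`|c1| + `|c3|) => q _; exact: ustar1_le.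
have b3' : bnd setT (fun q => ustar3 alpha c1 c3 (eta q)).
  by exists (`|c1| + `|c3|) => q _; exact: ustar3_le.
have k3 := decayingD (decayingM_bnd px c1' b1') (decayingM_bnd pz c3' b3').
have k4 := decayingZ alpha (decayingB (decayingM_bnd sz c1' b1') (decayingM_bnd sx c3' b3')).
exact: (decayingB (decayingD (decayingB k3 k4) (decayingZ g de)) kc).
Qed.

Lemma is_derive_Lagrangian_family : is_derive (0 : R) (1 : R)
  (fun e => Lagrangian h alpha c1 c3 g sigma (vary eta nu e) (vary Phi dPhi e))
  (\int[@area R]_q (d_x dPhi q * (par eta X0 q 0 1 + star3 alpha c1 c3 (eta q))
     - d_z dPhi q * (par eta X0 q 0 0 + star1 alpha c1 c3 (eta q))
     + nu q * (inertia h alpha eta Phi q + star_force alpha c1 c3 g sigma eta Phi q))).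
Proof.
have D1 := is_derive_variation d0 seta snu rPx rPz rdPx rdPz rA1 rA2 rA3
  (family_beltrami rA1 rA2 rA3 above bvp) (family_no_slip bvp)
  (family_tangential seta snu CPhi CdPhi bvp) (fun e ed => family_hodge seta snu rA1 rA2 rA3 bvp ed).
have D2 := is_derive_star_variation g sigma alpha0 d0 seta snu rPx rPz rdPx rdPz star_hodge.
have D := is_deriveD D1 D2.
have [[/field_decaying a1 /field_decaying a2] _ _ _] := trace_hodge.
have [[/field_decaying b1 /field_decaying b3] _ _ _] := star_trace_hodge.
have px := field_decaying (reg_field rdPx); have pz := field_decaying (reg_field rdPz).
have [n0 _ _] := snu; have dn := field_decaying (reg_field n0).
have p1 := pintD (pintB (decaying_pint px a2) (decaying_pint pz a1)) (decaying_pint dn inertia_decaying).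
have p2 := pintD (pintB (decaying_pint px b3) (decaying_pint pz b1)) (decaying_pint dn star_force_decaying).
set T := (X in is_derive _ _ _ X).
have TE : T = \int[@area R]_q (d_x dPhi q * par eta X0 q 0 1 - d_z dPhi q * par eta X0 q 0 0
      + nu q * inertia h alpha eta Phi q)
    + \int[@area R]_q (d_x dPhi q * star3 alpha c1 c3 (eta q) - d_z dPhi q * star1 alpha c1 c3 (eta q)
      + nu q * star_force alpha c1 c3 g sigma eta Phi q).
  rewrite -(pint_add p1 p2); apply: eq_pint => q.
  move: (inertia _ _ _ _ _) (star_force _ _ _ _ _ _ _ _) (d_x _ _) (d_z _ _) => *; ring.
have E1 : \int[@area R]_q (d_x dPhi q * par eta X0 q 0 1 - d_z dPhi q * par eta X0 q 0 0
      + nu q * inertia h alpha eta Phi q) = \int[@area R]_q let p := (0, surf eta q) in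
      (par2E eta nu A2 A3 (0, q) * d_x dPhi q - par1E eta nu A1 A2 (0, q) * d_z dPhi q
       + nu q * (2^-1 * (V1 p * V1 p + V2 p * V2 p + V3 p * V3 p)
                 - (V2 p - d_x eta q * V1 p - d_z eta q * V3 p) * V2 p)).
  apply: eq_pint => q; have [-> ->] := BVPsol_trace.1 q; rewrite /inertia -/X0.
  have [-> -> ->] := BVPsol_trace.2 q; cbv zeta; rewrite -/(sf q).
  by rewrite (mulrC (d_x dPhi q)) (mulrC (d_z dPhi q)).
have S00 : S 0 = S0 by rewrite /S vary0.
have E2 : \int[@area R]_q (d_x dPhi q * star3 alpha c1 c3 (eta q) - d_z dPhi q * star1 alpha c1 c3 (eta q)
      + nu q * star_force alpha c1 c3 g sigma eta Phi q) = \int[@area R]_q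
      (d_x dPhi q * star3 alpha c1 c3 (eta q) - d_z dPhi q * star1 alpha c1 c3 (eta q)
       + nu q * (d_x Phi q * ustar1 alpha c1 c3 (eta q) + d_z Phi q * ustar3 alpha c1 c3 (eta q)
         - alpha * (d_z (S 0) q * ustar1 alpha c1 c3 (eta q) - d_x (S 0) q * ustar3 alpha c1 c3 (eta q))
         + g * eta q - (d_x (fun q => sigma * (d_x eta q * invslope (steep eta q))) q
             + d_z (fun q => sigma * (d_z eta q * invslope (steep eta q))) q))).
  by apply: eq_pint => q; rewrite S00.
rewrite TE E1 E2 {TE E1 E2}.
set L := (X in is_derive _ _ X _) in D.
have LE e : `|e| < d -> L e = Lagrangian h alpha c1 c3 g sigma (vary eta nu e) (vary Phi dPhi e).
  by move=> ed; rewrite (Lagrangian_family ed).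
(* The decomposition is available for |e| < d only, so the derivative at 0 is carried over by
   equality of germs. *)
have nE : \forall e \near (0 : R), L e = Lagrangian h alpha c1 c3 g sigma (vary eta nu e) (vary Phi dPhi e).
  exists d => [//|e]; rewrite /ball /= sub0r normrN; exact: LE.
exact (near_eq_is_derive nE D).
Qed.

End LagrangianFamily.

(** * Test functions *)

Section Positivity.
Context {R : realType}.
Notation P := (R * R)%type.

Lemma pint_eq0 (f : P -> R) : continuous f -> pint f -> (forall q, 0 <= f q) ->
  \int[@area R]_q f q = 0 -> forall q, f q = 0.
Proof.
move=> cf pf f0 If q0; apply/eqP; rewrite eq_le f0 andbT leNgt; apply/negP => c0.
set c := f q0 in c0.
have /cvgrPdist_lt/(_ (c / 2) (divr_gt0 c0 (ltr0n R 2))) [[Bx Bz] /= [nx nz] Bf] := cf q0.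
move: nx nz Bf; rewrite !nbhs_ballP => -[d1 /= d10 H1] [d2 /= d20 H2] Bf.
pose d := Num.min d1 d2 / 2; have d0 : 0 < d by rewrite divr_gt0// lt_min d10 d20.
have [dd1 dd2] : d < d1 /\ d < d2.
  have m1 : Num.min d1 d2 <= d1 by rewrite ge_min lexx.
  have m2 : Num.min d1 d2 <= d2 by rewrite ge_min lexx orbT.
  by rewrite /d; move: m1 m2 d0; rewrite /d; move: (Num.min _ _) => m *; split; lra.
pose B : set P := `[q0.1 - d, q0.1 + d]%classic `*` `[q0.2 - d, q0.2 + d]%classic.
have mB : measurable (B : set (measurableTypeR R * measurableTypeR R)).
  by apply: measurableX; exact: measurable_itv.
have fB q : B q -> c / 2 <= f q.
  move=> [/=]; rewrite !in_itv /= => /andP[x1 x2] /andP[z1 z2].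
  have : `|f q0 - f q| < c / 2.
    apply: (Bf q); split; [apply: H1|apply: H2]; rewrite /ball /= ltr_norml; apply/andP; split; lra.
  rewrite -/c ltr_norml => /andP[]; lra.
have mf : measurable_fun setT (EFin \o f : measurableTypeR R * measurableTypeR R -> \bar R).
  by have /integrableP[] := pf.
have aB : (@area R) B = ((2 * d) ^+ 2)%:E.
  have mI y : lebesgue_measure (`[(y - d)%R, (y + d)%R]%classic : set R) = (2 * d)%:E.
    rewrite lebesgue_measure_itv /= lte_fin ifT; last by lra.
    by rewrite -EFinB; congr EFin; ring.
  rewrite /area product_measure1E; try exact: measurable_itv.
  by rewrite [X in (X * _)%E]mI [X in (_ * X)%E]mI -EFinM.
have L : ((c / 2)%:E * (@area R) B <= \int[@area R]_q (f q)%:E)%E.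
  rewrite -integral_cst//.
  apply: (@le_trans _ _ (\int[@area R]_(q in B) (f q)%:E)%E).
    apply: ge0_le_integral => //.
    - by move=> q _; rewrite lee_fin; lra.
    - by apply: measurable_funTS.
  by apply: ge0_subset_integral => // q _; rewrite lee_fin.
have fin : (\int[@area R]_q (f q)%:E)%E \is a fin_num by exact: integrable_fin_num.
move: L; rewrite -(fineK fin) -/(Rintegral (@area R) setT f) If aB -EFinM lee_fin.
have p : 0 < c / 2 * (2 * d) ^+ 2 by rewrite mulr_gt0 ?divr_gt0// exprn_gt0// mulr_gt0.
by rewrite leNgt p.
Qed.

End Positivity.

(** * A rational kernel and its derivatives *)

Section Kernel.
Context {R : realType}.
Notation P := (R * R)%type.
Variable q0 : P.

Let rho (q : P) : R := 1 + (q.1 - q0.1) ^+ 2 + (q.2 - q0.2) ^+ 2.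
(** A rational function with its maximum 1 at [q0]: high powers concentrate there like an
    approximate identity, and each of them lies in the class of admissible variations. *)
Definition kernel (q : P) : R := (rho q)^-1.

Let rho_ge1 q : 1 <= rho q.
Proof. by rewrite /rho -addrA lerDl addr_ge0 ?sqr_ge0. Qed.

Let rho_neq0 q : rho q != 0.
Proof. by rewrite gt_eqF// (lt_le_trans ltr01). Qed.

Lemma kernel_gt0 q : 0 < kernel q.
Proof. by rewrite invr_gt0 (lt_le_trans ltr01). Qed.

Lemma kernel_le1 q : kernel q <= 1.
Proof. by rewrite invf_le1 ?(lt_le_trans ltr01). Qed.

Lemma kernel_center : kernel q0 = 1.
Proof. by rewrite /kernel /rho !subrr !expr0n /= !addr0 invr1. Qed.

Let B1 q := (q.1 - q0.1) * kernel q.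
Let B2 q := (q.2 - q0.2) * kernel q.

(* The algebra generated by these functions is closed under differentiation. *)
Inductive kernel_poly : (P -> R) -> Prop :=
| kp_kernel : kernel_poly kernel
| kp_fst : kernel_poly B1
| kp_snd : kernel_poly B2
| kp_cst c : kernel_poly (fun=> c)
| kpD f g : kernel_poly f -> kernel_poly g -> kernel_poly (fun q => f q + g q)
| kpM f g : kernel_poly f -> kernel_poly g -> kernel_poly (fun q => f q * g q).

Lemma kp_bnd f : kernel_poly f -> bnd setT f.
Proof.
have bk (t : R) q : t ^+ 2 <= rho q -> `|t * kernel q| <= 1.
  move=> tr; rewrite normrM (ger0_norm (ltW (kernel_gt0 q))) /kernel.
  rewrite ler_pdivrMr ?(lt_le_trans ltr01)// mul1r.
  have : `|t| ^+ 2 <= rho q by rewrite real_normK ?num_real.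
  by have := rho_ge1 q; move: (rho q) `|t| => r s *; nra.
elim=> [|||c|f1 g _ bf _ bg|f1 g _ bf _ bg].
- by exists 1 => q _; rewrite (ger0_norm (ltW (kernel_gt0 q))) kernel_le1.
- by exists 1 => q _; apply: bk; have := sqr_ge0 (q.2 - q0.2); rewrite /rho; lra.
- by exists 1 => q _; apply: bk; have := sqr_ge0 (q.1 - q0.1); rewrite /rho; lra.
- exact: bnd_cst.
- exact: bndD.
- exact: bndM.
Qed.

Let diff_shift1 (q : P) : differentiable (fun q : P => q.1 - q0.1) q.
Proof. by apply: differentiableB => //; exact: differentiable_fst. Qed.

Let diff_shift2 (q : P) : differentiable (fun q : P => q.2 - q0.2) q.
Proof. by apply: differentiableB => //; exact: differentiable_snd. Qed.

Let hder_shift1 (q v : P) : hder q v (fun q : P => q.1 - q0.1) v.1.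
Proof.
have h1 : hder q v (fst : P -> R) v.1 by apply: hder_linear => p; exact: cvg_fst.
by apply: (hder_conv (hderD h1 (hderN (hder_cst q0.1 q v)))); rewrite oppr0 addr0.
Qed.

Let hder_shift2 (q v : P) : hder q v (fun q : P => q.2 - q0.2) v.2.
Proof.
have h1 : hder q v (snd : P -> R) v.2 by apply: hder_linear => p; exact: cvg_snd.
by apply: (hder_conv (hderD h1 (hderN (hder_cst q0.2 q v)))); rewrite oppr0 addr0.
Qed.

Let diff_rho q : differentiable rho q.
Proof.
have -> : rho = fun q => 1 + (q.1 - q0.1) * (q.1 - q0.1) + (q.2 - q0.2) * (q.2 - q0.2).
  by apply/funext => p; rewrite /rho !expr2.
by apply: differentiableD; [apply: differentiableD => //|]; exact: differentiableM.
Qed.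

Let hder_rho (q v : P) : hder q v rho (2 * (v.1 * (q.1 - q0.1) + v.2 * (q.2 - q0.2))).
Proof.
have h1 := hder_shift1 q v; have h2 := hder_shift2 q v.
rewrite /rho; under eq_fun do rewrite !expr2.
apply: (hder_conv (hderD (hderD (hder_cst 1 q v) (hderM h1 h1)) (hderM h2 h2))); ring.
Qed.

Lemma hder_kernel (q v : P) : hder q v kernel (- 2 * kernel q * (v.1 * B1 q + v.2 * B2 q)).
Proof.
have [dr Dr] := hder_rho q v.
split; first exact: derivableV.
have -> : 'D_v kernel q = - (rho q) ^- 2 *: 'D_v rho q by exact: deriveV.
rewrite Dr /B1 /B2 /kernel [_ *: _]mulrC.
have := rho_neq0 q; move: (rho q) (q.1 - _) (q.2 - _) => r x y r0; by field.
Qed.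

Lemma kp_derive f : kernel_poly f -> (forall q, differentiable f q) /\
  forall v, exists2 g, kernel_poly g & forall q, hder q v f (g q).
Proof.
have dk q : differentiable kernel q by exact: differentiableV.
have kd v : kernel_poly (fun q => - 2 * (v.1 * B1 q + v.2 * B2 q)).
  apply: kpM; first exact: kp_cst.
  by apply: kpD; apply: kpM; first [exact: kp_cst|exact: kp_fst|exact: kp_snd].
elim=> [|||c|f1 g kf [df IHf] kg [dg IHg]|f1 g kf [df IHf] kg [dg IHg]].
- split=> // v; exists (fun q => kernel q * (- 2 * (v.1 * B1 q + v.2 * B2 q))).
    by apply: kpM; [exact: kp_kernel|exact: kd].
  by move=> q; apply: (hder_conv (hder_kernel q v)); ring.
- split=> [q|v]; first exact: differentiableM.
  exists (fun q => v.1 * kernel q + B1 q * (- 2 * (v.1 * B1 q + v.2 * B2 q))).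
    apply: kpD; apply: kpM; first [exact: kp_cst|exact: kp_kernel|exact: kp_fst|exact: kd].
  move=> q; apply: (hder_conv (hderM (hder_shift1 q v) (hder_kernel q v))).
  by rewrite /B1; ring.
- split=> [q|v]; first exact: differentiableM.
  exists (fun q => v.2 * kernel q + B2 q * (- 2 * (v.1 * B1 q + v.2 * B2 q))).
    apply: kpD; apply: kpM; first [exact: kp_cst|exact: kp_kernel|exact: kp_snd|exact: kd].
  move=> q; apply: (hder_conv (hderM (hder_shift2 q v) (hder_kernel q v))).
  by rewrite /B2; ring.
- split=> [q|v]; first exact: differentiable_cst.
  by exists (fun=> 0) => [|q]; [exact: kp_cst|exact: hder_cst].
- split=> [q|v]; first exact: differentiableD.
  have [f' kf' hf] := IHf v; have [g' kg' hg] := IHg v.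
  by exists (fun q => f' q + g' q) => [|q]; [exact: kpD|exact: hderD].
- split=> [q|v]; first exact: differentiableM.
  have [f' kf' hf] := IHf v; have [g' kg' hg] := IHg v.
  exists (fun q => f1 q * g' q + g q * f' q) => [|q]; first by apply: kpD; exact: kpM.
  exact: hderM.
Qed.

(** The derivative of [kernel] is again [kernel] times an element of the algebra. Every iterated
    derivative therefore keeps one factor [kernel], which provides the decay, while the other factor
    is bounded. *)
Lemma kernel_poly_iterD (vs : seq P) f : kernel_poly f ->
  exists2 g, kernel_poly g & Defs.iterD vs (fun q => kernel q * f q) = fun q => kernel q * g q.
Proof.
move=> kf; elim: vs => [|v vs [g kg E]]; first by exists f.
have [_ /(_ v)[g' kg' hg]] := kp_derive kg.
exists (fun q => g' q + g q * (- 2 * (v.1 * B1 q + v.2 * B2 q))).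
  apply: kpD => //; apply: kpM => //; apply: kpM; first exact: kp_cst.
  by apply: kpD; apply: kpM; first [exact: kp_cst|exact: kp_fst|exact: kp_snd].
apply/funext => q; rewrite /= E; apply: hder_val.
by apply: (hder_conv (hderM (hder_kernel q v) (hg q))); ring.
Qed.

Lemma kernel_decays : decays 2^-1 idfun setT kernel.
Proof.
(* The constant is that of Peetre's inequality 1 + |q|^2 <= 2 (1 + |q - q0|^2)(1 + |q0|^2); the rate
   1 exceeds 1/2. *)
exists 1, (2 * (1 + q0.1 ^+ 2 + q0.2 ^+ 2)); split; first by lra.
move=> q _; rewrite (ger0_norm (ltW (kernel_gt0 q))) powRN powRr1; last first.
  by rewrite !addr_ge0 ?sqr_ge0.
have w1 : 0 < 1 + q.1 ^+ 2 + q.2 ^+ 2 by apply: lt_le_trans (wt_base_ge1 q).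
rewrite ler_pdivlMr// /kernel ler_pdivrMl ?(lt_le_trans ltr01)// /rho.
have aux (x y a b : R) : 1 + x ^+ 2 + y ^+ 2 <=
    (1 + (x - a) ^+ 2 + (y - b) ^+ 2) * (2 * (1 + a ^+ 2 + b ^+ 2)).
  have s1 := sqr_ge0 (x - 2 * a); have s2 := sqr_ge0 (y - 2 * b).
  have m1 : 0 <= ((x - a) ^+ 2 + (y - b) ^+ 2) * (a ^+ 2 + b ^+ 2).
    by apply: mulr_ge0; rewrite addr_ge0 ?sqr_ge0.
  have t1 : x ^+ 2 <= 2 * (x - a) ^+ 2 + 2 * a ^+ 2 by rewrite -subr_ge0; move: s1; congr (0 <= _); ring.
  have t2 : y ^+ 2 <= 2 * (y - b) ^+ 2 + 2 * b ^+ 2 by rewrite -subr_ge0; move: s2; congr (0 <= _); ring.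
  lra.
exact: aux.
Qed.

Lemma kernel_poly_test f : kernel_poly f -> decaying_smooth (fun q => kernel q * f q).
Proof.
move=> kf; split=> [n vs _ p _|vs]; have [g kg ->] := kernel_poly_iterD vs kf.
  have [dg _] := kp_derive kg.
  have dk : differentiable (fun q => kernel q * g q) p.
    by apply: differentiableM => //; exact: (kp_derive kp_kernel).1.
  by split=> // ; exact: differentiable_continuous.
exact: decaysM_bnd kernel_decays (kp_bnd kg).
Qed.

Lemma kernel_exp_test k : decaying_smooth (fun q => kernel q ^+ k.+1).
Proof.
have kpX : kernel_poly (fun q => kernel q ^+ k).
  elim: k => [|k IH]; first exact: kp_cst.
  by under eq_fun do rewrite exprS; apply: kpM => //; exact: kp_kernel.
by under eq_fun do rewrite exprS; exact: kernel_poly_test.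
Qed.

End Kernel.

(** * The fundamental lemma of the calculus of variations *)

Section FundamentalLemma.
Context {R : realType}.
Notation P := (R * R)%type.

Lemma geometric_bound (t M : R) : 0 < t -> (forall k : nat, (1 + t) ^+ k <= M) -> False.
Proof.
move=> t0 H; have bern k : 1 + t * k%:R <= (1 + t) ^+ k.
  elim: k => [|k IH]; first by rewrite mulr0 addr0 expr0.
  rewrite exprS -[k.+1%:R]natr1; have k0 : 0 <= k%:R :> R by [].
  have : (1 + t) * (1 + t * k%:R) <= (1 + t) * (1 + t) ^+ k by rewrite ler_wpM2l//; lra.
  by apply: le_trans; rewrite -subr_ge0; move: (k%:R : R) k0 => n n0; nra.
pose k := (Num.truncn (M / t)).+1.
have kM : M / t < k%:R by rewrite /k truncnS_gt.
have := le_trans (bern k) (H k).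
move: kM; rewrite ltr_pdivrMr// mulrC => kM; lra.
Qed.

Lemma kernel_away (q0 : P) (d : R) q : 0 < d -> (1 + d ^+ 2)^-1 < kernel q0 q ->
  `|q0.1 - q.1| < d /\ `|q0.2 - q.2| < d.
Proof.
move=> d0; have r1 : 0 < 1 + d ^+ 2 by rewrite ltr_pwDl ?sqr_ge0.
have := kernel_gt0 q0 q; rewrite /kernel invr_gt0 => k0.
rewrite ltf_pV2 ?posrE//.
have s1 := sqr_ge0 (q.1 - q0.1); have s2 := sqr_ge0 (q.2 - q0.2).
have aux (x : R) : x ^+ 2 < d ^+ 2 -> `|x| < d.
  by move=> xd; rewrite -ltr_sqr ?nnegrE ?(ltW d0)// real_normK ?num_real.
by move=> H; split; rewrite distrC; apply: aux; lra.
Qed.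

(* If K >= c/2 > 0 where the kernel A exceeds r, then for r < r1 < 1
   [A^(k+2) K + M r^k A^2 >= (c/2) r1^k A^2 max(0, A - r1)], and (r1/r)^k is unbounded. *)
Lemma fundamental_lemma_nonpos (K : P -> R) : decaying K ->
  (forall f, decaying_smooth f -> \int[@area R]_q (f q * K q) = 0) -> forall q0, K q0 <= 0.
Proof.
move=> dK H q0; rewrite leNgt; apply/negP => c0.
set c := K q0 in c0; have [cK _] := dK.
have [M MK] : bnd setT K by apply: (decays_bnd _ dK.2); rewrite invr_ge0 ler0n.
have M0 : 0 <= M := le_trans (normr_ge0 _) (MK q0 I).
have /cvgrPdist_lt/(_ (c / 2) (divr_gt0 c0 (ltr0n R 2))) [[Bx Bz] /= [nx nz] Bf] := cK q0.
move: nx nz Bf; rewrite !nbhs_ballP => -[d1 /= d10 H1] [d2 /= d20 H2] Bf.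
pose d := Num.min d1 d2; have d0 : 0 < d by rewrite lt_min d10 d20.
pose r := (1 + d ^+ 2)^-1; have r0 : 0 < r by rewrite invr_gt0 ltr_pwDl ?sqr_ge0.
have dd : 0 < d ^+ 2 by rewrite exprn_gt0.
have r_lt1 : r < 1 by rewrite invf_lt1; lra.
pose r1 := (r + 1) / 2; have [rr1 r11] : r < r1 /\ r1 < 1 by rewrite /r1; split; lra.
pose A := kernel q0.
have Kc q : r < A q -> c / 2 <= K q.
  move=> /(kernel_away d0)[x1 x2].
  have : `|K q0 - K q| < c / 2.
    apply: (Bf q); split; [apply: H1|apply: H2]; rewrite /ball /=.
      by apply: (lt_le_trans x1); rewrite ge_min lexx.
    by apply: (lt_le_trans x2); rewrite ge_min lexx orbT.
  by rewrite -/c ltr_norml => /andP[]; lra.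
have A0 q : 0 < A q := kernel_gt0 q0 q; have A1 q : A q <= 1 := kernel_le1 q0 q.
have cA : continuous A by move=> q; apply: differentiable_continuous; exact: (kp_derive (kp_kernel q0)).1.
have dA : decaying A by split=> //; exact: kernel_decays.
(* A continuous cut-off that takes the place of an indicator: it is positive only where [A] > [r1],
   and at [q0] it equals 1 - r1 > 0, so that the integral [J] is positive. *)
pose s q := Num.max 0 (A q - r1).
have cs : continuous s by move=> q; apply: (@continuous_max _ _ (fun=> 0) (fun q => A q - r1));
  [exact: cvg_cst|apply: cvgB; [exact: cA|exact: cvg_cst]].
have s0 q : 0 <= s q by rewrite le_max lexx.
have s1 q : s q <= 1 by rewrite ge_max ler01 /=; have := A1 q; have := rr1; lra.
have ds : decaying (fun q => A q * s q).
  by apply: decayingM_bnd => //; exists 1 => q _; rewrite ger0_norm.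
have pA : pint (fun q => A q * A q) by exact: decaying_pint.
have ps : pint (fun q => A q * (A q * s q)) by exact: decaying_pint.
pose I := \int[@area R]_q (A q * A q); pose J := \int[@area R]_q (A q * (A q * s q)).
have J0 : 0 < J.
  have g0 q : 0 <= A q * (A q * s q) by rewrite !mulr_ge0// ltW.
  rewrite lt_def pint_ge0// andbT; apply/eqP => J0.
  have := pint_eq0 (_ : continuous (fun q => A q * (A q * s q))) ps g0 J0 q0.
  rewrite /s /A kernel_center !mul1r => E; have {E} := E _.
  have -> : Num.max 0 (1 - r1) = 1 - r1 by apply: max_r; lra.
  move=> E; suff : 1 - r1 = 0 by lra.
  by apply: E => q; apply: cvgM; [exact: cA|exact: ds.1].
have ineq k q : c / 2 * r1 ^+ k * (A q * (A q * s q)) <= A q ^+ k.+2 * K q + M * r ^+ k * (A q * A q).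
  have Ak : A q ^+ k.+2 = A q * A q * A q ^+ k by rewrite !exprS mulrA.
  have AA : 0 <= A q * A q by rewrite mulr_ge0 ?ltW.
  have rk : 0 <= r ^+ k by rewrite exprn_ge0 ?ltW.
  rewrite Ak; have [Ar|rA] := leP (A q) r.
    have -> : s q = 0 by apply: max_l; lra.
    rewrite !mulr0 -mulrA -[M * _ * _]mulrC -mulrDr mulr_ge0//.
    have Akr : A q ^+ k <= r ^+ k by apply: lerXn2r; rewrite ?nnegrE ?(ltW (A0 q)) ?(ltW r0).
    have Ak0 : 0 <= A q ^+ k by rewrite exprn_ge0 ?ltW.
    have := MK q Logic.I; rewrite ler_norml => /andP[KM _].
    have : A q ^+ k * - M <= A q ^+ k * K q by rewrite ler_wpM2l.
    have : A q ^+ k * M <= r ^+ k * M by rewrite ler_wpM2r.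
    by move: (A q ^+ k) (r ^+ k) => *; lra.
  have K0 := Kc q rA.
  have T : c / 2 * r1 ^+ k * s q <= A q ^+ k * K q.
    have [Ar|r1A] := leP (A q) r1.
      have -> : s q = 0 by apply: max_l; lra.
      by rewrite mulr0 mulr_ge0 ?exprn_ge0 ?ltW//; lra.
    have k1 : r1 ^+ k <= A q ^+ k by apply: lerXn2r; rewrite ?nnegrE ?(ltW (A0 q)) ?(ltW r1A)//; lra.
    have k2 : 0 <= r1 ^+ k by rewrite exprn_ge0//; lra.
    have c2 : 0 <= c / 2 by lra.
    apply: (@le_trans _ _ (r1 ^+ k * (c / 2))).
      by rewrite [leRHS]mulrC ler_piMr// mulr_ge0.
    by apply: ler_pM.
  have := ler_wpM2l AA T; have : 0 <= M * r ^+ k * (A q * A q) by apply: mulr_ge0 AA; exact: mulr_ge0.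
  by move: (A q ^+ k) (r ^+ k) (r1 ^+ k) => *; lra.
have int k : c / 2 * r1 ^+ k * J <= M * r ^+ k * I.
  have pk : pint (fun q => A q ^+ k.+2 * K q).
    apply: decaying_pint dK; exact: field_decaying (reg_field (decaying_smooth_reg [::] (kernel_exp_test q0 k.+1))).
  rewrite /J /I -(pint_scale _ ps) -(pint_scale _ pA).
  rewrite -[leRHS]add0r -(H _ (kernel_exp_test q0 k.+1)) -(pint_add pk (pintZ _ pA)).
  apply: (pint_le (pintZ _ ps) (pintD pk (pintZ _ pA))) => q; exact: ineq.
(* The integrated inequality says (r1/r)^k <= M I / (c/2 J) for all k, although r1/r > 1. *)
apply: (@geometric_bound (r1 / r - 1) (M * I / (c / 2 * J))).
  by rewrite subr_gt0 ltr_pdivlMr// mul1r.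
move=> k; rewrite addrC subrK expr_div_n ler_pdivlMr ?mulr_gt0 ?divr_gt0//.
rewrite mulrC mulrA ler_pdivrMr ?exprn_gt0//.
by have := int k; move: (r ^+ k) (r1 ^+ k) => *; lra.
Qed.

Lemma fundamental_lemma (K : P -> R) : decaying K ->
  (forall f, decaying_smooth f -> \int[@area R]_q (f q * K q) = 0) -> forall q, K q = 0.
Proof.
move=> dK H q; apply/eqP; rewrite eq_le fundamental_lemma_nonpos//=.
rewrite -oppr_le0; apply: (@fundamental_lemma_nonpos (fun q => - K q)).
  by have := decayingZ (-1) dK; under eq_fun do rewrite mulN1r.
move=> f sf; have pf : pint (fun q => f q * K q).
  by apply: decaying_pint dK; exact: field_decaying (reg_field (decaying_smooth_reg [::] sf)).
by under eq_Rintegral do rewrite mulrN -mulN1r; rewrite (pint_scale _ pf) H// mulr0.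
Qed.

End FundamentalLemma.

(** * The Euler-Lagrange equations *)

Section Stationarity.
Context {R : realType}.
Notation P := (R * R)%type.
Notation preg f := (reg idfun (@setT P) (@setT P) 2^-1 f).

Lemma iterD0 (vs : seq P) : Defs.iterD vs (fun=> 0 : R) = fun=> 0.
Proof.
elim: vs => [//|v vs IH]; apply/funext => q /=; rewrite IH.
exact: (@derive_cst _ _ _ (0 : R) q v).
Qed.

Lemma d_x0 (q : P) : d_x (fun=> 0 : R) q = 0.
Proof. exact: (@derive_cst _ _ _ (0 : R)). Qed.

Lemma d_z0 (q : P) : d_z (fun=> 0 : R) q = 0.
Proof. exact: (@derive_cst _ _ _ (0 : R)). Qed.

Lemma decaying_smooth0 : decaying_smooth (fun _ : P => 0 : R).
Proof.
split=> [n vs _ q _|vs]; rewrite iterD0; last exact: decays0.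
split=> [|_]; [exact: cst_continuous|exact: differentiable_cst].
Qed.

Lemma decaying_smooth_admissible (f : P -> R) : decaying_smooth f -> admissible_potential f.
Proof.
move=> [sf df]; split=> [//||vs _]; last exact: df.
by apply: decays_weak (df [::]); rewrite invr_ge0 ler0n.
Qed.

(** One direction integrates by parts in the plane. For the other the fundamental lemma applies
    twice; test functions for Phi are taken among the decaying smooth functions, for which the
    integration by parts is justified by [reg_divergence]. *)
Lemma stationary_iff (a1 a2 K : P -> R) : preg a1 -> preg a2 -> decaying K ->
  (forall f F, decaying_smooth f -> admissible_potential F ->
     \int[@area R]_q (d_x F q * a2 q - d_z F q * a1 q + f q * K q) = 0) <->
  (forall q, d_z a1 q - d_x a2 q = 0) /\ (forall q, K q = 0).
Proof.
move=> r1 r2 dK; have T := @subset_refl _ [set: P].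
have [[C1' d1 _] [C2' d2 _]] := (r1, r2).
split=> [H|[div0 K0] f F sf aF]; last first.
  have [rx rz] := admissible_potential_reg aF.
  have [px pz] := (field_decaying (reg_field rx), field_decaying (reg_field rz)).
  have [sF dF _] := aF; have CF : C1 setT F := smooth_C1 [::] sF.
  (* An admissible potential may decay arbitrarily slowly. Its boundedness is enough here, since the
     products F a keep the decay of a. *)
  have bF : bnd setT F := decays_bnd (lexx 0) dF.
  have CN : C1 setT (fun q => - (F q * a1 q)) := C1N openT (C1M openT CF C1').
  have E q : d_x (fun q => F q * a2 q) q + d_z (fun q => - (F q * a1 q)) q
      = d_x F q * a2 q - d_z F q * a1 q.
    rewrite (d_zN q (C1M openT CF C1')) /d_x /d_z (derive_C1M _ CF C2' (I : setT q)) (derive_C1M _ CF C1' (I : setT q)).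
    have := div0 q; rewrite /d_x /d_z => /subr0_eq ->.
    by move: (F q) (a1 q) (a2 q) ('D_(1, 0) F q) ('D_(0, 1) F q) => *; ring.
  transitivity (\int[@area R]_q (d_x (fun q => F q * a2 q) q + d_z (fun q => - (F q * a1 q)) q)).
    by apply: eq_pint => q; rewrite E K0 mulr0 addr0.
  have pE : pint (fun q => d_x (fun q => F q * a2 q) q + d_z (fun q => - (F q * a1 q)) q).
    have := pintB (decaying_pint px (field_decaying (reg_field r2))) (decaying_pint pz (field_decaying (reg_field r1))).
    by congr pint; apply/funext => q; rewrite E.
  exact (plane_divergence_C1 (C1M openT CF C2') CN (bndM_decays bF d2) (decaysN (bndM_decays bF d1)) pE).
(* The two variations are tested separately, each time with the other one equal to zero. *)
have ad0 := decaying_smooth_admissible decaying_smooth0.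
split; last first.
  apply: fundamental_lemma dK _ => f sf; rewrite -[RHS](H f _ sf ad0); apply: eq_pint => q.
  by rewrite d_x0 d_z0 !mul0r subrr add0r.
apply: fundamental_lemma => [|f sf].
  by apply: decayingB; exact: reg_decaying_derive.
have rf : preg f := decaying_smooth_reg [::] sf.
have [[Cf _ _] df] := (rf, field_decaying (reg_field rf)).
have rg1 := reg_half2 openT T rf r2; have rg2 := regN openT T (reg_half2 openT T rf r1).
have [pdiv div0] := reg_divergence rg1 rg2.
have pm : pint (fun q => f q * (d_z a1 q - d_x a2 q)).
  by apply: decaying_pint => //; apply: decayingB; exact: reg_decaying_derive.
have S := pint_add pm pdiv; rewrite div0 addr0 in S; rewrite -S.
apply: (etrans _ (H _ _ decaying_smooth0 (decaying_smooth_admissible sf))); apply: eq_pint => q.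
rewrite (d_zN q (C1M openT Cf C1')) /d_x /d_z (derive_C1M _ Cf C2' (I : setT q)) (derive_C1M _ Cf C1' (I : setT q)).
by move: (f q) (a1 q) (a2 q) ('D_(1, 0) f q) ('D_(0, 1) f q) ('D_(1, 0) a2 q) ('D_(0, 1) a1 q) => *; ring.
Qed.

Lemma hodgeD (a1 a2 E1 E2 b1 b2 G1 G2 : P -> R) : hodge a1 a2 E1 E2 -> hodge b1 b2 G1 G2 ->
  hodge (fun q => a1 q + b1 q) (fun q => a2 q + b2 q)
        (fun q => E1 q + G1 q) (fun q => E2 q + G2 q).
Proof.
move=> ha hb.
have f0 : field (fun=> 0 : R) by split; [exact: C1_cst openT _|exact: decays0].
have h0 : hodge (fun=> 0 : R) (fun=> 0 : R) (fun=> 0 : R) (fun=> 0 : R).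
  split=> [||q|q]; [exact: (conj f0 f0)|exact: (conj f0 f0)|by rewrite d_x0 d_z0|].
  have -> : (fun _ : P => - 0 - 0 : R) = fun=> 0 by apply/funext => p; rewrite !oppr0 addr0.
  have -> : (fun _ : P => 0 - 0 : R) = fun=> 0 by apply/funext => p; rewrite subr0.
  by rewrite d_x0 d_z0 addr0.
have := hodgeB ha (hodgeB h0 hb).
have E (f k : P -> R) : (fun q => f q - (0 - k q)) = fun q => f q + k q.
  by apply/funext => q; rewrite sub0r opprK.
by rewrite !E.
Qed.

Lemma hodge_trivial (a1 a2 E1 E2 : P -> R) : hodge a1 a2 E1 E2 ->
  (forall q, d_z a1 q - d_x a2 q = 0) -> forall q, E1 q = 0 /\ E2 q = 0.
Proof.
move=> [[[Ca1 _] [Ca2 _]] [fE1 fE2] cE dE] div0 q.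
have [CE1 CE2] := (fE1.1, fE2.1).
have dv q' : d_x E1 q' + d_z E2 q' = 0.
  have := dE q'; rewrite (d_xB q' (C1N openT Ca2) CE1) (d_zB q' Ca1 CE2) (d_xN q' Ca2).
  by have := div0 q'; move: (d_x _ _) (d_z _ _) (d_x _ _) (d_z _ _) => *; lra.
have I0 := curlfree_divfree_orthogonal fE1 fE2 fE1 fE2 cE dv.
have pE := pintD (pintM fE1 fE1) (pintM fE2 fE2).
have cc : continuous (fun q => E1 q * E1 q + E2 q * E2 q).
  have [c1 c2] := (field_continuous fE1, field_continuous fE2).
  by move=> p; apply: cvgD; apply: cvgM; first [exact: c1|exact: c2].
have g0 p : 0 <= E1 p * E1 p + E2 p * E2 p by rewrite -!expr2 addr_ge0 ?sqr_ge0.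
have := pint_eq0 cc pE g0 I0 q; rewrite -!expr2 => /eqP.
by rewrite paddr_eq0 ?sqr_ge0// !sqrf_eq0 => /andP[/eqP -> /eqP ->].
Qed.

End Stationarity.

(** * Identities in the bulk and at the bottom *)

Section FirstIntegrals.
Context {R : realType}.
Notation P3 := (R * R * R)%type.

Lemma div_curl (A : P3 -> 'rV[R]_3) p : regular_field A -> div3 (curl A) p = 0.
Proof.
move=> rA.
have C (i : 'I_3) := (regular_field_coord i rA).1.
have CD (i : 'I_3) v : C1 setT ('D_v (fun p => A p 0 i)) := (regular_field_coord i rA).2 v.
have S (i : 'I_3) v w : 'D_w ('D_v (fun p => A p 0 i)) p = 'D_v ('D_w (fun p => A p 0 i)) p.
  exact: (derive_comm openT (C i) (CD i v) (CD i w) (fun _ _ => erefl) (fun _ _ => erefl) I).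
rewrite /div3.
have -> : (fun p => curl A p 0 0) = fun p => D_y (fun p' => A p' 0 2) p - D_z (fun p' => A p' 0 1) p.
  by apply/funext => q; rewrite /curl mxE.
have -> : (fun p => curl A p 0 1) = fun p => D_z (fun p' => A p' 0 0) p - D_x (fun p' => A p' 0 2) p.
  by apply/funext => q; rewrite /curl mxE.
have -> : (fun p => curl A p 0 2) = fun p => D_x (fun p' => A p' 0 1) p - D_y (fun p' => A p' 0 0) p.
  by apply/funext => q; rewrite /curl mxE.
have B (i j : 'I_3) v w u : 'D_u (fun p => 'D_v (fun p => A p 0 i) p - 'D_w (fun p => A p 0 j) p) p
    = 'D_u ('D_v (fun p => A p 0 i)) p - 'D_u ('D_w (fun p => A p 0 j)) p.
  exact: (derive_C1B u (CD i v) (CD j w) I).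
have aux (a b c a' b' c' x y z : R) : x = a - b -> y = c - a' -> z = b' - c' ->
  a = a' -> b = b' -> c = c' -> x + y + z = 0 by move=> -> -> -> -> -> ->; ring.
exact (aux _ _ _ _ _ _ _ _ _ (B 2 1 (0, 1, 0) (0, 0, 1) (1, 0, 0)) (B 0 2 (0, 0, 1) (1, 0, 0) (0, 1, 0))
  (B 1 0 (1, 0, 0) (0, 1, 0) (0, 0, 1)) (S 2 (0, 1, 0) (1, 0, 0)) (S 1 (0, 0, 1) (1, 0, 0))
  (S 0 (0, 0, 1) (0, 1, 0))).
Qed.

(** The vertical component of curl A contains only horizontal derivatives of A_1 and A_3, and these
    components vanish on the whole bottom plane. *)
Lemma no_normal_flux (h : R) (A : P3 -> 'rV[R]_3) x z : regular_field A ->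
  (forall x z, cross (A (x, - h, z)) jvec = 0) -> dot (curl A (x, - h, z)) jvec = 0.
Proof.
move=> rA bot.
have [j0 j1 j2] : [/\ @jvec R 0 0 = 0, @jvec R 0 1 = 1 & @jvec R 0 2 = 0] := vec3E _ _ _.
have A0 x' z' : A (x', - h, z') 0 0 = 0 := (cross_jvec_eq0 (bot x' z')).1.
have A2 x' z' : A (x', - h, z') 0 2 = 0 := (cross_jvec_eq0 (bot x' z')).2.
have L (i : 'I_3) v : (forall t : R, A ((x, - h, z) + t *: v) 0 i = 0) ->
    'D_v (fun p => A p 0 i) (x, - h, z) = 0.
  move=> A0'; have dA := C1_derivable v (regular_field_coord i rA).1 (I : setT ((x, - h, z) + 0 *: v)).
  have := is_derive_line dA; rewrite scale0r addr0.
  have -> : (fun s : R => A ((x, - h, z) + s *: v) 0 i) = cst 0 by apply/funext.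
  by move=> d1; rewrite -(@derive_val _ _ _ _ _ _ _ d1) derive_cst.
rewrite dot3E j0 j1 j2 !mulr0 add0r addr0 mulr1 /curl mxE /=.
rewrite /D_z /D_x (L 0 (0, 0, 1)); last first.
  move=> t; have -> : (x, - h, z) + t *: ((0, 0, 1) : P3) = ((x + t * 0, - h + t * 0), z + t * 1) by [].
  by rewrite !mulr0 !addr0.
rewrite (L 2 (1, 0, 0)) ?subrr// => t.
have -> : (x, - h, z) + t *: ((1, 0, 0) : P3) = ((x + t * 1, - h + t * 0), z + t * 0) by [].
by rewrite !mulr0 !addr0.
Qed.

End FirstIntegrals.

Section MainTheorem.
Context {R : realType}.
Notation P := (R * R)%type.
Notation P3 := (R * R * R)%type.
Notation Q := (R * P3)%type.
Variables (h alpha c1 c3 : R) (eta Phi : P -> R).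
Hypotheses (h0 : 0 < h) (eta_adm : admissible_surface h eta) (Phi_adm : admissible_potential Phi)
  (BVP_unique : uniquely_solvable_near h alpha eta Phi)
  (BVP_regular : regular_dependence h alpha eta Phi)
  (star_regular : star_regular_near alpha c1 c3 eta).

(** The regular family, the clearance above the bottom, unique solvability and the potential of the
    trivial flow each come with their own radius around e = 0; the smallest of the four serves for
    all. *)
Lemma regular_line (nu dPhi : P -> R) : decaying_smooth nu -> admissible_potential dPhi ->
  exists d (F : Q -> 'rV[R]_3), [/\ 0 < d, forall i, qreg2 d (fun ep => F ep 0 i) & forall e, `|e| < d ->
    [/\ forall q, - h < vary eta nu e q,
      solves_BVP h alpha (vary eta nu e) (vary Phi dPhi e) (fun p => F (e, p)),
      uniquely_solvable h alpha (vary eta nu e) (vary Phi dPhi e)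
    & has_invLap (div2 (fun q => perp (par (vary eta nu e) (Astar alpha c1 c3) q)))]].
Proof.
move=> sn aP.
have [d1 [F [d10 Ck dF bvp]]] := BVP_regular sn aP.
have [d2 d20 above] := vary_above h0 eta_adm sn.
have [d3 d30 un] := near0_ball (BVP_unique sn aP).
have [d4 d40 st] := near0_ball (star_regular sn).
pose d := Num.min (Num.min d1 d2) (Num.min d3 d4).
have [[m1 m2] [m3 m4]] : (d <= d1 /\ d <= d2) /\ (d <= d3 /\ d <= d4).
  by rewrite /d !ge_min !lexx !orbT.
exists d, F; split=> [|i|e ed]; first by rewrite !lt_min d10 d20 d30 d40.
  exact: qreg2_sub m1 (family_coord i Ck dF).
split; [exact: above (lt_le_trans ed m2)|exact: bvp (lt_le_trans ed m1)
  |exact: un (lt_le_trans ed m3)|exact: st (lt_le_trans ed m4)].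
Qed.

End MainTheorem.

(** * Equivalence with the free-surface conditions *)

Section Equivalence.
Context {R : realType}.
Notation P := (R * R)%type.
Notation P3 := (R * R * R)%type.
Notation Q := (R * P3)%type.
Notation preg f := (reg idfun (@setT P) (@setT P) 2^-1 f).
Variables (h alpha c1 c3 g sigma : R) (eta Phi : P -> R).
Hypotheses (h0 : 0 < h) (alpha0 : alpha != 0)
  (eta_adm : admissible_surface h eta) (Phi_adm : admissible_potential Phi)
  (BVP_unique : uniquely_solvable_near h alpha eta Phi)
  (BVP_regular : regular_dependence h alpha eta Phi)
  (star_regular : star_regular_near alpha c1 c3 eta).
Let X := BVPsol h alpha eta Phi.
Let a1 q := par eta X q 0 0 + star1 alpha c1 c3 (eta q).
Let a2 q := par eta X q 0 1 + star3 alpha c1 c3 (eta q).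
Let K q := inertia h alpha eta Phi q + star_force alpha c1 c3 g sigma eta Phi q.
Let E := invLap (div2 (fun q => perp (par eta X q))).
Let S := invLap (div2 (fun q => perp (par eta (Astar alpha c1 c3) q))).

Let line := regular_line h0 eta_adm BVP_unique BVP_regular star_regular.
Let seta : surface_admissible eta := decaying_smooth_surface eta_adm.1.
Let CPhi : C1 setT Phi. Proof. by have [s _ _] := Phi_adm; exact: smooth_C1 [::] s. Qed.

Lemma is_derive_Lagrangian (nu dPhi : P -> R) : decaying_smooth nu -> admissible_potential dPhi ->
  is_derive (0 : R) (1 : R)
    (fun e => Lagrangian h alpha c1 c3 g sigma (vary eta nu e) (vary Phi dPhi e))
    (\int[@area R]_q (d_x dPhi q * a2 q - d_z dPhi q * a1 q + nu q * K q)).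
Proof.
move=> sn ap; have [d [F [d0 rF H]]] := line sn ap.
have [rPx rPz] := admissible_potential_reg Phi_adm; have [rdx rdz] := admissible_potential_reg ap.
have [sdP _ _] := ap.
apply: (is_derive_Lagrangian_family g sigma d0 alpha0 seta (decaying_smooth_surface sn) CPhi
  (smooth_C1 [::] sdP) rPx rPz rdx rdz (rF 0) (rF 1) (rF 2)) => e /H[]//.
Qed.

Lemma trace_facts : [/\ preg a1 /\ preg a2, decaying K,
    hodge (fun q => par eta X q 0 0) (fun q => par eta X q 0 1) (d_x E) (d_z E) /\
    hodge (fun q => star1 alpha c1 c3 (eta q)) (fun q => star3 alpha c1 c3 (eta q)) (d_x S) (d_z S),
    forall q, let v := curl X (surf eta q) in
      v 0 0 + v 0 1 * d_x eta q = d_x Phi q + alpha * d_z E q /\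
      v 0 2 + v 0 1 * d_z eta q = d_z Phi q - alpha * d_x E q
  & forall q, let v := curl X (surf eta q) in
      d_z (fun q => par eta X q 0 0) q - d_x (fun q => par eta X q 0 1) q
      = v 0 1 - d_x eta q * v 0 0 - d_z eta q * v 0 2].
Proof.
have sn := @decaying_smooth0 R; have ap := decaying_smooth_admissible sn.
have snu := decaying_smooth_surface sn.
have [d [F [d0 rF H]]] := line sn ap.
have d00 : `|0 : R| < d by rewrite normr0.
have ab e (ed : `|e| < d) : forall q, - h < vary eta (fun=> 0) e q by case: (H e ed).
have bv e (ed : `|e| < d) : solves_BVP h alpha (vary eta (fun=> 0) e) (vary Phi (fun=> 0) e) (fun p => F (e, p)).
  by case: (H e ed).
have un e (ed : `|e| < d) : uniquely_solvable h alpha (vary eta (fun=> 0) e) (vary Phi (fun=> 0) e).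
  by case: (H e ed).
have st e (ed : `|e| < d) : has_invLap (div2 (fun q => perp (par (vary eta (fun=> 0) e) (Astar alpha c1 c3) q))).
  by case: (H e ed).
have [rPx rPz] := admissible_potential_reg Phi_adm.
have [sdP _ _] := ap; have CdP : C1 setT (fun _ : P => 0 : R) := smooth_C1 [::] sdP.
have T := @subset_refl _ [set: P].
split.
- have [r1 r2] := reg_par seta snu (rF 0) (rF 1) (rF 2).
  have [pE _] := BVPsol_trace d0 seta snu ab bv un.
  have [re _ _] := seta.
  split.
    apply: (regD openT T _ (reg_star1 c1 c3 alpha0 openT T re)).
    have -> : (fun q => par eta X q 0 0) = fun q => par1E eta (fun=> 0) (fun ep => F ep 0 0) (fun ep => F ep 0 1) (0, q).
      by apply/funext => q; rewrite (pE q).1.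
    exact: reg_slice d00 r1.
  apply: (regD openT T _ (reg_star3 c1 c3 alpha0 openT T re)).
  have -> : (fun q => par eta X q 0 1) = fun q => par2E eta (fun=> 0) (fun ep => F ep 0 1) (fun ep => F ep 0 2) (0, q).
    by apply/funext => q; rewrite (pE q).2.
  exact: reg_slice d00 r2.
- exact: decayingD (inertia_decaying d0 seta snu (rF 0) (rF 1) (rF 2) ab bv un)
    (star_force_decaying g sigma d0 alpha0 seta snu rPx rPz st).
- split; first exact: trace_hodge d0 seta snu (rF 0) (rF 1) (rF 2) ab bv un.
  exact: star_trace_hodge d0 alpha0 seta snu st.
- exact: trace_tangential d0 seta snu CPhi CdP ab bv un.
- exact: trace_divergence d0 seta snu (rF 0) (rF 1) (rF 2) ab bv un.
Qed.

Lemma Euler_Lagrange_iff : Euler_Lagrange h alpha c1 c3 g sigma eta Phi <->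
  (forall q, d_z a1 q - d_x a2 q = 0) /\ (forall q, K q = 0).
Proof.
have [[r1 r2] dK _ _ _] := trace_facts.
rewrite -(stationary_iff r1 r2 dK); split=> H f F sf aF.
  have D := is_derive_Lagrangian sf aF; have D0 := H f F sf aF.
  by rewrite -(@derive_val _ _ _ _ _ _ _ D) (@derive_val _ _ _ _ _ _ _ D0).
by have D := is_derive_Lagrangian sf aF; rewrite (H f F sf aF) in D.
Qed.

(** For A this is [trace_divergence]. For the trivial flow it is the chain rule with star1' = -
    ustar3 and star3' = ustar1, the vertical component of ustar being zero. *)
Lemma flux_divergence q : let v := curl X (surf eta q) in
  d_z a1 q - d_x a2 q = dot v (Nvec eta q) + dot (ustar alpha c1 c3 (eta q)) (Nvec eta q).
Proof.
have [_ _ [[[[CA1 _] [CA2 _]] _ _ _] [[[Cb1 _] [Cb3 _]] _ _ _]] _ /(_ q) dA] := trace_facts.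
have [re _ _] := seta.
cbv zeta; rewrite !dot3E /Nvec; have [-> -> ->] := vec3E (- d_x eta q) 1 (- d_z eta q).
have [-> -> ->] := ustarE alpha c1 c3 (eta q).
have E1 : d_z a1 q = d_z (fun q => par eta X q 0 0) q + - ustar3 alpha c1 c3 (eta q) * d_z eta q.
  have T := hder_star1 c1 c3 alpha0 re (0, 1) (I : setT q).
  by rewrite /d_z (derive_C1D _ CA1 Cb1 (I : setT q)) (hder_val T).
have E2 : d_x a2 q = d_x (fun q => par eta X q 0 1) q + ustar1 alpha c1 c3 (eta q) * d_x eta q.
  have T := hder_star3 c1 c3 alpha0 re (1, 0) (I : setT q).
  by rewrite /d_x (derive_C1D _ CA2 Cb3 (I : setT q)) (hder_val T).
rewrite E1 E2; move: dA => /=.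
move: (d_z (fun q => par eta X q 0 0) q) (d_x (fun q => par eta X q 0 1) q) => u w.
move: (ustar1 _ _ _ _) (ustar3 _ _ _ _) (d_x eta q) (d_z eta q) => *; lra.
Qed.

Lemma enorm_Nvec_neq0 q : enorm (Nvec eta q) != 0.
Proof.
rewrite /enorm sqrtr_eq0 -ltNge dot3E.
have [-> -> ->] := vec3E (- d_x eta q) 1 (- d_z eta q).
have := sqr_ge0 (d_x eta q); have := sqr_ge0 (d_z eta q); rewrite !expr2 => *; lra.
Qed.

Lemma kinematic_iff : kinematic_condition alpha c1 c3 eta (curl X) <->
  forall q, d_z a1 q - d_x a2 q = 0.
Proof.
have dn (u : 'rV[R]_3) q : dot u (nvec eta q) = (enorm (Nvec eta q))^-1 * dot u (Nvec eta q).
  have sE (i : 'I_3) : nvec eta q 0 i = (enorm (Nvec eta q))^-1 * Nvec eta q 0 i by rewrite mxE.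
  by rewrite !dot3E !sE; ring.
split=> H q; have := H q.
  rewrite flux_divergence !dn -mulrDr => /eqP; rewrite mulf_eq0 invr_eq0 (negPf (enorm_Nvec_neq0 q)).
  by move=> /eqP.
by rewrite !dn -mulrDr flux_divergence => ->; rewrite mulr0.
Qed.

Lemma capillarityE q : capillarity sigma eta q =
  sigma * d_x (fun q => d_x eta q / Num.sqrt (1 + enorm (grad eta q) ^+ 2)) q
  + sigma * d_z (fun q => d_z eta q / Num.sqrt (1 + enorm (grad eta q) ^+ 2)) q.
Proof.
have slope r : (Num.sqrt (1 + enorm (grad eta r) ^+ 2))^-1 = invslope (steep eta r).
  by rewrite invslopeE ?steep_ge0// enorm_sqr dot2E (gradE _ r).1 (gradE _ r).2.
have -> : (fun q => d_x eta q / Num.sqrt (1 + enorm (grad eta q) ^+ 2))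
    = fun q => d_x eta q * invslope (steep eta q) by apply/funext => r; rewrite slope.
have -> : (fun q => d_z eta q / Num.sqrt (1 + enorm (grad eta q) ^+ 2))
    = fun q => d_z eta q * invslope (steep eta q) by apply/funext => r; rewrite slope.
have [[Cx _ _] [Cz _ _]] := reg_capillary 1 seta.
have e1 (f : P -> R) : (fun q => 1 * f q) = f by apply/funext => r; rewrite mul1r.
rewrite !e1 in Cx Cz; have Cs : C1 setT (fun _ : P => sigma) := C1_cst openT sigma.
have Z (f : P -> R) v : C1 setT f -> 'D_v (fun q => sigma * f q) q = sigma * 'D_v f q.
  move=> Cf; rewrite (derive_C1M v Cs Cf (I : setT q)).
  by rewrite (@derive_cst _ _ _ sigma q v) mulr0 addr0.
exact (f_equal2 +%R (Z _ _ Cx) (Z _ _ Cz)).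
Qed.

(** The kinematic condition turns v . N into u1 ex + u3 ez. The term - (v . N) v2 then cancels the
    part of grad Phi . ustar that comes from v2 grad eta, and the alpha terms cancel each other, so
    that v . ustar remains. *)
Let surface_balance (v1 v2 v3 u1 u3 ex ez sx sz ge kx kz : R) :
  v1 * - ex + v2 * 1 + v3 * - ez + (u1 * - ex + 0 * 1 + u3 * - ez) = 0 ->
  2^-1 * (v1 * v1 + v2 * v2 + v3 * v3) - (v2 - ex * v1 - ez * v3) * v2
  + ((v1 + v2 * ex + alpha * sz) * u1 + (v3 + v2 * ez - alpha * sx) * u3
     - alpha * (sz * u1 - sx * u3) + ge - (kx + kz))
  = 2^-1 * (v1 * v1 + v2 * v2 + v3 * v3) + (v1 * u1 + v2 * 0 + v3 * u3) + ge - kx - kz.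
Proof.
move=> kin; have -> : v2 - ex * v1 - ez * v3 = u1 * ex + u3 * ez.
  by apply/eqP; rewrite -subr_eq0 -[X in _ == X]kin; apply/eqP; ring.
ring.
Qed.

Lemma dynamic_iff : (forall q, d_z a1 q - d_x a2 q = 0) ->
  (forall q, K q = 0) <-> dynamic_condition alpha c1 c3 g sigma eta (curl X).
Proof.
move=> div0; have [_ _ [hA hS] tang _] := trace_facts.
have ES q : d_x E q + d_x S q = 0 /\ d_z E q + d_z S q = 0.
  exact: (hodge_trivial (hodgeD hA hS) div0).
suff KE q : K q = 2^-1 * enorm (curl X (surf eta q)) ^+ 2
    + dot (curl X (surf eta q)) (ustar alpha c1 c3 (eta q)) + g * eta q
    - sigma * d_x (fun q' => d_x eta q' / Num.sqrt (1 + enorm (grad eta q') ^+ 2)) q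
    - sigma * d_z (fun q' => d_z eta q' / Num.sqrt (1 + enorm (grad eta q') ^+ 2)) q.
  by rewrite /dynamic_condition; cbv beta zeta; split=> H q; have := H q; rewrite KE.
have [t1 t2] := tang q; have [s1 s2] := ES q.
have := div0 q; rewrite flux_divergence /K /inertia /star_force -/X -/S capillarityE.
rewrite enorm_sqr !dot3E; have [-> -> ->] := vec3E (- d_x eta q) 1 (- d_z eta q).
have [-> -> ->] := ustarE alpha c1 c3 (eta q).
(* The tangential condition solved for grad Phi, with the gradient part of A replaced by minus that
   of Astar. *)
have F1 : d_x Phi q = curl X (surf eta q) 0 0 + curl X (surf eta q) 0 1 * d_x eta q + alpha * d_z S q.
  by rewrite t1 -addrA -mulrDr s2 mulr0 addr0.
have F2 : d_z Phi q = curl X (surf eta q) 0 2 + curl X (surf eta q) 0 1 * d_z eta q - alpha * d_x S q.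
  by rewrite t2 -addrA -opprD -mulrDr s1 mulr0 subr0.
rewrite F1 F2; exact: surface_balance.
Qed.

End Equivalence.

Theorem mainTheorem1 (R : realType) (h g sigma c1 c3 alpha : R)
    (eta Phi : R * R -> R)
    (h_gt0 : 0 < h) (alpha_neq0 : alpha != 0)
    (eta_adm : admissible_surface h eta) (Phi_adm : admissible_potential Phi)
    (BVP_unique : uniquely_solvable_near h alpha eta Phi)
    (BVP_regular : regular_dependence h alpha eta Phi)
    (star_regular : star_regular_near alpha c1 c3 eta) :
  let v := curl (BVPsol h alpha eta Phi) in
  [/\ forall p, fluid h eta p -> div3 v p = 0,
      forall p, fluid h eta p -> curl v p = alpha *: v p,
      forall x z : R, dot (v (x, - h, z)) jvec = 0
    & Euler_Lagrange h alpha c1 c3 g sigma eta Phi <->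
      kinematic_condition alpha c1 c3 eta v /\
      dynamic_condition alpha c1 c3 g sigma eta v].
Proof.
move=> v.
(* A property that holds for e near 0 holds at e = 0; the direction (eta, Phi) serves as an
   arbitrary admissible line. *)
have [ex _] : uniquely_solvable h alpha eta Phi.
  have := nbhs_singleton (BVP_unique _ _ eta_adm.1 Phi_adm).
  have V0 (f k : R * R -> R) : vary f k 0 = f by apply/funext => q; rewrite /vary mul0r addr0.
  by rewrite !V0.
have [[rX _] bulk bot _ _] : solves_BVP h alpha eta Phi (BVPsol h alpha eta Phi) := xgetPex _ ex.
split.
- by move=> p _; exact: div_curl.
- by move=> p /bulk[].
- by move=> x z; exact: no_normal_flux rX bot.
rewrite (kinematic_iff g sigma h_gt0 alpha_neq0 eta_adm Phi_adm BVP_unique BVP_regular star_regular).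
rewrite (Euler_Lagrange_iff g sigma h_gt0 alpha_neq0 eta_adm Phi_adm BVP_unique BVP_regular star_regular).
(* K = 0 amounts to the dynamic condition only in the presence of the kinematic one, so in both
   directions the first equation is kept while the second is translated. *)
by split=> -[kin]; rewrite (dynamic_iff g sigma h_gt0 alpha_neq0 eta_adm Phi_adm BVP_unique
  BVP_regular star_regular kin).
Qed.
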